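(* Let $L(s,f)$ be a good $L$-function (see context); for example $L(s,f)=\zeta(s)$, the Riemann zeta function. Fix $\delta\in(0,1)$ and for each $T>e$ let $\sigma_T=\frac12+\frac{1}{(\log T)^{\delta}}$. Then for every base $B>1$ and every $\tau\in[1,B)$, $$\lim_{T\to\infty}\frac{\mu\left\{t\in[T,2T]:\ 1\le M_B\left(|L(\sigma_T+it,f)|\right)\le\tau\right\}}{T}=\log_B\tau,$$ where $\mu$ is Lebesgue measure.
   Context: For $x>0$ the mantissa $M_B(x)\in[1,B)$ is defined by $x=M_B(x)B^k$ with $k\in\mathbb{Z}$, and $M_B(0)=0$. An $L$-function $L(s,f)=\sum_{n\ge1}a_f(n)n^{-s}$ is good if: (1) it has an Euler product $L(s,f)=\prod_{p}\prod_{j=1}^d(1-\alpha_{f,j}(p)p^{-s})^{-1}$; (2) it has a meromorphic continuation to $\mathbb{C}$, is of finite order, and has at most finitely many poles, all on the line $\mathrm{Re}(s)=1$; (3) it satisfies a functional equation $e^{i\omega}G(s)L(s,f)=e^{-i\omega}\overline{G(1-\bar s)L(1-\bar s,f)}$ with $\omega\in\mathbb{R}$ and $G(s)=Q^s\prod_{i=1}^h\Gamma(\lambda_i s+\mu_i)$, where $Q>0$, $\lambda_i>0$, $\mathrm{Re}(\mu_i)\ge0$; (4) for some $\aleph>0$ and $c\in\mathbb{C}$, for $x\ge2$, $\sum_{p\le x}|a_f(p)|^2/p=\aleph\log\log x+c+O(1/\log x)$; (5) $|\alpha_{f,j}(p)|\le1$ for all $p,j$; (6) if $N(\sigma,T)$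 denotes the number of zeros $\rho$ of $L(s,f)$ with $\mathrm{Re}(\rho)\ge\sigma$ and $\mathrm{Im}(\rho)\in[0,T]$, then for some $\beta>0$, $N(\sigma,T)=O(T^{1-\beta(\sigma-\frac12)}\log T)$. *)

(* Defs.v *)
From HB Require Import structures.
From mathcomp Require Import all_boot all_order all_algebra.
From mathcomp Require Import all_classical all_reals all_analysis.
From mathcomp Require Import complex.

Set Implicit Arguments.
Unset Strict Implicit.
Unset Printing Implicit Defensive.

Import Order.TTheory GRing.Theory Num.Theory.
Import numFieldNormedType.Exports.
Import Normc.

Local Open Scope classical_set_scope.
Local Open Scope ring_scope.

Section ComplexAnalysis.
Variable R : realType.
Local Notation C := (R[i]^o).
Implicit Types (f g : C -> C) (z w s : C).

Definition cexp z : C :=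
  (expR (complex.Re z))%:C%C * (cos (complex.Im z) +i* sin (complex.Im z))%C.

(* [x ^ s] for real [x > 0], with the real logarithm of [x]. *)
Definition cpow (x : R) s : C := cexp (s * (ln x)%:C%C).

(* Gauss's product formula; meaningful when [z] is not in {0, -1, -2, ...}. *)
Definition cGamma z : C :=
  lim ((fun n : nat => (n`!)%:R * cpow n%:R z / \prod_(k < n.+1) (z + k%:R) : C)
         @ \oo).

Definition nonpos_integer z := exists k : nat, z = - k%:R.

Definition holomorphic_near f z := \forall w \near z, derivable f w 1.

Definition meromorphic_at f z := exists (m : nat) (g : C -> C),
  holomorphic_near g z /\ \forall w \near z^', (w - z) ^+ m * f w = g w.

Definition is_pole f z := normc (f w) @[w --> z^'] --> +oo.

(* The values of [f] at its poles are unconstrained; elsewhere they are the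
   genuine ones (no removable singularity is left unfilled). *)
Definition meromorphic f :=
  forall z, meromorphic_at f z /\ (~ is_pole f z -> derivable f z 1).

(* For a meromorphic [f] with finitely many poles this is equivalent to
   finiteness of the (Nevanlinna) order. *)
Definition finite_order f := exists A r : R,
  forall s, r <= normc s -> normc (f s) <= expR (normc s `^ A).

Definition has_zero_order f z (m : nat) := exists g : C -> C,
  [/\ holomorphic_near g z, g z != 0
    & \forall w \near z^', f w = (w - z) ^+ m * g w].

(* Multiplicity of [z] as a zero of [f]; it is 0 if [f z != 0] and at poles. *)
Definition zero_mult f z : nat := xget 0%N [set m | has_zero_order f z m].

Definition zero_count f (sigma T : R) : \bar R :=
  \esum_(rho in [set rho : C | sigma <= complex.Re rho
                               /\ 0 <= complex.Im rho <= T])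
    ((zero_mult f rho)%:R)%:E.

End ComplexAnalysis.

Section GoodLFunction.
Variable R : realType.
Local Notation C := (R[i]^o).
Implicit Types (a : nat -> C) (L : C -> C) (s : C).

Definition dirichlet_series a L := forall s, 1 < complex.Re s ->
  (\sum_(1 <= n < N) a n * cpow n%:R (- s) : C) @[N --> \oo] --> L s.

Definition euler_product (d : nat) (alpha : 'I_d -> nat -> C) L :=
  forall s, 1 < complex.Re s ->
  (\prod_(1 <= p < N | prime p) \prod_(j < d)
     (1 - alpha j p * cpow p%:R (- s))^-1 : C) @[N --> \oo] --> L s.

Definition gamma_factor (Q : R) (h : nat) (lambda : 'I_h -> R) (mu : 'I_h -> C) s
    : C :=
  cpow Q s * \prod_(i < h) cGamma ((lambda i)%:C%C * s + mu i).

(* [s] is a pole neither of [L] nor of any of the Gamma factors. *)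
Definition regular_point L (h : nat) (lambda : 'I_h -> R) (mu : 'I_h -> C) s :=
  ~ is_pole L s /\
  forall i, ~ nonpos_integer ((lambda i)%:C%C * s + mu i).

(* An identity of meromorphic functions, stated off the poles of both sides. *)
Definition functional_equation L (omega Q : R) (h : nat)
    (lambda : 'I_h -> R) (mu : 'I_h -> C) :=
  forall s, let s' : C := 1 - (s^*)%C in
  regular_point L lambda mu s -> regular_point L lambda mu s' ->
  cexp (0 +i* omega)%C * (gamma_factor Q lambda mu s * L s) =
  cexp (0 -i* omega)%C * ((gamma_factor Q lambda mu s' * L s')^*)%C.

Definition prime_second_moment a (aleph : R) (c : C) := exists K : R,
  forall x : R, 2 <= x ->
  normc ((\sum_(1 <= p < (Num.truncn x).+1 | prime p) normc (a p) ^+ 2 / p%:R)%:C%C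
        - ((aleph * ln (ln x))%:C%C + c)) <= K / ln x.

(* The implied constant is uniform in [sigma >= 1/2]. *)
Definition zero_density L (beta : R) := exists K : R,
  \forall T \near +oo, forall sigma : R, 2^-1 <= sigma ->
  (zero_count L sigma T <= (K * T `^ (1 - beta * (sigma - 2^-1)) * ln T)%:E)%E.

(* [L] is the meromorphic function on the plane and [a] its Dirichlet
   coefficients; [a 0] plays no role. *)
Definition good_Lfunction a L :=
  dirichlet_series a L
  /\ (exists (d : nat) (alpha : 'I_d -> nat -> C),
        euler_product alpha L
        /\ forall j p, prime p -> normc (alpha j p) <= 1)
  /\ [/\ meromorphic L, finite_order L, finite_set [set s | is_pole L s]
       & forall s, is_pole L s -> complex.Re s = 1]
  /\ (exists (omega Q : R) (h : nat) (lambda : 'I_h -> R) (mu : 'I_h -> C),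
        [/\ 0 < Q, forall i, 0 < lambda i, forall i, 0 <= complex.Re (mu i)
          & functional_equation L omega Q lambda mu])
  /\ (exists (aleph : R) (c : C), 0 < aleph /\ prime_second_moment a aleph c)
  /\ (exists beta : R, 0 < beta /\ zero_density L beta).

End GoodLFunction.

Section Mantissa.
Variable R : realType.
Implicit Types (B x m : R).

Definition mantissa_spec B x m :=
  1 <= m < B /\ exists k : int, x = m * B ^ k.

Definition mantissa B x : R :=
  if x == 0 then 0 else xget 0 [set m | mantissa_spec B x m].

Lemma mantissaP B x : 1 < B -> 0 < x -> mantissa_spec B x (mantissa B x).
Proof.
move=> B1 x0; have B0 : 0 < B := lt_trans ltr01 B1.
rewrite /mantissa gt_eqF//.
have lB : 0 < ln B by rewrite ln_gt0.
have Bk (j : int) : B ^ j = expR (j%:~R * ln B).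
  by rewrite -powR_intmul ?ltW// /powR gt_eqF.
set k := Num.floor (ln x / ln B).
apply: (@xgetPex _ 0 [set m | mantissa_spec B x m]); exists (x / B ^ k).
split; last by exists k; rewrite divfK// gt_eqF// exprz_gt0.
rewrite ler_pdivlMr ?exprz_gt0// mul1r ltr_pdivrMr ?exprz_gt0//.
have -> : B * B ^ k = B ^ (k + 1) by rewrite expfzDr ?gt_eqF// expr1z mulrC.
rewrite !Bk -{1 2}(lnK x0) ler_expR ltr_expR -ler_pdivlMr// -ltr_pdivrMr//.
exact: Num.Theory.floor_itv.
Qed.

Lemma mantissa_spec_uniq B x m m' : 1 < B ->
  mantissa_spec B x m -> mantissa_spec B x m' -> m = m'.
Proof.
move=> B1 [/andP[m1 mB] [k xk]] [/andP[m1' mB'] [k' xk']].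
have B0 : 0 < B := lt_trans ltr01 B1.
have step n n' (j j' : int) : n < B -> 1 <= n' -> n * B ^ j = n' * B ^ j' ->
    (j' < j + 1)%R.
  move=> nB n1 e; rewrite -(ltr_eXz2l B1); apply: (@le_lt_trans _ _ (n' * B ^ j')).
    by rewrite ler_peMl// exprz_ge0// ltW.
  by rewrite -e expfzDr ?gt_eqF// expr1z mulrC ltr_pM2l ?exprz_gt0.
have e : m * B ^ k = m' * B ^ k' by rewrite -xk.
have kk : k = k'.
  by apply/eqP; rewrite eq_le -!ltzD1 (step _ _ _ _ mB m1' e)
       (step _ _ _ _ mB' m1 (esym e)).
by move: e; rewrite kk => /mulIf; apply; rewrite gt_eqF// exprz_gt0.
Qed.

End Mantissa.

(* Main.v *)
(** With [b = log B], the mantissa of [|L|] lies in [[1, tau]] exactly when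
    [log |L| / b] modulo 1 lies in [[0, log tau / b]], so the theorem says that
    [log |L(sigma_T + it)| / b] is equidistributed modulo 1 for [t] in [[T, 2T]].

    Let [P_X(s)] be the sum over prime powers [p^k <= X] of the terms of
    [log L(s)], with [log X = log T / (log log T)^2]. Zero density leaves only
    [o(T)] values of [t] for which the disc of centre [3 + it] and radius about
    [5/2] contains a zero of [L]. On the other discs [log L] exists and, by
    Phragmen-Lindelof, has real part [O(log T)], so Borel-Caratheodory makes the
    tail of its Taylor series at [3 + it] negligible at [sigma_T + it]; the first
    coefficients are those of [P_X] up to a negligible error, because
    [log L - P_X] is tiny on the unit disc around [3 + it]. The tail of the
    Taylor series of [P_X] is small in mean square. Hence [log |L|] is [Re P_X]
    up to [o(1)] outside a set of measure [o(T)].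

    By unique factorisation the moments of [Re P_X] over [[T, 2T]] of order up to
    a large multiple of [log log T] agree with those of a model in which the
    [p^{-it}] are replaced by independent random roots of unity. Comparing Taylor
    expansions, the characteristic function of [Re P_X] at any fixed nonzero
    frequency is close to that of the model, which is a product over primes
    bounded by [exp (- c sum_p |a(p)|^2 / p^{2 sigma_T})] and tends to 0 since the
    sum grows like [log log T]. The Fejer kernel turns the vanishing of all nonzero
    frequencies into equidistribution. *)

Require Import Defs.
From mathcomp Require Import all_boot all_order all_algebra.
From mathcomp Require Import all_classical all_reals all_analysis.
From mathcomp Require Import complex ring lra zify.

Set Implicit Arguments.
Unset Strict Implicit.
Unset Printing Implicit Defensive.

Import Order.TTheory GRing.Theory Num.Theory.
Import numFieldNormedType.Exports.
Import Normc.

Local Open Scope classical_set_scope.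
Local Open Scope ring_scope.


(** * Complex differentiation and Cauchy integrals *)

Section ComplexNorm.
Variable R : realType.
Local Notation C := (R[i]).
Implicit Types (x y : R) (z w u v : C).

(** The parameters constrain one another. The centre [3 + i t] puts the unit disc in [Re s >= 2],
    where [log L] and [P_X] differ by [O(1 / X)], while the radius [5 / 2] reaches exactly the line
    [1 / 2]; [sigma_T] is inside by only [eta = (log T)^(-delta)]. So [N] Taylor terms leave a tail
    like [exp (- eta N / 5)], whereas errors in the first [N] coefficients are magnified to
    [4^N / X]: [N] must be a small multiple of [log X]. The moment comparison costs a power of [X]
    of order [log log T], which must stay below [T]. The choice of [log X] allows both, and
    [delta < 1] makes [eta log X] outgrow [log log T]; it also makes the zero-density bound [o(T)].
    For equidistribution it is enough that the variance tends to infinity, and that every arc gets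
    an upper bound: an arc and its complement share the measure [T]. Averages over roots of unity, a
    Fejer kernel on a finite grid and the use of [ln |L|] alone keep expectations finite and avoid
    branches of the logarithm. *)

Lemma nc_ge0 z : 0 <= normc z.
Proof. by case: z => a b; rewrite /normc sqrtr_ge0. Qed.

Lemma nc_sqr z : normc z ^+ 2 = complex.Re z ^+ 2 + complex.Im z ^+ 2.
Proof. by case: z => a b /=; rewrite sqr_sqrtr// addr_ge0 ?sqr_ge0. Qed.

Lemma nc_eq0 z : (normc z == 0) = (z == 0).
Proof. by apply/eqP/eqP => [/eq0_normc//|->]; rewrite normc0. Qed.

Lemma nc_gt0 z : (0 < normc z) = (z != 0).
Proof. by rewrite lt_neqAle nc_ge0 andbT eq_sym nc_eq0. Qed.

Lemma ncB z w : normc (z - w) <= normc z + normc w.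
Proof. by rewrite -(normcN w); exact: le_normcD. Qed.

Lemma nc_distC z w : normc (z - w) = normc (w - z).
Proof. by rewrite -normcN opprB. Qed.

Lemma nc_ler_sub z w : normc z - normc w <= normc (z - w).
Proof. by rewrite lerBlDr -{1}(subrK w z) le_normcD. Qed.

Lemma nc_ler_add z w : normc z - normc w <= normc (z + w).
Proof. by rewrite -(normcN w) -{2}(opprK w); exact: nc_ler_sub. Qed.

Lemma nc_tri u z w : normc (z - w) <= normc (z - u) + normc (u - w).
Proof. by rewrite (_ : z - w = (z - u) + (u - w)) ?le_normcD//; ring. Qed.

Lemma nc_X z n : normc (z ^+ n) = normc z ^+ n.
Proof. by elim: n => [|n IH]; rewrite ?expr0 ?normc1// !exprS normcM IH. Qed.

Lemma nc_real x : normc (x%:C)%C = `|x|.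
Proof. by rewrite /normc /= expr0n addr0 sqrtr_sqr. Qed.

Lemma nc_nat n : normc (n%:R : C) = n%:R.
Proof. by rewrite -(rmorph_nat (real_complex R)) nc_real normr_nat. Qed.

Lemma Re_le_nc z : `|complex.Re z| <= normc z.
Proof.
rewrite -(ler_pXn2r (ltn0Sn 1)) ?nnegrE ?normr_ge0 ?nc_ge0//.
by rewrite nc_sqr real_normK ?num_real// lerDl sqr_ge0.
Qed.

Lemma Im_le_nc z : `|complex.Im z| <= normc z.
Proof.
rewrite -(ler_pXn2r (ltn0Sn 1)) ?nnegrE ?normr_ge0 ?nc_ge0//.
by rewrite nc_sqr real_normK ?num_real// lerDr sqr_ge0.
Qed.

Lemma nc_le_ReIm z : normc z <= `|complex.Re z| + `|complex.Im z|.
Proof.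
rewrite {1}[z]complexE; apply: (le_trans (le_normcD _ _)).
by rewrite normcM !nc_real /normc /= expr0n expr1n add0r sqrtr1 mul1r.
Qed.

Lemma nc_sum (I : Type) (r : seq I) (P : pred I) (F : I -> C) :
  normc (\sum_(i <- r | P i) F i) <= \sum_(i <- r | P i) normc (F i).
Proof.
elim/big_rec2: _ => [|i y1 y2 Pi IH]; first by rewrite normc0.
by apply: (le_trans (le_normcD _ _)); rewrite lerD2l.
Qed.

Lemma nc_prod (I : Type) (r : seq I) (P : pred I) (F : I -> C) :
  normc (\prod_(i <- r | P i) F i) = \prod_(i <- r | P i) normc (F i).
Proof. by elim/big_rec2: _ => [|i y1 y2 Pi <-]; rewrite ?normc1// normcM. Qed.

Lemma nc_conj z : normc (z^*)%C = normc z.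
Proof. by case: z => a b; rewrite /normc /= sqrrN. Qed.

Lemma Re_conjM z : (z * z^*)%C = (normc z ^+ 2)%:C%C.
Proof.
rewrite nc_sqr; case: z => a b; apply/eqP; rewrite eq_complex /= mulrN opprK.
by rewrite -!expr2 eqxx /= mulrN (mulrC b) addNr.
Qed.

Lemma Re_sum (I : Type) (r : seq I) (P : pred I) (F : I -> C) :
  complex.Re (\sum_(i <- r | P i) F i) = \sum_(i <- r | P i) complex.Re (F i).
Proof. exact: (raddf_sum (@complex.Re R)). Qed.

Lemma Im_sum (I : Type) (r : seq I) (P : pred I) (F : I -> C) :
  complex.Im (\sum_(i <- r | P i) F i) = \sum_(i <- r | P i) complex.Im (F i).
Proof. exact: (raddf_sum (@complex.Im R)). Qed.

Lemma ReD z w : complex.Re (z + w) = complex.Re z + complex.Re w.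
Proof. exact: (raddfD (@complex.Re R)). Qed.
Lemma ImD z w : complex.Im (z + w) = complex.Im z + complex.Im w.
Proof. exact: (raddfD (@complex.Im R)). Qed.
Lemma ReN z : complex.Re (- z) = - complex.Re z.
Proof. by case: z. Qed.
Lemma ImN z : complex.Im (- z) = - complex.Im z.
Proof. by case: z. Qed.
Lemma ReB z w : complex.Re (z - w) = complex.Re z - complex.Re w.
Proof. by rewrite ReD ReN. Qed.
Lemma ImB z w : complex.Im (z - w) = complex.Im z - complex.Im w.
Proof. by rewrite ImD ImN. Qed.
Lemma cReM z w : complex.Re (z * w) =
  complex.Re z * complex.Re w - complex.Im z * complex.Im w.
Proof. by case: z; case: w. Qed.
Lemma cImM z w : complex.Im (z * w) =
  complex.Re z * complex.Im w + complex.Im z * complex.Re w.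
Proof. by case: z; case: w. Qed.
Lemma ReZl x z : complex.Re ((x%:C)%C * z) = x * complex.Re z.
Proof. by rewrite cReM /= mul0r subr0. Qed.
Lemma ImZl x z : complex.Im ((x%:C)%C * z) = x * complex.Im z.
Proof. by rewrite cImM /= mul0r addr0. Qed.

End ComplexNorm.

(** * The complex exponential and its second-order expansion *)

Section ComplexExp.
Variable R : realType.
Local Notation C := (R[i]).
Implicit Types (x y : R) (z w u v : C).

Fact ce_key : unit. Proof. exact: tt. Qed.

(* Locked, so that rewriting does not unfold it into a product. *)
Definition ce : C -> C := locked_with ce_key (@cexp R).

Lemma ce_cexp z : ce z = cexp z.
Proof. by rewrite /ce unlock. Qed.

Lemma ceE z : ce z = ((expR (complex.Re z))%:C *
  (cos (complex.Im z) +i* sin (complex.Im z)))%C.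
Proof. by rewrite ce_cexp. Qed.

Lemma ce0 : ce 0 = 1.
Proof. by rewrite ceE /= expR0 cos0 sin0 mul1r. Qed.

Lemma ceD z w : ce (z + w) = ce z * ce w.
Proof.
rewrite !ceE ReD ImD expRD cosD sinD; apply/eqP; rewrite eq_complex /=.
by apply/andP; split; apply/eqP; ring.
Qed.

Lemma ce_neq0 z : ce z != 0.
Proof.
have : ce z * ce (- z) = 1 by rewrite -ceD subrr ce0.
by apply: contra_eq_neq => ->; rewrite mul0r eq_sym oner_eq0.
Qed.

Lemma ceN z : ce (- z) = (ce z)^-1.
Proof.
by apply: (mulfI (ce_neq0 z)); rewrite -ceD subrr ce0 mulfV ?ce_neq0.
Qed.

Lemma ceX z n : ce (n%:R * z) = ce z ^+ n.
Proof.
elim: n => [|n IH]; first by rewrite mul0r ce0 expr0.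
by rewrite -natr1 mulrDl mul1r ceD IH exprSr.
Qed.

Lemma nc_ce z : normc (ce z) = expR (complex.Re z).
Proof.
rewrite ceE normcM nc_real ger0_norm ?expR_ge0// /normc cos2Dsin2 sqrtr1.
by rewrite mulr1.
Qed.

Lemma nc_ce_im y : normc (ce (0 +i* y)%C) = 1.
Proof. by rewrite nc_ce /= expR0. Qed.

Lemma ce_im y : ce (0 +i* y)%C = (cos y +i* sin y)%C.
Proof. by rewrite ceE /= expR0 mul1r. Qed.

Lemma ce_real x : ce (x%:C)%C = (expR x)%:C%C.
Proof. by rewrite ceE /= cos0 sin0 mulr1. Qed.

Lemma ce_conj z : ce (z^*)%C = ((ce z)^*)%C.
Proof.
rewrite !ceE; case: z => a b /=; rewrite cosN sinN; apply/eqP.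
by rewrite eq_complex /= !mul0r !subr0 !addr0 mulrN !eqxx.
Qed.

Lemma expR_quad x : x <= 2^-1 -> expR x - 1 - x <= 2 * x ^+ 2.
Proof.
move=> x1; have h : 1 - x <= expR (- x) by have := expR_ge1Dx (- x).
have p : 0 < 1 - x by lra.
have : expR x <= (1 - x)^-1.
  by rewrite -[X in X <= _]invrK lef_pV2 ?posrE ?invr_gt0 ?expR_gt0// -expRN.
move=> h2; have : (1 - x)^-1 - 1 - x = x ^+ 2 / (1 - x).
  by field; rewrite gt_eqF.
move=> h3; have : x ^+ 2 / (1 - x) <= 2 * x ^+ 2.
  by rewrite ler_pdivrMr//; have := sqr_ge0 x; nra.
lra.
Qed.

Lemma expR_quad_abs x : `|x| <= 2^-1 -> `|expR x - 1 - x| <= 2 * x ^+ 2.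
Proof.
rewrite ler_norml => /andP[x1 x2]; rewrite ger0_norm ?expR_quad//.
by have := expR_ge1Dx x; lra.
Qed.

Lemma sin_le_abs y : `|sin y| <= `|y|.
Proof.
wlog y0 : y / 0 <= y.
  move=> H; have [/H//|/ltW yl] := leP 0 y.
  by have := H (- y); rewrite sinN !normrN; apply; rewrite oppr_ge0.
rewrite (ger0_norm y0); have [->|yn0] := eqVneq y 0; first by rewrite sin0 normr0.
have yp : 0 < y by rewrite lt_neqAle eq_sym yn0.
have [c _] := @MVT R (@sin R) (@cos R) 0 y yp
  (fun x _ => is_derive_sin x) (continuous_subspaceT (@continuous_sin R)).
rewrite sin0 !subr0 => ->; rewrite normrM (ger0_norm y0).
by rewrite ler_piMl ?cos_max.
Qed.

Lemma cos_quad y : 1 - y ^+ 2 / 2 <= cos y.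
Proof.
have -> : y = (y / 2) *+ 2 by rewrite -mulr_natr divfK.
rewrite cos_mulr2n cos2sin2.
have h := sin_le_abs (y / 2).
have : sin (y / 2) ^+ 2 <= (y / 2) ^+ 2.
  by rewrite -(real_normK (num_real (sin _))) -(real_normK (num_real (y / 2)))
     lerXn2r ?nnegrE ?normr_ge0.
have -> : (y / 2 *+ 2) ^+ 2 / 2 = 2 * (y / 2) ^+ 2 by rewrite -mulr_natr; field.
by rewrite -mulr_natr; move: (sin (y / 2) ^+ 2) ((y / 2) ^+ 2) => s q; lra.
Qed.

Lemma sin_cub y : `|sin y - y| <= `|y| ^+ 3.
Proof.
wlog y0 : y / 0 <= y.
  move=> H; have [/H//|/ltW yl] := leP 0 y.
  have : `|sin (- y) - - y| <= `|- y| ^+ 3 by apply: H; rewrite oppr_ge0.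
  by rewrite sinN -opprD !normrN.
have [->|yn0] := eqVneq y 0; first by rewrite sin0 subrr normr0 expr0n.
have yp : 0 < y by rewrite lt_neqAle eq_sym yn0.
have [c cy] := @MVT R (@sin R) (@cos R) 0 y yp
  (fun x _ => is_derive_sin x) (continuous_subspaceT (@continuous_sin R)).
rewrite sin0 !subr0 => ->; rewrite -{2}(mul1r y) -mulrBl normrM (ger0_norm y0).
rewrite exprSr; apply: ler_wpM2r => //.
have h2 := cos_quad c; have h1 := cos_le1 c; rewrite ler0_norm; last by lra.
move: cy; rewrite in_itv/= => /andP[c0 cy].
have : c ^+ 2 <= y ^+ 2 by rewrite lerXn2r ?nnegrE// ltW.
rewrite opprB; have := sqr_ge0 c; lra.
Qed.

(** Real and imaginary parts reduce to Taylor bounds for [expR], [cos] and [sin]. The constant is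
    generous: the quadratic order is what yields the derivative of [ce] and the [1 / n^2] increments
    of Gauss's product. *)
Lemma ce_quad z : normc z <= 2^-1 -> normc (ce z - 1 - z) <= 10 * normc z ^+ 2.
Proof.
move=> z1; have hx := Re_le_nc z; have hy := Im_le_nc z.
rewrite nc_sqr; case: z z1 hx hy => x y z1; rewrite [complex.Re _]/= [complex.Im _]/= => hx hy.
have ex := expR_quad_abs (le_trans hx z1).
have hc := cos_quad y; have hc1 := cos_le1 y; have hs := sin_cub y.
have hs1 := sin_le_abs y.
have y1 := le_trans hy z1; have x1 := le_trans hx z1.
have x2 : `|x| ^+ 2 = x ^+ 2 by rewrite real_normK ?num_real.
have y2 : `|y| ^+ 2 = y ^+ 2 by rewrite real_normK ?num_real.
apply: (le_trans (nc_le_ReIm _)).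
rewrite !ReB !ImB ceE ReZl ImZl /= subr0.
have -> : expR x * cos y - 1 - x =
  (expR x - 1 - x) * cos y + (1 + x) * (cos y - 1) by ring.
have -> : expR x * sin y - y =
  (expR x - 1 - x) * sin y + x * sin y + (sin y - y) by ring.
have h1 : `|(expR x - 1 - x) * cos y| <= 2 * x ^+ 2.
  by rewrite normrM; apply: (le_trans (ler_piMr _ (cos_max _))).
have h2 : `|(1 + x) * (cos y - 1)| <= y ^+ 2.
  rewrite normrM (ler0_norm (_ : cos y - 1 <= 0)); last by lra.
  have : `|1 + x| <= 2 by move: x1; rewrite !ler_norml; lra.
  by move=> h; have := normr_ge0 (1 + x); nra.
have h3 : `|(expR x - 1 - x) * sin y| <= 2 * x ^+ 2.
  by rewrite normrM; apply: (le_trans (ler_piMr _ (sin_max _))).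
have h4 : `|x * sin y| <= x ^+ 2 + y ^+ 2.
  rewrite normrM; apply: (@le_trans _ _ (`|x| * `|y|)).
    exact: ler_wpM2l.
  by rewrite -x2 -y2; have := sqr_ge0 (`|x| - `|y|);
     have := sqr_ge0 (`|x|);have := sqr_ge0 (`|y|); nra.
have h5 : `|sin y - y| <= y ^+ 2.
  apply: (le_trans hs); rewrite -y2 exprS ler_piMl ?sqr_ge0//; lra.
have k1 := ler_normD ((expR x - 1 - x) * cos y) ((1 + x) * (cos y - 1)).
have k2 := ler_normD ((expR x - 1 - x) * sin y + x * sin y) (sin y - y).
have k3 := ler_normD ((expR x - 1 - x) * sin y) (x * sin y).
have := sqr_ge0 x; have := sqr_ge0 y; lra.
Qed.

End ComplexExp.

(** * Continuity and derivatives of complex functions *)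

Section Differentiability.
Variable R : realType.
Local Notation C := (R[i]).

(** The size [N] of increments is a parameter, so that the closure rules are proved once for
    functions on the plane ([ccnt]) and for curves with a real parameter ([rcnt]). *)
Definition cnt (V : zmodType) (N : V -> R) (f : V -> C) (x : V) :=
  forall e : R, 0 < e -> exists2 d : R, 0 < d &
    forall h : V, N h < d -> normc (f (x + h) - f x) < e.

Section Cnt.
Variables (V : zmodType) (N : V -> R).
Implicit Types (f g : V -> C) (x : V).

Lemma cnt_cst (c : C) x : cnt N (fun=> c) x.
Proof. by move=> e e0; exists 1 => // h _; rewrite subrr normc0. Qed.

Lemma cntD f g x : cnt N f x -> cnt N g x -> cnt N (fun h => f h + g h) x.
Proof.
move=> cf cg e e0; have e2 : 0 < e / 2 by rewrite divr_gt0.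
have [d d0 fd] := cf _ e2; have [d' d0' gd] := cg _ e2.
exists (Num.min d d') => [|h]; first by rewrite lt_min d0 d0'.
rewrite lt_min => /andP[/fd h1 /gd h2].
rewrite (_ : _ - _ = (f (x + h) - f x) + (g (x + h) - g x)); last by ring.
apply: (le_lt_trans (le_normcD _ _)); lra.
Qed.

Lemma cntN f x : cnt N f x -> cnt N (fun h => - f h) x.
Proof.
move=> cf e /cf[d d0 fd]; exists d => // h /fd.
by rewrite -opprD normcN.
Qed.

Lemma cntB f g x : cnt N f x -> cnt N g x -> cnt N (fun h => f h - g h) x.
Proof. by move=> cf cg; exact/cntD/cntN. Qed.

Lemma cntM f g x : cnt N f x -> cnt N g x -> cnt N (fun h => f h * g h) x.
Proof.
move=> cf cg e e0.
pose A := normc (f x) + normc (g x) + 1.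
have A0 : 0 < A by rewrite /A; have := nc_ge0 (f x); have := nc_ge0 (g x); lra.
have e1 : 0 < Num.min 1 (e / (2 * A)) by rewrite lt_min ltr01 divr_gt0// mulr_gt0.
have [d d0 fd] := cf _ e1; have [d' d0' gd] := cg _ e1.
exists (Num.min d d') => [|h]; first by rewrite lt_min d0 d0'.
rewrite lt_min => /andP[/fd h1 /gd h2].
move: h1 h2; rewrite !lt_min => /andP[h1 h1'] /andP[h2 h2'].
rewrite (_ : _ - _ = (f (x + h) - f x) * (g (x + h) - g x) +
  ((f (x + h) - f x) * g x + f x * (g (x + h) - g x))); last by ring.
apply: (le_lt_trans (le_normcD _ _)).
apply: (@le_lt_trans _ _ (normc ((f (x + h) - f x) * (g (x + h) - g x)) +
  (normc ((f (x + h) - f x) * g x) + normc (f x * (g (x + h) - g x))))).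
  by rewrite lerD2l le_normcD.
rewrite !normcM.
move: h1' h2'; rewrite !ltr_pdivlMr ?mulr_gt0//.
move: h1 h2; rewrite /A; move: (nc_ge0 (f x)) (nc_ge0 (g x)).
move: (nc_ge0 (f (x + h) - f x)) (nc_ge0 (g (x + h) - g x)).
move: (normc (f (x+h) - f x)) (normc (g (x+h) - g x)) (normc (f x)) (normc (g x)).
move=> a b F G a0 b0 F0 G0 a1 b1 ha hb; nra.
Qed.

Lemma cntV f x : f x != 0 -> cnt N f x -> cnt N (fun h => (f h)^-1) x.
Proof.
move=> fx cf e e0; set a := normc (f x).
have a0 : 0 < a by rewrite nc_gt0.
have e1 : 0 < Num.min (a / 2) (e * a ^+ 2 / 2).
  by rewrite lt_min !divr_gt0// mulr_gt0// exprn_gt0.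
have [d d0 fd] := cf _ e1; exists d => // h /fd; rewrite lt_min => /andP[h1 h2].
have b0 : a / 2 < normc (f (x + h)).
  have := nc_ler_sub (f x) (f x - f (x + h)); rewrite subKr nc_distC -/a; lra.
have fn : f (x + h) != 0 by rewrite -nc_gt0; lra.
rewrite (_ : _ - _ = (f x - f (x + h)) / (f x * f (x + h))); last first.
  by field; rewrite fn fx.
rewrite normcM normcV normcM -/a nc_distC ltr_pdivrMr; last first.
  by rewrite mulr_gt0//; lra.
have hb : 0 < e * a by rewrite mulr_gt0.
rewrite mulrA; nra.
Qed.

Lemma cnt_comp f x (F : C -> C) : cnt N f x -> cnt (@normc R) F (f x) ->
  cnt N (fun h => F (f h)) x.
Proof.
move=> cf cF e /cF[d d0 Fd]; have [d' d0' fd] := cf _ d0.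
by exists d' => // h /fd /Fd; rewrite subrKC.
Qed.

Lemma cnt_sum (I : Type) (r : seq I) (P : pred I) (F : I -> V -> C) x :
  (forall i, P i -> cnt N (F i) x) -> cnt N (fun h => \sum_(i <- r | P i) F i h) x.
Proof.
move=> H; elim: r => [|i r IH].
  have -> : (fun h : V => \sum_(i <- [::] | P i) F i h) = (fun=> 0).
    by apply/funext => h; rewrite big_nil.
  exact: cnt_cst.
case Pi : (P i); last first.
  have -> // : (fun h : V => \sum_(i0 <- i :: r | P i0) F i0 h) =
    (fun h => \sum_(i0 <- r | P i0) F i0 h).
  by apply/funext => h; rewrite big_cons Pi.
have -> : (fun h : V => \sum_(i0 <- i :: r | P i0) F i0 h) =
    (fun h => F i h + \sum_(i0 <- r | P i0) F i0 h).
  by apply/funext => h; rewrite big_cons Pi.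
exact/cntD/IH/H.
Qed.

Lemma cnt_ext f g x : (exists2 d, 0 < d & forall h, N h < d -> f (x + h) = g (x + h)) ->
  f x = g x -> cnt N f x -> cnt N g x.
Proof.
move=> [d d0 fg] fgx cf e /cf[d' d0' fd].
exists (Num.min d d') => [|h]; first by rewrite lt_min d0 d0'.
by rewrite lt_min => /andP[/fg <- /fd]; rewrite fgx.
Qed.

End Cnt.

Definition ccnt (f : C -> C) (z : C) := cnt (@normc R) f z.
Definition rcnt (f : R -> C) (x : R) := cnt (fun h : R => `|h|) f x.

Lemma ccnt_id z : ccnt (fun w => w) z.
Proof. by move=> e e0; exists e => // h he; rewrite addrAC subrr add0r. Qed.

Lemma rcnt_id x : rcnt (fun y => (y%:C)%C) x.
Proof. by move=> e e0; exists e => // h he; rewrite -rmorphB addrAC subrr add0r nc_real. Qed.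

Lemma rcnt_affine (z v : C) x : rcnt (fun y => z + (y%:C)%C * v) x.
Proof. by apply: cntD; [exact: cnt_cst|apply: cntM; [exact: rcnt_id|exact: cnt_cst]]. Qed.

(** Caratheodory's form of differentiability: the difference quotient [phi] is continuous at 0 and
    the increment formula is an identity in [h]. Product and chain rules become algebra on [phi],
    without a case distinction at [h = 0]. *)
Definition cder (f : C -> C) (z l : C) := exists phi : C -> C,
  [/\ ccnt phi 0, phi 0 = l & forall h : C, f (z + h) = f z + phi h * h].

Definition rder (f : R -> C) (x : R) (l : C) := exists phi : R -> C,
  [/\ rcnt phi 0, phi 0 = l & forall h, f (x + h) = f x + phi h * (h%:C)%C].

Lemma cder_eps f z l : cder f z l -> forall e : R, 0 < e -> exists2 d : R, 0 < d &
  forall h, normc h < d -> normc (f (z + h) - f z - l * h) <= e * normc h.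
Proof.
move=> [phi [cp p0 fp]] e /cp[d d0 pd]; exists d => // h /pd.
rewrite add0r p0 => ph; rewrite fp (_ : _ - _ - _ = (phi h - l) * h); last by ring.
by rewrite normcM ler_wpM2r ?nc_ge0// ltW.
Qed.

Lemma eps_cder f z l : (forall e : R, 0 < e -> exists2 d : R, 0 < d &
  forall h, normc h < d -> normc (f (z + h) - f z - l * h) <= e * normc h) ->
  cder f z l.
Proof.
move=> H; exists (fun h => if h == 0 then l else (f (z + h) - f z) / h); split.
- move=> e e0; have [|d d0 fd] := H (e / 2); first by rewrite divr_gt0.
  exists d => // h hd; rewrite add0r eqxx; case: eqVneq => [_|hn0].
    by rewrite subrr normc0.
  have := fd h hd.
  rewrite (_ : _ - _ - _ = ((f (z + h) - f z) / h - l) * h); last by field.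
  rewrite normcM ler_pM2r ?nc_gt0//; lra.
- by rewrite eqxx.
- move=> h; case: eqVneq => [->|hn0]; first by rewrite !addr0 mulr0 addr0.
  by rewrite divfK//; ring.
Qed.

Lemma cder_cnt f z l : cder f z l -> ccnt f z.
Proof.
move=> [phi [cp p0 fp]] e e0.
have cph : ccnt (fun h => phi h * h) 0 by apply: cntM => //; exact: ccnt_id.
have [d d0 H] := cph _ e0.
exists d => // h /H; rewrite add0r mulr0 subr0 fp.
by rewrite (addrC (f z)) addrK.
Qed.

Lemma cder_cst c z : cder (fun=> c) z 0.
Proof.
exists (fun=> 0); split => //; first exact: cnt_cst.
by move=> h; rewrite mul0r addr0.
Qed.

Lemma cder_id z : cder (fun w => w) z 1.
Proof.
exists (fun=> 1); split => //; first exact: cnt_cst.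
by move=> h; rewrite mul1r.
Qed.

Lemma cderD f g z l m : cder f z l -> cder g z m ->
  cder (fun w => f w + g w) z (l + m).
Proof.
move=> [p [cp <- fp]] [q [cq <- gq]]; exists (fun h => p h + q h).
by split => [||h] //; [exact: cntD|rewrite fp gq; ring].
Qed.

Lemma cderM f g z l m : cder f z l -> cder g z m ->
  cder (fun w => f w * g w) z (l * g z + f z * m).
Proof.
move=> df dg; have cg := cder_cnt dg.
case: df dg => [p [cp <- fp]] [q [cq <- gq]].
exists (fun h => p h * g (z + h) + f z * q h); split.
- apply: cntD; apply: cntM => //; last exact: cnt_cst.
  by move=> e /cg[d d0 H]; exists d => // h /H; rewrite add0r addr0.
- by rewrite addr0.
- by move=> h; rewrite gq fp; ring.
Qed.

Lemma cderV f z l : f z != 0 -> (forall h, f (z + h) != 0) ->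
  cder f z l -> cder (fun w => (f w)^-1) z (- l / f z ^+ 2).
Proof.
move=> fz fn df; have cf := cder_cnt df.
case: df => p [cp <- fp].
exists (fun h => - p h / (f z * f (z + h))); split.
- apply: cntM; first exact: cntN.
  apply: cntV; first by rewrite mulf_neq0.
  apply: cntM; first exact: cnt_cst.
  by move=> e /cf[d d0 H]; exists d => // h /H; rewrite add0r addr0.
- by rewrite addr0 expr2.
- by move=> h; have := fn h; rewrite fp => fh; field; rewrite fz fh.
Qed.

Lemma cder_comp f g z l m : cder f z l -> cder g (f z) m ->
  cder (fun w => g (f w)) z (m * l).
Proof.
move=> df [q [cq <- gq]]; case: (df) => p [cp <- fp].
exists (fun h => q (p h * h) * p h); split.
- apply: cntM => //; apply: (@cnt_comp _ _ (fun h => p h * h) 0 q).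
    by apply: cntM => //; exact: ccnt_id.
  by rewrite mulr0.
- by rewrite mulr0.
- by move=> h; rewrite fp gq; ring.
Qed.

Lemma cder_rder f (p : R -> C) x l m : cder f (p x) l -> rder p x m ->
  rder (fun y => f (p y)) x (l * m).
Proof.
move=> [q [cq <- gq]] [r [cr <- fr]].
exists (fun h => q (r h * (h%:C)%C) * r h); split.
- apply: cntM => //; apply: (@cnt_comp _ _ (fun h : R => r h * (h%:C)%C) 0 q).
    by apply: cntM => //; exact: rcnt_id.
  by rewrite mulr0.
- by rewrite mulr0.
- by move=> h; rewrite fr gq; ring.
Qed.

Lemma rder_affine (z v : C) x : rder (fun y => z + (y%:C)%C * v) x v.
Proof.
exists (fun=> v); split => //; first exact: cnt_cst.
by move=> h; rewrite rmorphD /=; ring.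
Qed.

Lemma rder_cnt f x l : rder f x l -> rcnt f x.
Proof.
move=> [phi [cp p0 fp]] e e0.
have cph : rcnt (fun h => phi h * (h%:C)%C) 0.
  by apply: cntM => //; exact: rcnt_id.
have [d d0 H] := cph _ e0.
exists d => // h /H; rewrite add0r mulr0 subr0 fp.
by rewrite (addrC (f x)) addrK.
Qed.

Lemma cder_ext f g z l : (exists2 d : R, 0 < d & forall h : C, normc h < d -> f (z + h) = g (z + h)) ->
  cder f z l -> cder g z l.
Proof.
move=> [d d0 fg] df; apply: eps_cder => e /(cder_eps df)[d' d0' H].
exists (Num.min d d') => [|h]; first by rewrite lt_min d0 d0'.
have fz : f z = g z by have := fg 0; rewrite normc0 addr0; apply.
by rewrite lt_min => /andP[/fg <- /H]; rewrite fz.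
Qed.

Lemma cder_sum (I : Type) (r : seq I) (P : pred I) (F : I -> C -> C) (l : I -> C) z :
  (forall i, P i -> cder (F i) z (l i)) ->
  cder (fun h => \sum_(i <- r | P i) F i h) z (\sum_(i <- r | P i) l i).
Proof.
move=> H; elim: r => [|i r IH].
  rewrite big_nil (_ : (fun h : C => _) = (fun=> 0)); first exact: cder_cst.
  by apply/funext => h; rewrite big_nil.
rewrite big_cons (_ : (fun h : C => _) = (fun h => (if P i then F i h else 0) +
   \sum_(i0 <- r | P i0) F i0 h)); last first.
  by apply/funext => h; rewrite big_cons; case: ifP; rewrite ?add0r.
case: ifPn => Pi; first exact/cderD/IH/H.
by rewrite -[X in cder _ _ X]add0r; apply: cderD => //; exact: cder_cst.
Qed.

Lemma cder_ce z : cder (@ce R) z (ce z).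
Proof.
apply: eps_cder => e e0; pose K := 10 * normc (ce z).
have K0 : 0 < K by rewrite mulr_gt0// nc_gt0 ce_neq0.
exists (Num.min 2^-1 (e / K)) => [|h]; first by rewrite lt_min invr_gt0 ltr0n divr_gt0.
rewrite lt_min => /andP[/ltW h1]; rewrite ltr_pdivlMr// => h2.
rewrite ceD (_ : _ - _ - _ = ce z * (ce h - 1 - h)); last by ring.
rewrite normcM; apply: (le_trans (ler_wpM2l (nc_ge0 _) (ce_quad h1))).
rewrite expr2; have := nc_ge0 h; move: h2; rewrite /K; nra.
Qed.

Lemma rder_ce (z v : C) x : rder (fun y => ce (z + (y%:C)%C * v)) x
  (ce (z + (x%:C)%C * v) * v).
Proof. by apply: cder_rder; [exact: cder_ce|exact: rder_affine]. Qed.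

Lemma cder_X n z : cder (fun w => w ^+ n) z (n%:R * z ^+ n.-1).
Proof.
elim: n => [|n IH]; first by rewrite mul0r; exact: cder_cst.
rewrite (_ : (fun w => _) = (fun w => w * w ^+ n)); last first.
  by apply/funext => w; rewrite exprS.
rewrite (_ : n.+1%:R * _ = 1 * z ^+ n + z * (n%:R * z ^+ n.-1)); last first.
  by case: n {IH} => [|n]; rewrite -natr1 ?expr0 /= ?exprS; ring.
exact/cderM/IH/cder_id.
Qed.

End Differentiability.


(** * Integrals of complex functions of a real variable *)

Section ComplexIntegral.
Variable R : realType.
Local Notation C := (R[i]).
Local Notation mu := (@lebesgue_measure R).
Implicit Types (a b c x y : R) (f g : R -> C).

Definition cint a b f : C :=
  ((\int[mu]_(x in `[a, b]) complex.Re (f x)) +i*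
   (\int[mu]_(x in `[a, b]) complex.Im (f x)))%C.

Definition rcnt_on a b f := forall x, a <= x <= b -> rcnt f x.

Lemma rcnt_Re f x : rcnt f x -> {for x, continuous (fun y => complex.Re (f y))}.
Proof.
move=> cf; apply/cvgrPdist_lt => e /cf[d d0 fd].
apply/nbhs_ballP; exists d => //= y; rewrite /ball /= distrC => xy.
rewrite distrC -ReB; apply: (le_lt_trans (Re_le_nc _)).
by rewrite -(subrKC x y); exact: fd.
Qed.

Lemma rcnt_Im f x : rcnt f x -> {for x, continuous (fun y => complex.Im (f y))}.
Proof.
move=> cf; apply/cvgrPdist_lt => e /cf[d d0 fd].
apply/nbhs_ballP; exists d => //= y; rewrite /ball /= distrC => xy.
rewrite distrC -ImB; apply: (le_lt_trans (Im_le_nc _)).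
by rewrite -(subrKC x y); exact: fd.
Qed.

Lemma continuous_on_integrable (h : R -> R) a b :
  (forall x, a <= x <= b -> {for x, continuous h}) ->
  mu.-integrable `[a, b] (EFin \o h).
Proof.
move=> ch; apply: continuous_compact_integrable; first exact: segment_compact.
by apply: continuous_in_subspaceT => x; rewrite inE /= in_itv /=; exact: ch.
Qed.

Lemma integrable_Re a b f : rcnt_on a b f ->
  mu.-integrable `[a, b] (EFin \o (fun x => complex.Re (f x))).
Proof. by move=> cf; apply: continuous_on_integrable => x /cf; exact: rcnt_Re. Qed.

Lemma integrable_Im a b f : rcnt_on a b f ->
  mu.-integrable `[a, b] (EFin \o (fun x => complex.Im (f x))).
Proof. by move=> cf; apply: continuous_on_integrable => x /cf; exact: rcnt_Im. Qed.

Lemma eq_cint a b f g : (forall x, a <= x <= b -> f x = g x) ->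
  cint a b f = cint a b g.
Proof.
move=> fg; congr (_ +i* _)%C; apply: eq_Rintegral => x;
  by rewrite inE /= in_itv /= => /fg ->.
Qed.

Lemma cintD a b f g : rcnt_on a b f -> rcnt_on a b g ->
  cint a b (fun x => f x + g x) = cint a b f + cint a b g.
Proof.
move=> cf cg; apply/eqP; rewrite eq_complex /=; apply/andP; split; apply/eqP.
  rewrite -RintegralD//; [|exact: integrable_Re..].
  by apply: eq_Rintegral => x _; rewrite ReD.
rewrite -RintegralD//; [|exact: integrable_Im..].
by apply: eq_Rintegral => x _; rewrite ImD.
Qed.

Lemma cintZ a b (k : C) f : rcnt_on a b f ->
  cint a b (fun x => k * f x) = k * cint a b f.
Proof.
move=> cf; have iR := integrable_Re cf; have iI := integrable_Im cf.
have ckf (c : R) : rcnt_on a b (fun x => (c%:C)%C * f x).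
  by move=> x /cf; apply: cntM; exact: cnt_cst.
have zR (c : R) :
    mu.-integrable `[a, b] (EFin \o (fun x => c * complex.Re (f x))).
  have := integrable_Re (ckf c); congr (mu.-integrable _ (EFin \o _)).
  by apply/funext => x; rewrite ReZl.
have zI (c : R) :
    mu.-integrable `[a, b] (EFin \o (fun x => c * complex.Im (f x))).
  have := integrable_Im (ckf c); congr (mu.-integrable _ (EFin \o _)).
  by apply/funext => x; rewrite ImZl.
case: k => k1 k2; apply/eqP; rewrite eq_complex /=; apply/andP; split; apply/eqP.
  rewrite -!RintegralZl// -RintegralB//.
  by apply: eq_Rintegral => x _; rewrite cReM.
rewrite -!RintegralZl// -RintegralD//.
by apply: eq_Rintegral => x _; rewrite cImM.
Qed.

Lemma cintN a b f : rcnt_on a b f -> cint a b (fun x => - f x) = - cint a b f.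
Proof.
move=> cf; rewrite -mulN1r -cintZ//.
by apply: eq_cint => x _; rewrite mulN1r.
Qed.

Lemma cintB a b f g : rcnt_on a b f -> rcnt_on a b g ->
  cint a b (fun x => f x - g x) = cint a b f - cint a b g.
Proof.
by move=> cf cg; rewrite cintD ?cintN// => x ax; apply: cntN; exact: cg.
Qed.

Lemma cint0 a b : cint a b (fun=> 0) = 0.
Proof.
by have := @cintZ a b 0 (fun=> 0) (fun x _ => cnt_cst _ 0 x); rewrite !mul0r.
Qed.

Lemma cint_sum a b (I : Type) (r : seq I) (P : pred I) (F : I -> R -> C) :
  (forall i, P i -> rcnt_on a b (F i)) ->
  cint a b (fun x => \sum_(i <- r | P i) F i x) = \sum_(i <- r | P i) cint a b (F i).
Proof.
move=> cF; elim: r => [|i r IH].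
  by rewrite big_nil -[RHS](cint0 a b); apply: eq_cint => x _; rewrite big_nil.
rewrite big_cons; case: ifPn => Pi.
  rewrite -IH -cintD; [|exact: cF|].
    by apply: eq_cint => x _; rewrite big_cons Pi.
  by move=> x xab; apply: cnt_sum => j Pj; exact: cF.
by rewrite -IH; apply: eq_cint => x _; rewrite big_cons (negbTE Pi).
Qed.

Lemma cint_cst a b (k : C) : a <= b -> cint a b (fun=> k) = ((b - a)%:C)%C * k.
Proof.
move=> ab; rewrite /cint !Rintegral_cst// /= lebesgue_measure_itv /= lte_fin.
have [ab'|] := ltP a b; last first.
  move=> ba; have -> : a = b by apply/eqP; rewrite eq_le ab ba.
  by rewrite subrr !mulr0 mul0r.
case: k => k1 k2; apply/eqP; rewrite eq_complex /=.
by rewrite !mul0r subr0 addr0 !(mulrC (b - a)) !eqxx.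
Qed.

Lemma Rint_split (h : R -> R) a b c : a <= b <= c ->
  mu.-integrable `[a, c] (EFin \o h) ->
  \int[mu]_(x in `[a, c]) h x =
  \int[mu]_(x in `[a, b]) h x + \int[mu]_(x in `[b, c]) h x.
Proof.
move=> /andP[ab bc] ih.
have := @Rintegral_itvB R h (BLeft a) (BRight c) b ih; rewrite !bnd_simp.
move=> /(_ ab bc) /eqP; rewrite subr_eq addrC => /eqP ->; congr (_ + _).
rewrite Rintegral_itv_obnd_cbnd//.
by apply: integrableS ih => //; apply: subset_itvr; rewrite bnd_simp.
Qed.

Lemma cint_split a b c f : a <= b <= c -> rcnt_on a c f ->
  cint a c f = cint a b f + cint b c f.
Proof.
move=> abc cf; apply/eqP; rewrite eq_complex /=; apply/andP; split; apply/eqP.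
  by apply: Rint_split => //; exact: integrable_Re.
by apply: Rint_split => //; exact: integrable_Im.
Qed.

(* Rotating so that the integral becomes real gives the sharp constant. *)
Lemma nc_cint_le a b f (g : R -> R) : rcnt_on a b f ->
  mu.-integrable `[a, b] (EFin \o g) ->
  (forall x, a <= x <= b -> normc (f x) <= g x) ->
  normc (cint a b f) <= \int[mu]_(x in `[a, b]) g x.
Proof.
move=> cf ig fg; set I := cint a b f.
have [I0|I0] := eqVneq I 0.
  rewrite I0 normc0; apply: Rintegral_ge0 => x /=; rewrite in_itv /= => xab.
  exact: le_trans (nc_ge0 _) (fg _ xab).
have n0 : normc I != 0 by rewrite nc_eq0.
pose u : C := ((I^*)%C / ((normc I)%:C)%C).
have u1 : normc u = 1.
  by rewrite normcM normcV nc_conj nc_real ger0_norm ?nc_ge0// mulfV.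
have cuf : rcnt_on a b (fun x => u * f x).
  by move=> x /cf; apply: cntM; exact: cnt_cst.
have uI : u * I = ((normc I)%:C)%C.
  rewrite /u mulrAC -(mulrC I) Re_conjM expr2 rmorphM /= mulfK//.
  by rewrite fmorph_eq0.
have : normc I = complex.Re (cint a b (fun x => u * f x)).
  by rewrite cintZ// -/I uI.
move=> ->; apply: le_Rintegral => //; first exact: integrable_Re.
move=> x /=; rewrite in_itv /= => xab; apply: le_trans (fg _ xab).
rewrite -[normc (f x)]mul1r -u1 -normcM.
exact: le_trans (ler_norm _) (Re_le_nc _).
Qed.

Lemma nc_cint_bound a b f (M : R) : a <= b -> rcnt_on a b f ->
  (forall x, a <= x <= b -> normc (f x) <= M) ->
  normc (cint a b f) <= M * (b - a).
Proof.
move=> ab cf fM.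
apply: (le_trans (@nc_cint_le _ _ _ (fun=> M) cf _ fM)).
  by apply: continuous_on_integrable => x _; exact: cvg_cst.
rewrite Rintegral_cst// /= lebesgue_measure_itv /= lte_fin.
have [//|ba] := ltP a b.
by rewrite mulr0 (_ : b - a = 0) ?mulr0//; apply/eqP; rewrite subr_eq0 eq_le ba.
Qed.

Lemma rder_Re (G : R -> C) x l : rder G x l ->
  is_derive x 1 (fun y => complex.Re (G y)) (complex.Re l).
Proof.
move=> [phi [cp p0 Gp]]; apply/is_derive1_caratheodory.
exists (fun y => complex.Re (phi (y - x))); split.
- by move=> y; rewrite -ReB -{1}(subrKC x y) Gp addrC addKr mulrC ReZl mulrC.
- rewrite -[x in {for x, _}]addr0.
  have := rcnt_Re cp; rewrite -{1}(subrr x) => H.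
  rewrite addr0; apply: (@continuous_comp _ _ _ (fun y => y - x)
    (fun h => complex.Re (phi h))) => //.
  by apply: cvgB; [exact: cvg_id|exact: cvg_cst].
- by rewrite subrr p0.
Qed.

Lemma rder_Im (G : R -> C) x l : rder G x l ->
  is_derive x 1 (fun y => complex.Im (G y)) (complex.Im l).
Proof.
move=> [phi [cp p0 Gp]]; apply/is_derive1_caratheodory.
exists (fun y => complex.Im (phi (y - x))); split.
- by move=> y; rewrite -ImB -{1}(subrKC x y) Gp addrC addKr mulrC ImZl mulrC.
- have := rcnt_Im cp; rewrite -{1}(subrr x) => H.
  apply: (@continuous_comp _ _ _ (fun y => y - x)
    (fun h => complex.Im (phi h))) => //.
  by apply: cvgB; [exact: cvg_id|exact: cvg_cst].
- by rewrite subrr p0.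
Qed.

Lemma real_FTC (h H : R -> R) a b : a < b ->
  (forall x, a <= x <= b -> {for x, continuous h}) ->
  (forall x, a <= x <= b -> is_derive x 1 H (h x)) ->
  \int[mu]_(x in `[a, b]) h x = H b - H a.
Proof.
move=> ab ch dH; rewrite /Rintegral (@continuous_FTC2 _ h H)//.
- by apply: continuous_in_subspaceT => x; rewrite inE /= in_itv /=; exact: ch.
- split.
  + move=> x; rewrite in_itv /= => /andP[ax xb].
    by case: (dH x); rewrite ?(ltW ax) ?(ltW xb).
  + apply: cvg_at_right_filter; apply/differentiable_continuous/derivable1_diffP.
    by case: (dH a); rewrite ?lexx ?(ltW ab).
  + apply: cvg_at_left_filter; apply/differentiable_continuous/derivable1_diffP.
    by case: (dH b); rewrite ?lexx ?(ltW ab).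
- move=> x; rewrite in_itv /= => /andP[ax xb]; rewrite derive1E.
  by apply: @derive_val; apply: dH; rewrite (ltW ax) (ltW xb).
Qed.

Lemma cint_FTC (g G : R -> C) a b : a <= b -> rcnt_on a b g ->
  (forall x, a <= x <= b -> rder G x (g x)) -> cint a b g = G b - G a.
Proof.
rewrite le_eqVlt => /orP[/eqP <- cg _|ab cg dG].
  rewrite subrr /cint set_itv1 !Rintegral_set1; reflexivity.
apply/eqP; rewrite eq_complex /= ReB ImB; apply/andP; split; apply/eqP.
  apply: (@real_FTC _ (fun y => complex.Re (G y))) => // x xab.
    exact/rcnt_Re/cg.
  exact/rder_Re/dG.
apply: (@real_FTC _ (fun y => complex.Im (G y))) => // x xab.
  exact/rcnt_Im/cg.
exact/rder_Im/dG.
Qed.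

Lemma rcnt_ce (z v : C) x : rcnt (fun y => ce (z + (y%:C)%C * v)) x.
Proof. exact/rder_cnt/rder_ce. Qed.

Lemma cint_ce (z v : C) a b : v != 0 -> a <= b ->
  cint a b (fun x => ce (z + (x%:C)%C * v)) =
  (ce (z + (b%:C)%C * v) - ce (z + (a%:C)%C * v)) / v.
Proof.
move=> v0 ab; rewrite mulrBl.
apply: (@cint_FTC _ (fun x => ce (z + (x%:C)%C * v) / v)) => //.
  by move=> x _; exact: rcnt_ce.
move=> x _; have [phi [cp p0 H]] := rder_ce z v x.
exists (fun h => phi h / v); split.
- by apply: cntM => //; exact: cnt_cst.
- by rewrite p0 mulfK.
- by move=> h; rewrite H; ring.
Qed.

End ComplexIntegral.


(** * Goursat's bisection argument and circles *)

Section Goursat.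
Variable R : realType.
Local Notation C := (R[i]).

(** Goursat's argument for an abstract function of rectangles, additive under cuts and [o] of the
    squared size at each point. Some quarter carries at least a quarter of [|J|]; the chosen
    quarters shrink to a point, where the local bound is violated. The abstraction matters because
    [cauchy_circle] uses rectangles in a parameter plane. *)
Lemma bisection_zero (J : R -> R -> R -> R -> C) (x1 x2 y1 y2 : R) :
  x1 <= x2 -> y1 <= y2 ->
  (forall a b c y y', x1 <= a <= b -> b <= c <= x2 -> y1 <= y <= y' -> y' <= y2 ->
     J a c y y' = J a b y y' + J b c y y') ->
  (forall a b c x x', y1 <= a <= b -> b <= c <= y2 -> x1 <= x <= x' -> x' <= x2 ->
     J x x' a c = J x x' a b + J x x' b c) ->
  (forall x0 y0 e, x1 <= x0 <= x2 -> y1 <= y0 <= y2 -> 0 < e ->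
     exists2 d, 0 < d & forall a b a' b', x1 <= a <= x0 -> x0 <= b <= x2 ->
       y1 <= a' <= y0 -> y0 <= b' <= y2 -> b - a < d -> b' - a' < d ->
       normc (J a b a' b') <= e * ((b - a) + (b' - a')) ^+ 2) ->
  J x1 x2 y1 y2 = 0.
Proof.
move=> x12 y12 addx addy loc; apply/eqP; rewrite -nc_eq0; apply/eqP.
apply: contrapT => /eqP Jn0.
have J0 : 0 < normc (J x1 x2 y1 y2) by rewrite lt_neqAle eq_sym Jn0 nc_ge0.
pose Q := ((R * R) * (R * R))%type.
pose nJ (q : Q) := normc (J q.1.1 q.1.2 q.2.1 q.2.2).
pose hl (p : R * R) := (p.1, (p.1 + p.2) / 2).
pose hr (p : R * R) := ((p.1 + p.2) / 2, p.2).
pose step (q : Q) : Q :=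
  if nJ q <= 4 * nJ (hl q.1, hl q.2) then (hl q.1, hl q.2) else
  if nJ q <= 4 * nJ (hl q.1, hr q.2) then (hl q.1, hr q.2) else
  if nJ q <= 4 * nJ (hr q.1, hl q.2) then (hr q.1, hl q.2) else (hr q.1, hr q.2).
pose ok (q : Q) := [/\ x1 <= q.1.1, q.1.1 <= q.1.2, q.1.2 <= x2 &
  [/\ y1 <= q.2.1, q.2.1 <= q.2.2 & q.2.2 <= y2]].
have stepJ q : ok q -> nJ q <= 4 * nJ (step q).
  rewrite /step /ok; case: q => -[a b] [c d] /= [h1 h2 h3 [h4 h5 h6]].
  case: ifPn => // n1; case: ifPn => // n2; case: ifPn => // n3.
  move: n1 n2 n3; rewrite -!ltNge /nJ /=; set m := (a + b) / 2; set n := (c + d) / 2.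
  have am : a <= m by rewrite /m; lra.
  have mb : m <= b by rewrite /m; lra.
  have cn : c <= n by rewrite /n; lra.
  have nd : n <= d by rewrite /n; lra.
  rewrite (addx a m b c d) ?h1 ?am ?mb ?h4 ?h5//.
  rewrite (addy c n d a m) ?h4 ?h1 ?cn ?nd ?am ?(le_trans mb)//.
  rewrite (addy c n d m b) ?h4 ?cn ?nd ?mb ?(le_trans h1)//.
  set j1 := J a m c n; set j2 := J a m n d; set j3 := J m b c n; set j4 := J m b n d.
  have := le_normcD (j1 + j2) (j3 + j4).
  have := le_normcD j1 j2; have := le_normcD j3 j4; lra.
have stepok q : ok q -> [/\ ok (step q), q.1.1 <= (step q).1.1, q.2.1 <= (step q).2.1,
    (step q).1.2 <= q.1.2 & [/\ (step q).2.2 <= q.2.2,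
    (step q).1.2 - (step q).1.1 = (q.1.2 - q.1.1) / 2 &
    (step q).2.2 - (step q).2.1 = (q.2.2 - q.2.1) / 2]].
  rewrite /ok; case: q => -[a b] [c d] /= [h1 h2 h3 [h4 h5 h6]].
  rewrite /step /hl /hr /=; clear -h1 h2 h3 h4 h5 h6; do 3?[case: ifPn => _ /=].
  - by split; [split; [..|split]|..|split]; first [lra|by field].
  - by split; [split; [..|split]|..|split]; first [lra|by field].
  - by split; [split; [..|split]|..|split]; first [lra|by field].
  - by split; [split; [..|split]|..|split]; first [lra|by field].
pose q n := iter n step ((x1, x2), (y1, y2)).
have okq n : ok (q n).
  by elim: n => [|n /stepok[]//]; split; rewrite /= ?lexx.
have hJ n : normc (J x1 x2 y1 y2) <= 4 ^+ n * nJ (q n).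
  elim: n => [|n IH]; first by rewrite expr0 mul1r.
  apply: (le_trans IH); rewrite exprSr -mulrA ler_wpM2l ?exprn_ge0//.
  exact: stepJ.
have wx n : (q n).1.2 - (q n).1.1 = (x2 - x1) / 2 ^+ n.
  elim: n => [|n IH]; first by rewrite expr0 divr1.
  have [_ _ _ _ [_ e _]] := stepok _ (okq n).
  by rewrite [q n.+1]/(step (q n)) e IH exprSr invfM mulrA.
have wy n : (q n).2.2 - (q n).2.1 = (y2 - y1) / 2 ^+ n.
  elim: n => [|n IH]; first by rewrite expr0 divr1.
  have [_ _ _ _ [_ _ e]] := stepok _ (okq n).
  by rewrite [q n.+1]/(step (q n)) e IH exprSr invfM mulrA.
have mono n m : (n <= m)%N -> [/\ (q n).1.1 <= (q m).1.1, (q n).2.1 <= (q m).2.1,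
    (q m).1.2 <= (q n).1.2 & (q m).2.2 <= (q n).2.2].
  elim: m => [|m IH]; first by rewrite leqn0 => /eqP ->; split.
  rewrite leq_eqVlt => /orP[/eqP <-|]; first by split.
  rewrite ltnS => /IH[h1 h2 h3 h4].
  have [_ k1 k2 k3 [k4 _ _]] := stepok _ (okq m); rewrite [q m.+1]/(step (q m)).
  by split; [exact: le_trans h1 k1|exact: le_trans h2 k2|
    exact: le_trans k3 h3|exact: le_trans k4 h4].
have cross n m : (q n).1.1 <= (q m).1.2 /\ (q n).2.1 <= (q m).2.2.
  have [nm|/ltnW nm] := leqP n m.
    have [h1 h2 _ _] := mono _ _ nm; have [_ h3 _ [_ h4 _]] := okq m.
    by split; [exact: le_trans h1 h3|exact: le_trans h2 h4].
  have [_ _ h1 h2] := mono _ _ nm; have [_ h3 _ [_ h4 _]] := okq n.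
  by split; [exact: le_trans h3 h1|exact: le_trans h4 h2].
pose xs := sup (range (fun n => (q n).1.1)).
pose ys := sup (range (fun n => (q n).2.1)).
have xsn n : (q n).1.1 <= xs <= (q n).1.2.
  apply/andP; split.
    apply: ub_le_sup; last by exists n.
    by exists (q 0%N).1.2 => _ [m _ <-]; exact: (cross m 0%N).1.
  apply: ge_sup; first by exists (q 0%N).1.1; exists 0%N.
  by move=> _ [m _ <-]; exact: (cross m n).1.
have ysn n : (q n).2.1 <= ys <= (q n).2.2.
  apply/andP; split.
    apply: ub_le_sup; last by exists n.
    by exists (q 0%N).2.2 => _ [m _ <-]; exact: (cross m 0%N).2.
  apply: ge_sup; first by exists (q 0%N).2.1; exists 0%N.
  by move=> _ [m _ <-]; exact: (cross m n).2.
pose W := (x2 - x1) + (y2 - y1).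
have W0 : 0 <= W by rewrite /W; lra.
(* With this [e] the local bound at a tiny rectangle, scaled back by [4 ^ n], gives
   [|J| <= e * W ^+ 2 <= |J| / 2]. The added 1 covers [W = 0]. *)
pose e := normc (J x1 x2 y1 y2) / (2 * (W ^+ 2 + 1)).
have e0 : 0 < e by rewrite divr_gt0// mulr_gt0// ltr_wpDl ?sqr_ge0.
have [d d0 Hd] := loc xs ys e (xsn 0%N) (ysn 0%N) e0.
have [n nd] : exists n, W / 2 ^+ n < d.
  have := @cvg_geometric R 1 2^-1; rewrite ger0_norm ?invr_ge0// invf_lt1 ?ltr1n//.
  move=> /(_ isT) /cvgrPdist_lt /(_ (d / (W + 1))).
  rewrite divr_gt0//; last by rewrite ltr_wpDl.
  move=> /(_ isT) [n _ /(_ n (leqnn n))]; rewrite /= sub0r normrN /geometric /= mul1r.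
  rewrite ger0_norm ?exprn_ge0 ?invr_ge0// ltr_pdivlMr ?ltr_wpDl// => h.
  exists n; apply: le_lt_trans h; rewrite mulrC exprVn ler_wpM2l ?invr_ge0 ?exprn_ge0//; lra.
have [k1 k2 k3 [k4 k5 k6]] := okq n.
have /andP[l1 l2] := xsn n; have /andP[l3 l4] := ysn n.
have p2 : (0 : R) < 2 ^+ n by rewrite exprn_gt0.
have bnd : nJ (q n) <= e * (W / 2 ^+ n) ^+ 2.
  rewrite /W mulrDl -wx -wy; apply: Hd; rewrite ?l1 ?l2 ?l3 ?l4 ?k1 ?k3 ?k4 ?k6//.
  - rewrite wx; apply: le_lt_trans nd; rewrite ler_pM2r ?invr_gt0// /W; lra.
  - rewrite wy; apply: le_lt_trans nd; rewrite ler_pM2r ?invr_gt0// /W; lra.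
have : normc (J x1 x2 y1 y2) <= e * W ^+ 2.
  apply: (le_trans (hJ n)); apply: (le_trans (ler_wpM2l _ bnd)); first by rewrite exprn_ge0.
  rewrite expr_div_n -exprM mulnC exprM (_ : 2 ^+ 2 = 4 :> R); last by rewrite -natrX.
  by rewrite mulrCA (mulrC (4 ^+ n)) divfK ?expf_neq0.
rewrite /e mulrAC ler_pdivlMr ?mulr_gt0 ?ltr_wpDl ?sqr_ge0//.
have := sqr_ge0 W; nra.
Qed.

Lemma nc_ce_sub1 (u : R) : normc (ce (0 +i* u)%C - 1) <= `|u|.
Proof.
rewrite -(ler_pXn2r (ltn0Sn 1)) ?nnegrE ?normr_ge0 ?nc_ge0// nc_sqr.
rewrite ReB ImB ce_im /= subr0 real_normK ?num_real// sqrrB1.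
have := cos2Dsin2 u; have := cos_quad u; rewrite -mulr_natr.
move: (cos u ^+ 2) (sin u ^+ 2) (u ^+ 2) (cos u) => a b c d; lra.
Qed.

Lemma geometric_lt (x e : R) : 0 <= x < 1 -> 0 < e ->
  exists N, forall m, (N <= m)%N -> x ^+ m < e.
Proof.
move=> /andP[x0 x1] e0; have := @cvg_geometric R 1 x; rewrite ger0_norm// => /(_ x1).
move=> /cvgrPdist_lt /(_ _ e0)[N _ H]; exists N => m /H /=.
by rewrite sub0r normrN /geometric /= mul1r ger0_norm ?exprn_ge0.
Qed.

Definition circ (r t : R) : C := (r%:C)%C * ce (0 +i* t)%C.

Lemma nc_circ (r t : R) : 0 <= r -> normc (circ r t) = r.
Proof. by move=> r0; rewrite normcM nc_real nc_ce_im mulr1 ger0_norm. Qed.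

Lemma iE (t : R) : (0 +i* t)%C = (t%:C * 'i)%C.
Proof. by apply/eqP; rewrite eq_complex /= !mulr0 !mul0r mulr1 subr0 addr0 !eqxx. Qed.

Lemma circ_affine (r t : R) : circ r t = (r%:C)%C * ce (0 + (t%:C)%C * 'i%C).
Proof. by rewrite add0r -iE. Qed.

Lemma rcnt_circ r t : rcnt (circ r) t.
Proof.
have -> : circ r = (fun t => (r%:C)%C * ce (0 + (t%:C)%C * 'i%C)).
  by apply/funext => x; rewrite circ_affine.
by apply: cntM; [exact: cnt_cst|exact: rcnt_ce].
Qed.

Lemma rder_circ r t : rder (circ r) t ('i%C * circ r t).
Proof.
have -> : circ r = (fun t => (r%:C)%C * ce (0 + (t%:C)%C * 'i%C)).
  by apply/funext => x; rewrite circ_affine.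
have [phi [cp p0 H]] := rder_ce 0 ('i%C : C) t.
exists (fun h => (r%:C)%C * phi h); split.
- by apply: cntM => //; exact: cnt_cst.
- by rewrite p0; ring.
- by move=> h; rewrite H; ring.
Qed.

Lemma circ_2pi r : circ r (2 * pi) = circ r 0.
Proof.
by rewrite /circ !ce_im -[2]/(1 + 1) mulrDl mul1r -mulr2n cos2pi sin2pi cos0 sin0.
Qed.

Lemma nc_circB r t t' : 0 <= r -> normc (circ r t - circ r t') <= r * `|t - t'|.
Proof.
move=> r0; have -> : circ r t - circ r t' = circ r t' * (ce (0 +i* (t - t'))%C - 1).
  rewrite /circ mulrBr mulr1 -mulrA -ceD; congr (_ * ce _ - _).
  by apply/eqP; rewrite eq_complex /= addr0 subrKC !eqxx.
by rewrite normcM nc_circ// ler_wpM2l// nc_ce_sub1.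
Qed.

End Goursat.


(** * Cauchy's formula on a circle *)

Section CauchyCircle.
Variable R : realType.
Local Notation C := (R[i]).

Lemma eps_eq0 (z : C) (K : R) : (forall e, 0 < e -> normc z <= e * K) -> z = 0.
Proof.
move=> H; apply/eqP; rewrite -nc_eq0 eq_le nc_ge0 andbT leNgt; apply/negP => z0.
have K0 : 0 < K.
  by have := H _ ltr01; rewrite mul1r; exact: lt_le_trans.
have := H (normc z / (2 * K)); rewrite divr_gt0 ?mulr_gt0// => /(_ isT).
rewrite invfM mulrA divfK ?gt_eqF//; lra.
Qed.

Lemma expR_lip (x y : R) : x <= 0 -> y <= 0 -> `|expR x - expR y| <= `|x - y|.
Proof.
wlog xy : x y / x <= y.
  move=> H; have [xy|/ltW yx] := leP x y; first exact: H.
  by move=> *; rewrite distrC (distrC x) H.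
move=> x0 y0; rewrite !ler0_norm ?subr_le0 ?ler_expR//.
rewrite !opprB -{1}(subrKC y x) expRD -[X in X - _]mulr1 -mulrBr.
have h1 := expR_ge1Dx (x - y); have h2 : expR y <= 1 by rewrite expR_le1.
have := expR_ge0 y; have h4 : expR (x - y) <= 1 by rewrite expR_le1 subr_le0.
nra.
Qed.

Variables (f : C -> C) (r Rr : R) (w : C).
Hypotheses (r0 : 0 < r) (rR : r < Rr) (wr : normc w < r).
Hypothesis (df : forall z, normc z < Rr -> exists l, cder f z l).

Let g t : C := circ r t - w.
Let E x : C := ce (0 + (x%:C)%C * 1).
(** Log-polar coordinates around [w]: [H 0] runs over the circle, and it contracts to [w] as [x]
    tends to minus infinity. Since [H x t - w] is [E x * g t], the form [dz / (z - w)] pulls back to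
    [dx + cauchy_kernel t dt], which has no singularity; Goursat's argument therefore runs on
    rectangles in [(x, t)]. *)
Let H x t : C := w + E x * g t.
Definition cauchy_kernel t : C := 'i%C * circ r t / (circ r t - w).
Local Notation kap := cauchy_kernel.
Let K0 := r / (r - normc w).

Let K00 : 0 < K0.
Proof. by rewrite divr_gt0// subr_gt0. Qed.

Let ncg t : r - normc w <= normc (g t).
Proof. by have := nc_ler_sub (circ r t) w; rewrite nc_circ// ltW. Qed.

Let gn0 t : g t != 0.
Proof. by rewrite -nc_gt0; apply: lt_le_trans (ncg t); rewrite subr_gt0. Qed.

Lemma rcnt_kernel t : rcnt kap t.
Proof.
apply: cntM; first by apply: cntM; [exact: cnt_cst|exact: rcnt_circ].
by apply: cntV; [exact: gn0|apply: cntB; [exact: rcnt_circ|exact: cnt_cst]].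
Qed.

Lemma nc_kernel t : normc (kap t) <= K0.
Proof.
rewrite normcM normcV normcM nc_circ ?(ltW r0)//.
have -> : normc ('i%C : C) = 1 by rewrite /normc /= expr0n expr1n add0r sqrtr1.
rewrite mul1r ler_pM2l// lef_pV2 ?posrE ?subr_gt0//; first exact: ncg.
by rewrite nc_gt0 gn0.
Qed.

Let ncE x : normc (E x) = expR x.
Proof. by rewrite nc_ce add0r mulr1. Qed.

Let ncH x t : x <= 0 -> normc (H x t) < Rr.
Proof.
move=> x0; apply: le_lt_trans rR.
have -> : H x t = (1 - E x) * w + E x * circ r t by rewrite /H /g; ring.
apply: (le_trans (le_normcD _ _)).
rewrite (normcM (1 - E x)) (normcM (E x)) ncE nc_circ ?(ltW r0)//.
have -> : 1 - E x = ((1 - expR x)%:C)%C.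
  by rewrite /E add0r mulr1 ce_real rmorphB.
have h : expR x <= 1 by rewrite expR_le1.
rewrite nc_real ger0_norm ?subr_ge0//.
move: wr => /ltW wr'; have := expR_ge0 x; nra.
Qed.

Let cntHt x t : rcnt (H x) t.
Proof.
apply: cntD; first exact: cnt_cst.
apply: cntM; first exact: cnt_cst.
by apply: cntB; [exact: rcnt_circ|exact: cnt_cst].
Qed.

Let cntHx x t : rcnt (fun x => H x t) x.
Proof.
apply: cntD; first exact: cnt_cst.
by apply: cntM; [exact: rcnt_ce|exact: cnt_cst].
Qed.

Let cf x t : x <= 0 -> ccnt f (H x t).
Proof. by move=> x0; have [l /cder_cnt] := df (ncH t x0). Qed.

(** The integral of [F z / (z - w)] along the image under [H] of the boundary of [[x1, x2] x
    [y1, y2]]. *)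
Let rectint (F : C -> C) x1 x2 y1 y2 : C :=
  cint x1 x2 (fun x => F (H x y1)) + cint y1 y2 (fun y => F (H x2 y) * kap y)
  - cint x1 x2 (fun x => F (H x y2)) - cint y1 y2 (fun y => F (H x1 y) * kap y).

Let onX (F : C -> C) : (forall x t, x <= 0 -> ccnt F (H x t)) ->
  forall a b t, b <= 0 -> rcnt_on a b (fun x => F (H x t)).
Proof.
move=> cF a b t b0 x /andP[_ xb]; apply: (@cnt_comp _ _ _ (fun x => H x t)).
  exact: cntHx.
by apply: cF; exact: le_trans b0.
Qed.

Let onY (F : C -> C) : (forall x t, x <= 0 -> ccnt F (H x t)) ->
  forall a b x, x <= 0 -> rcnt_on a b (fun y => F (H x y) * kap y).
Proof.
move=> cF a b x x0 y _; apply: cntM; last exact: rcnt_kernel.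
by apply: (@cnt_comp _ _ _ (H x)); [exact: cntHt|exact: cF].
Qed.

Let rectintB F G a b c d : (forall x t, x <= 0 -> ccnt F (H x t)) ->
  (forall x t, x <= 0 -> ccnt G (H x t)) -> a <= b <= 0 ->
  rectint (fun z => F z - G z) a b c d = rectint F a b c d - rectint G a b c d.
Proof.
move=> cF cG /andP[ab b0]; have a0 := le_trans ab b0.
rewrite /rectint !cintB; try exact: onX.
have eqY x : (fun y => (F (H x y) - G (H x y)) * kap y) =
    (fun y => F (H x y) * kap y - G (H x y) * kap y).
  by apply/funext => y; ring.
by rewrite !eqY !cintB; try exact: onY; ring.
Qed.

Let rectint_affine (al l : C) a b c d : a <= b <= 0 -> c <= d ->
  rectint (fun z => al + l * z) a b c d = 0.
Proof.
move=> /andP[ab b0] cd.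
have rE x : rcnt E x by exact: rcnt_ce.
have intX y : cint a b (fun x => al + l * H x y) =
    ((b - a)%:C)%C * (al + l * w) + l * g y * (E b - E a).
  have -> : (fun x => al + l * H x y) = (fun x => (al + l * w) + (l * g y) * E x).
    by apply/funext => x; rewrite /H; ring.
  rewrite cintD; first last.
  - by move=> x _; apply: cntM; [exact: cnt_cst|exact: rE].
  - by move=> x _; exact: cnt_cst.
  rewrite cint_cst// cintZ; last by move=> x _.
  by rewrite cint_ce ?oner_eq0// divr1.
have intY x : cint c d (fun y => (al + l * H x y) * kap y) =
    (al + l * w) * cint c d kap + l * E x * (g d - g c).
  have -> : (fun y => (al + l * H x y) * kap y) =
      (fun y => (al + l * w) * kap y + (l * E x) * ('i%C * circ r y)).
    apply/funext => y; rewrite /H /kap -/(g y); have := gn0 y => gy.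
    by field.
  rewrite cintD; first last.
  - move=> y _; apply: cntM; first exact: cnt_cst.
    by apply: cntM; [exact: cnt_cst|exact: rcnt_circ].
  - by move=> y _; apply: cntM; [exact: cnt_cst|exact: rcnt_kernel].
  rewrite cintZ; last by move=> y _; exact: rcnt_kernel.
  rewrite cintZ; last by move=> y _; apply: cntM; [exact: cnt_cst|exact: rcnt_circ].
  rewrite (@cint_FTC _ (fun y => 'i%C * circ r y) (circ r))//.
  - by rewrite /g; ring.
  - by move=> y _; apply: cntM; [exact: cnt_cst|exact: rcnt_circ].
  - by move=> y _; exact: rder_circ.
by rewrite /rectint !intX !intY; ring.
Qed.

Let nc_rectint F a b c d (m : R) : (forall x t, x <= 0 -> ccnt F (H x t)) ->
  a <= b <= 0 -> c <= d -> 0 <= m ->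
  (forall x y, a <= x <= b -> c <= y <= d -> normc (F (H x y)) <= m) ->
  normc (rectint F a b c d) <= m * (2 * (1 + K0)) * ((b - a) + (d - c)).
Proof.
move=> cF /andP[ab b0] cd m0 Fm; have a0 := le_trans ab b0.
have aab : a <= a <= b by rewrite lexx.
have bab : a <= b <= b by rewrite lexx ab.
have ccd : c <= c <= d by rewrite lexx.
have dcd : c <= d <= d by rewrite lexx cd.
have bX y : c <= y <= d -> normc (cint a b (fun x => F (H x y))) <= m * (b - a).
  move=> cyd; apply: nc_cint_bound => //; first exact: onX.
  by move=> x axb; exact: Fm.
have bY x : a <= x <= b -> normc (cint c d (fun y => F (H x y) * kap y)) <= m * K0 * (d - c).
  move=> axb; apply: nc_cint_bound => //.
    by apply: onY => //; case/andP: axb => _ /le_trans; exact.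
  move=> y cyd; rewrite normcM; apply: ler_pM; rewrite ?nc_ge0//; first exact: Fm.
  exact: nc_kernel.
rewrite /rectint.
set i1 := cint _ _ _; set i2 := cint _ _ _; set i3 := cint _ _ _; set i4 := cint _ _ _.
have h1 : normc i1 <= _ := bX _ ccd; have h3 : normc i3 <= _ := bX _ dcd.
have h2 : normc i2 <= _ := bY _ bab; have h4 : normc i4 <= _ := bY _ aab.
have := ncB (i1 + i2 - i3) i4; have := ncB (i1 + i2) i3; have := le_normcD i1 i2.
have k1 : 0 <= m * (b - a) by rewrite mulr_ge0// subr_ge0.
have k2 : 0 <= m * (d - c) by rewrite mulr_ge0// subr_ge0.
have k3 : 0 <= m * (b - a) * K0 by rewrite mulr_ge0// ltW.
have k4 : 0 <= m * (d - c) * K0 by rewrite mulr_ge0// ltW.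
nra.
Qed.

Let rectint0 x1 y1 y2 : x1 <= 0 -> y1 <= y2 -> rectint f x1 0 y1 y2 = 0.
Proof.
move=> x10 y12; apply: bisection_zero => //.
- move=> a b c y y' /andP[_ ab] /andP[bc c0] _ _.
  have b0 := le_trans bc c0.
  rewrite /rectint (@cint_split _ a b c (fun x => f (H x y)));
    [|by rewrite ab|exact: onX].
  rewrite (@cint_split _ a b c (fun x => f (H x y'))); [|by rewrite ab|exact: onX].
  by do ![move: (cint _ _ _) => ?]; ring.
- move=> a b c x x' /andP[_ ab] /andP[bc _] /andP[_ xx'] x0.
  rewrite /rectint (@cint_split _ a b c (fun y => f (H x y) * kap y));
    [|by rewrite ab|apply: onY => //; exact: le_trans x0].
  rewrite (@cint_split _ a b c (fun y => f (H x' y) * kap y));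
    [|by rewrite ab|exact: onY].
  by do ![move: (cint _ _ _) => ?]; ring.
move=> x0 y0 e /andP[_ x00] _ e0.
have [l dl] := df (ncH y0 x00).
pose q := 8 * r * (1 + K0).
have q0 : 0 < q by rewrite !mulr_gt0// addr_gt0.
have e1 : 0 < e / q by rewrite divr_gt0.
have [d1 d10 Hd] := cder_eps dl e1.
exists (d1 / (8 * r)) => [|a b c d /andP[_ ax0] /andP[x0b b0] /andP[_ cy0] /andP[y0d _] bad dcd].
  by rewrite divr_gt0// mulr_gt0.
(* The tangent map integrates to 0 by [rectint_affine]. The difference is at most [e / q] times the
   displacement, and [q] collects the constants of the displacement bound and of [nc_rectint]. *)
pose aff z := (f (H x0 y0) - l * H x0 y0) + l * z.
have caff x t : x <= 0 -> ccnt aff (H x t).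
  move=> _; apply: cntD; first exact: cnt_cst.
  by apply: cntM; [exact: cnt_cst|exact: ccnt_id].
have ab := le_trans ax0 x0b; have cd := le_trans cy0 y0d.
have ab0 : a <= b <= 0 by rewrite ab.
have -> : rectint f a b c d = rectint (fun z => f z - aff z) a b c d.
  by rewrite rectintB// [X in _ - X]rectint_affine// subr0.
pose S := (b - a) + (d - c).
have S0 : 0 <= S by rewrite addr_ge0// subr_ge0.
have -> : e * S ^+ 2 = (e / q * (4 * r * S)) * (2 * (1 + K0)) * S.
  by rewrite /q; field; rewrite !gt_eqF// addr_gt0.
apply: nc_rectint => //.
- by move=> x t x0'; apply: cntB; [exact: cf|exact: caff].
- by apply: mulr_ge0; [exact: ltW|rewrite !mulr_ge0// ltW].
move=> x y /andP[ax xb] /andP[cy yd].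
have HH : normc (H x y - H x0 y0) <= 4 * r * S / 2.
  have -> : H x y - H x0 y0 = (E x - E x0) * g y + E x0 * (circ r y - circ r y0).
    by rewrite /H /g; ring.
  apply: (le_trans (le_normcD _ _)).
  rewrite (normcM (E x - E x0)) (normcM (E x0)) ncE.
  have i1 : normc (E x - E x0) <= b - a.
    rewrite /E !add0r !mulr1 !ce_real -rmorphB nc_real.
    apply: (le_trans (expR_lip _ _)); rewrite ?(le_trans xb)//.
    by rewrite ler_norml; lra.
  have i2 : normc (g y) <= 2 * r.
    apply: (le_trans (ncB _ _)); rewrite nc_circ ?(ltW r0)//; move: wr; lra.
  have i3 : normc (circ r y - circ r y0) <= r * (d - c).
    apply: (le_trans (nc_circB _ _ (ltW r0))); rewrite ler_pM2l//.
    by rewrite ler_norml; lra.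
  have i4 : expR x0 <= 1 by rewrite expR_le1.
  have i5 := expR_ge0 x0; have i6 := nc_ge0 (circ r y - circ r y0).
  have i7 : normc (E x - E x0) * normc (g y) <= (b - a) * (2 * r).
    by apply: ler_pM; rewrite ?nc_ge0.
  have i8 : expR x0 * normc (circ r y - circ r y0) <= 1 * (r * (d - c)).
    by apply: ler_pM; rewrite ?nc_ge0.
  have i9 : 0 <= r * (d - c) by rewrite mulr_ge0 ?subr_ge0// ltW.
  rewrite /S; lra.
have Sd : 4 * r * S / 2 < d1.
  move: bad dcd; rewrite !ltr_pdivlMr ?mulr_gt0// /S; lra.
have := Hd (H x y - H x0 y0) (le_lt_trans HH Sd).
rewrite subrKC.
have -> : f (H x y) - f (H x0 y0) - l * (H x y - H x0 y0) = f (H x y) - aff (H x y).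
  by rewrite /aff; ring.
move=> h; apply: (le_trans h); rewrite ler_pM2l//; apply: (le_trans HH).
have : 0 <= 4 * r * S by rewrite !mulr_ge0// ltW.
lra.
Qed.

(** The sides at [t = 0] and [t = 2 * pi] cancel by periodicity, so the integral over the circle
    equals that over its contractions, where [f] is close to [f w]. The winding integral on the
    right stays unevaluated; [cauchy_pser] computes it from the geometric series. *)
Theorem cauchy_circle :
  cint 0 (2 * pi) (fun t => f (circ r t) * kap t) = f w * cint 0 (2 * pi) kap.
Proof.
have pi0 : (0 : R) <= 2 * pi by rewrite mulr_ge0// pi_ge0.
have key x : x <= 0 -> cint 0 (2 * pi) (fun t => f (circ r t) * kap t) =
    cint 0 (2 * pi) (fun t => f (H x t) * kap t).
  move=> x0; have := rectint0 x0 pi0; rewrite /rectint.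
  have -> : (fun x => f (H x (2 * pi))) = (fun x => f (H x 0)).
    by apply/funext => u; rewrite /H /g circ_2pi.
  have -> : (fun y => f (H 0 y) * kap y) = (fun t => f (circ r t) * kap t).
    by apply/funext => t; rewrite /H /E mul0r addr0 ce0 mul1r /g subrKC.
  by rewrite [X in X - _ - _]addrC addrK => /eqP; rewrite subr_eq0 => /eqP.
apply/eqP; rewrite -subr_eq0; apply/eqP.
apply: (@eps_eq0 _ (K0 * (2 * pi))) => e e0.
have wR : normc w < Rr by exact: lt_trans rR.
have [l /cder_cnt /(_ _ e0)[d d0 Hd]] := df wR.
(* At [x = - u] the contracted circle lies within [2 * r * expR (- u) <= 2 * r / u = d] of [w]. *)
pose u := 2 * r / d.
have u0 : 0 < u by rewrite divr_gt0// mulr_gt0.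
have xu : - u <= 0 by rewrite oppr_le0 ltW.
rewrite (key _ xu) -cintZ; last by move=> t _; exact: rcnt_kernel.
rewrite -cintB; [|exact: onY|by move=> t _; apply: cntM; [exact: cnt_cst|exact: rcnt_kernel]].
have -> : e * (K0 * (2 * pi)) = (e * K0) * (2 * pi - 0) by rewrite subr0 (mulrA e K0).
apply: nc_cint_bound => //.
  move=> t ht; apply: cntB; first exact: (onY cf xu ht).
  by apply: cntM; [exact: cnt_cst|exact: rcnt_kernel].
move=> t _; rewrite -mulrBl normcM; apply: ler_pM; rewrite ?nc_ge0 ?nc_kernel//.
apply/ltW/Hd; rewrite (normcM (E _)) ncE.
have : normc (g t) < 2 * r.
  apply: (le_lt_trans (ncB _ _)); rewrite nc_circ ?(ltW r0)//; move: wr; lra.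
have e1 : expR (- u) * u <= 1.
  rewrite expRN mulrC ler_pdivrMr ?expR_gt0// mul1r.
  by have := expR_ge1Dx u; lra.
have du : d * u = 2 * r by rewrite /u mulrC divfK ?gt_eqF.
have := expR_gt0 (- u); move=> h1 h2.
apply: (@lt_le_trans _ _ (expR (- u) * (2 * r))); first by rewrite ltr_pM2l.
rewrite -du mulrCA -[X in _ <= X]mulr1; apply: ler_wpM2l => //; exact: ltW.
Qed.

End CauchyCircle.


(** * Holomorphic functions on discs *)

Section PowerSeries.
Variable R : realType.
Local Notation C := (R[i]).
Implicit Types (f g : C -> C) (a b : nat -> C) (r M : R) (w z : C).

(* [f] is the sum of the power series [a] on the disc of radius [r], with the
   rate of convergence given by the bound [normc (a k) <= M / r ^ k]. *)
Definition pser f a r M := (forall k, normc (a k) * r ^+ k <= M) /\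
  forall w, normc w < r -> forall m,
    normc (f w - \sum_(k < m) a k * w ^+ k) <=
    M * (normc w / r) ^+ m * (r / (r - normc w)).

Definition holo_disc f r := forall z, normc z < r -> exists l, cder f z l.

Lemma nc_i : normc ('i%C : C) = 1.
Proof. by rewrite /normc /= expr0n expr1n add0r sqrtr1. Qed.

Lemma circ_neq0 r t : 0 < r -> circ r t != 0.
Proof. by move=> r0; rewrite -nc_gt0 nc_circ// ltW. Qed.

Lemma rcnt_circX r t k : 0 < r -> rcnt (fun t => (circ r t)^-1 ^+ k) t.
Proof.
move=> r0; elim: k => [|k IH]; first exact: cnt_cst.
have -> : (fun t => (circ r t)^-1 ^+ k.+1) =
    (fun t => (circ r t)^-1 * (circ r t)^-1 ^+ k).
  by apply/funext => u; rewrite exprS.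
apply: cntM => //; apply: cntV; [exact: circ_neq0|exact: rcnt_circ].
Qed.

(** On the circle [z / (z - w)] is a geometric series in [w / z] whose remainder after [m] terms is
    exactly [(w / z) ^+ m] times the kernel; this is the source of the rate in [pser]. *)
Lemma kernel_expand (F : R -> C) r w M m : 0 < r -> normc w < r ->
  rcnt_on 0 (2 * pi) F -> (forall t, normc (F t) <= M) ->
  normc (cint 0 (2 * pi) (fun t => F t * cauchy_kernel r w t) -
    'i%C * \sum_(k < m) w ^+ k * cint 0 (2 * pi) (fun t => F t * (circ r t)^-1 ^+ k))
  <= M * (normc w / r) ^+ m * (r / (r - normc w)) * (2 * pi).
Proof.
move=> r0 wr cF FM.
have pi0 : (0 : R) <= 2 * pi by rewrite mulr_ge0// pi_ge0.
have cFX k : rcnt_on 0 (2 * pi) (fun t => F t * (circ r t)^-1 ^+ k).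
  by move=> t /cF ct; apply: cntM => //; exact: rcnt_circX.
have cS : rcnt_on 0 (2 * pi) (fun t => \sum_(k < m) w ^+ k * (F t * (circ r t)^-1 ^+ k)).
  move=> t ht; apply: cnt_sum => k _; apply: cntM; first exact: cnt_cst.
  exact: cFX.
have -> : \sum_(k < m) w ^+ k * cint 0 (2 * pi) (fun t => F t * (circ r t)^-1 ^+ k) =
    cint 0 (2 * pi) (fun t => \sum_(k < m) w ^+ k * (F t * (circ r t)^-1 ^+ k)).
  rewrite cint_sum; last first.
    by move=> k _ t ht; apply: cntM; [exact: cnt_cst|exact: cFX].
  by apply: eq_bigr => k _; rewrite cintZ//.
have cK : rcnt_on 0 (2 * pi) (fun t => F t * cauchy_kernel r w t).
  by move=> t /cF ct; apply: cntM => //; exact: rcnt_kernel.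
have ciS : rcnt_on 0 (2 * pi) (fun t => 'i%C *
    \sum_(k < m) w ^+ k * (F t * (circ r t)^-1 ^+ k)).
  by move=> t ht; apply: cntM; [exact: cnt_cst|exact: cS].
rewrite -cintZ// -cintB//.
have -> (A : R) : A * (2 * pi) = A * (2 * pi - 0) by rewrite subr0.
apply: nc_cint_bound => //.
  by move=> t ht; apply: cntB; [exact: cK|exact: ciS].
move=> t _; set z := circ r t.
have z0 : z != 0 by exact: circ_neq0.
have zw : z - w != 0.
  rewrite -nc_gt0; apply: lt_le_trans (nc_ler_sub z w).
  by rewrite nc_circ ?subr_gt0// ltW.
have -> : F t * cauchy_kernel r w t -
    'i%C * (\sum_(k < m) w ^+ k * (F t * z^-1 ^+ k)) =
    F t * (w / z) ^+ m * cauchy_kernel r w t.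
  have -> : \sum_(k < m) w ^+ k * (F t * z^-1 ^+ k) =
      F t * \sum_(k < m) (w / z) ^+ k.
    by rewrite mulr_sumr; apply: eq_bigr => k _; rewrite exprMn; ring.
  have q1 : w / z - 1 != 0.
    by rewrite subr_eq0; apply: contra zw => /eqP e; rewrite subr_eq0 eq_sym -(divfK z0 w) e mul1r.
  have -> : \sum_(k < m) (w / z) ^+ k = ((w / z) ^+ m - 1) / (w / z - 1).
    by rewrite subrX1 mulrAC mulfV// mul1r.
  rewrite /cauchy_kernel -/z; move: ((w / z) ^+ m) => Q.
  have -> : w / z - 1 = - ((z - w) / z) by field.
  by field; rewrite z0 zw.
rewrite !normcM nc_X normcM normcV nc_circ ?(ltW r0)//.
apply: ler_pM; rewrite ?mulr_ge0 ?nc_ge0 ?exprn_ge0 ?divr_ge0 ?nc_ge0 ?(ltW r0)//.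
  by apply: ler_wpM2r; rewrite ?exprn_ge0 ?divr_ge0 ?nc_ge0 ?(ltW r0).
by have := @nc_kernel R r w r0 wr t; rewrite /cauchy_kernel !normcM.
Qed.

Lemma ce_2pik k : ce ((2 * pi)%:C%C * (- k%:R * 'i%C)) = 1 :> C.
Proof.
have -> : (2 * pi)%:C%C * (- k%:R * 'i%C) = - (k%:R * (0 +i* (2 * pi))%C) :> C.
  by rewrite (iE (2 * pi)) mulNr mulrN mulrCA.
rewrite ceN ceX ce_im -[2]/(1 + 1) mulrDl mul1r -mulr2n cos2pi sin2pi.
by rewrite expr1n invr1.
Qed.

Lemma cint_circX r k : 0 < r -> cint 0 (2 * pi) (fun t => 1 * (circ r t)^-1 ^+ k) =
  if k == 0%N then ((2 * pi)%:C)%C else 0.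
Proof.
move=> r0; have pi0 : (0 : R) <= 2 * pi by rewrite mulr_ge0// pi_ge0.
case: eqVneq => [->|k0].
  rewrite (_ : (fun t => _) = (fun=> 1)); last by apply/funext => t; rewrite expr0 mulr1.
  by rewrite cint_cst// subr0 mulr1.
have -> : (fun t => 1 * (circ r t)^-1 ^+ k) =
    (fun t => (r%:C)%C^-1 ^+ k * ce (0 + (t%:C)%C * (- k%:R * 'i%C))).
  apply/funext => t; rewrite mul1r /circ invfM exprMn add0r; congr (_ * _).
  by rewrite -ceN -ceX iE; congr ce; rewrite mulNr !mulrN mulrCA.
rewrite cintZ; last by move=> t _; exact: rcnt_ce.
rewrite cint_ce//; last by rewrite mulf_neq0 ?oppr_eq0 ?pnatr_eq0// -nc_eq0 nc_i oner_eq0.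
by rewrite !add0r ce_2pik mul0r ce0 subrr mul0r mulr0.
Qed.

Lemma cauchy_pser f r Rr M : 0 < r -> r < Rr -> holo_disc f Rr ->
  (forall t, normc (f (circ r t)) <= M) -> exists a, pser f a r M.
Proof.
move=> r0 rR hf fM.
have pi0 : (0 : R) < 2 * pi by rewrite mulr_gt0// pi_gt0.
have cf : rcnt_on 0 (2 * pi) (fun t => f (circ r t)).
  move=> t _; apply: cnt_comp; first exact: rcnt_circ.
  have cR : normc (circ r t) < Rr by rewrite nc_circ// ltW.
  by have [l /cder_cnt] := hf _ cR.
pose c k := cint 0 (2 * pi) (fun t => f (circ r t) * (circ r t)^-1 ^+ k).
have pin0 : ((2 * pi)%:C)%C != 0 :> C by rewrite fmorph_eq0 gt_eqF.
exists (fun k => c k / ((2 * pi)%:C)%C); split.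
  move=> k; rewrite normcM normcV nc_real (ger0_norm (ltW pi0)).
  rewrite mulrAC ler_pdivrMr// -ler_pdivlMr ?exprn_gt0//.
  have -> : M * (2 * pi) / r ^+ k = M / r ^+ k * (2 * pi - 0) by rewrite subr0; ring.
  apply: nc_cint_bound; first exact: ltW.
    by move=> t /cf ct; apply: cntM => //; exact: rcnt_circX.
  move=> t _; rewrite normcM nc_X normcV nc_circ ?(ltW r0)// exprVn.
  by rewrite ler_wpM2r ?invr_ge0 ?exprn_ge0 ?(ltW r0).
have i0 : ('i%C : C) != 0 by rewrite -nc_eq0 nc_i oner_eq0.
move=> w wr m.
(* [kernel_expand] for the constant function 1: all moments but the zeroth vanish, whence the
   winding integral [2 i pi]. *)
have K1 : cint 0 (2 * pi) (cauchy_kernel r w) = 'i%C * ((2 * pi)%:C)%C.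
  apply/eqP; rewrite -subr_eq0; apply/eqP.
  apply: (@eps_eq0 _ _ (r / (r - normc w) * (2 * pi))) => e e0.
  have [|N HN] := @geometric_lt R (normc w / r) e _ e0.
    by rewrite divr_ge0 ?nc_ge0 ?(ltW r0)//= ltr_pdivrMr// mul1r.
  have := @kernel_expand (fun=> 1) r w 1 N.+1 r0 wr.
  have -> : (fun t => 1 * cauchy_kernel r w t) = cauchy_kernel r w.
    by apply/funext => t; rewrite mul1r.
  rewrite big_ord_recl expr0 mul1r cint_circX// eqxx big1 ?addr0; last first.
    by move=> i _; rewrite cint_circX//= mulr0.
  move=> H; apply: (le_trans (H _ _)).
  - by move=> t _; exact: cnt_cst.
  - by move=> t; rewrite normc1.
  rewrite mul1r -mulrA ler_wpM2r//; last exact/ltW/HN.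
  by rewrite mulr_ge0 ?(ltW pi0)// divr_ge0 ?(ltW r0)// subr_ge0 ltW.
have := @kernel_expand (fun t => f (circ r t)) r w M m r0 wr cf fM.
rewrite (cauchy_circle r0 rR wr hf) K1.
have -> : \sum_(k < m) w ^+ k * cint 0 (2 * pi) (fun t => f (circ r t) * (circ r t)^-1 ^+ k)
   = ((2 * pi)%:C)%C * \sum_(k < m) c k / ((2 * pi)%:C)%C * w ^+ k.
  rewrite mulr_sumr; apply: eq_bigr => k _.
  by rewrite -/(c k) mulrA (mulrC _ (c k / _)) divfK// mulrC.
have -> : f w * ('i%C * ((2 * pi)%:C)%C) - 'i%C * (((2 * pi)%:C)%C *
   \sum_(k < m) c k / ((2 * pi)%:C)%C * w ^+ k) =
   (f w - \sum_(k < m) c k / ((2 * pi)%:C)%C * w ^+ k) * ('i%C * ((2 * pi)%:C)%C).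
  ring.
rewrite normcM (normcM 'i%C) nc_i mul1r nc_real (ger0_norm (ltW pi0)).
by rewrite ler_pM2r.
Qed.

Lemma rcnt_nc (F : R -> C) x : rcnt F x -> {for x, continuous (fun y => normc (F y))}.
Proof.
move=> cF; apply/cvgrPdist_lt => e /cF[d d0 fd].
apply/nbhs_ballP; exists d => //= y; rewrite /ball /= distrC => xy.
apply: (@le_lt_trans _ _ (normc (F y - F x))).
  rewrite ler_norml; have := nc_ler_sub (F y) (F x); have := nc_ler_sub (F x) (F y).
  rewrite (nc_distC (F x)); lra.
by rewrite -(subrKC x y); exact: fd.
Qed.

Lemma rcnt_bounded (F : R -> C) (a b : R) : a <= b -> rcnt_on a b F ->
  exists M, forall x, a <= x <= b -> normc (F x) <= M.
Proof.
move=> ab cF; have [|c cab H] := @EVT_max R (fun y => normc (F y)) a b ab.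
  apply: continuous_in_subspaceT => x; rewrite inE /= in_itv /= => xab.
  exact/rcnt_nc/cF.
by exists (normc (F c)) => x xab; apply: H; rewrite in_itv.
Qed.

Lemma circ_surj r z : 0 <= r -> normc z = r -> exists2 t, 0 <= t <= 2 * pi & z = circ r t.
Proof.
move=> r0 zr; have [r00|rn0] := eqVneq r 0.
  exists 0; first by rewrite lexx mulr_ge0 ?pi_ge0.
  by rewrite /circ r00 mul0r; apply/eqP; rewrite -nc_eq0 zr r00.
have rp : 0 < r by rewrite lt_neqAle eq_sym rn0.
have := nc_sqr z; rewrite zr => rr.
pose x := complex.Re z / r; pose y := complex.Im z / r.
have xy : x ^+ 2 + y ^+ 2 = 1.
  by rewrite !expr_div_n -mulrDl -rr mulfV// expf_neq0.
have x1 : -1 <= x <= 1.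
  rewrite -ler_norml -(ler_pXn2r (ltn0Sn 1)) ?nnegrE// real_normK ?num_real// expr1n.
  by rewrite -xy lerDl sqr_ge0.
have hp := @acos_ge0 R x x1; have hq := @acos_lepi R x x1.
have s := sin_acos x1; have c := acosK x1.
have sy : Num.sqrt (1 - x ^+ 2) = `|y| by rewrite -xy addrC addKr sqrtr_sqr.
have zE (t : R) : cos t = x -> sin t = y -> z = circ r t.
  move=> cx sx; rewrite /circ ce_im cx sx; apply/eqP; rewrite eq_complex /= !mul0r.
  by rewrite subr0 addr0 /x /y !(mulrC r) !divfK// !eqxx.
have [y0|y0] := leP 0 y.
  exists (acos x); first by rewrite hp /=; have := pi_ge0 R; lra.
  by apply: zE => //; rewrite s sy ger0_norm.
exists (2 * pi - acos x); first by apply/andP; split; lra.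
have p2 : 2 * pi = pi *+ 2 :> R by rewrite mulr_natl.
apply: zE.
  by rewrite p2 cosB cos2pi sin2pi mul1r mul0r addr0.
by rewrite p2 sinB cos2pi sin2pi mul1r mul0r sub0r s sy ltr0_norm ?opprK.
Qed.

Lemma circle_bounded f r Rr : 0 < r -> r < Rr -> holo_disc f Rr ->
  exists M, forall t, normc (f (circ r t)) <= M.
Proof.
move=> r0 rR hf.
have [||M HM] := @rcnt_bounded (fun t => f (circ r t)) 0 (2 * pi).
- by rewrite mulr_ge0// pi_ge0.
- move=> t _; apply: cnt_comp; first exact: rcnt_circ.
  have cR : normc (circ r t) < Rr by rewrite nc_circ// ltW.
  by have [l /cder_cnt] := hf _ cR.
exists M => t; have := nc_circ t (ltW r0) => /(circ_surj (ltW r0))[u u2 ->].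
exact: HM.
Qed.

Lemma holo_pser f r Rr : 0 < r -> r < Rr -> holo_disc f Rr ->
  exists a M, pser f a r M.
Proof.
move=> r0 rR hf; have [M HM] := circle_bounded r0 rR hf.
by have [a pa] := cauchy_pser r0 rR hf HM; exists a, M.
Qed.

End PowerSeries.


(** * Sums, uniqueness and derivatives of power series *)

Section PowerSeriesTheory.
Variable R : realType.
Local Notation C := (R[i]).
Implicit Types (f g : C -> C) (a b : nat -> C) (r M : R) (w z : C).

Lemma geo_sum_le (q : R) m n : 0 <= q < 1 ->
  \sum_(m <= k < n) q ^+ k <= q ^+ m / (1 - q).
Proof.
move=> /andP[q0 q1]; have q1' : 0 < 1 - q by rewrite subr_gt0.
have [nm|mn] := leqP n m; first by rewrite big_geq// divr_ge0 ?exprn_ge0 ?(ltW q1').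
suff : \sum_(m <= k < n) q ^+ k = (q ^+ m - q ^+ n) / (1 - q).
  by move=> ->; rewrite ler_pM2r ?invr_gt0// gerBl exprn_ge0.
apply: (mulIf (lt0r_neq0 q1')); rewrite divfK ?lt0r_neq0//.
rewrite -(subnKC (ltnW mn)); move: (n - m)%N => {mn}n.
elim: n => [|n IH]; first by rewrite addn0 big_geq// mul0r subrr.
by rewrite addnS big_nat_recr ?leq_addr//= mulrDl IH exprS; ring.
Qed.

Lemma sum_ord_tail (V : zmodType) (F : nat -> V) m n : (m <= n)%N ->
  \sum_(k < n) F k - \sum_(k < m) F k = \sum_(m <= k < n) F k.
Proof.
move=> mn; rewrite -!(big_mkord xpredT F) (big_cat_nat (leq0n m) mn) /=.
by rewrite addrAC subrr add0r.
Qed.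

Lemma le_eps (x y : R) : (forall e, 0 < e -> x <= y + e) -> x <= y.
Proof.
move=> H; rewrite leNgt; apply/negP => yx.
have := H ((x - y) / 2); rewrite divr_gt0 ?subr_gt0// => /(_ isT); lra.
Qed.

Lemma pser_ratio r w : 0 < r -> normc w < r ->
  (0 <= normc w / r < 1) /\ r / (r - normc w) = (1 - normc w / r)^-1.
Proof.
move=> r0 wr; split.
  by rewrite divr_ge0 ?nc_ge0 ?(ltW r0)//= ltr_pdivrMr// mul1r.
by field; rewrite (gt_eqF r0) subr_eq0 (gt_eqF wr).
Qed.

Lemma pser_term a r M w k : 0 < r -> normc w < r -> normc (a k) * r ^+ k <= M ->
  normc (a k * w ^+ k) <= M * (normc w / r) ^+ k.
Proof.
move=> r0 wr ak; rewrite normcM nc_X expr_div_n mulrA ler_pdivlMr ?exprn_gt0//.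
by rewrite mulrAC ler_wpM2r ?exprn_ge0 ?nc_ge0.
Qed.

Definition psum a w : C :=
  (limn (series (fun k => complex.Re (a k * w ^+ k))) +i*
   limn (series (fun k => complex.Im (a k * w ^+ k))))%C.

Lemma psum_pser a r M : 0 < r -> (forall k, normc (a k) * r ^+ k <= M) ->
  pser (psum a) a r M.
Proof.
move=> r0 aM; split => // w wr m.
have [q01 ->] := pser_ratio r0 wr; set q := normc w / r in q01 *.
have M0 : 0 <= M by apply: le_trans (aM 0%N); rewrite mulr_ge0 ?nc_ge0 ?exprn_ge0 ?(ltW r0).
have tm k : normc (a k * w ^+ k) <= M * q ^+ k by exact: pser_term.
have cv (P : C -> R) : (forall z, `|P z| <= normc z) ->
    cvgn (series (fun k => P (a k * w ^+ k))).
  move=> PN; apply: normed_cvg.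
  apply: (@series_le_cvg _ _ (geometric M q)).
  - by move=> k; exact: normr_ge0.
  - by move=> k; rewrite /geometric /= mulr_ge0// exprn_ge0//; case/andP: q01.
  - by move=> k; exact: le_trans (PN _) (tm k).
  - apply: is_cvg_geometric_series; case/andP: q01 => q0 q1.
    by rewrite ger0_norm.
have cR := cv _ (@Re_le_nc R); have cI := cv _ (@Im_le_nc R).
apply: le_eps => e e0; have e2 : 0 < e / 2 by rewrite divr_gt0.
have [N1 _ H1] := (cvgrPdist_lt _ _).1 cR _ e2.
have [N2 _ H2] := (cvgrPdist_lt _ _).1 cI _ e2.
pose n := maxn m (maxn N1 N2).
have := H1 n; rewrite /= !leq_max leqnn /= orbT => /(_ isT) h1.
have := H2 n; rewrite /= !leq_max leqnn /= !orbT => /(_ isT) h2.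
have mn : (m <= n)%N by rewrite leq_max leqnn.
have sE (P : {additive C -> R}) : series (fun k => P (a k * w ^+ k)) n =
    P (\sum_(k < n) a k * w ^+ k).
  by rewrite /series /= raddf_sum big_mkord.
have hn : normc (psum a w - \sum_(k < n) a k * w ^+ k) < e.
  apply: (le_lt_trans (nc_le_ReIm _)); rewrite ReB ImB.
  move: h1 h2; rewrite [series _ n](sE (@complex.Re R)) [series _ n](sE (@complex.Im R)).
  rewrite /psum [complex.Re (_ +i* _)%C]/= [complex.Im (_ +i* _)%C]/=; lra.
apply: (le_trans (nc_tri (\sum_(k < n) a k * w ^+ k) _ _)).
rewrite addrC lerD ?(ltW hn)//.
rewrite (sum_ord_tail (fun k => a k * w ^+ k) mn).
apply: (le_trans (nc_sum _ _ _)).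
apply: (@le_trans _ _ (\sum_(m <= k < n) M * q ^+ k)).
  by apply: ler_sum => k _.
by rewrite -mulr_sumr -mulrA ler_wpM2l// geo_sum_le.
Qed.

Lemma pser_uniq f g a r M M' w : 0 < r -> pser f a r M -> pser g a r M' ->
  normc w < r -> f w = g w.
Proof.
move=> r0 [_ pf] [_ pg] wr; apply/eqP; rewrite -subr_eq0; apply/eqP.
have [q01 qE] := pser_ratio r0 wr.
apply: (@eps_eq0 _ _ ((M + M') * (r / (r - normc w)))) => e e0.
have MM : 0 <= r / (r - normc w).
  by rewrite divr_ge0 ?(ltW r0)// subr_ge0 ltW.
have [N HN] := geometric_lt q01 e0.
have h1 := pf w wr N; have h2 := pg w wr N; have h3 := HN N (leqnn N).
apply: (le_trans (nc_tri (\sum_(k < N) a k * w ^+ k) _ _)).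
rewrite (nc_distC _ (g w)); apply: (le_trans (lerD h1 h2)).
rewrite -mulrDl -mulrDl [in X in _ <= X]mulrCA mulrA; apply: ler_wpM2r => //.
apply: ler_wpM2l; last exact: ltW.
have M0 : 0 <= M * (r / (r - normc w)).
  by have := le_trans (nc_ge0 _) (pf w wr 0%N); rewrite expr0 mulr1.
have M0' : 0 <= M' * (r / (r - normc w)).
  by have := le_trans (nc_ge0 _) (pg w wr 0%N); rewrite expr0 mulr1.
have Kp : 0 < r / (r - normc w) by rewrite divr_gt0// subr_gt0.
by move: M0 M0'; rewrite !pmulr_lge0// => *; exact: addr_ge0.
Qed.

Lemma pser_M_ge0 f a r M : 0 < r -> pser f a r M -> 0 <= M.
Proof.
by move=> r0 [aM _]; apply: le_trans (aM 0%N); rewrite expr0 mulr1 nc_ge0.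
Qed.

Lemma pser_shrink f a r r' M : 0 < r' -> r' <= r -> pser f a r M -> pser f a r' M.
Proof.
move=> r0 rr pf; have rp := lt_le_trans r0 rr; have M0 := pser_M_ge0 rp pf.
case: pf => aM pf; split.
  move=> k; apply: le_trans (aM k); rewrite ler_wpM2l ?nc_ge0//.
  by rewrite lerXn2r ?nnegrE// ltW.
move=> w wr m; have wr' := lt_le_trans wr rr; apply: (le_trans (pf w wr' m)).
have [/andP[q0 q1] ->] := pser_ratio rp wr'; have [/andP[q0' q1'] ->] := pser_ratio r0 wr.
have qq : normc w / r <= normc w / r'.
  by rewrite ler_wpM2l ?nc_ge0// lef_pV2 ?posrE.
apply: ler_pM.
- by rewrite mulr_ge0// exprn_ge0.
- by rewrite invr_ge0 subr_ge0 ltW.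
- by rewrite ler_wpM2l// lerXn2r.
- by rewrite lef_pV2 ?posrE ?subr_gt0// lerB.
Qed.

Lemma pser0 f a r M : 0 < r -> pser f a r M -> f 0 = a 0%N.
Proof.
move=> r0 pf; have [_ /(_ 0)] := pf; rewrite normc0 => /(_ r0 1%N).
rewrite mul0r expr1 mulr0 mul0r big_ord1 expr0 mulr1 => h.
by apply/eqP; rewrite -subr_eq0 -nc_eq0 eq_le h nc_ge0.
Qed.

Lemma dcoef_bound a r (rho M : R) : 0 < rho -> rho < r ->
  (forall k, normc (a k) * r ^+ k <= M) ->
  exists M', forall k, normc (k.+1%:R * a k.+1) * rho ^+ k <= M'.
Proof.
move=> p0 pr aM; have r0 := lt_trans p0 pr.
pose q := rho / r.
have q0 : 0 <= q by rewrite divr_ge0// ltW.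
have q1 : q < 1 by rewrite ltr_pdivrMr// mul1r.
have M0 : 0 <= M by apply: le_trans (aM 0%N); rewrite mulr_ge0 ?nc_ge0 ?exprn_ge0 ?(ltW r0).
exists (M / r * (1 - q)^-1) => k.
have kq : k.+1%:R * q ^+ k <= (1 - q)^-1.
  apply: le_trans (_ : \sum_(0 <= i < k.+1) q ^+ i <= _); last first.
    by have := @geo_sum_le q 0 k.+1; rewrite expr0 mul1r; apply; rewrite q0.
  have -> : k.+1%:R * q ^+ k = \sum_(0 <= i < k.+1) q ^+ k.
    by rewrite sumr_const_nat subn0 mulr_natl.
  rewrite !big_nat; apply: ler_sum => i /andP[_ ik].
  by apply: ler_wiXn2l => //; exact: ltW.
have -> : normc (k.+1%:R * a k.+1) * rho ^+ k =
    (normc (a k.+1) * r ^+ k.+1) / r * (k.+1%:R * q ^+ k).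
  rewrite normcM nc_nat /q expr_div_n exprS; field.
  by rewrite expf_neq0 ?gt_eqF.
apply: ler_pM => //.
- by rewrite divr_ge0 ?mulr_ge0 ?nc_ge0 ?exprn_ge0// ltW.
- by rewrite mulr_ge0// exprn_ge0.
- by rewrite ler_pM2r ?invr_gt0.
Qed.

Definition dcoef a k : C := k.+1%:R * a k.+1.

(** Near 0 the polynomials [dq m] converge uniformly to the difference quotient [phi], which is thus
    continuous at 0. The radius [rho2] between [rho] and [r] absorbs the factor [k + 1] coming from
    [(w + h) ^+ k.+1 - w ^+ k.+1]. *)
Lemma pser_cder f a r M w : 0 < r -> pser f a r M -> normc w < r ->
  cder f w (psum (dcoef a) w).
Proof.
move=> r0 pf wr; case: (pf) => aM pf'.
have w0 := nc_ge0 w.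
have [rho [rho2 [p0 wp pp p2r]]] : exists rho rho2 : R,
    [/\ 0 < rho, normc w < rho, rho < rho2 & rho2 < r].
  by exists ((2 * normc w + r) / 3), ((normc w + 2 * r) / 3); split; lra.
have p20 := lt_trans p0 pp; have pr := lt_trans pp p2r.
have [M' bM] := dcoef_bound p20 p2r aM.
have [_ pb] := psum_pser p20 bM.
pose q := rho / rho2.
have q01 : 0 <= q < 1 by rewrite divr_ge0 ?(ltW p0) ?(ltW p20)//= ltr_pdivrMr// mul1r.
have M0 : 0 <= M' by apply: le_trans (bM 0%N); rewrite expr0 mulr1 nc_ge0.
pose dq m h : C := \sum_(k < m) a k.+1 * \sum_(i < k.+1) (w + h) ^+ (k - i) * w ^+ i.
pose phi h : C := if h == 0 then psum (dcoef a) w else (f (w + h) - f w) / h.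
pose K := M' / (1 - q).
have K0 : 0 <= K by rewrite divr_ge0// subr_ge0 ltW//; case/andP: q01.
have dqE h n : (\sum_(k < n.+1) a k * (w + h) ^+ k) - (\sum_(k < n.+1) a k * w ^+ k) =
    h * dq n h.
  rewrite -sumrB big_ord_recl !expr0 subrr add0r mulr_sumr; apply: eq_bigr => k _.
  rewrite -mulrBr mulrCA; congr (_ * _).
  by rewrite subrXX [w + h - w]addrC addKr; congr (_ * _); apply: eq_bigr => i _; rewrite subSS.
have tail h m n : normc (w + h) <= rho -> (m <= n)%N ->
    normc (dq n h - dq m h) <= K * q ^+ m.
  move=> hh mn; rewrite /dq (sum_ord_tail (fun k => a k.+1 *
     \sum_(i < k.+1) (w + h) ^+ (k - i) * w ^+ i) mn).
  apply: (le_trans (nc_sum _ _ _)).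
  apply: (@le_trans _ _ (\sum_(m <= k < n) M' * q ^+ k)); last first.
    by rewrite -mulr_sumr /K mulrAC -mulrA ler_wpM2l// geo_sum_le.
  apply: ler_sum => k _.
  have : normc (\sum_(i < k.+1) (w + h) ^+ (k - i) * w ^+ i) <= k.+1%:R * rho ^+ k.
    apply: (le_trans (nc_sum _ _ _)).
    have -> : k.+1%:R * rho ^+ k = \sum_(i < k.+1) rho ^+ k.
      by rewrite sumr_const card_ord mulr_natl.
    apply: ler_sum => i _; rewrite normcM !nc_X.
    have ik : (i <= k)%N by rewrite -ltnS.
    have -> : rho ^+ k = rho ^+ (k - i) * rho ^+ i by rewrite -exprD subnK.
    apply: ler_pM; rewrite ?exprn_ge0 ?nc_ge0//.
      by rewrite lerXn2r ?nnegrE ?nc_ge0 ?(ltW p0).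
    by rewrite lerXn2r ?nnegrE ?nc_ge0 ?(ltW p0) ?(ltW wp).
  move=> h2; rewrite normcM; apply: (le_trans (ler_wpM2l (nc_ge0 _) h2)).
  have := bM k; rewrite normcM nc_nat => h3.
  have -> : q ^+ k = rho ^+ k / rho2 ^+ k by exact: expr_div_n.
  rewrite (mulrA M') ler_pdivlMr ?exprn_gt0//.
  have := ler_wpM2r (exprn_ge0 k (ltW p0)) h3; lra.
(* At [h = 0] the error is that of the derived series, elsewhere that of [pser] for [f]. A larger
   index [n] makes it at most [e], and [tail] leads back from [n] to [m]. *)
have app h m : normc (w + h) <= rho -> normc (phi h - dq m h) <= K * q ^+ m.
  move=> hh; apply: le_eps => e e0.
  rewrite /phi; case: eqVneq => [h0|hn0].
    have [|N HN] := @geometric_lt R q (e / (K + 1)) q01.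
      by rewrite divr_gt0// ltr_wpDl.
    pose n := maxn m N.
    have dn : dq n h = \sum_(k < n) dcoef a k * w ^+ k.
      rewrite /dq h0 addr0; apply: eq_bigr => k _; rewrite /dcoef mulrAC mulrC; congr (_ * _).
      rewrite (_ : k.+1%:R * _ = \sum_(i < k.+1) w ^+ k); last first.
        by rewrite sumr_const card_ord mulr_natl.
      apply: eq_bigr => i _; rewrite -exprD subnK//.
      by rewrite -ltnS.
    apply: (le_trans (nc_tri (dq n h) _ _)); rewrite addrC; apply: lerD.
      by apply: tail => //; rewrite leq_max leqnn.
    rewrite dn; have wp2 := lt_trans wp pp; apply: (le_trans (pb w wp2 n)).
    have [/andP[s0 s1] ->] := pser_ratio p20 wp2.
    have sq : normc w / rho2 <= q by rewrite ler_pM2r ?invr_gt0// ltW.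
    apply: (@le_trans _ _ (M' * q ^+ n * (1 - q)^-1)).
      apply: ler_pM; rewrite ?mulr_ge0 ?exprn_ge0// ?invr_ge0 ?subr_ge0 ?(ltW s1)//.
        by rewrite ler_wpM2l// lerXn2r ?nnegrE//; exact: le_trans sq.
      by case/andP: q01 => q0 q1; rewrite lef_pV2 ?posrE ?subr_gt0// lerB.
    rewrite mulrAC -/K; have := HN n; rewrite leq_max leqnn orbT => /(_ isT).
    rewrite ltr_pdivlMr ?ltr_wpDl// => h1.
    have : 0 <= q ^+ n by rewrite exprn_ge0//; case/andP: q01.
    move=> h2; move: h1; rewrite mulrDr mulr1 (mulrC (q ^+ n)); lra.
  have hp : 0 < normc h by rewrite nc_gt0.
  pose A := M * (r / (r - rho)) / normc h.
  have A0 : 0 <= A.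
    rewrite !mulr_ge0 ?invr_ge0 ?(ltW r0) ?(ltW hp)//; first exact: pser_M_ge0 pf.
    by rewrite subr_ge0 ltW// (lt_trans pp).
  have q01' : 0 <= rho / r < 1.
    by rewrite divr_ge0 ?(ltW p0) ?(ltW r0)//= ltr_pdivrMr// mul1r (lt_trans pp).
  have [|N HN] := @geometric_lt R (rho / r) (e / (2 * A + 1)) q01'.
    by rewrite divr_gt0// ltr_wpDl// mulr_ge0.
  pose n := maxn m N.
  have bd z : normc z <= rho -> normc (f z - \sum_(k < n.+1) a k * z ^+ k) <=
      M * (rho / r) ^+ n.+1 * (r / (r - rho)).
    move=> zp; have zr : normc z < r by apply: (le_lt_trans zp); exact: lt_trans p2r.
    apply: (le_trans (pf' z zr _)).
    have [/andP[s0 s1] ->] := pser_ratio r0 zr.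
    have -> : r / (r - rho) = (1 - rho / r)^-1.
      by field; rewrite ?subr_eq0 (gt_eqF r0) (gt_eqF pr).
    have sq : normc z / r <= rho / r by rewrite ler_pM2r ?invr_gt0.
    apply: ler_pM; rewrite ?mulr_ge0 ?exprn_ge0// ?invr_ge0 ?subr_ge0 ?(ltW s1)//.
    - exact: pser_M_ge0 pf.
    - apply: ler_wpM2l; first exact: pser_M_ge0 pf.
      by rewrite lerXn2r ?nnegrE//; exact: le_trans sq.
    - by case/andP: q01' => q0 q1; rewrite lef_pV2 ?posrE ?subr_gt0// lerB.
  apply: (le_trans (nc_tri (dq n h) _ _)); rewrite addrC; apply: lerD.
    by apply: tail => //; rewrite leq_max leqnn.
  have -> : (f (w + h) - f w) / h - dq n h = ((f (w + h) - \sum_(k < n.+1) a k * (w + h) ^+ k)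
      - (f w - \sum_(k < n.+1) a k * w ^+ k)) / h.
    have -> : dq n h = h * dq n h / h by rewrite mulrAC mulfV// mul1r.
    by rewrite -dqE; field.
  rewrite normcM normcV ler_pdivrMr//.
  apply: (le_trans (ncB _ _)); apply: (le_trans (lerD (bd _ hh) (bd _ (ltW wp)))).
  have := HN n.+1; rewrite (leq_trans (leq_maxr m N))// => /(_ isT).
  have pA : 0 < 2 * A + 1 by rewrite ltr_wpDl// mulr_ge0.
  rewrite (ltr_pdivlMr _ _ pA) => h1; rewrite mulrDr mulr1 in h1.
  have h2 : 0 <= (rho / r) ^+ n.+1 by rewrite exprn_ge0//; case/andP: q01'.
  have -> : M * (rho / r) ^+ n.+1 * (r / (r - rho)) = (rho / r) ^+ n.+1 * A * normc h.
    by rewrite /A -[RHS]mulrA divfK ?nc_eq0// [RHS]mulrCA [RHS]mulrA.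
  rewrite -mulrDl ler_pM2r//; lra.
exists phi; split; last first.
- move=> h; rewrite /phi; case: eqVneq => [->|h0]; first by rewrite !addr0 mulr0 addr0.
  by rewrite divfK//; ring.
- by rewrite /phi eqxx.
move=> e e0; have e3 : 0 < e / 3 / (K + 1) by rewrite !divr_gt0// ltr_wpDl.
have [N HN] := geometric_lt q01 e3.
have KN : K * q ^+ N < e / 3.
  have := HN N (leqnn N); rewrite ltr_pdivlMr ?ltr_wpDl// mulrDr mulr1 (mulrC _ K).
  have : 0 <= q ^+ N by rewrite exprn_ge0//; case/andP: q01.
  lra.
have cX n : ccnt (fun h => (w + h) ^+ n) 0.
  have h1 : cder (fun z => z ^+ n) (w + 0) (n%:R * (w + 0) ^+ n.-1) by exact: cder_X.
  apply: (@cnt_comp _ _ _ (fun h => w + h) 0 (fun z => z ^+ n)).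
    by apply: cntD; [exact: cnt_cst|exact: ccnt_id].
  exact: cder_cnt h1.
have cd : ccnt (dq N) 0.
  apply: cnt_sum => k _; apply: cntM; first exact: cnt_cst.
  by apply: cnt_sum => i _; apply: cntM; [exact: cX|exact: cnt_cst].
have [|d d0 Hd] := cd (e / 3); first by rewrite divr_gt0.
exists (Num.min d (rho - normc w)) => [|h]; first by rewrite lt_min d0 subr_gt0.
rewrite lt_min => /andP[hd hr].
have hh : normc (w + h) <= rho by apply: (le_trans (le_normcD _ _)); lra.
have h0 : normc (w + 0) <= rho by rewrite addr0 ltW.
have := app h N hh; have := app 0 N h0; have := Hd h hd; rewrite !add0r => k1 k2 k3.
have := nc_tri (dq N h) (phi h) (phi 0); have := nc_tri (dq N 0) (dq N h) (phi 0).
rewrite (nc_distC (dq N 0) (phi 0)); move: k1 k2 k3 KN; clear; lra.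
Qed.

End PowerSeriesTheory.


(** * Logarithms, averages over roots of unity, Borel-Caratheodory *)

Section HolomorphicFunctions.
Variable R : realType.
Local Notation C := (R[i]).
Implicit Types (f g : C -> C) (a b : nat -> C) (r M : R) (w z : C).

Lemma cderN f z l : cder f z l -> cder (fun w => - f w) z (- l).
Proof.
move=> [p [cp <- fp]]; exists (fun h => - p h); split => //; first exact: cntN.
by move=> h; rewrite fp; ring.
Qed.

Lemma cderV_loc f z l : f z != 0 -> cder f z l ->
  cder (fun w => (f w)^-1) z (- l / f z ^+ 2).
Proof.
move=> fz df; have cf := cder_cnt df.
have [|d d0 Hd] := cf (normc (f z)); first by rewrite nc_gt0.
have nz h : normc h < d -> f (z + h) != 0.
  move=> /Hd; apply: contraTneq => ->; rewrite sub0r normcN ltxx//.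
(* [cderV] asks for a function without zeros; [f] has none near [z], and those farther away are
   overwritten by the value [f z]. *)
pose f' w := if f w == 0 then f z else f w.
have f'E h : normc h < d -> f (z + h) = f' (z + h).
  by move=> /nz /negbTE; rewrite /f' => ->.
have f'z : f' z = f z by rewrite /f'; case: ifP.
have df' : cder f' z l by apply: cder_ext df; exists d.
rewrite -f'z; apply: (@cder_ext _ (fun w => (f' w)^-1)).
  by exists d => // h /f'E ->.
apply: cderV => //; first by rewrite f'z.
by move=> h; rewrite /f'; case: ifPn.
Qed.

Lemma cder0_cst f r : 0 < r -> (forall z, normc z < r -> cder f z 0) ->
  forall z, normc z < r -> f z = f 0.
Proof.
move=> r0 df z zr.
have := @cint_FTC R (fun=> 0) (fun x => f (0 + (x%:C)%C * z)) 0 1 ler01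
  (fun x _ => cnt_cst _ 0 x).
rewrite cint0 !add0r mul1r mul0r => H; apply/eqP; rewrite -subr_eq0 eq_sym; apply/eqP.
apply: H => x /andP[x0 x1].
rewrite -[X in rder _ _ X](mul0r z); apply: (@cder_rder _ f (fun x => 0 + (x%:C)%C * z)).
  apply: df; rewrite add0r normcM nc_real ger0_norm//.
  by apply: le_lt_trans zr; rewrite ler_piMl ?nc_ge0.
exact: rder_affine.
Qed.

Lemma psum_holo f a r M : 0 < r -> pser f a r M -> holo_disc (psum (dcoef a)) r.
Proof.
move=> r0 [aM _] w wr.
pose rho := (normc w + r) / 2.
have wp : normc w < rho by rewrite /rho; lra.
have pr : rho < r by rewrite /rho; lra.
have p0 : 0 < rho by apply: le_lt_trans wp; exact: nc_ge0.
have [M' bM] := dcoef_bound p0 pr aM.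
by eexists; apply: (pser_cder p0 (psum_pser p0 bM) wp).
Qed.

Lemma log_disc f r Rr : 0 < r -> r < Rr -> holo_disc f Rr ->
  (forall z, normc z < Rr -> f z != 0) ->
  exists g a M, [/\ pser g a r M, a 0%N = 0 & forall z, normc z < r ->
    ln (normc (f z)) = ln (normc (f 0)) + complex.Re (g z)].
Proof.
move=> r0 rR hf fn.
pose r1 := (2 * r + Rr) / 3; pose r2 := (r + 2 * Rr) / 3.
have rr1 : r < r1 by rewrite /r1; lra.
have r12 : r1 < r2 by rewrite /r1 /r2; lra.
have r2R : r2 < Rr by rewrite /r2; lra.
have r10 := lt_trans r0 rr1; have r20 := lt_trans r10 r12.
have [a0 [M0 pf]] := holo_pser r20 r2R hf.
pose f1 := psum (dcoef a0).
have df w : normc w < r2 -> cder f w (f1 w) by exact: pser_cder pf.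
have hf1 : holo_disc f1 r2 by exact: psum_holo pf.
pose q w := f1 w * (f w)^-1.
have hq : holo_disc q r2.
  move=> w wr; have [l dl] := hf1 w wr; eexists; apply: cderM; first exact: dl.
  by apply: cderV_loc; [apply: fn; exact: lt_trans r2R|exact: df].
have [b [M1 pq]] := holo_pser r10 r12 hq.
pose c k : C := if k is k'.+1 then b k' / k'.+1%:R else 0.
have dc : dcoef c = b.
  by apply/funext => k; rewrite /dcoef /= mulrC divfK ?pnatr_eq0.
have M10 := pser_M_ge0 r10 pq.
have cM k : normc (c k) * r1 ^+ k <= M1 * r1.
  case: k => [|k]; first by rewrite [c 0%N]/(0 : C) normc0 mul0r mulr_ge0// ltW.
  rewrite exprSr mulrA ler_pM2r//; case: pq => [bM _]; apply: le_trans (bM k).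
  rewrite ler_wpM2r ?exprn_ge0 ?(ltW r10)// normcM normcV nc_nat.
  by rewrite ler_piMr ?nc_ge0// invf_le1// ler1n.
have pg := psum_pser r10 cM; pose g := psum c.
have dg w : normc w < r1 -> cder g w (q w).
  move=> wr; have := pser_cder r10 pg wr; rewrite dc.
  rewrite -(pser_uniq r10 pq (psum_pser r10 (proj1 pq)) wr); exact.
pose h w := f w * ce (- g w).
have dh w : normc w < r1 -> cder h w 0.
  move=> wr; have wr2 := lt_trans wr r12.
  have := cderM (df w wr2) (cder_comp (cderN (dg w wr)) (cder_ce (- g w))).
  have fw : f w != 0 by apply: fn; exact: lt_trans r2R.
  congr (cder h w _); rewrite /q; field.
  exact: fw.
exists g, c, (M1 * r1); split => //; first exact: pser_shrink (ltW rr1) pg.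
move=> z zr; have zr1 := lt_trans zr rr1.
have := cder0_cst r10 dh zr1; rewrite /h.
have -> : g 0 = 0 by exact: (pser0 r10 pg).
rewrite oppr0 ce0 mulr1 => <-; rewrite normcM nc_ce ReN.
have fz : f z != 0 by apply: fn; apply: lt_trans r2R; exact: lt_trans r12.
rewrite lnM ?posrE ?nc_gt0 ?expR_gt0// expRK; lra.
Qed.

(* Integer powers of [e^{2 i pi j / N}]. *)
Definition rootu (N : nat) (j : nat) (v : int) : C :=
  ce (0 +i* (2 * pi * v%:~R * j%:R / N%:R))%C.

Lemma nc_rootu N j v : normc (rootu N j v) = 1.
Proof. exact: nc_ce_im. Qed.

Lemma rootu0 N j : rootu N j 0 = 1.
Proof. by rewrite /rootu mulr0 !mul0r ce0. Qed.

Lemma rootuD N j v v' : rootu N j (v + v') = rootu N j v * rootu N j v'.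
Proof.
rewrite /rootu -ceD; congr ce; apply/eqP; rewrite eq_complex /= addr0 eqxx /=.
by rewrite rmorphD /= mulrDr !mulrDl.
Qed.

Lemma rootuN N j v : rootu N j (- v) = ((rootu N j v)^*)%C.
Proof.
rewrite /rootu -ce_conj; congr ce; apply/eqP; rewrite eq_complex /= eqxx /=.
by rewrite rmorphN /= mulrN !mulNr.
Qed.

Lemma rootuX N j v n : rootu N j (v * n%:Z) = rootu N j v ^+ n.
Proof.
elim: n => [|n IH]; first by rewrite mulr0 rootu0 expr0.
by rewrite intS mulrDr mulr1 rootuD IH exprS.
Qed.

Lemma cos_neq1 (y : R) : 0 < y < 2 * pi -> cos y != 1.
Proof.
move=> /andP[y0 y2]; have -> : y = (y / 2) *+ 2 by rewrite -mulr_natr divfK.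
rewrite cos_mulr2n cos2sin2.
have s : 0 < sin (y / 2) by apply: sin_gt0_pi; apply/andP; split; lra.
rewrite lt_eqF// -mulr_natr; have := exprn_gt0 2 s.
by move: (sin (y / 2) ^+ 2) => x; lra.
Qed.

Lemma sum_rootu N (v : int) : (`|v| < N)%N ->
  \sum_(j < N) rootu N j v = if v == 0 then N%:R else 0.
Proof.
move=> vN; case: eqVneq => [->|v0].
  by rewrite (eq_bigr (fun=> 1)) ?sumr_const ?card_ord// => j _; rewrite rootu0.
have N0 : (N%:R : R) != 0 by rewrite pnatr_eq0; case: N vN.
pose ze := rootu N 1 v.
have zj (j : nat) : rootu N j v = ze ^+ j.
  rewrite /ze /rootu -ceX; congr ce; apply/eqP; rewrite eq_complex.
  rewrite cReM cImM -(rmorph_nat (real_complex R)) /= !mulr0 !mul0r subr0 addr0 eqxx /=.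
  by apply/eqP; field.
have zN : ze ^+ N = 1.
  rewrite -zj /rootu.
  have -> : 2 * pi * v%:~R * N%:R / N%:R = 2 * pi * v%:~R :> R by field.
  have e1 (n : nat) : ce (0 +i* (2 * pi * n%:R))%C = 1 :> C.
    have -> : (0 +i* (2 * pi * n%:R))%C = n%:R * (0 +i* (2 * pi))%C :> C.
      apply/eqP; rewrite eq_complex cReM cImM -(rmorph_nat (real_complex R)) /=.
      by rewrite !mulr0 !mul0r subr0 addr0 eqxx /= mulrC.
    rewrite ceX ce_im -[2]/(1 + 1) mulrDl mul1r -mulr2n cos2pi sin2pi.
    by rewrite expr1n.
  case: v {vN v0 ze zj} => n; first exact: e1.
  rewrite NegzE rmorphN /= mulrN.
  have -> : (0 +i* (- (2 * pi * n.+1%:~R)))%C = - (0 +i* (2 * pi * n.+1%:R))%C :> C.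
    by apply/eqP; rewrite eq_complex /= oppr0 !eqxx.
  by rewrite ceN e1 invr1.
have z1 : ze != 1.
  pose y := 2 * pi * `|v|%N%:R / N%:R : R.
  have cy : complex.Re ze = cos y.
    rewrite /ze /rootu ce_im /= mulr1 /y.
    case: v {vN v0 zN zj ze y} => n //.
    by rewrite NegzE rmorphN /= mulrN mulNr cosN.
  have : cos y != 1.
    have p : (0 : R) < 2 * pi by rewrite mulr_gt0// pi_gt0.
    have Np : (0 : R) < N%:R by rewrite lt_neqAle eq_sym N0 ler0n.
    have v1 : 0 < (`|v|%N%:R : R) by rewrite ltr0n absz_gt0.
    apply: cos_neq1; rewrite /y (divr_gt0 (mulr_gt0 p v1) Np) /=.
    by rewrite ltr_pdivrMr// ltr_pM2l// ltr_nat.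
  by apply: contra => /eqP e; rewrite -cy e.
have : (ze - 1) * \sum_(j < N) ze ^+ j = 0 by rewrite -subrX1 zN subrr.
move=> /eqP; rewrite mulf_eq0 subr_eq0 (negbTE z1) /= => /eqP z0.
by rewrite -[RHS]z0; apply: eq_bigr => j _.
Qed.

(** A Fourier coefficient on the circle of radius [rho], computed at [N]-th roots of unity. The
    condition on [k + v] excludes aliasing among the first [m] coefficients; the others enter the
    error. *)
Lemma pser_mean f a r M (rho : R) m N (v : int) :
  0 < rho -> rho < r -> pser f a r M -> (forall k, (k < m)%N -> (absz (k%:Z + v)%R < N)%N) ->
  normc (\sum_(j < N) (f ((rho%:C)%C * rootu N j 1) * rootu N j v)
    - N%:R * (\sum_(k < m) if k%:Z + v == 0 then a k * ((rho%:C)%C ^+ k) else 0)) <=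
  N%:R * (M * (rho / r) ^+ m * (r / (r - rho))).
Proof.
move=> p0 pr [aM pf] lm.
have -> : N%:R * (\sum_(k < m) if k%:Z + v == 0 then a k * (rho%:C)%C ^+ k else 0) =
   \sum_(j < N) (\sum_(k < m) a k * ((rho%:C)%C * rootu N j 1) ^+ k) * rootu N j v.
  under [RHS]eq_bigr do rewrite mulr_suml.
  rewrite exchange_big /= mulr_sumr; apply: eq_bigr => k _.
  under eq_bigr do rewrite exprMn -rootuX mul1r -!mulrA -rootuD.
  rewrite -!mulr_sumr sum_rootu ?lm//.
  by case: ifP => _; rewrite ?mulr0// [RHS]mulrA mulrC.
rewrite -sumrB; apply: (le_trans (nc_sum _ _ _)).
have -> (x : R) : N%:R * x = \sum_(j < N) x by rewrite sumr_const card_ord mulr_natl.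
apply: ler_sum => j _; rewrite -mulrBl normcM nc_rootu mulr1.
have e : normc ((rho%:C)%C * rootu N j 1) = rho.
  by rewrite normcM nc_rootu mulr1 nc_real ger0_norm// ltW.
by have := pf ((rho%:C)%C * rootu N j 1); rewrite e => /(_ pr m).
Qed.

Lemma pser_err_lt M (rho r e : R) : 0 < rho -> rho < r -> 0 < e ->
  exists N, forall m, (N <= m)%N -> M * (rho / r) ^+ m * (r / (r - rho)) < e.
Proof.
move=> p0 pr e0; have r0 := lt_trans p0 pr.
pose A := `|M| * (r / (r - rho)).
have K0 : 0 < r / (r - rho) by rewrite divr_gt0// subr_gt0.
have A0 : 0 <= A by rewrite mulr_ge0// ltW.
have q01 : 0 <= rho / r < 1.
  by rewrite divr_ge0 ?(ltW p0) ?(ltW r0)//= ltr_pdivrMr// mul1r.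
have A1 : 0 < A + 1 by rewrite ltr_wpDl.
have [|N HN] := @geometric_lt R (rho / r) (e / (A + 1)) q01; first exact: divr_gt0.
exists N => m /HN; rewrite ltr_pdivlMr// => h.
have q0 : 0 <= (rho / r) ^+ m by rewrite exprn_ge0//; case/andP: q01.
apply: le_lt_trans h; apply: (@le_trans _ _ ((rho / r) ^+ m * A)).
  rewrite /A [X in _ <= X]mulrA ler_pM2r// mulrC ler_wpM2l// ler_norm//.
by rewrite ler_wpM2l// lerDl.
Qed.

(* The weights [1 + Re (u e_j^-k)] are nonnegative with mean 1, and against them
   the average of [g] over a circle is [a 0 + u a k rho^k / 2]. *)
Lemma borel_caratheodory g a r M (B rho : R) k : 0 < rho -> rho < r ->
  pser g a r M -> (forall z, normc z < r -> complex.Re (g z) <= B) -> (0 < k)%N ->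
  normc (a k) * rho ^+ k <= 2 * (B - complex.Re (a 0%N)).
Proof.
move=> p0 pr pg gB k0.
suff : complex.Re (a 0%N) + normc (a k) * rho ^+ k / 2 <= B by lra.
apply: le_eps => e e0.
have e2 : 0 < e / 2 by rewrite divr_gt0.
have [N0 HN0] := pser_err_lt M p0 pr e2.
(* The frequencies [i - k], [i] and [i + k] with [i < m] all stay below [m + k] in absolute value,
   so one [N] serves the three averages. *)
pose m := maxn N0 k.+1; pose N := (m + k)%N.
have km : (k < m)%N by rewrite leq_max leqnn orbT.
have Np : (0 < N)%N by rewrite addn_gt0 k0 orbT.
have NR : (0 : R) < N%:R by rewrite ltr0n.
have er : M * (rho / r) ^+ m * (r / (r - rho)) < e / 2.
  by apply: HN0; rewrite leq_max leqnn.
have [u u1 ua] : exists2 u : C, normc u = 1 & u * a k = ((normc (a k))%:C)%C.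
  have [ak0|ak0] := eqVneq (a k) 0.
    by exists 1; rewrite ?normc1// ak0 mulr0 normc0.
  have n0 : normc (a k) != 0 by rewrite nc_eq0.
  exists ((a k)^*%C / ((normc (a k))%:C)%C).
    by rewrite normcM normcV nc_conj nc_real ger0_norm ?nc_ge0// mulfV.
  rewrite mulrAC -(mulrC (a k)) Re_conjM expr2 rmorphM /= mulfK//.
  by rewrite fmorph_eq0.
pose G j := g ((rho%:C)%C * rootu N j 1).
pose W v := \sum_(j < N) (G j * rootu N j v).
have Wb (v : int) (c : C) : (forall i, (i < m)%N -> (absz (i%:Z + v)%R < N)%N) ->
    (\sum_(i < m) if i%:Z + v == 0 then a i * ((rho%:C)%C ^+ i) else 0) = c ->
    normc (W v - N%:R * c) <= N%:R * (e / 2).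
  move=> vN <-; apply: (le_trans (pser_mean p0 pr pg vN)).
  by rewrite ler_pM2l// ltW.
have pick l : (l < m)%N -> (\sum_(i < m) if i%:Z - l%:Z == 0 then
    a i * ((rho%:C)%C ^+ i) else 0) = a l * ((rho%:C)%C ^+ l).
  move=> lm; rewrite (bigD1 (Ordinal lm)) //= subrr eqxx big1 ?addr0// => i il.
  rewrite ifF//; apply: contraNF il => /eqP h; apply/eqP; apply: val_inj => /=; lia.
have W0 : normc (W 0 - N%:R * a 0%N) <= N%:R * (e / 2).
  apply: Wb => [i|]; first by rewrite addr0 /N; lia.
  by have := pick 0%N; rewrite oppr0 expr0 mulr1; apply; exact: leq_ltn_trans km.
have W1 : normc (W (- k%:Z) - N%:R * (a k * (rho%:C)%C ^+ k)) <= N%:R * (e / 2).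
  by apply: Wb => [i|]; [rewrite /N; lia|exact: pick].
have W2 : normc (W k%:Z - N%:R * 0) <= N%:R * (e / 2).
  apply: Wb => [i|]; first by rewrite /N; lia.
  by apply: big1 => i _; rewrite ifF//; apply/negbTE; lia.
pose wt j := 1 + complex.Re (u * rootu N j (- k%:Z)).
have wt0 j : 0 <= wt j.
  have := Re_le_nc (u * rootu N j (- k%:Z)); rewrite normcM u1 nc_rootu mulr1.
  by rewrite ler_norml /wt; lra.
have wtE j : ((wt j)%:C)%C = 1 + (u * rootu N j (- k%:Z) + (u^*)%C * rootu N j k%:Z) / 2.
  rewrite /wt rmorphD /= ReJ_add; congr (_ + (_ + _) / _).
  by rewrite rmorphM /= -rootuN opprK.
have sumW : \sum_(j < N) ((wt j)%:C)%C * G j =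
    W 0 + (u * W (- k%:Z) + (u^*)%C * W k%:Z) / 2.
  rewrite /W !mulr_sumr -big_split /= mulr_suml -big_split /=.
  by apply: eq_bigr => j _; rewrite wtE rootu0; field.
have sumwt : \sum_(j < N) wt j = N%:R.
  apply: (@complexI R); rewrite rmorph_sum /= rmorph_nat.
  under eq_bigr do rewrite wtE.
  rewrite big_split /= sumr_const card_ord -mulr_suml big_split /= -!mulr_sumr.
  rewrite !sum_rootu ?abszN ?absz_nat ?ltn_addr//.
  by rewrite oppr_eq0 eqz_nat (negbTE (lt0n_neq0 k0)) !mulr0 addr0 mul0r addr0.
have up : complex.Re (\sum_(j < N) ((wt j)%:C)%C * G j) <= N%:R * B.
  rewrite Re_sum -sumwt mulr_suml; apply: ler_sum => j _; rewrite ReZl ler_wpM2l//.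
  by apply: gB; rewrite normcM nc_rootu mulr1 nc_real ger0_norm// ltW.
have lo : N%:R * (complex.Re (a 0%N) + normc (a k) * rho ^+ k / 2) - N%:R * e <=
    complex.Re (\sum_(j < N) ((wt j)%:C)%C * G j).
  rewrite sumW.
  have -> : W 0 + (u * W (- k%:Z) + (u^*)%C * W k%:Z) / 2 =
     N%:R * (a 0%N + u * (a k * (rho%:C)%C ^+ k) / 2) +
     ((W 0 - N%:R * a 0%N) + (u * (W (- k%:Z) - N%:R * (a k * (rho%:C)%C ^+ k)) / 2 +
      (u^*)%C * (W k%:Z - N%:R * 0) / 2)).
    by field.
  set E := (_ - _) + (_ + _).
  have Eb : normc E <= N%:R * e.
    apply: (le_trans (le_normcD _ _)).
    set E1 := u * _ / 2; set E2 := _ * _ / 2.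
    have b1 : normc E1 <= N%:R * (e / 2) / 2.
      rewrite normcM normcM u1 mul1r normcV nc_nat ler_pM2r ?invr_gt0//.
    have b2 : normc E2 <= N%:R * (e / 2) / 2.
      rewrite normcM normcM nc_conj u1 mul1r normcV nc_nat ler_pM2r ?invr_gt0//.
    have := le_normcD E1 E2; lra.
  have -> : N%:R * (a 0%N + u * (a k * (rho%:C)%C ^+ k) / 2) =
      ((N%:R)%:C)%C * (a 0%N + ((normc (a k) * rho ^+ k / 2)%:C)%C).
    by rewrite mulrA ua !rmorphM /= fmorphV !rmorph_nat rmorphXn /=.
  have rc (x : R) : complex.Re (x%:C)%C = x by [].
  rewrite ReD ReZl ReD rc.
  have := Re_le_nc E; rewrite ler_norml; lra.
have := le_trans lo up; rewrite -mulrBr ler_pM2l//; lra.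
Qed.

End HolomorphicFunctions.

Arguments rootu {R} N j v.


(** * The maximum modulus principle on rectangles *)

Section MaximumModulus.
Variable R : realType.
Local Notation C := (R[i]).

Lemma nc_sqrD (u v : C) : normc (u + v) ^+ 2 =
  normc u ^+ 2 + normc v ^+ 2 + complex.Re (2 * (u^*)%C * v).
Proof.
rewrite !nc_sqr ReD ImD -mulrA cReM -(rmorph_nat (real_complex R)) /= mul0r subr0 cReM.
by case: u; case: v => a b c d /=; ring.
Qed.

Lemma ccnt_pair (f : C -> C) (p : R * R) : ccnt f (p.1 +i* p.2)%C ->
  {for p, continuous (fun q : R * R => normc (f (q.1 +i* q.2)%C))}.
Proof.
move=> cf; apply/cvgrPdist_lt => e /cf[d d0 fd].
have d2 : 0 < d / 2 by rewrite divr_gt0.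
exists (ball p.1 (d / 2), ball p.2 (d / 2)); first by split; exact: nbhsx_ballx.
move=> q [] /=; rewrite /ball /= => q1 q2.
pose h : C := ((q.1 - p.1) +i* (q.2 - p.2))%C.
have qE : (q.1 +i* q.2)%C = (p.1 +i* p.2)%C + h.
  by apply/eqP; rewrite eq_complex /= !subrKC !eqxx.
have hd : normc h < d.
  apply: (le_lt_trans (nc_le_ReIm _)); rewrite /h [complex.Re _]/= [complex.Im _]/=.
  rewrite distrC (distrC q.2); lra.
apply: (@le_lt_trans _ _ (normc (f (q.1 +i* q.2)%C - f (p.1 +i* p.2)%C))).
  rewrite ler_norml.
  have := nc_ler_sub (f (q.1 +i* q.2)%C) (f (p.1 +i* p.2)%C).
  have := nc_ler_sub (f (p.1 +i* p.2)%C) (f (q.1 +i* q.2)%C).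
  rewrite (nc_distC (f (p.1 +i* p.2)%C)); lra.
by rewrite qE; exact: fd.
Qed.

(* Adding [e |z|^2] makes the mean value inequality strict, so that the maximum
   cannot be attained in the interior. *)
Lemma maximum_modulus_rect (f : C -> C) (x1 x2 y1 y2 M : R) : x1 < x2 -> y1 < y2 ->
  (forall x y, x1 <= x <= x2 -> y1 <= y <= y2 -> exists l, cder f (x +i* y)%C l) ->
  (forall x y, x1 <= x <= x2 -> y1 <= y <= y2 ->
     [|| x == x1, x == x2, y == y1 | y == y2] -> normc (f (x +i* y)%C) <= M) ->
  forall x y, x1 <= x <= x2 -> y1 <= y <= y2 -> normc (f (x +i* y)%C) <= M.
Proof.
move=> x12 y12 df bd x y hx hy.
pose B := (x1 ^+ 2 + x2 ^+ 2) + (y1 ^+ 2 + y2 ^+ 2).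
have B0 : 0 <= B by rewrite !addr_ge0// sqr_ge0.
have zB a b : x1 <= a <= x2 -> y1 <= b <= y2 -> normc ((a +i* b)%C ^+ 2) <= B.
  move=> /andP[a1 a2] /andP[b1 b2]; rewrite nc_X nc_sqr /= /B.
  have h1 : a ^+ 2 <= x1 ^+ 2 + x2 ^+ 2.
    have := sqr_ge0 x1; have := sqr_ge0 x2; have [a0|a0] := leP 0 a; nra.
  have h2 : b ^+ 2 <= y1 ^+ 2 + y2 ^+ 2.
    have := sqr_ge0 y1; have := sqr_ge0 y2; have [b0|b0] := leP 0 b; nra.
  lra.
apply: le_eps => e' e'0; pose e := e' / (B + 1).
have B1 : 0 < B + 1 by rewrite ltr_wpDl.
have e0 : 0 < e by rewrite divr_gt0.
pose F (p : R * R) := normc (f (p.1 +i* p.2)%C) + e * normc ((p.1 +i* p.2)%C ^+ 2).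
pose D : set (R * R) := `[x1, x2]%classic `*` `[y1, y2]%classic.
have [||| c cD Fc] := @compact_EVT_max (R * R)%type R F D.
- by exists (x, y); split; rewrite /= in_itv.
- by apply: compact_setX; exact: segment_compact.
- apply: continuous_in_subspaceT => p; rewrite inE => -[] /=; rewrite !in_itv /= => p1 p2.
  apply: cvgD.
    by apply: ccnt_pair; have [l /cder_cnt] := df _ _ p1 p2.
  apply: cvgMr; apply: (@ccnt_pair (fun z => z ^+ 2)).
  exact: cder_cnt (cder_X 2 _).
move: cD; rewrite inE => -[] /=; rewrite !in_itv /= => c1 c2.
suff key : F c <= M + e * B.
  have Fxy : F (x, y) <= F c by apply: Fc; rewrite inE; split; rewrite /= in_itv.
  have h1 : 0 <= e * normc ((x +i* y)%C ^+ 2) by rewrite mulr_ge0 ?nc_ge0// ltW.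
  have h2 : e * B <= e'.
    by rewrite /e mulrAC ler_pdivrMr// ler_pM2l// lerDl.
  have h3 : normc (f (x +i* y)%C) + e * normc ((x +i* y)%C ^+ 2) <= M + e * B.
    exact: le_trans Fxy key.
  by apply: le_trans (_ : M + e * B <= _); rewrite ?lerD2l//; apply: le_trans h3; rewrite lerDl.
have [cb|cnb] := boolP [|| c.1 == x1, c.1 == x2, c.2 == y1 | c.2 == y2].
  by apply: lerD; [exact: bd|rewrite ler_pM2l// zB].
exfalso; move: cnb; rewrite !negb_or => /and4P[n1 n2 n3 n4].
case/andP: c1 => c11 c12; case/andP: c2 => c21 c22.
have i1 : x1 < c.1 by rewrite lt_neqAle eq_sym n1.
have i2 : c.1 < x2 by rewrite lt_neqAle n2.
have i3 : y1 < c.2 by rewrite lt_neqAle eq_sym n3.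
have i4 : c.2 < y2 by rewrite lt_neqAle n4.
have [Rr R0 HR] : exists2 Rr, 0 < Rr & [/\ Rr <= c.1 - x1, Rr <= x2 - c.1,
    Rr <= c.2 - y1 & Rr <= y2 - c.2].
  exists (Num.min (Num.min (c.1 - x1) (x2 - c.1)) (Num.min (c.2 - y1) (y2 - c.2))).
    by rewrite !lt_min !subr_gt0 i1 i2 i3 i4.
  by split; rewrite !ge_min lexx ?orbT.
case: HR => R1 R2 R3 R4.
pose z0 : C := (c.1 +i* c.2)%C.
have inD h : normc h < Rr -> [/\ x1 <= complex.Re (z0 + h) <= x2,
    y1 <= complex.Im (z0 + h) <= y2 & z0 + h = (complex.Re (z0 + h) +i* complex.Im (z0 + h))%C].
  move=> hR; have := Re_le_nc h; have := Im_le_nc h; rewrite !ler_norml.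
  rewrite ReD ImD /z0 [complex.Re (_ +i* _)%C]/= [complex.Im (_ +i* _)%C]/= => h1 h2.
  split; [lra|lra|by case: h {hR h1 h2}].
pose g h := f (z0 + h).
have hg : holo_disc g Rr.
  move=> h /inD[k1 k2 k3]; have [l dl] := df _ _ k1 k2; exists (l * 1).
  apply: (@cder_comp _ (fun h => z0 + h) f); last by rewrite k3.
  by rewrite -[1]add0r; apply: cderD; [exact: cder_cst|exact: cder_id].
pose r := Rr / 2; have r0 : 0 < r by rewrite divr_gt0.
have rR : r < Rr by rewrite /r; lra.
have [a [M1 pg]] := holo_pser r0 rR hg.
pose rho := r / 2; have p0 : 0 < rho by rewrite divr_gt0.
have pr : rho < r by rewrite /rho; lra.
have [|N0 HN] := @pser_err_lt R M1 rho r (e * rho ^+ 2) p0 pr.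
  by rewrite mulr_gt0// exprn_gt0.
pose N := maxn N0 2.
have er := HN N (leq_maxl _ _).
have N2 : (1 < N)%N by rewrite leq_max orbT.
have NR : (0 : R) < N%:R by rewrite ltr0n (ltn_trans _ N2).
have := @pser_mean R g a r M1 rho N N 0 p0 pr pg.
have -> : \sum_(k < N) (if k%:Z + 0 == 0 then a k * (rho%:C)%C ^+ k else 0) = a 0%N.
  rewrite (bigD1 (Ordinal (ltn_trans (ltn0Sn 0) N2))) //= ?eqxx expr0 mulr1 big1 ?addr0//.
  move=> i i0; rewrite ifF// addr0; apply: contraNF i0 => /eqP h.
  by case: h => h; apply/eqP; exact: val_inj.
rewrite -(pser0 r0 pg) /g addr0 => H.
have {}H := H (fun k kN => ltac:(by rewrite addr0)).
have eN j : normc ((rho%:C)%C * rootu N j 1 : C) = rho.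
  by rewrite normcM nc_rootu mulr1 nc_real ger0_norm// ltW.
have low : N%:R * normc (f z0) - N%:R * (e * rho ^+ 2) <
    \sum_(j < N) normc (f (z0 + (rho%:C)%C * rootu N j 1)).
  have := nc_sum (index_enum 'I_N) xpredT (fun j => f (z0 + (rho%:C)%C * rootu N j 1) * rootu N j 0).
  under [X in _ <= X]eq_bigr do rewrite normcM nc_rootu mulr1.
  move=> h1.
  have h2 := nc_ler_sub (N%:R * f z0) (N%:R * f z0 -
    \sum_(j < N) f (z0 + (rho%:C)%C * rootu N j 1) * rootu N j 0).
  rewrite subKr normcM nc_nat nc_distC in h2.
  have h3 : N%:R * (M1 * (rho / r) ^+ N * (r / (r - rho))) < N%:R * (e * rho ^+ 2).
    by rewrite ltr_pM2l.
  move: H h1 h2 h3; clear; lra.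
have upj (j : 'I_N) : normc (f (z0 + (rho%:C)%C * rootu N j 1)) +
    e * normc ((z0 + (rho%:C)%C * rootu N j 1) ^+ 2) <= F c.
  have [|k1 k2 k3] := inD ((rho%:C)%C * rootu N j 1).
    by rewrite eN; exact: lt_trans rR.
  rewrite k3; apply: (Fc (complex.Re (z0 + (rho%:C)%C * rootu N j 1),
    complex.Im (z0 + (rho%:C)%C * rootu N j 1))).
  by rewrite inE; split; rewrite /= in_itv.
(* The mean of [|z + rho e_j|^2] over the roots of unity exceeds [|z|^2] by exactly [rho ^+ 2],
   while the mean value error in [low] is strictly smaller than [e * rho ^+ 2]. *)
have sq (z : C) : \sum_(j < N) normc ((z + (rho%:C)%C * rootu N j 1) ^+ 2) =
    N%:R * (normc (z ^+ 2) + rho ^+ 2).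
  have -> : \sum_(j < N) normc ((z + (rho%:C)%C * rootu N j 1) ^+ 2) =
      \sum_(j < N) ((normc (z ^+ 2) + rho ^+ 2) +
        complex.Re (2 * (z^*)%C * (rho%:C)%C * rootu N j 1)).
    by apply: eq_bigr => j _; rewrite !nc_X nc_sqrD eN mulrA.
  have s0 : \sum_(j < N) rootu N j 1 = 0 :> C by rewrite sum_rootu.
  rewrite big_split /= sumr_const card_ord -Re_sum -mulr_sumr s0 mulr0.
  by rewrite addr0 mulr_natl.
have fin : \sum_(j < N) normc (f (z0 + (rho%:C)%C * rootu N j 1)) +
    e * (N%:R * (normc (z0 ^+ 2) + rho ^+ 2)) <=
    N%:R * (normc (f z0) + e * normc (z0 ^+ 2)).
  rewrite -sq mulr_sumr -big_split mulr_natl -[X in _ *+ X](card_ord N) -sumr_const.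
  by apply: ler_sum => j _; exact: upj.
clear -low fin; clearbody e; move: low fin.
move: (\sum_(j < N) normc _) (N%:R : R) (normc (f z0)) (normc (z0 ^+ 2)) (rho ^+ 2).
move=> S n a b c'; lra.
Qed.

End MaximumModulus.

(** * Translation between filters and epsilon-delta statements *)

Section Interface.
Variable R : realType.
Local Notation C := (R[i]).

Lemma norm_normc (z : C) : `|z| = ((normc z)%:C)%C.
Proof. by rewrite normc_def; case: z. Qed.

Lemma posC (e : C) : 0 < e -> exists2 d : R, 0 < d & e = (d%:C)%C.
Proof.
rewrite ltcE /= => /andP[/eqP e1 e2]; exists (complex.Re e) => //.
by case: e e1 e2 => a b /= ->.
Qed.

Lemma nearC (P : set (C^o)) (z : C) :
  (\forall w \near (z : C^o), P w) <->
  exists2 d : R, 0 < d & forall h, normc h < d -> P (z + h).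
Proof.
split=> [/nbhs_ballP[e /= e0 H]|[d d0 H]].
  have [d d0 ed] := posC e0; exists d => // h hd; apply: H.
  rewrite /ball /= opprD addrA subrr add0r normrN norm_normc ed ltcR//.
apply/nbhs_ballP; exists (d%:C)%C; first by rewrite /= ltcR.
move=> w; rewrite /ball /= norm_normc ltcR nc_distC => wd.
by rewrite -(subrKC z w); exact: H.
Qed.

Lemma dnearC (P : set (C^o)) (z : C) :
  (\forall w \near (z : C^o)^', P w) <->
  exists2 d : R, 0 < d & forall h, h != 0 -> normc h < d -> P (z + h).
Proof.
have -> : (\forall w \near (z : C^o)^', P w) =
    (\forall w \near (z : C^o), w != z -> P w) by [].
rewrite nearC; split=> -[d d0 H]; exists d => // h.
- by move=> h0 hd; apply: H => //; rewrite -subr_eq0 addrC addKr.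
- move=> hd; rewrite -subr_eq0 addrC addKr => h0; exact: H.
Qed.

Lemma derivable_cder (f : C^o -> C^o) (z : C) :
  derivable f z 1 <-> exists l : C, cder (f : C -> C) z l.
Proof.
split=> [/cvg_ex[l /cvgrPdist_le H]|[l dl]].
  exists l; apply: eps_cder => e e0.
  have eC : 0 < (e%:C)%C :> C by rewrite ltcR.
  have [d d0 Hd] := (dnearC _ _).1 (H _ eC).
  exists d => // h hd; have [->|h0] := eqVneq h 0.
    by rewrite addr0 subrr mulr0 subrr normc0 mulr0.
  have := Hd h h0 hd; rewrite add0r norm_normc lecR /= => k.
  have e1 : f (z + h) - f z - l * h = - ((l - h^-1 * (f (h * 1 + z) - f z)) * h).
    by rewrite mulr1 (addrC h); field.
  by rewrite e1 normcN normcM ler_wpM2r ?nc_ge0.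
apply/cvg_ex; exists l; apply/cvgrPdist_le => e' /posC[e e0 ->].
have [d d0 Hd] := cder_eps dl e0.
apply/dnearC; exists d => // h h0 hd; rewrite add0r norm_normc lecR /=.
have := Hd h hd.
have e1 : f (z + h) - f z - l * h = - ((l - h^-1 * (f (h * 1 + z) - f z)) * h).
  by rewrite mulr1 (addrC h); field.
by rewrite e1 normcN normcM ler_pM2r ?nc_gt0.
Qed.

End Interface.


(** * Growth in vertical strips *)

Section GammaRatio.
Variable R : realType.
Local Notation C := (R[i]).

Lemma real_rate (u b : nat -> R) : (forall m n, `|u m - u n| <= b m + b n) ->
  exists l, forall n, `|u n - l| <= b n.
Proof.
move=> ub; pose l := sup (range (fun n => u n - b n)).
have lb n : u n - b n <= l.
  apply: ub_le_sup; last by exists n.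
  exists (u 0%N + b 0%N) => _ [m _ <-].
  by have := ub m 0%N; rewrite ler_norml; lra.
have lu n : l <= u n + b n.
  apply: ge_sup; first by exists (u 0%N - b 0%N); exists 0%N.
  by move=> _ [m _ <-]; have := ub m n; rewrite ler_norml; lra.
by exists l => n; rewrite ler_norml; have := lb n; have := lu n; lra.
Qed.

Lemma complex_rate (u : nat -> C) (b : nat -> R) :
  (forall m n, normc (u m - u n) <= b m + b n) ->
  exists l, forall n, normc (u n - l) <= 2 * b n.
Proof.
move=> ub.
have [|l1 H1] := @real_rate (fun n => complex.Re (u n)) b.
  by move=> m n; rewrite -ReB; exact: le_trans (Re_le_nc _) (ub m n).
have [|l2 H2] := @real_rate (fun n => complex.Im (u n)) b.
  by move=> m n; rewrite -ImB; exact: le_trans (Im_le_nc _) (ub m n).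
exists (l1 +i* l2)%C => n; apply: (le_trans (nc_le_ReIm _)); rewrite ReB ImB /=.
have := H1 n; have := H2 n; lra.
Qed.

Lemma inv_sq_sum n : \sum_(k < n) (k.+1%:R ^+ 2)^-1 <= 2 :> R.
Proof.
suff H m : \sum_(k < m.+1) (k.+1%:R ^+ 2)^-1 <= 2 - (m.+1%:R)^-1 :> R.
  case: n => [|n]; first by rewrite big_ord0.
  by apply: (le_trans (H n)); rewrite gerBl invr_ge0.
elim: m => [|{}n IH]; first by rewrite big_ord1 expr1n invr1; lra.
rewrite big_ord_recr /=.
have : (n.+2%:R ^+ 2)^-1 <= (n.+1%:R)^-1 - (n.+2%:R)^-1 :> R.
  have -> : (n.+1%:R)^-1 - (n.+2%:R)^-1 = (n.+1%:R * n.+2%:R)^-1 :> R.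
    rewrite -(natr1 n.+1); have : (0 : R) < n.+1%:R by rewrite ltr0n.
    by move: (n.+1%:R : R) => x x0; field; rewrite !gt_eqF// addr_gt0.
  rewrite lef_pV2 ?posrE ?mulr_gt0 ?exprn_gt0 ?ltr0n// expr2 ler_pM2r ?ltr0n//.
  by rewrite ler_nat.
by move=> h; apply: le_trans (lerD IH h) _; rewrite addrA subrK.
Qed.

Lemma ln_le_sub1 (x : R) : 0 < x -> ln x <= x - 1.
Proof. by move=> x0; have := expR_ge1Dx (ln x); rewrite lnK ?posrE//; lra. Qed.

Lemma ln_ge_inv (x : R) : 0 < x -> 1 - x^-1 <= ln x.
Proof.
move=> x0; have := ln_le_sub1 (_ : 0 < x^-1); rewrite invr_gt0 => /(_ x0).
by rewrite lnV ?posrE//; lra.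
Qed.

Lemma ln_succ (n : nat) : (0 < n)%N ->
  (n.+1%:R)^-1 <= ln (n.+1%:R / n%:R : R) <= (n%:R)^-1.
Proof.
move=> n0; have p : (0 : R) < n%:R by rewrite ltr0n.
have q : (0 : R) < n.+1%:R / n%:R by rewrite divr_gt0// ltr0n.
apply/andP; split.
  apply: le_trans (ln_ge_inv q); rewrite invf_div le_eqVlt; apply/orP; left; apply/eqP.
  by rewrite -natr1; field; rewrite natr1 pnatr_eq0.
apply: (le_trans (ln_le_sub1 q)); rewrite le_eqVlt; apply/orP; left; apply/eqP.
by rewrite -natr1; field; rewrite pnatr_eq0 -lt0n.
Qed.

Definition gauss (z : C) (n : nat) : C :=
  (n`!)%:R * ce (z * ((ln n%:R)%:C)%C) / \prod_(k < n.+1) (z + k%:R).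

Lemma gauss_neq0 z n : (forall k : nat, z + k%:R != 0) -> gauss z n != 0.
Proof.
move=> zk; have P0 : \prod_(k < n.+1) (z + k%:R) != 0.
  by apply/prodf_neq0 => k _; exact: zk.
have f0 : (n`!%:R : C) != 0 by rewrite pnatr_eq0 -lt0n fact_gt0.
by rewrite /gauss !mulf_neq0 ?ce_neq0 ?invr_eq0.
Qed.

Lemma gauss_step z n : (0 < n)%N -> (forall k : nat, z + k%:R != 0) ->
  gauss z n.+1 = gauss z n *
    (ce (z * ((ln (n.+1%:R / n%:R))%:C)%C) * n.+1%:R / (z + n.+1%:R)).
Proof.
move=> n0 zk; rewrite /gauss [in LHS]big_ord_recr /= factS natrM.
have p : (0 : R) < n%:R by rewrite ltr0n.
have -> : ln n.+1%:R = ln n%:R + ln (n.+1%:R / n%:R) :> R.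
  by rewrite -lnM ?posrE ?divr_gt0 ?ltr0n// mulrC divfK// gt_eqF.
rewrite rmorphD /= mulrDr ceD.
have : \prod_(k < n.+1) (z + k%:R) != 0 by apply/prodf_neq0 => k _; exact: zk.
move: (\prod_(k < n.+1) (z + k%:R)) (zk n.+1) => P; move: (n.+1%:R : C) => N1 z1 P0.
by field; rewrite P0 z1.
Qed.

Lemma gauss_step_bound z n : (0 < n)%N -> 2 * normc z <= n%:R ->
  (forall k : nat, z + k%:R != 0) ->
  normc (gauss z n.+1 - gauss z n) <=
  normc (gauss z n) * ((40 * normc z ^+ 2 + 2 * normc z) / n%:R ^+ 2).
Proof.
move=> n0 zn zk; rewrite gauss_step//.
set lam := ln _; set g := gauss z n.
have /andP[l1 l2] := ln_succ n0; rewrite -/lam in l1 l2.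
have p : (0 : R) < n%:R by rewrite ltr0n.
have p1 : (0 : R) < n.+1%:R by rewrite ltr0n.
have z0 := nc_ge0 z.
have np : (1 : R) <= n%:R by rewrite ler1n.
have n1E : n.+1%:R = n%:R + 1 :> R by rewrite -natr1.
have lam0 : 0 <= lam by apply: le_trans l1; rewrite invr_ge0.
have -> : g * (ce (z * (lam%:C)%C) * n.+1%:R / (z + n.+1%:R)) - g =
   g * ((n.+1%:R * (ce (z * (lam%:C)%C) - 1 - z * (lam%:C)%C) +
      z * ((n.+1%:R * lam - 1)%:C)%C) / (z + n.+1%:R)).
  rewrite rmorphB rmorphM /= rmorph_nat rmorph1; move: (zk n.+1).
  by move: (n.+1%:R : C) => N1 z1; field.
rewrite normcM ler_wpM2l ?nc_ge0// normcM normcV.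
have zlam : normc (z * (lam%:C)%C) <= normc z / n%:R.
  by rewrite normcM nc_real (ger0_norm lam0) ler_wpM2l.
have zl2 : normc (z * (lam%:C)%C) <= 2^-1.
  by apply: (le_trans zlam); rewrite ler_pdivrMr//; lra.
have h1 : normc (n.+1%:R * (ce (z * (lam%:C)%C) - 1 - z * (lam%:C)%C)) <=
    2 * n%:R * (10 * (normc z / n%:R) ^+ 2).
  rewrite normcM nc_nat; apply: ler_pM; rewrite ?nc_ge0//; first by rewrite n1E; lra.
  apply: (le_trans (ce_quad zl2)); rewrite ler_pM2l// lerXn2r ?nnegrE ?nc_ge0//.
  by rewrite divr_ge0// ltW.
have h2 : normc (z * ((n.+1%:R * lam - 1)%:C)%C) <= normc z / n%:R.
  rewrite normcM nc_real ler_wpM2l// ger0_norm.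
    rewrite lerBlDr; apply: (le_trans (ler_wpM2l (ltW p1) l2)).
    by rewrite n1E mulrDl mul1r mulfV ?gt_eqF// addrC.
  by rewrite subr_ge0 -[X in X <= _](mulfV (lt0r_neq0 p1)) ler_wpM2l// ltW.
have h3 : n%:R / 2 <= normc (z + n.+1%:R).
  have := nc_ler_add n.+1%:R z; rewrite nc_nat (addrC z) n1E; lra.
have h4 := le_trans (le_normcD _ _) (lerD h1 h2).
rewrite ler_pdivrMr; last by apply: lt_le_trans h3; rewrite divr_gt0.
apply: (le_trans h4).
have -> : 2 * n%:R * (10 * (normc z / n%:R) ^+ 2) + normc z / n%:R =
   (40 * normc z ^+ 2 + 2 * normc z) / n%:R ^+ 2 * (n%:R / 2).
  by field; rewrite gt_eqF.
rewrite ler_wpM2l// divr_ge0 ?sqr_ge0// addr_ge0 ?mulr_ge0//; exact: sqr_ge0.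
Qed.

(** Relative increments are [O(1 / n^2)]. From an [n1] so large that all later increments together
    stay below a quarter of [|gauss z n1|], the sequence cannot approach 0, so the limit is
    nonzero. *)
Lemma gauss_cvg z : (forall k : nat, z + k%:R != 0) ->
  exists l : C, l != 0 /\ forall e, 0 < e -> exists N, forall n, (N <= n)%N ->
    normc (gauss z n - l) <= e.
Proof.
move=> zk; pose A := 40 * normc z ^+ 2 + 2 * normc z.
have A0 : 0 <= A by rewrite addr_ge0 ?mulr_ge0 ?sqr_ge0 ?nc_ge0.
have [n1 n1p n1b] : exists2 n1 : nat, (0 < n1)%N & 2 * normc z + 8 * A <= n1%:R - 2.
  exists (Num.truncn (2 * normc z + 8 * A)).+3 => //.
  have : 2 * normc z + 8 * A < (Num.truncn (2 * normc z + 8 * A)).+1%:R.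
    by exact: truncnS_gt.
  have -> : (Num.truncn (2 * normc z + 8 * A)).+3%:R =
      (Num.truncn (2 * normc z + 8 * A)).+1%:R + 2 :> R.
    by rewrite -natrD addn2.
  by rewrite addrK => /ltW.
pose u m := gauss z (n1 + m).
pose g0 := normc (gauss z n1).
have g00 : 0 < g0 by rewrite nc_gt0 gauss_neq0.
(* Telescoping majorant: [b m - b m.+1] is [2 * g0 * A / ((n - 1) * n)] at [n = n1 + m], which
   dominates the increment as long as [|u m| <= 2 * g0]. *)
pose b m : R := 2 * g0 * A / (n1%:R + m%:R - 1).
have z0 := nc_ge0 z.
have dp m : (1 : R) <= n1%:R + m%:R - 1.
  have : (0 : R) <= m%:R by []; have := A0; lra.
have dp' m : (0 : R) < n1%:R + m%:R - 1 by have := dp m; lra.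
have b0 m : 0 <= b m.
  by rewrite divr_ge0 ?mulr_ge0 ?(ltW g00) ?(ltW (dp' m)).
have bb : b 0%N <= g0 / 4.
  rewrite /b addr0 ler_pdivrMr; last by have := dp' 0%N; rewrite addr0.
  have := A0; have := g00; nra.
have step m : normc (u m) <= 2 * g0 -> normc (u m.+1 - u m) <= b m - b m.+1.
  move=> um; rewrite /u addnS.
  apply: (le_trans (gauss_step_bound _ _ zk)).
  - by rewrite addn_gt0 n1p.
  - by rewrite natrD; have : (0 : R) <= m%:R by []; have := A0; lra.
  apply: (@le_trans _ _ (2 * g0 * (A / (n1 + m)%:R ^+ 2))).
    by rewrite ler_wpM2r// divr_ge0 ?sqr_ge0.
  have -> : b m - b m.+1 = 2 * g0 * (A / ((n1%:R + m%:R - 1) * (n1%:R + m%:R))).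
    have -> : b m.+1 = 2 * g0 * A / (n1%:R + m%:R).
      by rewrite /b -natr1; congr (_ / _); ring.
    have p1 : n1%:R + m%:R - 1 != 0 :> R by rewrite gt_eqF.
    have p2 : n1%:R + m%:R != 0 :> R by rewrite gt_eqF//; have := dp' m; lra.
    by rewrite /b; field; rewrite p1 p2.
  rewrite ler_wpM2l ?mulr_ge0 ?(ltW g00)// ler_wpM2l//.
  have e : (n1 + m)%:R = n1%:R + m%:R :> R by rewrite natrD.
  rewrite e lef_pV2 ?posrE; first by have := dp m; nra.
  - by rewrite exprn_gt0//; have := dp' m; lra.
  - by rewrite mulr_gt0//; have := dp' m; lra.
have cum m : normc (u m - u 0%N) <= b 0%N - b m /\ normc (u m) <= 2 * g0.
  elim: m => [|m [IH1 IH2]].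
    rewrite subrr normc0 subrr; split => //; rewrite /u addn0 -/g0; lra.
  have s := step m IH2.
  have h1 : normc (u m.+1 - u 0%N) <= b 0%N - b m.+1.
    apply: (le_trans (nc_tri (u m) _ _)); lra.
  split => //.
  have : normc (u m.+1) <= normc (u m.+1 - u 0%N) + g0.
    by have := le_normcD (u m.+1 - u 0%N) (u 0%N); rewrite subrK /u addn0.
  have := b0 m.+1; lra.
have cauchy m n : (m <= n)%N -> normc (u n - u m) <= b m - b n.
  elim: n => [|n IH]; first by rewrite leqn0 => /eqP ->; rewrite !subrr normc0.
  rewrite leq_eqVlt => /orP[/eqP ->|]; first by rewrite !subrr normc0.
  rewrite ltnS => /IH h; have s := step n (cum n).2.
  apply: (le_trans (nc_tri (u n) _ _)); lra.
have [m n|l Hl] := @complex_rate u b.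
  have [mn|/ltnW nm] := leqP m n.
    by rewrite nc_distC; have := cauchy _ _ mn; have := b0 n; lra.
  by have := cauchy _ _ nm; have := b0 m; lra.
exists l; split.
  have := Hl 0%N; rewrite /u addn0 => h.
  have := nc_ler_sub (gauss z n1) (gauss z n1 - l); rewrite subKr -/g0 => h'.
  by rewrite -nc_gt0; lra.
move=> e e0; pose m0 := (Num.truncn (4 * g0 * A / e)).+1.
have m0b : 4 * g0 * A / e < m0%:R by exact: truncnS_gt.
exists (n1 + m0)%N => n nm.
have n1n : (n1 <= n)%N by exact: leq_trans (leq_addr _ _) nm.
have -> : n = (n1 + (n - n1))%N by rewrite subnKC.
apply: (le_trans (Hl _)); rewrite /b mulrA ler_pdivrMr//.
have h : (m0%:R : R) <= (n - n1)%:R by rewrite ler_nat -(leq_add2l n1) subnKC.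
move: m0b; rewrite ltr_pdivrMr// => h1.
have h2 : e * m0%:R <= e * (n1%:R + (n - n1)%:R - 1).
  rewrite ler_pM2l//; have : (1 : R) <= n1%:R by rewrite ler1n.
  lra.
lra.
Qed.

Lemma harmonic_ge (m n : nat) : (m <= n)%N ->
  ln (n.+1%:R) - ln (m.+1%:R) <= \sum_(m <= k < n) (k.+1%:R : R)^-1.
Proof.
elim: n => [|n IH]; first by rewrite leqn0 => /eqP ->; rewrite subrr big_geq.
rewrite leq_eqVlt => /orP[/eqP ->|]; first by rewrite subrr big_geq.
rewrite ltnS => mn; rewrite big_nat_recr//=.
have h1 := IH mn; have /andP[_] := ln_succ (ltn0Sn n).
rewrite ln_div ?posrE ?ltr0n// => h2; apply: le_trans (lerD h1 h2).
rewrite le_eqVlt; apply/orP; left; apply/eqP; ring.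
Qed.

(* For [k >= y^2] the summand [u / (u^2 + y^2)], [u = k + c], is within
   [O(1 / k^2)] of [1 / (k + 1)]. *)
Lemma digamma_term (c y A : R) (k : nat) : 0 <= A -> `|c| <= A -> 1 <= `|y| ->
  (if y ^+ 2 <= k%:R then (k.+1%:R)^-1 else 0) - 4 * (2 * A + 3) ^+ 2 / k.+1%:R ^+ 2
  <= (k%:R + c) / ((k%:R + c) ^+ 2 + y ^+ 2).
Proof.
move=> A0 cA y1; set u := k%:R + c.
have y2 : 1 <= y ^+ 2 by rewrite -(real_normK (num_real y)) expr_ge1.
have D0 : 0 < u ^+ 2 + y ^+ 2 by rewrite ltr_wpDl ?sqr_ge0//; lra.
have k0 : (0 : R) <= k%:R by [].
have p1 : (0 : R) < k.+1%:R by rewrite ltr0n.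
have k1E : k.+1%:R = k%:R + 1 :> R by rewrite natr1.
have Du : -1 / 2 <= u / (u ^+ 2 + y ^+ 2).
  by rewrite ler_pdivlMr//; have := sqr_ge0 (u + 1); nra.
have cl : - A <= c <= A by rewrite -ler_norml.
have Cp : 0 <= 4 * (2 * A + 3) ^+ 2 / k.+1%:R ^+ 2.
  by apply: divr_ge0; [apply: mulr_ge0 => //; exact: sqr_ge0|exact: sqr_ge0].
have small : k%:R <= 2 * A + 2 -> 3 / 2 <= 4 * (2 * A + 3) ^+ 2 / k.+1%:R ^+ 2.
  move=> kA; rewrite ler_pdivlMr ?exprn_gt0//.
  have : k.+1%:R ^+ 2 <= (2 * A + 3) ^+ 2 by rewrite lerXn2r ?nnegrE ?k1E//; lra.
  have := sqr_ge0 (2 * A + 3); lra.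
have [kA|kA] := leP k%:R (2 * A + 2).
  have s := small kA.
  have : (if y ^+ 2 <= k%:R then (k.+1%:R)^-1 else 0) <= 1 :> R.
    by case: ifP => _ //; rewrite invf_le1// ler1n.
  move=> t1; apply: (@le_trans _ _ (1 - 3 / 2)); first exact: lerB.
  by apply: le_trans Du; lra.
have u0 : k%:R / 2 <= u by rewrite /u; lra.
have up : 0 <= u / (u ^+ 2 + y ^+ 2) by rewrite divr_ge0 ?(ltW D0)//; lra.
case: ifPn => [yk|_]; last by apply: le_trans up; rewrite sub0r oppr_le0.
rewrite lerBlDr -lerBlDl.
have -> : (k.+1%:R)^-1 - u / (u ^+ 2 + y ^+ 2) =
    (u * (c - 1) + y ^+ 2) / (k.+1%:R * (u ^+ 2 + y ^+ 2)) + 0 * u.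
  have p1' := lt0r_neq0 p1; have D0' := lt0r_neq0 D0.
  move: p1' D0'; rewrite k1E /u => q1 q2; field.
  by rewrite q1 q2.
rewrite mul0r addr0 ler_pdivrMr ?mulr_gt0//.
have -> : 4 * (2 * A + 3) ^+ 2 / k.+1%:R ^+ 2 * (k.+1%:R * (u ^+ 2 + y ^+ 2)) =
    4 * (2 * A + 3) ^+ 2 * (u ^+ 2 + y ^+ 2) / k.+1%:R.
  by have p1' := lt0r_neq0 p1; field.
rewrite ler_pdivlMr// k1E.
have h1 : u * (c - 1) + y ^+ 2 <= k%:R * (2 * A + 3).
  have : u * (c - 1) <= (k%:R + A) * (A + 1) by rewrite /u; nra.
  rewrite /u; nra.
have h2 : k%:R ^+ 2 / 4 <= u ^+ 2 by nra.
have h3 : (u * (c - 1) + y ^+ 2) * (k%:R + 1) <= k%:R * (2 * A + 3) * (2 * k%:R).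
  have e0 : 0 <= k%:R * (2 * A + 3) by rewrite mulr_ge0//; lra.
  have e1 : (k%:R : R) + 1 <= 2 * k%:R by lra.
  apply: (@le_trans _ _ (k%:R * (2 * A + 3) * (k%:R + 1))).
    by rewrite ler_wpM2r//; lra.
  by rewrite ler_wpM2l.
apply: (le_trans h3).
have e2 : 4 * (2 * A + 3) ^+ 2 * (k%:R ^+ 2 / 4) <= 4 * (2 * A + 3) ^+ 2 * (u ^+ 2 + y ^+ 2).
  by rewrite ler_wpM2l ?mulr_ge0 ?sqr_ge0//; lra.
apply: le_trans e2.
have -> : k%:R * (2 * A + 3) * (2 * k%:R) = (2 * (2 * A + 3)) * k%:R ^+ 2 by ring.
have -> : 4 * (2 * A + 3) ^+ 2 * (k%:R ^+ 2 / 4) = (2 * A + 3) ^+ 2 * k%:R ^+ 2 by field.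
by rewrite ler_wpM2r ?sqr_ge0//; nra.
Qed.

Lemma nc_sub1_le (w : C) : normc (1 - w) <= expR (- complex.Re w + normc w ^+ 2 / 2).
Proof.
rewrite -(ler_pXn2r (ltn0Sn 1)) ?nnegrE ?nc_ge0 ?expR_ge0// -expRM_natl.
have -> : normc (1 - w) ^+ 2 = 1 + (- (2 * complex.Re w) + normc w ^+ 2).
  by rewrite !nc_sqr ReB ImB /=; ring.
apply: (le_trans (expR_ge1Dx _)); rewrite ler_expR; lra.
Qed.

(** The growth of [Gamma (z + r) / Gamma z], by elementary means: the quotient of the two products
    is [n ^ r] times the product of the [|1 - w k|], and the sum of the [Re (w k)] is at least
    [r (ln n - ln (y^2 + 2)) - O(1)] by [digamma_term] and [harmonic_ge]. So [n ^ r] cancels and a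
    power of [y^2 + 2] remains. *)
Lemma gauss_ratio (x r A y : R) (n : nat) : 0 < r -> 0 <= A -> `|x + r| <= A ->
  1 <= `|y| -> y ^+ 2 + 1 <= n%:R ->
  normc (gauss ((x + r) +i* y)%C n) <=
  expR (r * (ln (y ^+ 2 + 2) + 8 * (2 * A + 3) ^+ 2 + 2 * r * (A + 1) ^+ 2)) *
  normc (gauss (x +i* y)%C n).
Proof.
move=> r0 A0 cA y1 yn.
pose z : C := (x +i* y)%C; pose z' : C := ((x + r) +i* y)%C.
have y2 : 1 <= y ^+ 2 by rewrite -(real_normK (num_real y)) expr_ge1.
have yn0 : y != 0 by apply: contraTneq y1 => ->; rewrite normr0 -ltNge.
have zn0 (v : R) (k : nat) : (v +i* y)%C + k%:R != 0 :> C.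
  rewrite eq_complex -(rmorph_nat (real_complex R)) /= addr0 negb_and yn0 orbT//.
pose w (k : nat) : C := (r%:C)%C / (z' + k%:R).
have wE (k : nat) : z + k%:R = (1 - w k) * (z' + k%:R).
  rewrite mulrBl mul1r /w divfK ?zn0// /z /z'; apply/eqP.
  by rewrite eq_complex -(rmorph_nat (real_complex R)) /= !addr0 subr0 eqxx andbT; apply/eqP; ring.
have n0 : (0 : R) < n%:R by lra.
have gE : normc (gauss z' n) = normc (gauss z n) * (expR (r * ln n%:R) *
   \prod_(k < n.+1) normc (1 - w k)).
  rewrite /gauss !normcM !normcV !nc_ce !nc_prod.
  have -> : complex.Re (z' * ((ln n%:R)%:C)%C) =
      complex.Re (z * ((ln n%:R)%:C)%C) + r * ln n%:R.
    by rewrite !cReM /=; ring.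
  rewrite expRD.
  have -> : \prod_(k < n.+1) normc (z + k%:R) =
      \prod_(k < n.+1) normc (1 - w k) * \prod_(k < n.+1) normc (z' + k%:R).
    by rewrite -big_split /=; apply: eq_bigr => k _; rewrite wE normcM.
  have P1 : \prod_(k < n.+1) normc (1 - w k) != 0.
    apply/prodf_neq0 => k _; rewrite nc_eq0.
    have := zn0 x k; rewrite wE mulf_eq0 negb_or => /andP[]//.
  have P2 : \prod_(k < n.+1) normc (z' + k%:R) != 0.
    by apply/prodf_neq0 => k _; rewrite nc_eq0 zn0.
  move: (\prod_(k < n.+1) normc (1 - w k)) (\prod_(k < n.+1) normc (z' + k%:R)) P1 P2.
  move=> P Q P0 Q0.
  by field; rewrite P0 Q0.
rewrite -/z -/z' gE mulrC ler_wpM2r ?nc_ge0//.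
have Pb : \prod_(k < n.+1) normc (1 - w k) <=
    expR (\sum_(k < n.+1) (- complex.Re (w k) + normc (w k) ^+ 2 / 2)).
  rewrite expR_sum; apply: ler_prod => k _; rewrite nc_ge0 /=; exact: nc_sub1_le.
apply: (le_trans (ler_wpM2l (expR_ge0 _) Pb)); rewrite -expRD ler_expR.
have K1 : (1 : R) <= (A + 1) ^+ 2 by rewrite expr_ge1//; lra.
have tm (k : nat) : - complex.Re (w k) + normc (w k) ^+ 2 / 2 <=
    - r * (if y ^+ 2 <= k%:R then (k.+1%:R)^-1 else 0) +
    (r * (4 * (2 * A + 3) ^+ 2) + r ^+ 2 * (A + 1) ^+ 2) * (k.+1%:R ^+ 2)^-1.
  have D0 : 0 < (k%:R + (x + r)) ^+ 2 + y ^+ 2 by rewrite ltr_wpDl ?sqr_ge0//; lra.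
  have n2 : normc (z' + k%:R) ^+ 2 = (k%:R + (x + r)) ^+ 2 + y ^+ 2.
    by rewrite nc_sqr ReD ImD -(rmorph_nat (real_complex R)) /= addr0 (addrC (x + r)).
  have Rw : complex.Re (w k) = r * ((k%:R + (x + r)) / ((k%:R + (x + r)) ^+ 2 + y ^+ 2)).
    rewrite /w ReZl; congr (r * _).
    have z0 := zn0 (x + r) k.
    have -> : (z' + k%:R)^-1 = ((normc (z' + k%:R) ^+ 2)^-1%:C)%C * ((z' + k%:R)^*)%C.
      apply: (mulfI z0); rewrite mulfV// mulrCA Re_conjM -rmorphM mulVf//.
      by rewrite n2 gt_eqF.
    rewrite ReZl n2 mulrC; congr (_ / _).
    by rewrite -(rmorph_nat (real_complex R)) /= addrC.
  have nw : normc (w k) ^+ 2 = r ^+ 2 / ((k%:R + (x + r)) ^+ 2 + y ^+ 2).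
    by rewrite /w normcM normcV nc_real exprMn exprVn n2 real_normK ?num_real.
  rewrite Rw nw; have := @digamma_term (x + r) y A k A0 cA y1.
  set T := (if _ then _ else _); move: T => T.
  set U := (k%:R + (x + r)) / _ => h.
  have h2 : ((k%:R + (x + r)) ^+ 2 + y ^+ 2)^-1 <= 2 * (A + 1) ^+ 2 * (k.+1%:R ^+ 2)^-1.
    rewrite -ler_pdivrMr ?invr_gt0 ?exprn_gt0 ?ltr0n// invrK mulrC.
    rewrite ler_pdivrMr// -natr1.
    move: cA; rewrite ler_norml => /andP[c1 c2]; set u := k%:R + (x + r).
    have e1 : (k%:R + 1) ^+ 2 <= 2 * u ^+ 2 + 2 * (A + 1) ^+ 2.
      have : (k%:R : R) + 1 <= `|u| + (A + 1).
        have := ler_norm u; rewrite /u; lra.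
      move=> e1; have : (k%:R + 1) ^+ 2 <= (`|u| + (A + 1)) ^+ 2.
        by rewrite lerXn2r ?nnegrE ?addr_ge0.
      rewrite -(real_normK (num_real u)).
      by have := sqr_ge0 (`|u| - (A + 1)); nra.
    have := sqr_ge0 u; nra.
  have h3 := ler_wpM2l (sqr_ge0 r) h2; have := ler_wpM2l (ltW r0) h.
  move: h3; rewrite /U; clear.
  move: (((k%:R + (x + r)) ^+ 2 + y ^+ 2)^-1) ((k.+1%:R ^+ 2)^-1) (k%:R + (x + r)).
  by move=> D E u; lra.
apply: (@le_trans _ _ (r * ln n%:R + (- r * \sum_(k < n.+1)
   (if y ^+ 2 <= k%:R then (k.+1%:R)^-1 else 0) +
   (r * (4 * (2 * A + 3) ^+ 2) + r ^+ 2 * (A + 1) ^+ 2) * \sum_(k < n.+1) (k.+1%:R ^+ 2)^-1))).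
  by rewrite lerD2l !mulr_sumr -big_split /=; apply: ler_sum => k _; exact: tm.
have sq := inv_sq_sum n.+1.
have B0 : 0 <= r * (4 * (2 * A + 3) ^+ 2) + r ^+ 2 * (A + 1) ^+ 2.
  by apply: addr_ge0; do 2?[apply: mulr_ge0 => //; rewrite ?sqr_ge0 ?(ltW r0)//].
have sq2 := ler_wpM2l B0 sq.
have hs : ln n%:R - ln (y ^+ 2 + 2) <=
    \sum_(k < n.+1) (if y ^+ 2 <= k%:R then (k.+1%:R)^-1 else 0).
  pose m := (Num.truncn (y ^+ 2)).+1.
  have mb : y ^+ 2 < m%:R by exact: truncnS_gt.
  have mb2 : m%:R <= y ^+ 2 + 1.
    rewrite /m -natr1 lerD2r truncn_le; lra.
  have mn : (m <= n)%N by rewrite -(ler_nat R); exact: le_trans yn.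
  apply: (@le_trans _ _ (\sum_(m <= k < n.+1) (k.+1%:R)^-1)).
    apply: le_trans (harmonic_ge (leqW mn)).
    apply: lerB; rewrite ler_ln ?posrE ?ltr0n//.
    - by rewrite ler_nat (leq_trans (leqnSn n)).
    - by rewrite -(ltr0n R).
    - by rewrite -natr1; lra.
    - by lra.
  rewrite -(big_mkord xpredT (fun k => if y ^+ 2 <= k%:R then (k.+1%:R)^-1 else 0)).
  rewrite (big_cat_nat (leq0n m) (leqW mn)) /=.
  apply: ler_wpDl.
    by apply: sumr_ge0 => k _; case: ifP => // _; rewrite invr_ge0.
  rewrite !big_nat; apply: ler_sum => k /andP[mk _].
  by rewrite ifT//; apply: (le_trans (ltW mb)); rewrite ler_nat.
have := ler_wpM2l (ltW r0) hs; lra.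
Qed.

End GammaRatio.


(** * The Gamma function as a limit of Gauss's products *)

Section Limits.
Variable R : realType.
Local Notation C := (R[i]).

Lemma cvgC (u : nat -> C) (l : C) : ((u : nat -> C^o) n @[n --> \oo] --> (l : C^o)) <->
  forall e : R, 0 < e -> exists N, forall n, (N <= n)%N -> normc (u n - l) <= e.
Proof.
split=> [/cvgrPdist_le H e e0|H].
  have eC : 0 < (e%:C)%C :> C by rewrite ltcR.
  have [N _ HN] := H _ eC; exists N => n /HN /=.
  by rewrite norm_normc lecR nc_distC.
apply/cvgrPdist_le => e' /posC[e e0 ->]; have [N HN] := H _ e0.
by exists N => // n /HN /=; rewrite norm_normc lecR nc_distC.
Qed.

Lemma nc_lim (u : nat -> C) (l : C) (B : R) (N0 : nat) :
  (forall e : R, 0 < e -> exists N, forall n, (N <= n)%N -> normc (u n - l) <= e) ->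
  (forall n, (N0 <= n)%N -> normc (u n) <= B) -> normc l <= B.
Proof.
move=> H uB; apply: le_eps => e /H[N HN].
have h1 := HN (maxn N N0) (leq_maxl _ _); have h2 := uB (maxn N N0) (leq_maxr _ _).
have := nc_ler_sub l (l - u (maxn N N0)); rewrite subKr nc_distC; lra.
Qed.

Lemma nc_lim_ge (u : nat -> C) (l : C) (B : R) (N0 : nat) :
  (forall e : R, 0 < e -> exists N, forall n, (N <= n)%N -> normc (u n - l) <= e) ->
  (forall n, (N0 <= n)%N -> B <= normc (u n)) -> B <= normc l.
Proof.
move=> H uB; apply: le_eps => e /H[N HN].
have h1 := HN (maxn N N0) (leq_maxl _ _); have h2 := uB (maxn N N0) (leq_maxr _ _).
have := nc_ler_sub (u (maxn N N0)) (u (maxn N N0) - l); rewrite subKr; lra.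
Qed.

Lemma cGamma_gauss (z : C) : (forall k : nat, z + k%:R != 0) ->
  (cGamma z : C) != 0 /\ forall e : R, 0 < e -> exists N, forall n, (N <= n)%N ->
    normc (gauss z n - cGamma z) <= e.
Proof.
move=> zk; have [l [l0 Hl]] := gauss_cvg zk.
suff -> : (cGamma z : C) = l by [].
have H : (gauss z : nat -> C^o) n @[n --> \oo] --> (l : C^o) by apply/cvgC.
have fE : (fun n : nat => (n`!)%:R * cpow n%:R z / \prod_(k < n.+1) (z + k%:R) : C^o) =
    gauss z.
  by apply/funext => n; rewrite /gauss ce_cexp.
rewrite /cGamma fE; exact: (cvg_lim (@norm_hausdorff _ (C^o)) H).
Qed.

Lemma gamma_ratio (x r : R) : 0 < r -> exists2 K : R, 0 < K & forall y : R, 1 <= `|y| ->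
  (cGamma (x +i* y)%C : C) != 0 /\
  normc (cGamma ((x + r) +i* y)%C : C) <=
  K * expR (r * ln (y ^+ 2 + 2)) * normc (cGamma (x +i* y)%C : C).
Proof.
move=> r0; pose A := `|x + r|.
exists (expR (r * (8 * (2 * A + 3) ^+ 2 + 2 * r * (A + 1) ^+ 2))); first exact: expR_gt0.
move=> y y1.
have yn0 : y != 0 by apply: contraTneq y1 => ->; rewrite normr0 -ltNge.
have zn0 (v : R) (k : nat) : (v +i* y)%C + k%:R != 0 :> C.
  rewrite eq_complex -(rmorph_nat (real_complex R)) /= addr0 negb_and yn0 orbT//.
have [g0 Hg] := cGamma_gauss (zn0 x); have [_ Hg'] := cGamma_gauss (zn0 (x + r)).
split => //; rewrite -expRD -mulrDr.
set E := expR _; have E0 : 0 < E by exact: expR_gt0.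
apply: le_eps => e e0.
have e1 : 0 < e / 2 by rewrite divr_gt0.
have [N1 H1] := Hg' _ e1; have e2 : 0 < e / 2 / E by rewrite !divr_gt0.
have [N2 H2] := Hg _ e2.
pose n := maxn (maxn N1 N2) (Num.truncn (y ^+ 2 + 1)).+1.
have n1 : (N1 <= n)%N by rewrite !leq_max leqnn.
have n2 : (N2 <= n)%N by rewrite !leq_max leqnn orbT.
have n3 : y ^+ 2 + 1 <= n%:R.
  by apply: le_trans (ltW (truncnS_gt _)) _; rewrite ler_nat leq_max leqnn orbT.
have h1 := H1 n n1; have h2 := H2 n n2.
have := @gauss_ratio R x r A y n r0 (normr_ge0 _) (lexx _) y1 n3.
have -> : expR (r * (ln (y ^+ 2 + 2) + 8 * (2 * A + 3) ^+ 2 + 2 * r * (A + 1) ^+ 2)) = E.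
  by congr expR; ring.
move=> h3.
have k1 := nc_ler_sub (cGamma ((x + r) +i* y)%C : C)
  ((cGamma ((x + r) +i* y)%C : C) - gauss ((x + r) +i* y)%C n).
rewrite subKr nc_distC in k1.
have k2 := nc_ler_sub (gauss (x +i* y)%C n) (cGamma (x +i* y)%C : C).
have k3 : E * normc (gauss (x +i* y)%C n) <= E * normc (cGamma (x +i* y)%C : C) + e / 2.
  have : normc (gauss (x +i* y)%C n) <= normc (cGamma (x +i* y)%C : C) + e / 2 / E by lra.
  move=> /(ler_wpM2l (ltW E0)); rewrite mulrDr [E * (_ / E)]mulrC divfK ?gt_eqF//.
lra.
Qed.

End Limits.

Section LogSeries.
Variable R : realType.
Local Notation C := (R[i]).

(** The series is a primitive of [- 1 / (1 - z)], so [(1 - z) * ce (- psum a z)] is constant. The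
    remainder bound is the one that [pser] gives at radius 1. *)
Lemma log1m_series (w : C) m : normc w < 1 -> 1 - w != 0 /\
  `|ln (normc (1 - w)) + complex.Re (\sum_(k < m) w ^+ k.+1 / k.+1%:R)| <=
  normc w ^+ m.+1 / (1 - normc w).
Proof.
move=> w1; pose a k : C := if k is k'.+1 then - (k'.+1%:R)^-1 else 0.
have aM k : normc (a k) * 1 ^+ k <= 1.
  rewrite expr1n mulr1; case: k => [|k]; first by rewrite [a 0%N]/(0 : C) normc0.
  by rewrite [a _]/(- (k.+1%:R)^-1 : C) normcN normcV nc_nat invf_le1// ler1n.
have pg := psum_pser ltr01 aM.
have nz (z : C) : normc z < 1 -> 1 - z != 0.
  by move=> z1; rewrite subr_eq0; apply: contraTneq z1 => <-; rewrite normc1 ltxx.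
have dE (z : C) : normc z < 1 -> psum (dcoef a) z = - (1 - z)^-1.
  move=> z1.
  have dM k : normc (dcoef a k) * 1 ^+ k <= 1.
    by rewrite expr1n mulr1 /dcoef /= mulrN mulfV ?pnatr_eq0// normcN normc1.
  have p1 := psum_pser ltr01 dM.
  have p2 : pser (fun z : C => - (1 - z)^-1) (dcoef a) 1 1.
    split => // v v1 n.
    have -> : \sum_(k < n) dcoef a k * v ^+ k = - \sum_(k < n) v ^+ k.
      rewrite -sumrN; apply: eq_bigr => k _.
      by rewrite /dcoef /= mulrN mulfV ?pnatr_eq0// mulN1r.
    have nv := nz v v1.
    have -> : - (1 - v)^-1 - - (\sum_(k < n) v ^+ k) = - (v ^+ n / (1 - v)).
      have v1' : v - 1 != 0 by rewrite -oppr_eq0 opprB.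
      have -> : \sum_(k < n) v ^+ k = (v ^+ n - 1) / (v - 1).
        by rewrite subrX1 mulrAC mulfV// mul1r.
      by move: (v ^+ n) => V; field; rewrite nv v1'.
    rewrite normcN normcM normcV nc_X divr1 !mul1r.
    rewrite ler_wpM2l ?exprn_ge0 ?nc_ge0// lef_pV2 ?posrE ?subr_gt0 ?nc_gt0//.
    by have := nc_ler_sub 1 v; rewrite normc1.
  exact: (pser_uniq ltr01 p1 p2).
pose h z : C := (1 - z) * ce (- psum a z).
have dh (z : C) : normc z < 1 -> cder h z 0.
  move=> z1; have dg := pser_cder ltr01 pg z1; rewrite dE// in dg.
  have d1 : cder (fun z : C => 1 - z) z (0 - 1).
    by apply: cderD; [exact: cder_cst|apply: cderN; exact: cder_id].
  have := cderM d1 (cder_comp (cderN dg) (cder_ce (- psum a z))).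
  congr (cder h z _); have := nz z z1 => z0.
  by field.
have := cder0_cst ltr01 dh w1; rewrite /h.
have -> : psum a 0 = 0 by exact: (pser0 ltr01 pg).
rewrite subr0 oppr0 ce0 mulr1 => hw.
have w0 := nz w w1; split => //.
have lnE : ln (normc (1 - w)) = complex.Re (psum a w).
  have := congr1 (@normc R) hw; rewrite normc1 normcM nc_ce ReN => e.
  have : ln (normc (1 - w) * expR (- complex.Re (psum a w))) = 0 by rewrite e ln1.
  rewrite lnM ?posrE ?nc_gt0 ?expR_gt0// expRK; lra.
have [_ /(_ w w1 m.+1)] := pg; rewrite divr1 !mul1r => hb.
apply: le_trans hb; rewrite lnE -ReD.
have -> : psum a w + \sum_(k < m) w ^+ k.+1 / k.+1%:R =
    psum a w - \sum_(k < m.+1) a k * w ^+ k.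
  rewrite big_ord_recl mul0r add0r -sumrN; congr (_ + _); apply: eq_bigr => k _.
  by rewrite [a _]/(- (k.+1%:R)^-1 : C) mulNr opprK mulrC.
exact: Re_le_nc.
Qed.

End LogSeries.


(** * The Euler product and the Dirichlet polynomial of log L *)

Section EulerProduct.
Variable R : realType.
Local Notation C := (R[i]).

(* [ps n s] is [n ^ (- s)]. *)
Definition ps (n : nat) (s : C) : C := ce (- s * ((ln (n%:R : R))%:C)%C).

Lemma nc_ps n s : normc (ps n s) = expR (- complex.Re s * ln n%:R).
Proof. by rewrite nc_ce mulrC ReZl ReN mulrC. Qed.

Lemma ps_X p k s : (0 < p)%N -> ps (p ^ k) s = ps p s ^+ k.
Proof.
move=> p0; rewrite /ps natrX lnXn ?ltr0n// -ceX; congr ce.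
by rewrite rmorphMn /= -[X in _ * X]mulr_natl mulrCA.
Qed.

Lemma nc_ps_le2 n s : (0 < n)%N -> 2 <= complex.Re s -> normc (ps n s) <= (n%:R ^+ 2)^-1.
Proof.
move=> n0 s2; have n1 : (0 : R) < n%:R by rewrite ltr0n.
have l0 : (0 : R) <= ln n%:R by rewrite ln_ge0// ler1n.
rewrite nc_ps -[X in _ <= X^-1]lnK ?posrE ?exprn_gt0// -expRN ler_expR lnXn//.
by rewrite mulNr lerN2 -[X in X <= _]mulr_natl ler_wpM2r.
Qed.

Variables (d : nat) (al : 'I_d -> nat -> C) (L : C -> C).
Hypothesis al1 : forall j p, prime p -> normc (al j p) <= 1.

(** The coefficient of [p ^ (- k s)] in [log L(s)], read off the Euler product. *)
Definition lcoef p k : C := (\sum_(j < d) al j p ^+ k) / k%:R.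

Lemma nc_lcoef p k : prime p -> (0 < k)%N -> normc (lcoef p k) <= d%:R / k%:R.
Proof.
move=> pp k0; rewrite normcM normcV nc_nat ler_pM2r ?invr_gt0 ?ltr0n//.
apply: (le_trans (nc_sum _ _ _)).
have -> : (d%:R : R) = \sum_(j < d) 1 by rewrite sumr_const card_ord.
by apply: ler_sum => j _; rewrite nc_X exprn_ile1 ?nc_ge0// al1.
Qed.

(** A pair [(p, k)] encodes the prime power [p ^ k.+1], so that the exponent 0 never occurs;
    bounding both entries by [X] loses no prime power up to [X]. *)
Definition okj X (j : 'I_X.+1 * 'I_X.+1) := prime j.1 && (j.1 ^ j.2.+1 <= X)%N.

Definition ppow X (j : 'I_X.+1 * 'I_X.+1) : nat := (j.1 ^ j.2.+1)%N.

Definition PX X (s : C) : C :=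
  \sum_(j | @okj X j) lcoef j.1 j.2.+1 * ps (ppow j) s.

Lemma PX_double X N s : (0 < X)%N -> (X < N)%N ->
  PX X s = \sum_(1 <= p < N | prime p) \sum_(j < d)
    \sum_(k < trunc_log p X) (al j p * ps p s) ^+ k.+1 / k.+1%:R.
Proof.
move=> X0 XN; rewrite /PX.
rewrite -(pair_big_dep (fun p : 'I_X.+1 => prime p) (fun p (k : 'I_X.+1) => (p ^ k.+1 <= X)%N)
  (fun (p : 'I_X.+1) (k : 'I_X.+1) => lcoef p k.+1 * ps (p ^ k.+1) s)) /=.
pose G (p : nat) := \sum_(j < d)
    \sum_(k < trunc_log p X) (al j p * ps p s) ^+ k.+1 / k.+1%:R.
have tl p k : prime p -> (p ^ k.+1 <= X)%N = (k < trunc_log p X)%N.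
  move=> pp; have p1 := prime_gt1 pp.
  have /andP[h1 h2] := trunc_log_bounds p1 X0.
  have [kl|kl] := ltnP k (trunc_log p X).
    by apply: leq_trans h1; rewrite leq_exp2l.
  by apply/negbTE; rewrite -ltnNge; apply: (leq_trans h2); rewrite leq_exp2l.
have inner (p : 'I_X.+1) : prime p ->
    \sum_(k < X.+1 | (p ^ k.+1 <= X)%N) lcoef p k.+1 * ps (p ^ k.+1) s = G p.
  move=> pp; have p0 := prime_gt0 pp.
  rewrite (eq_bigl (fun k : 'I_X.+1 => (k < trunc_log p X)%N)); last by move=> k; exact: tl.
  have tX : (trunc_log p X <= X.+1)%N.
    apply: leq_trans (leqnSn _); rewrite -ltnS; apply: (@leq_trans (p ^ trunc_log p X).+1).
      by rewrite ltnS ltnW// ltn_expl// prime_gt1.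
    by rewrite ltnS trunc_logP// prime_gt1.
  rewrite -(big_ord_widen _ (fun k => lcoef p k.+1 * ps (p ^ k.+1) s) tX) /G exchange_big /=.
  apply: eq_bigr => k _; rewrite /lcoef mulrAC -[RHS]mulr_suml; congr (_ / _).
  by rewrite mulr_suml; apply: eq_bigr => j _; rewrite exprMn ps_X.
rewrite (eq_bigr (fun p : 'I_X.+1 => G p)); last by move=> p; exact: inner.
rewrite -(big_mkord (fun p => prime p) G) [RHS](@big_cat_nat _ _ _ X.+1)//=.
rewrite [X in _ = _ + X]big_nat_cond [X in _ = _ + X]big1 ?addr0; last first.
  move=> p /andP[/andP[Xp _] pp]; apply: big1 => j _.
  have -> : trunc_log p X = 0%N.
    by apply/eqP; rewrite -leqn0 leqNgt -tl// expn1 -ltnNge.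
  by rewrite big_ord0.
by rewrite (big_ltn_cond (ltn0Sn X)).
Qed.

Hypothesis EP : euler_product al (L : R[i]^o -> R[i]^o).

Lemma tail_sq_sum X N : (0 < X)%N -> (X < N)%N ->
  \sum_(X.+1 <= p < N) ((p%:R : R) ^+ 2)^-1 <= (X%:R)^-1.
Proof.
move=> X0; elim: N => [//|N IH]; rewrite ltnS leq_eqVlt => /orP[/eqP <-|XN].
  by rewrite big_geq// invr_ge0.
have N0 : (0 : R) < N%:R by rewrite ltr0n (leq_trans _ XN).
suff : \sum_(X.+1 <= p < N.+1) ((p%:R : R) ^+ 2)^-1 <= (X%:R)^-1 - (N%:R)^-1.
  by move=> /le_trans; apply; rewrite gerBl invr_ge0 ltW.
elim: N XN {IH} N0 => [//|N IH] XN N0; rewrite big_nat_recr//=.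
have stp : (N.+1%:R ^+ 2)^-1 <= (N%:R)^-1 - (N.+1%:R)^-1 :> R.
  have N1 : (0 : R) < N%:R by rewrite ltr0n (leq_trans X0).
  have -> : (N%:R)^-1 - (N.+1%:R)^-1 = (N%:R * N.+1%:R)^-1 :> R.
    rewrite -(natr1 N); move: (N%:R : R) N1 => x x0.
    by field; rewrite !gt_eqF// addr_gt0.
  by rewrite lef_pV2 ?posrE ?mulr_gt0 ?exprn_gt0// expr2 ler_pM2r// ler_nat.
have [XN'|NX] := ltnP X N.
  have N1 : (0 : R) < N%:R by rewrite ltr0n (leq_trans X0)// ltnW.
  by apply: (le_trans (lerD (IH XN' N1) stp)); rewrite addrA subrK.
move: stp; have -> : N = X by apply/eqP; rewrite eqn_leq NX -ltnS.
by move=> stp; rewrite big_geq// add0r.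
Qed.

(** Each prime [p <= X] omits only powers beyond [X], costing at most [2 / X^2] per root [al j p],
    and each [p > X] costs [2 / p^2]. Both groups add up to [2 / X] per [j], hence [4 d / X]. The
    bound holds for all long partial products, and its lower half keeps the limit [L s] away from
    0. *)
Lemma L_approx X s : (0 < X)%N -> 2 <= complex.Re s ->
  L s != 0 /\ `|ln (normc (L s)) - complex.Re (PX X s)| <= 4 * d%:R / X%:R.
Proof.
move=> X0 s2.
have s1 : 1 < complex.Re s by lra.
have XR : (0 : R) < X%:R by rewrite ltr0n.
have /cvgC H := EP s1.
pose w j p := al j p * ps p s.
have w4 j p : prime p -> normc (w j p) <= (p%:R ^+ 2)^-1 /\ normc (w j p) <= 2^-1.
  move=> pp; have h : normc (w j p) <= (p%:R ^+ 2)^-1.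
    rewrite normcM -[X in _ <= X]mul1r ler_pM ?nc_ge0 ?al1//.
    by rewrite nc_ps_le2// prime_gt0.
  split => //; apply: (le_trans h); rewrite lef_pV2 ?posrE ?exprn_gt0 ?ltr0n ?prime_gt0//.
  have := prime_gt1 pp; rewrite -(ltr_nat R) => p1.
  have : (2 : R) <= p%:R by rewrite (ler_nat R 2) prime_gt1.
  by move: (p%:R : R) => x; nra.
pose E N := \prod_(1 <= p < N | prime p) \prod_(j < d)
  (1 - al j p * cpow p%:R (- s : R[i]^o) : C)^-1.
pose lE N := \sum_(1 <= p < N | prime p) \sum_(j < d) (- ln (normc (1 - w j p))).
have EE N : normc (E N) = expR (lE N).
  rewrite /E nc_prod /lE expR_sum; apply: eq_bigr => p pp.
  rewrite nc_prod expR_sum; apply: eq_bigr => j _.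
  have -> : (cpow p%:R (- s : R[i]^o) : C) = ps p s by rewrite /ps ce_cexp.
  have [w1 w2] := w4 j p pp.
  have wlt : normc (w j p) < 1 by lra.
  have [nz _] := @log1m_series R (w j p) 0 wlt.
  by rewrite normcV expRN lnK// posrE nc_gt0.
have key N : (X < N)%N -> `|lE N - complex.Re (PX X s)| <= 4 * d%:R / X%:R.
  move=> XN; rewrite (PX_double _ X0 XN) Re_sum /lE -sumrB.
  apply: (le_trans (ler_norm_sum _ _ _)).
  pose b p : R := if (p <= X)%N then (X%:R ^+ 2)^-1 else (p%:R ^+ 2)^-1.
  apply: (@le_trans _ _ (\sum_(1 <= p < N | prime p) 2 * d%:R * b p)).
    apply: ler_sum => p pp; rewrite Re_sum -sumrB.
    apply: (le_trans (ler_norm_sum _ _ _)).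
    have -> : 2 * d%:R * b p = \sum_(j < d) 2 * b p.
      by rewrite sumr_const card_ord -mulr_natl; ring.
    apply: ler_sum => j _; have [w1 w2] := w4 j p pp.
    have wlt : normc (w j p) < 1 by lra.
    have [_ hb] := @log1m_series R (w j p) (trunc_log p X) wlt.
    rewrite -opprD normrN; apply: (le_trans hb).
    have /andP[t1 t2] := trunc_log_bounds (prime_gt1 pp) X0.
    have p0 := prime_gt0 pp; have pR : (0 : R) < p%:R by rewrite ltr0n.
    apply: (@le_trans _ _ (2 * normc (w j p) ^+ (trunc_log p X).+1)).
      rewrite mulrC ler_wpM2r ?exprn_ge0 ?nc_ge0//.
      by rewrite -[X in _ <= X]invrK lef_pV2 ?posrE ?invr_gt0 ?subr_gt0//; lra.
    rewrite ler_pM2l//.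
    apply: (@le_trans _ _ (((p ^ (trunc_log p X).+1)%:R ^+ 2)^-1)).
      by rewrite natrX -exprM mulnC exprM -exprVn lerXn2r ?nnegrE ?nc_ge0.
    rewrite /b; case: ifPn => [pX|].
      rewrite lef_pV2 ?posrE ?exprn_gt0 ?ltr0n ?expn_gt0 ?p0// lerXn2r ?nnegrE//.
      by rewrite ler_nat ltnW.
    move=> _; rewrite lef_pV2 ?posrE ?exprn_gt0 ?ltr0n ?expn_gt0 ?p0// lerXn2r ?nnegrE//.
    by rewrite ler_nat -{1}(expn1 p) leq_exp2l ?prime_gt1.
  have -> : 4 * d%:R / X%:R = 2 * d%:R * (2 / X%:R) :> R by ring.
  rewrite -mulr_sumr ler_wpM2l ?mulr_ge0//.
  apply: (@le_trans _ _ (\sum_(1 <= p < N) b p)).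
    rewrite big_mkcond /=; apply: ler_sum => p _; case: ifP => // _.
    by rewrite /b; case: ifP => _; rewrite invr_ge0 sqr_ge0.
  rewrite (@big_cat_nat _ _ _ X.+1)//=.
  have -> : 2 / X%:R = (X%:R)^-1 + (X%:R)^-1 :> R by rewrite mulrDl mul1r.
  apply: lerD.
    rewrite big_nat (eq_bigr (fun=> (X%:R ^+ 2)^-1)); last first.
      by move=> p /andP[_]; rewrite ltnS /b => ->.
    rewrite -big_nat sumr_const_nat subn1 /= -[X in X <= _]mulr_natr expr2 invfM.
    by rewrite -mulrA mulVf ?mulr1// gt_eqF.
  rewrite big_nat (eq_bigr (fun p => (p%:R ^+ 2)^-1)); last first.
    by move=> p /andP[Xp _]; rewrite /b leqNgt Xp.
  by rewrite -big_nat; exact: tail_sq_sum.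
have lo : expR (complex.Re (PX X s) - 4 * d%:R / X%:R) <= normc (L s).
  apply: (nc_lim_ge H (N0 := X.+1)) => N XN.
  have := key N XN; rewrite ler_norml => /andP[h1 h2].
  have -> : normc (\prod_(1 <= p < N | prime p) \prod_(j < d)
    (1 - al j p * cpow p%:R (- s : R[i]^o) : C)^-1) = expR (lE N) by exact: EE.
  rewrite ler_expR; move: h1 h2; move: (lE N) (complex.Re _) (4 * _ / _) => *; lra.
have hi : normc (L s) <= expR (complex.Re (PX X s) + 4 * d%:R / X%:R).
  apply: (nc_lim H (N0 := X.+1)) => N XN.
  have := key N XN; rewrite ler_norml => /andP[h1 h2].
  have -> : normc (\prod_(1 <= p < N | prime p) \prod_(j < d)
    (1 - al j p * cpow p%:R (- s : R[i]^o) : C)^-1) = expR (lE N) by exact: EE.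
  rewrite ler_expR; move: h1 h2; move: (lE N) (complex.Re _) (4 * _ / _) => *; lra.
have L0 : 0 < normc (L s) by apply: lt_le_trans lo; exact: expR_gt0.
split; first by rewrite -nc_gt0.
have := lo; rewrite -{1}(expRK (_ - _)) => _.
have lo' : complex.Re (PX X s) - 4 * d%:R / X%:R <= ln (normc (L s)).
  by rewrite -ler_expR lnK ?posrE.
have hi' : ln (normc (L s)) <= complex.Re (PX X s) + 4 * d%:R / X%:R.
  by rewrite -ler_expR lnK ?posrE.
rewrite ler_norml; move: lo' hi'.
move: (ln _) (complex.Re _) (4 * _ / _) => *; lra.
Qed.

End EulerProduct.


(** * Statements for large real arguments *)

Section Asymptotics.
Variable R : realType.

Lemma pinf_ge (M : R) : \forall x \near +oo, M <= x.
Proof. by exists M; split => [|x /ltW]; first exact: num_real. Qed.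

Lemma pinf_gt (M : R) : \forall x \near +oo, M < x.
Proof. by exists M; split => [|x]; first exact: num_real. Qed.

Lemma near_ln_le (a b c : R) : 0 < c -> \forall x \near +oo, a * ln x + b <= c * x.
Proof.
move=> c0; pose A := `|a| + `|b| + 1.
have A0 : 0 < A by rewrite ltr_wpDl// addr_ge0.
near=> x.
have x1 : 1 <= x by near: x; exact: pinf_ge.
have x0 : 0 < x by lra.
have xb : (3 * A / c) ^+ 2 <= x by near: x; exact: pinf_ge.
pose s := Num.sqrt x.
have s0 : 0 < s by rewrite sqrtr_gt0.
have ss : s ^+ 2 = x by rewrite sqr_sqrtr// ltW.
have s1 : 1 <= s by rewrite -(ler_pXn2r (ltn0Sn 1)) ?nnegrE ?(ltW s0)// expr1n ss.
have sA : 3 * A / c <= s.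
  rewrite -(ler_pXn2r (ltn0Sn 1)) ?nnegrE ?(ltW s0)// ?ss//.
  by rewrite divr_ge0 ?mulr_ge0 ?(ltW A0) ?(ltW c0).
have l : ln x <= 2 * s.
  by rewrite -ss lnXn// -[X in X <= _]mulr_natl ler_pM2l// ltW// ln_sublinear.
have l0 : 0 <= ln x by rewrite ln_ge0.
have h1 : a * ln x <= A * (2 * s).
  apply: (le_trans (ler_wpM2r l0 (_ : a <= A))).
    by apply: (le_trans (ler_norm a)); rewrite /A -addrA lerDl addr_ge0.
  by rewrite ler_wpM2l// ltW.
have h2 : b <= A * s.
  apply: (le_trans (ler_norm b)); apply: (@le_trans _ _ (A * 1)).
    by rewrite mulr1 /A addrAC lerDr addr_ge0.
  by rewrite ler_wpM2l// ltW.
have h3 : 3 * A <= c * s by move: sA; rewrite (ler_pdivrMr _ _ c0) (mulrC s).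
apply: (@le_trans _ _ (3 * A * s)); first by (have e : 3 * A * s = A * (2 * s) + A * s by ring); rewrite e; exact: lerD.
apply: (le_trans (ler_wpM2r (ltW s0) h3)).
by rewrite -mulrA -expr2 ss.
Unshelve. all: by end_near. Qed.

Lemma near_ln (P : set R) : (\forall x \near +oo, P x) -> \forall x \near +oo, P (ln x).
Proof.
move=> [M [Mr H]]; exists (expR M); split => // x Mx; apply: H.
have x0 : 0 < x by apply: lt_trans Mx; exact: expR_gt0.
by rewrite -ltr_expR lnK ?posrE.
Qed.

Lemma near_ex (P : set R) : (\forall x \near +oo, P x) ->
  exists2 M, 0 < M & forall x, M <= x -> P x.
Proof.
move=> [M [Mr H]]; exists (`|M| + 1); first by rewrite ltr_wpDl.
by move=> x Mx; apply: H; have := ler_norm M; lra.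
Qed.

Lemma near_ex1 (P : set R) : (\forall x \near +oo, P x) ->
  exists M, forall x, M <= x -> P x.
Proof. by move=> /near_ex[M _ HM]; exists M. Qed.

End Asymptotics.

(** * Functional equation and Phragmen-Lindelof principle *)

Section Growth.
Variable R : realType.
Local Notation C := (R[i]).
Variables (L : C -> C).
Let Lo : R[i]^o -> R[i]^o := L.
(* [lra] reads the whole local context, which is slow in long proofs. *)
Local Ltac slim := clear -Lo.

Lemma L_holo : meromorphic Lo -> finite_set [set s | is_pole Lo s] ->
  exists T0 : R, forall z : C, T0 < complex.Im z ->
    ~ is_pole Lo z /\ exists l, cder L z l.
Proof.
move=> mL /finite_seqP[s sE].
(* The sum of all [|Im|] dominates each of them, so no pole lies above this height. *)
pose T0 := \sum_(z <- s) `|complex.Im (z : C)|.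
exists T0 => z zT.
have np : ~ is_pole Lo z.
  move=> pz; have : [set` s] z by rewrite -sE.
  move=> /= zs; have : `|complex.Im z| <= T0.
    rewrite /T0 (big_rem z zs) /= lerDl.
    by apply: sumr_ge0 => i _.
  by have := ler_norm (complex.Im z); lra.
split => //; apply/derivable_cder; exact: (mL z).2 np.
Qed.

(** The functional equation carries the line [Re s = -1] to [Re s = 2], where [L] is bounded. Each
    Gamma quotient shifts the argument by [3 * lam i] and is polynomially bounded by [gamma_ratio];
    [y ^+ 2 + 2 <= t ^+ 4] expresses the bound through [ln t]. *)
Lemma L_left (omega Q : R) (h : nat) (lam : 'I_h -> R) (mu : 'I_h -> C) (T0 B : R) :
  0 < Q -> (forall i, 0 < lam i) ->
  functional_equation Lo omega Q lam mu ->
  (forall z : C, T0 < complex.Im z -> ~ is_pole Lo z) ->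
  (forall t : R, normc (L (2 +i* t)%C) <= B) ->
  exists A : R, 0 <= A /\ \forall t \near +oo, normc (L ((-1) +i* t)%C) <= expR (A * ln t).
Proof.
move=> Q0 lam0 FE np LB.
have per i : exists A : R, 0 <= A /\ \forall t \near +oo,
   [/\ 1 <= lam i * t + complex.Im (mu i),
     (cGamma ((lam i)%:C%C * ((-1) +i* t)%C + mu i) : C) != 0 &
     normc (cGamma ((lam i)%:C%C * (2 +i* t)%C + mu i) : C) <=
     expR (A * ln t) * normc (cGamma ((lam i)%:C%C * ((-1) +i* t)%C + mu i) : C)].
  have li := lam0 i.
  pose x := - lam i + complex.Re (mu i); pose r := 3 * lam i.
  have r0 : 0 < r by rewrite mulr_gt0.
  have [K K0 HK] := gamma_ratio x r0.
  exists (`|ln K| + r * 4); split; first by rewrite addr_ge0// mulr_ge0// ltW.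
  near=> t.
  have t0 : 0 < t by near: t; exact: pinf_gt.
  have t3 : 3 <= t by near: t; exact: pinf_ge.
  pose y := lam i * t + complex.Im (mu i).
  have y1 : 1 <= y.
    have : (1 + `|complex.Im (mu i)|) / lam i <= t by near: t; exact: pinf_ge.
    rewrite ler_pdivrMr// /y; have := ler_norm (- complex.Im (mu i)); rewrite normrN; lra.
  have yt : y ^+ 2 + 2 <= t ^+ 4.
    have h1 : lam i + `|complex.Im (mu i)| + 2 <= t by near: t; exact: pinf_ge.
    have h2 : y <= (t - 2) * t.
      have := ler_norm (complex.Im (mu i)); have := normr_ge0 (complex.Im (mu i)).
      rewrite /y; nra.
    have h3 : y ^+ 2 <= ((t - 2) * t) ^+ 2 by rewrite lerXn2r ?nnegrE//; lra.
    have -> : t ^+ 4 = (t * t) ^+ 2 by ring.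
    apply: (@le_trans _ _ (((t - 2) * t) ^+ 2 + 2)); first by rewrite lerD2r.
    by move: t3; clear; nra.
  have E1 : (lam i)%:C%C * ((-1) +i* t)%C + mu i = (x +i* y)%C.
    rewrite /x /y; case: (mu i) => m1 m2; apply/eqP; rewrite eq_complex /=.
    by apply/andP; split; apply/eqP; ring.
  have E2 : (lam i)%:C%C * (2 +i* t)%C + mu i = ((x + r) +i* y)%C.
    rewrite /x /y /r; case: (mu i) => m1 m2; apply/eqP; rewrite eq_complex /=.
    by apply/andP; split; apply/eqP; ring.
  have [|g0 g1] := HK y; first by rewrite ger0_norm//; lra.
  rewrite E1 E2; split => //; apply: (le_trans g1); rewrite ler_wpM2r ?nc_ge0//.
  rewrite -{1}(lnK (_ : K \in Num.pos)) ?posrE// -expRD ler_expR mulrDl.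
  have lt1 : 1 <= ln t.
    by rewrite -ler_expR lnK ?posrE//; near: t; exact: pinf_ge.
  apply: lerD.
    by apply: (le_trans (ler_norm _)); rewrite ler_peMr.
  rewrite -mulrA ler_wpM2l ?(ltW r0)//.
  have -> : 4 * ln t = ln (t ^+ 4) by rewrite lnXn// mulr_natl.
  by rewrite ler_ln ?posrE ?exprn_gt0// ltr_wpDl// sqr_ge0.
have [A HA] := choice per.
exists (`|ln (`|B| + 1)| + `|3 * ln Q| + \sum_i A i); split.
  by rewrite !addr_ge0// sumr_ge0// => i _; exact: (HA i).1.
have [M HM] := choice (fun i => near_ex1 (HA i).2).
pose T1 := \sum_i `|M i|.
near=> t.
have t1 : 1 <= t by near: t; exact: pinf_ge.
have t0 : 0 < t by lra.
have tT : T0 < t by near: t; exact: pinf_gt.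
have te : 1 <= ln t.
  by rewrite -ler_expR lnK ?posrE//; near: t; exact: pinf_ge.
have tM i : M i <= t.
  have : T1 <= t by near: t; exact: pinf_ge.
  apply: le_trans; apply: (le_trans (ler_norm _)).
  by rewrite /T1 (bigD1 i)//= lerDl sumr_ge0.
have HG i := (HM i) t (tM i).
pose s : C := ((-1) +i* t)%C; pose s' : C := (2 +i* t)%C.
have s'E : (1 - (s^*)%C : C) = s'.
  by rewrite /s /s'; apply/eqP; rewrite eq_complex /=; apply/andP; split; apply/eqP; ring.
have reg (v : R) : regular_point Lo lam mu (v +i* t)%C.
  split; first exact: np.
  move=> i [k]; move=> /(congr1 (@complex.Im R)).
  rewrite ImD ImZl ImN -(rmorph_nat (real_complex R)) /= oppr0 => e.
  by have [] := HG i; rewrite e ler10.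
have := FE s; rewrite /= s'E => /(_ (reg _) (reg _)).
rewrite /gamma_factor /cpow -!ce_cexp => /(congr1 (@normc R)).
have cp (v : C) : normc (ce (v * (ln Q)%:C%C) : C) = expR (complex.Re v * ln Q).
  by rewrite nc_ce mulrC ReZl mulrC.
rewrite !normcM nc_conj !normcM !cp !nc_prod !nc_ce [complex.Re s]/= [complex.Re s']/=.
rewrite [complex.Re (0 +i* _)%C]/= [complex.Re (0 +i* _)%C]/= !expR0 !mul1r => E.
pose Pg := \prod_i normc (cGamma ((lam i)%:C%C * s + mu i) : C).
pose Pg' := \prod_i normc (cGamma ((lam i)%:C%C * s' + mu i) : C).
have P0 : 0 < Pg by apply: prodr_gt0 => i _; rewrite nc_gt0; have [] := HG i.
have PP : Pg' <= expR (\sum_i A i * ln t) * Pg.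
  rewrite expR_sum -big_split /=; apply: ler_prod => i _.
  by rewrite nc_ge0 /=; have [] := HG i.
have LE : normc (L s) = expR (3 * ln Q) * (Pg' / Pg) * normc (L s').
  have e1 : expR (2 * ln Q) = expR (3 * ln Q) * expR (-1 * ln Q).
    by rewrite -expRD; congr expR; ring.
  move: E; rewrite -/Pg -/Pg' e1 => E.
  have q0 : expR (-1 * ln Q) != 0 by rewrite expR_eq0.
  have p0 := lt0r_neq0 P0.
  apply: (mulfI q0); apply: (mulfI p0).
  have -> : Pg * (expR (-1 * ln Q) * normc (L s)) = expR (-1 * ln Q) * Pg * normc (L s) by ring.
  rewrite E; field.
  exact: p0.
rewrite -/s LE.
have b1 : Pg' / Pg <= expR (\sum_i A i * ln t) by rewrite ler_pdivrMr.
have b2 : normc (L s') <= expR (ln (`|B| + 1)).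
  rewrite lnK ?posrE ?ltr_wpDl//; apply: (le_trans (LB t)).
  by apply: (le_trans (ler_norm B)); rewrite lerDl.
apply: (@le_trans _ _ (expR (3 * ln Q) * expR (\sum_i A i * ln t) * expR (ln (`|B| + 1)))).
  apply: ler_pM; rewrite ?nc_ge0 ?mulr_ge0 ?expR_ge0 ?invr_ge0 ?(ltW P0)//.
    by apply: prodr_ge0 => i _; exact: nc_ge0.
  by rewrite ler_wpM2l ?expR_ge0.
rewrite -!expRD ler_expR -mulr_suml.
have h1 : ln (`|B| + 1) <= `|ln (`|B| + 1)| * ln t.
  by apply: (le_trans (ler_norm _)); rewrite ler_peMr.
have h2 : 3 * ln Q <= `|3 * ln Q| * ln t.
  by apply: (le_trans (ler_norm _)); rewrite ler_peMr.
move: h1 h2; move: (\sum_i A i) (ln (`|B| + 1)) (3 * ln Q) => X Y Z h1 h2; rewrite !mulrDl; move: h1 h2; clear; lra.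
Unshelve. all: by end_near. Qed.

(** The maximum principle on [[-1, 2] x [t / 2, 3 t / 2]] for [L s * ce (- E (s - s0))], where
    [E w = 2 cos (w / 3)]. The strip has width 3, so [cos] of a third of the horizontal distance is
    at least [1 / 2], and the factor decays doubly exponentially in the vertical direction, which
    defeats any finite order; at [s0] it costs only [expR 2]. *)
Lemma phragmen_lindelof (T0 A B : R) : 0 <= A -> finite_order Lo ->
  (forall z : C, T0 < complex.Im z -> exists l, cder L z l) ->
  (forall x t : R, 2 <= x -> normc (L (x +i* t)%C) <= B) ->
  (\forall t \near +oo, normc (L ((-1) +i* t)%C) <= expR (A * ln t)) ->
  exists A' : R, 0 <= A' /\ \forall t \near +oo, forall x, -1 <= x ->
    normc (L (x +i* t)%C) <= expR (A' * ln t).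
Proof.
move=> A0 [A1 [r1 FO]] hol LB /near_ex[M M0 HM].
exists (2 + `|ln (`|B| + 1)| + 2 * A); split.
  by rewrite !addr_ge0// mulr_ge0.
near=> t => x x1.
have t3 : 3 <= t by near: t; exact: pinf_ge.
have t0 : 0 < t by lra.
have te : 1 <= ln t.
  by rewrite -ler_expR lnK ?posrE//; near: t; exact: pinf_ge.
have tT : 2 * T0 + 1 <= t by near: t; exact: pinf_ge.
have tM : 2 * M <= t by near: t; exact: pinf_ge.
have tr : 2 * r1 <= t by near: t; exact: pinf_ge.
have tA : `|A1| * ln t + (`|A1| * ln 4 + ln 2) <= 6^-1 * t.
  by near: t; apply: near_ln_le; rewrite invr_gt0.
have B0 : 0 < `|B| + 1 by rewrite ltr_wpDl.
have BE : B <= expR (`|ln (`|B| + 1)| * ln t).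
  apply: (@le_trans _ _ (`|B| + 1)).
    by apply: (le_trans (ler_norm B)); rewrite lerDl.
  rewrite -{1}(lnK (_ : `|B| + 1 \in Num.pos)) ?posrE// ler_expR.
  by apply: (le_trans (ler_norm _)); rewrite ler_peMr.
have [x2|x2] := leP 2 x.
  apply: (le_trans (LB x t x2)); apply: (le_trans BE); rewrite ler_expR ler_wpM2r//; first by move: te; slim; lra.
  by move: A0; have := normr_ge0 (ln (`|B| + 1)); slim; lra.
pose s0 : C := (x +i* t)%C.
pose E (w : C) : C := ce ((0 +i* 3^-1)%C * w) + ce (- (0 +i* 3^-1)%C * w).
have ReE (a b : R) : complex.Re (E (a +i* b)%C) =
    cos (3^-1 * a) * (expR (- (3^-1 * b)) + expR (3^-1 * b)).
  have e1 : (0 +i* 3^-1)%C * (a +i* b)%C = ((- (3^-1 * b)) +i* (3^-1 * a))%C :> C.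
    by apply/eqP; rewrite eq_complex /=; apply/andP; split; apply/eqP; ring.
  have e2 : - (0 +i* 3^-1)%C * (a +i* b)%C = ((3^-1 * b) +i* (- (3^-1 * a)))%C :> C.
    by apply/eqP; rewrite eq_complex /=; apply/andP; split; apply/eqP; ring.
  by rewrite /E e1 e2 ReD !ceE !ReZl /= cosN; ring.
pose F (s : C) := L s * ce (- E (s - s0)).
have dE (z : C) : exists l, cder E z l.
  have lin (c : C) : cder (fun w => c * w) z (0 * z + c * 1).
    by apply: cderM; [exact: cder_cst|exact: cder_id].
  by eexists; apply: cderD; apply: cder_comp; [exact: lin|exact: cder_ce|exact: lin|exact: cder_ce].
pose V := expR (`|ln (`|B| + 1)| * ln t + 2 * A * ln t).
have V1 : 1 <= V.
  by rewrite -expR0 ler_expR addr_ge0 ?mulr_ge0//; move: te; slim; lra.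
have Fle (a b : R) : -1 <= a <= 2 -> normc (F (a +i* b)%C) <=
    normc (L (a +i* b)%C) * expR (- (2^-1 * expR (3^-1 * `|b - t|))).
  move=> /andP[a1 a2]; rewrite normcM ler_wpM2l ?nc_ge0// nc_ce ReN ler_expR lerN2.
  have -> : (a +i* b)%C - s0 = ((a - x) +i* (b - t))%C.
    by rewrite /s0; apply/eqP; rewrite eq_complex /= !eqxx.
  rewrite ReE.
  have c1 : 2^-1 <= cos (3^-1 * (a - x)).
    apply: le_trans (cos_quad _).
    have : (3^-1 * (a - x)) ^+ 2 <= 1.
      rewrite -(real_normK (num_real _)) expr_le1// ler_norml; move: a1 a2 x1 x2; slim; lra.
    slim; lra.
  apply: ler_pM; rewrite ?expR_ge0 ?invr_ge0//.
  have [bt|bt] := leP 0 (b - t).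
    by rewrite ger0_norm// lerDr expR_ge0.
  by rewrite ltr0_norm// mulrN lerDl expR_ge0.
have Fle1 (a b : R) : -1 <= a <= 2 -> normc (F (a +i* b)%C) <= normc (L (a +i* b)%C).
  by move=> /Fle /le_trans; apply; rewrite ler_piMr ?nc_ge0.
have horiz (a b : R) : -1 <= a <= 2 -> (b == t / 2) || (b == 3 * t / 2) ->
    normc (L (a +i* b)%C) * expR (- (2^-1 * expR (3^-1 * `|b - t|))) <= 1.
  move=> ha hb.
  have bt : `|b - t| = t / 2.
    by case/orP: hb => /eqP ->; [rewrite ler0_norm; move: t0; slim; lra|rewrite ger0_norm; move: t0; slim; lra].
  have b1 : t / 2 <= b <= 3 * t / 2 by case/orP: hb => /eqP ->; move: t0; slim; lra.
  have n1 : r1 <= normc (a +i* b)%C.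
    have := Im_le_nc (a +i* b)%C; have := ler_norm b; rewrite /=; move: b1 tr; slim; lra.
  have n2 : normc (a +i* b)%C <= 4 * t.
    apply: (le_trans (nc_le_ReIm _)); rewrite /= (ger0_norm (_ : 0 <= b)); last by move: b1 t0; slim; lra.
    have : `|a| <= 2 by rewrite ler_norml; move: ha; slim; lra.
    move: b1 t3; slim; lra.
  have n3 : 1 <= normc (a +i* b)%C.
    have := Im_le_nc (a +i* b)%C; have := ler_norm b; rewrite /=; move: b1 t3; slim; lra.
  have fo := FO _ n1.
  rewrite bt; apply: (le_trans (ler_wpM2r (expR_ge0 _) fo)); rewrite -expRD -[X in _ <= X]expR0.
  rewrite ler_expR subr_le0.
  apply: (@le_trans _ _ (expR (`|A1| * ln (4 * t)))).
    rewrite /powR gt_eqF; last by move: n3; slim; lra.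
    rewrite ler_expR; apply: (le_trans (ler_wpM2r (ln_ge0 n3) (ler_norm A1))).
    by rewrite ler_wpM2l// ler_ln ?posrE//; move: n2 n3 t0; slim; lra.
  rewrite (mulrC 2^-1) ler_pdivlMr// -{1}(lnK (_ : (2 : R) \in Num.pos)) ?posrE// -expRD ler_expR.
  rewrite lnM ?posrE// mulrDr; move: tA; slim; lra.
have main : normc (F (x +i* t)%C) <= V.
  apply: (@maximum_modulus_rect R F (-1) 2 (t / 2) (3 * t / 2) V); [slim; lra|move: t0; slim; lra| | |move: x1 x2; slim; lra|move: t0; slim; lra].
  - move=> a b ha hb.
    have [|l dl] := hol (a +i* b)%C; first by rewrite /=; move: hb tT; slim; lra.
    have [l' dl'] := dE ((a +i* b)%C - s0).
    eexists; apply: cderM; first exact: dl.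
    apply: (@cder_comp _ (fun s => - E (s - s0))); last exact: cder_ce.
    apply: cderN; apply: (@cder_comp _ (fun s => s - s0)); last exact: dl'.
    by apply: cderD; [exact: cder_id|apply: cderN; exact: cder_cst].
  - move=> a b ha hb /or4P[/eqP ea|/eqP ea|hb'|hb'].
    + apply: (le_trans (Fle1 _ _ ha)); rewrite ea.
      apply: (le_trans (HM b _)); first by move: hb tM; slim; lra.
      rewrite ler_expR; apply: (@le_trans _ _ (2 * A * ln t)); last by rewrite lerDr mulr_ge0//; move: te; slim; lra.
      rewrite -mulrA (mulrCA 2 A) ler_wpM2l//.
      have -> : 2%:R * ln t = ln (t ^+ 2) by rewrite lnXn// mulr_natl.
      rewrite ler_ln ?posrE ?exprn_gt0//; first by rewrite expr2; move: hb t3; slim; nra.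
      move: hb t0; slim; lra.
    + apply: (le_trans (Fle1 _ _ ha)); rewrite ea.
      apply: (le_trans (LB _ _ (lexx 2))); apply: (le_trans BE).
      by rewrite ler_expR lerDl !mulr_ge0//; move: te A0; slim; lra.
    + by apply: (le_trans (Fle _ _ ha)); apply: le_trans V1; apply: horiz => //; rewrite hb'.
    + by apply: (le_trans (Fle _ _ ha)); apply: le_trans V1; apply: horiz => //; rewrite hb' orbT.
have := main; rewrite normcM nc_ce ReN.
have -> : (x +i* t)%C - s0 = (0 +i* 0)%C by rewrite subrr.
rewrite ReE !mulr0 oppr0 cos0 expR0 mul1r => h.
have : normc (L (x +i* t)%C) <= V * expR 2.
  rewrite -[X in X <= _]mulr1 -[X in _ * X](mulVf (_ : expR 2 != 0)) ?expR_eq0//.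
  by rewrite mulrA -expRN ler_pM2r ?expR_gt0.
move=> /le_trans; apply; rewrite /V -expRD ler_expR !mulrDl.
move: te; slim; lra.
Unshelve. all: by end_near. Qed.

End Growth.


(** * Approximation of log L by a Dirichlet polynomial *)

Section Zeros.
Variable R : realType.
Local Notation C := (R[i]).

Lemma holo_disc_shift (f : C -> C) (c : C) (r : R) :
  (forall h, normc h < r -> exists l, cder f (c + h) l) -> holo_disc (fun h => f (c + h)) r.
Proof.
move=> hol z zr; have [l dl] := hol z zr; exists (l * (0 + 1)).
apply: (@cder_comp _ (fun h => c + h)) => //.
by apply: cderD; [exact: cder_cst|exact: cder_id].
Qed.

Lemma factor_zero (F : C -> C) (a : nat -> C) (r M : R) (m : nat) : 0 < r -> pser F a r M ->
  (forall k, (k < m)%N -> a k = 0) -> (0 < m)%N ->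
  exists G M', pser G (fun k => a (m + k)%N) r M' /\
    forall h, normc h < r -> F h = h ^+ m * G h.
Proof.
move=> r0 pf az m0; pose b k := a (m + k)%N; pose M' := M / r ^+ m.
have rm0 : 0 < r ^+ m by rewrite exprn_gt0.
have hb k : normc (b k) * r ^+ k <= M'.
  by rewrite /M' ler_pdivlMr// -mulrA -exprD addnC; exact: pf.1.
have pG := psum_pser r0 hb.
exists (psum b), M'; split => // h hr.
have [->|hn0] := eqVneq h 0.
  by rewrite (pser0 r0 pf) az// expr0n eqn0Ngt m0 mul0r.
have h0 : 0 < normc h by rewrite nc_gt0.
apply/eqP; rewrite -subr_eq0; apply/eqP; apply: (@eps_eq0 _ _ (1 + normc h ^+ m)) => e e0.
have [N1 H1] := pser_err_lt M h0 hr e0.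
have [N2 H2] := pser_err_lt M' h0 hr e0.
pose n := maxn N1 N2.
have -> : F h - h ^+ m * psum b h = (F h - \sum_(k < m + n) a k * h ^+ k) -
    h ^+ m * (psum b h - \sum_(k < n) b k * h ^+ k).
  have -> : \sum_(k < m + n) a k * h ^+ k = h ^+ m * \sum_(k < n) b k * h ^+ k.
    rewrite big_split_ord /= big1 ?add0r; last by move=> i _; rewrite az ?mul0r.
    by rewrite mulr_sumr; apply: eq_bigr => i _; rewrite exprD mulrCA.
  by ring.
apply: (le_trans (ncB _ _)); rewrite (mulrDr e) (mulr1 e) normcM nc_X; apply: lerD.
  apply: (le_trans (pf.2 _ hr _)); apply/ltW/H1.
  by rewrite (leq_trans (leq_maxl N1 N2))// leq_addl.
rewrite mulrC ler_wpM2r ?exprn_ge0 ?nc_ge0//.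
by apply: (le_trans (pG.2 _ hr _)); apply/ltW/H2; rewrite leq_maxr.
Qed.

(** [zero_mult] is a choice with default value 0. The power series at [z0] is not identically zero
    because of [z0 + w0], so some order exists and the choice is genuine. The chosen order cannot be
    0, since [f] would then tend to a nonzero value at [z0]. *)
Lemma zero_mult_gt0 (f : C -> C) (r : R) (z0 w0 : C) : 0 < r ->
  (forall h, normc h < r -> exists l, cder f (z0 + h) l) ->
  f z0 = 0 -> normc w0 < r -> f (z0 + w0) != 0 ->
  (0 < zero_mult (f : R[i]^o -> R[i]^o) z0)%N.
Proof.
move=> r0 hol f0 w0r fw; pose F h := f (z0 + h).
have hF : holo_disc F r by exact: holo_disc_shift.
have [rr [rr0 wrr rrr]] : exists rr : R, [/\ 0 < rr, normc w0 < rr & rr < r].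
  by exists ((normc w0 + r) / 2); have := nc_ge0 w0; split; lra.
have [a [M pf]] := holo_pser rr0 rrr hF.
have a0 : a 0%N = 0 by rewrite -(pser0 rr0 pf) /F addr0.
have ex : exists k, a k != 0.
  apply: contrapT => H.
  have az k : a k = 0 by apply: contrapT => /eqP h; apply: H; exists k.
  have p0 : pser (fun=> 0) a rr 0.
    split => [k|w _ m]; first by rewrite az normc0 mul0r.
    by rewrite big1 ?subr0 ?normc0 ?mul0r// => i _; rewrite az mul0r.
  by have := pser_uniq rr0 pf p0 wrr; rewrite /F => e; rewrite e eqxx in fw.
have [m am mmin] := ex_minnP ex.
have m0 : (0 < m)%N by rewrite lt0n; apply: contraNneq am => ->; rewrite a0.
have az k : (k < m)%N -> a k = 0.
  by move=> km; apply: contrapT => /eqP /mmin; rewrite leqNgt km.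
have [G [M' [pG GE]]] := factor_zero rr0 pf az m0.
have zo : has_zero_order (f : R[i]^o -> R[i]^o) z0 m.
  exists (fun w => G (w - z0)); split.
  - apply/nearC; exists rr => // h hr; apply/derivable_cder.
    eexists; apply: (@cder_comp _ (fun w => w - z0)).
      by apply: cderD; [exact: cder_id|exact: cder_cst].
    by rewrite addrAC subrr add0r; apply: (pser_cder rr0 pG).
  - by rewrite subrr (pser0 rr0 pG) addn0.
  - apply/dnearC; exists rr => // h h0 hr.
    by rewrite addrAC subrr add0r -GE.
rewrite lt0n; apply/eqP => zm0.
have : has_zero_order (f : R[i]^o -> R[i]^o) z0 (zero_mult (f : R[i]^o -> R[i]^o) z0).
  exact: (xgetPex 0%N (ex_intro _ m zo)).
rewrite zm0 => -[g [hg g0 /dnearC[d1 d10 fg]]].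
have e0 : 0 < normc (g z0 : C) / 2 by rewrite divr_gt0// nc_gt0.
have /derivable_cder[l /cder_cnt /(_ _ e0)[d2 d20 H2]] := nbhs_singleton hg.
have [|l' /cder_cnt /(_ _ e0)[d3 d30 H3]] := hol 0; first by rewrite normc0.
pose d := Num.min d1 (Num.min d2 d3) / 2.
have d0 : 0 < d by rewrite divr_gt0// !lt_min d10 d20.
have dd : d < Num.min d1 (Num.min d2 d3) by rewrite /d; move: d0; rewrite /d; lra.
move: dd; rewrite !lt_min => /and3P[dd1 dd2 dd3].
pose h : C := (d%:C)%C.
have nh : normc h = d by rewrite nc_real gtr0_norm.
have h0 : h != 0 by rewrite -nc_gt0 nh.
have := H2 h; have := H3 h; rewrite nh addr0 => /(_ dd3) h3 /(_ dd2) h2.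
have := fg h h0; rewrite nh => /(_ dd1); rewrite expr0 mul1r => fe.
move: h3; rewrite f0 subr0 fe => h3.
have := nc_ler_sub (g z0 : C) (g (z0 + h) : C); rewrite nc_distC.
by apply/negP; rewrite -ltNge; move: h2 h3; lra.
Qed.

(** Every duplicate-free list of zeros in the region has length at most [N], so a longest one
    exists, and it must contain all zeros. The list form is what allows an interval to be removed
    around each height. *)
Lemma zero_list (f : C -> C) (sg T T1 N : R) : 0 <= T1 -> 0 <= N ->
  (zero_count (f : R[i]^o -> R[i]^o) sg T <= N%:E)%E ->
  (forall z : C, f z = 0 -> sg <= complex.Re z -> T1 <= complex.Im z <= T ->
    (0 < zero_mult (f : R[i]^o -> R[i]^o) z)%N) ->
  exists zs : seq C, (size zs)%:R <= N /\
    forall z, f z = 0 -> sg <= complex.Re z -> T1 <= complex.Im z <= T -> z \in zs.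
Proof.
move=> T10 N0 zc mult.
pose Z (z : C) := [/\ f z = 0, sg <= complex.Re z & T1 <= complex.Im z <= T].
have key (s : seq C) : uniq s -> (forall z, z \in s -> Z z) -> (size s)%:R <= N.
  move=> us sZ; rewrite -lee_fin; apply: le_trans zc; apply: esum_ge.
  exists [set` (s : seq (R[i]^o))]; first split.
  - exact: finite_seq.
  - move=> z /= zs; have [_ h1 /andP[h2 h3]] := sZ z zs.
    by split => //; rewrite h3 (le_trans T10 h2).
  - rewrite -fsbig_seq// sumEFin lee_fin -sum1_size natr_sum.
    rewrite big_seq [X in _ <= X]big_seq; apply: ler_sum => z zs.
    by have [h0 h1 h2] := sZ z zs; rewrite ler_nat mult.
pose P k := `[< exists s : seq C, [/\ uniq s, forall z, z \in s -> Z z & size s = k] >].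
have exP : exists k, P k by exists 0%N; apply/asboolP; exists [::].
have ubP k : P k -> (k <= Num.truncn N)%N.
  move=> /asboolP[s [us sZ <-]]; rewrite -(natrK (R := R) (size s)).
  by apply: le_truncn; exact: key.
have [k /asboolP[s [us sZ sk]] kmax] := ex_maxnP exP ubP.
exists s; split; first exact: key.
move=> z fz sz tz; apply: contrapT => /negP zs.
have : P k.+1.
  apply/asboolP; exists (z :: s); split; [by rewrite /= zs|move=> w|by rewrite /= sk].
  by rewrite inE => /orP[/eqP ->|/sZ].
by move=> /kmax; rewrite ltnn.
Qed.

End Zeros.


(** * Mean squares of Dirichlet polynomials *)

Section MeanSquare.
Variable R : realType.
Local Notation C := (R[i]).
Local Notation mu := (@lebesgue_measure R).

Definition ei (y : R) : C := ce (0 +i* y)%C.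

Lemma nc_ei y : normc (ei y) = 1.
Proof. exact: nc_ce_im. Qed.

Lemma ei0 : ei 0 = 1.
Proof. exact: ce0. Qed.

Lemma eiD x y : ei (x + y) = ei x * ei y.
Proof. by rewrite /ei -ceD; congr ce; apply/eqP; rewrite eq_complex /= addr0 !eqxx. Qed.

Lemma ei_conj y : ((ei y)^*)%C = ei (- y).
Proof. by rewrite /ei -ce_conj. Qed.

Lemma ei_sum (I : Type) (r : seq I) (P : pred I) (F : I -> R) :
  ei (\sum_(i <- r | P i) F i) = \prod_(i <- r | P i) ei (F i).
Proof.
elim/big_rec2: _ => [|i y1 y2 _ IH]; first exact: ei0.
by rewrite eiD IH.
Qed.

Lemma ei_affine u t : ei (t * u) = ce (0 + (t%:C)%C * (0 +i* u)%C).
Proof.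
by rewrite add0r /ei; congr ce; apply/eqP; rewrite eq_complex /= !mul0r mulr0 subr0 addr0 !eqxx.
Qed.

Lemma rcnt_ei u t : rcnt (fun t => ei (t * u)) t.
Proof.
apply: (@cnt_ext _ _ _ (fun t => ce (0 + (t%:C)%C * (0 +i* u)%C))).
- by exists 1 => // h _; rewrite -ei_affine.
- by rewrite -ei_affine.
- exact: rcnt_ce.
Qed.

Lemma cint_ei T u : 0 < T -> u != 0 -> normc (cint T (2 * T) (fun t => ei (t * u))) <= 2 / `|u|.
Proof.
move=> T0 u0.
have v0 : (0 +i* u)%C != 0 :> C by rewrite eq_complex /= eqxx.
rewrite (@eq_cint _ _ _ _ (fun t => ce (0 + (t%:C)%C * (0 +i* u)%C))); last first.
  by move=> t _; rewrite -ei_affine.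
rewrite cint_ce//; last by lra.
rewrite -!ei_affine normcM normcV.
have -> : normc (0 +i* u)%C = `|u| by rewrite /= expr0n add0r sqrtr_sqr.
rewrite ler_wpM2r ?invr_ge0//; apply: (le_trans (ncB _ _)).
by rewrite !nc_ei.
Qed.

Lemma ln_gap (m n X : nat) : (0 < m <= X)%N -> (0 < n <= X)%N -> m != n ->
  (X%:R)^-1 <= `|ln (m%:R) - ln (n%:R)| :> R.
Proof.
wlog mn : m n / (m < n)%N => [H hm hn ne|/andP[m0 mX] /andP[n0 nX] _].
  have [lt|lt|e] := ltngtP m n; first exact: H.
    by rewrite distrC; apply: H => //; rewrite eq_sym.
  by rewrite e eqxx in ne.
have m0' : (0 : R) < m%:R by rewrite ltr0n.
have n0' : (0 : R) < n%:R by rewrite ltr0n.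
rewrite distrC -ln_div ?posrE//; apply: (le_trans _ (ler_norm _)).
apply: (le_trans _ (ln_ge_inv _)); last by rewrite divr_gt0.
rewrite invf_div; apply: (@le_trans _ _ (n%:R^-1)).
  by rewrite lef_pV2 ?posrE// ?ler_nat// ltr0n (leq_trans n0).
rewrite -[X in X - _](mulfV (lt0r_neq0 n0')) -mulrBl -[X in X <= _]mul1r.
by rewrite ler_pM2r ?invr_gt0// lerBrDr -[1 + _]/(1%:R + _) -natrD ler_nat add1n.
Qed.

(** The diagonal contributes [T * |b i|^2]; elsewhere [ei] oscillates with frequency at least
    [1 / X] by [ln_gap], so its integral is at most [2 * X]. The crude second term is affordable
    because [X] will be [T] to a power tending to 0. *)
Lemma mean_square (I : finType) (P : pred I) (n : I -> nat) (b : I -> C) (X : nat) (T : R) :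
  0 < T -> (forall i, P i -> (0 < n i <= X)%N) -> {in P &, injective n} ->
  \int[mu]_(t in `[T, (2 * T)]) (normc (\sum_(i | P i) b i * ei (t * (- ln (n i)%:R))) ^+ 2) <=
  T * \sum_(i | P i) normc (b i) ^+ 2 + 2 * X%:R * (\sum_(i | P i) normc (b i)) ^+ 2.
Proof.
move=> T0 nX inj; pose S t := \sum_(i | P i) b i * ei (t * (- ln (n i)%:R)); rewrite -/(S _).
pose J i j t := b i * ((b j)^*)%C * ei (t * (ln (n j)%:R - ln (n i)%:R)).
have cJ i j : rcnt_on T (2 * T) (J i j).
  by move=> t _; apply: cntM; [exact: cnt_cst|exact: rcnt_ei].
have SE t : ((normc (S t) ^+ 2)%:C)%C = \sum_(i | P i) \sum_(j | P j) J i j t.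
  rewrite -Re_conjM {1}/S mulr_suml; apply: eq_bigr => i _.
  rewrite /S rmorph_sum mulr_sumr /=; apply: eq_bigr => j _.
  rewrite [X in _ * X = _](_ : _ = ((b j)^*)%C * ei (- (t * - ln (n j)%:R))); last first.
    by rewrite -ei_conj; exact: (rmorphM (@conjc R)).
  rewrite /J mulrACA -eiD; congr (_ * ei _).
  by rewrite !mulrN opprK mulrBr addrC.
have -> : \int[mu]_(t in `[T, (2 * T)]) (normc (S t) ^+ 2) =
    complex.Re (cint T (2 * T) (fun t => \sum_(i | P i) \sum_(j | P j) J i j t)).
  by rewrite -(@eq_cint _ _ _ (fun t => ((normc (S t) ^+ 2)%:C)%C)).
have [Jc JcE] : exists Jc, forall i j, cint T (2 * T) (J i j) = Jc i j.
  by exists (fun i j => cint T (2 * T) (J i j)).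
have -> : cint T (2 * T) (fun t => \sum_(i | P i) \sum_(j | P j) J i j t) =
    \sum_(i | P i) \sum_(j | P j) Jc i j.
  rewrite cint_sum; last by move=> i _ t tT; apply: cnt_sum => j _; exact: cJ.
  apply: eq_bigr => i _; rewrite cint_sum; last by move=> j _; exact: cJ.
  by apply: eq_bigr => j _; exact: JcE.
rewrite Re_sum.
have b2 : 2 * X%:R * (\sum_(i | P i) normc (b i)) ^+ 2 =
    \sum_(i | P i) \sum_(j | P j) 2 * X%:R * (normc (b i) * normc (b j)).
  rewrite expr2 mulr_suml mulr_sumr; apply: eq_bigr => i _.
  by rewrite mulr_sumr mulr_sumr.
rewrite b2 mulr_sumr -big_split /=; apply: ler_sum => i Pi.
rewrite Re_sum (bigD1 i Pi) /= [X in _ <= _ + X](bigD1 i Pi) /= addrA; apply: lerD.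
  have -> : Jc i i = (T * normc (b i) ^+ 2)%:C%C.
    rewrite -JcE (@eq_cint _ _ _ _ (fun=> ((normc (b i) ^+ 2)%:C)%C)); last first.
      by move=> t _; rewrite /J subrr mulr0 ei0 mulr1 Re_conjM.
    rewrite cint_cst; last by lra.
    have -> : 2 * T - T = T by ring.
    by rewrite -(rmorphM (real_complex R)).
  by rewrite /= lerDl !mulr_ge0 ?nc_ge0.
apply: ler_sum => j /andP[Pj ji].
apply: (le_trans (ler_norm _)); apply: (le_trans (Re_le_nc _)).
rewrite -JcE /J cintZ; last by move=> t _; exact: rcnt_ei.
rewrite normcM [X in X <= _]mulrC normcM nc_conj ler_wpM2r ?mulr_ge0 ?nc_ge0//.
have ne : n j != n i by apply: contra ji => /eqP /inj ->.
have gap := ln_gap (nX j Pj) (nX i Pi) ne.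
have X0 : (0 : R) < X%:R by rewrite ltr0n; have /andP[/leq_trans h /h] := nX i Pi.
have g0 : 0 < `|ln (n j)%:R - ln (n i)%:R : R| by apply: lt_le_trans gap; rewrite invr_gt0.
apply: (le_trans (cint_ei T0 _)); first by rewrite -normr_gt0.
by rewrite ler_pM2l// -[X in _ <= X]invrK lef_pV2 ?posrE ?invr_gt0.
Qed.

Lemma harmonic_le n : (0 < n)%N -> \sum_(1 <= k < n.+1) (k%:R : R)^-1 <= 1 + ln n%:R.
Proof.
elim: n => [//|[|n] IH] _; first by rewrite big_nat1 invr1 ln1 addr0.
rewrite big_nat_recr//=; apply: (le_trans (lerD (IH isT) (lexx _))).
have /andP[h _] := @ln_succ R n.+1 isT.
have -> : ln n.+2%:R = ln (n.+1%:R) + ln (n.+2%:R / n.+1%:R) :> R.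
  by rewrite ln_div ?posrE ?ltr0n// addrC subrK.
by rewrite addrA lerD2l.
Qed.

Lemma ppow_gt0 X (j : 'I_X.+1 * 'I_X.+1) : okj j -> (0 < ppow j <= X)%N.
Proof. by move=> /andP[pp le]; rewrite /ppow le expn_gt0 prime_gt0. Qed.

Lemma ppow_inj X : {in @okj X &, injective (@ppow X)}.
Proof.
move=> [p k] [q l] /andP[/= pp _] /andP[/= pq _] e.
rewrite /ppow /= in e.
have pq' : p = q :> nat.
  have : (p %| q ^ l.+1)%N by rewrite -e dvdn_exp.
  by rewrite Euclid_dvdX// andbT => /prime_nt_dvdP; apply=> //; case: (p : nat) pp => [|[|]].
have ->: p = q by exact: val_inj.
congr (_, _); apply: val_inj => /=; move: e; rewrite pq' => /eqP.
by rewrite eqn_exp2l ?prime_gt1// => /eqP [].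
Qed.

Lemma sum_ppow_le X (F : nat -> R) : (forall n, 0 <= F n) ->
  \sum_(j | @okj X j) F (ppow j) <= \sum_(1 <= n < X.+1) F n.
Proof.
move=> F0.
pose h (j : 'I_X.+1 * 'I_X.+1) : 'I_X.+1 := inord (ppow j).
have hE j : okj j -> h j = ppow j :> nat.
  by move=> /ppow_gt0/andP[_ le]; rewrite inordK.
rewrite (partition_big h xpredT)//=.

apply: (@le_trans _ _ (\sum_(n < X.+1 | (0 < n)%N) F n)); last first.
  by rewrite big_mkcond big_ord_recl /= add0r big_add1 /= big_mkord.
rewrite [X in X <= _](bigID (fun n : 'I_X.+1 => (0 < n)%N)) /= [X in _ + X]big1 ?addr0; last first.
  move=> n n0; rewrite big1// => j /andP[oj /eqP hj].
  by move: n0; rewrite -hj hE// -eqn0Ngt; have /andP[] := ppow_gt0 oj; case: (ppow j).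
apply: ler_sum => n _.
have [j0 /andP[oj0 /eqP hj0]|no] := pickP (fun j => okj j && (h j == n)).
  rewrite (big_pred1 j0).
    by rewrite -hE// hj0.
  move=> j; apply/andP/eqP => [[oj /eqP hj]|->]; last by rewrite oj0 hj0.
  by apply: (ppow_inj oj oj0); rewrite -!hE// hj hj0.
by rewrite big_pred0.
Qed.

End MeanSquare.


Section PowerSeriesAlgebra.
Variable R : realType.
Local Notation C := (R[i]).

Lemma pser_lin (I : finType) (P : pred I) (c : I -> C) (F : I -> C -> C)
    (e : I -> nat -> C) (M : I -> R) (r : R) : 0 < r ->
  (forall i, P i -> pser (F i) (e i) r (M i)) ->
  pser (fun z => \sum_(i | P i) c i * F i z) (fun k => \sum_(i | P i) c i * e i k) r
    (\sum_(i | P i) normc (c i) * M i).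
Proof.
move=> r0 H; split=> [k|w wr m].
  apply: (@le_trans _ _ ((\sum_(i | P i) normc (c i) * normc (e i k)) * r ^+ k)).
    rewrite ler_wpM2r ?exprn_ge0 ?(ltW r0)//; apply: (le_trans (nc_sum _ _ _)).
    by apply: ler_sum => i _; rewrite normcM.
  rewrite mulr_suml; apply: ler_sum => i Pi; rewrite -mulrA ler_wpM2l ?nc_ge0//.
  exact: (H i Pi).1.
have -> : \sum_(i | P i) c i * F i w - \sum_(k < m) (\sum_(i | P i) c i * e i k) * w ^+ k =
    \sum_(i | P i) c i * (F i w - \sum_(k < m) e i k * w ^+ k).
  rewrite [X in _ - X](eq_bigr (fun k : 'I_m => \sum_(i | P i) c i * (e i k * w ^+ k))); last first.
    by move=> k _; rewrite mulr_suml; apply: eq_bigr => i _; rewrite mulrA.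
  by rewrite exchange_big -sumrB; apply: eq_bigr => i _; rewrite -mulr_sumr -mulrBr.
apply: (le_trans (nc_sum _ _ _)); rewrite !mulr_suml; apply: ler_sum => i Pi.
rewrite normcM -!(mulrA (normc (c i))) ler_wpM2l ?nc_ge0//.
exact: (H i Pi).2.
Qed.

Lemma pserB f g (a b : nat -> C) (r M M' : R) : 0 < r -> pser f a r M -> pser g b r M' ->
  pser (fun z => f z - g z) (fun k => a k - b k) r (M + M').
Proof.
move=> r0 [a1 a2] [b1 b2]; split=> [k|w wr m].
  apply: (@le_trans _ _ ((normc (a k) + normc (b k)) * r ^+ k)).
    by rewrite ler_wpM2r ?exprn_ge0 ?(ltW r0)// ncB.
  by rewrite mulrDl lerD.
have -> : f w - g w - \sum_(k < m) (a k - b k) * w ^+ k =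
    (f w - \sum_(k < m) a k * w ^+ k) - (g w - \sum_(k < m) b k * w ^+ k).
  rewrite (eq_bigr (fun k : 'I_m => a k * w ^+ k - b k * w ^+ k)); last first.
    by move=> k _; rewrite mulrBl.
  by rewrite sumrB; ring.
by apply: (le_trans (ncB _ _)); rewrite -mulrA mulrDl lerD// mulrA; [exact: a2|exact: b2].
Qed.

Lemma psD n (s z : C) : ps n (s + z) = ps n s * ps n z.
Proof. by rewrite /ps -ceD; congr ce; rewrite opprD mulrDl. Qed.

Lemma ps_cder n (z : C) : exists l, cder (ps n) z l.
Proof.
eexists; apply: (@cder_comp _ (fun s => - s * ((ln (n%:R : R))%:C)%C)); last exact: cder_ce.
by apply: cderM; [apply: cderN; exact: cder_id|exact: cder_cst].
Qed.

Lemma ps_pser (r : R) n : 0 < r -> (0 < n)%N ->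
  exists e, pser (ps n) e r (expR (r * ln n%:R)).
Proof.
move=> r0 n0; apply: (@cauchy_pser _ _ r (r + 1)) => //; first by rewrite ltrDl.
  by move=> z _; exact: ps_cder.
move=> t; rewrite nc_ps ler_expR ler_wpM2r ?ln_ge0 ?ler1n//.
have := Re_le_nc (circ r t); rewrite (nc_circ _ (ltW r0)).
by rewrite ler_norml => /andP[h _]; rewrite lerNl.
Qed.

(** The point [sigma_T + i t] lies at distance [5/2 - eta] from the centre, and the series are
    controlled up to radius [5/2 - eta/2]; the quotient of these radii is at most [1 - eta / 5]. *)
Lemma ratio_bound (eta : R) N : 0 < eta <= 2^-1 ->
  ((5/2 - eta) / (5/2 - eta/2)) ^+ N * ((5/2 - eta/2) / ((5/2 - eta/2) - (5/2 - eta))) <=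
  expR (- (eta * N%:R / 5)) * (5 / eta).
Proof.
move=> /andP[e0 e1].
have r0 : 0 < 5/2 - eta/2 by lra.
apply: ler_pM.
- by rewrite exprn_ge0// divr_ge0//; lra.
- by rewrite divr_ge0//; lra.
- have -> : - (eta * N%:R / 5) = N%:R * - (eta / 5) by ring.
  rewrite expRM_natl lerXn2r ?nnegrE ?expR_ge0//; first by rewrite divr_ge0//; lra.
  apply: (le_trans _ (expR_ge1Dx _)); rewrite ler_pdivrMr//.
  have := sqr_ge0 eta; move: e0 e1; rewrite expr2; lra.
- have -> : 5/2 - eta/2 - (5/2 - eta) = eta / 2 by field.
  rewrite ler_pdivrMr; last by lra.
  have -> : 5 / eta * (eta / 2) = 5 / 2 by field; rewrite gt_eqF.
  lra.
Qed.

End PowerSeriesAlgebra.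

(** * Comparison of ln |L| with the Dirichlet polynomial *)

Section LogApprox.
Variable R : realType.
Local Notation C := (R[i]).
Local Notation mu := (@lebesgue_measure R).
Variables (d : nat) (al : 'I_d -> nat -> C) (L : C -> C).
Hypothesis al1 : forall j p, prime p -> normc (al j p) <= 1.
Hypothesis EP : euler_product al (L : R[i]^o -> R[i]^o).
Local Ltac slim := clear -al1 EP.

Lemma PX1 s : PX al 1 s = 0.
Proof.
rewrite /PX big_pred0// => -[p k]; apply/negbTE; rewrite negb_and /=.
have [pp|//] := boolP (prime p); rewrite -ltnNge /=.
by apply: (leq_trans (prime_gt1 pp)); rewrite -[X in (X <= _)%N]expn1 leq_exp2l ?prime_gt1.
Qed.

(** The case [X = 1] of [L_approx], where [PX] is an empty sum. *)
Lemma ln_L_bound s : 2 <= complex.Re s -> L s != 0 /\ `|ln (normc (L s))| <= 4 * d%:R.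
Proof.
move=> s2; have [h1 h2] := L_approx al1 EP (ltn0Sn 0) s2; split => //.
by move: h2; rewrite PX1 /= subr0 divr1.
Qed.

Definition ps_rem (e : nat -> nat -> C) N (z : C) n := ps n z - \sum_(m < N) e n m * z ^+ m.

(** The four errors are, in order: the discrepancy at the centre; that of the first [N]
    coefficients, each at most [16 d / X * (5 / 4)^k] and multiplied by at most [(5 / 2)^k], with
    [25 / 8 < 4]; the tail of [log L], through Borel-Caratheodory with real part at most [G + 4 d];
    and the tail of [P_X], kept as it stands because it is only small on average over [t]. *)
Lemma log_approx (e : nat -> nat -> C) (eta G t : R) (X N : nat) :
  0 < eta <= 2^-1 -> (0 < X)%N -> (0 < N)%N -> 0 <= G ->
  (forall n, (0 < n)%N -> pser (ps n) (e n) (5/2 - eta/2) (expR ((5/2 - eta/2) * ln n%:R))) ->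
  (forall h, normc h < 5/2 -> exists l, cder L ((3 +i* t)%C + h) l) ->
  (forall h, normc h < 5/2 - eta/4 -> L ((3 +i* t)%C + h) != 0) ->
  (forall h, normc h < 5/2 - eta/4 -> ln (normc (L ((3 +i* t)%C + h))) <= G) ->
  `|ln (normc (L ((2^-1 + eta) +i* t)%C)) - complex.Re (PX al X ((2^-1 + eta) +i* t)%C)| <=
  4 * d%:R / X%:R + N%:R * (16 * d%:R / X%:R * 4 ^+ N) +
  2 * (G + 4 * d%:R) * (expR (- (eta * N%:R / 5)) * (5 / eta)) +
  normc (\sum_(j | @okj X j) lcoef al j.1 j.2.+1 *
     ps_rem e N (((eta - 5/2)%:C)%C) (ppow j) * ps (ppow j) (3 +i* t)%C).
Proof.
move=> eta01 X0 N0 G0 he hol nz LG.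
have /andP[eta0 eta1] := eta01.
set c := (3 +i* t)%C in hol nz LG *.
have cE : ((2^-1 + eta) +i* t)%C = c + ((eta - 5/2)%:C)%C.
  by apply/eqP; rewrite eq_complex /= addr0 eqxx andbT; apply/eqP; field.
have nz0 : normc (((eta - 5/2)%:C)%C : C) = 5/2 - eta.
  by rewrite nc_real ler0_norm ?opprB//; lra.
have rb := ratio_bound N eta01.
rewrite cE; move: (((eta - 5/2)%:C)%C : C) nz0 => z0 nz0 {cE}.
have [r3 r3E] : exists r3 : R, r3 = 5/2 - eta/2 by eexists.
rewrite -r3E in he rb; rewrite -nz0 in rb.
have r30 : 0 < r3 by lra.
have z0r : normc z0 < r3 by lra.
have d0 : (0 : R) <= d%:R by [].
have X0' : (0 : R) < X%:R by rewrite ltr0n.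
pose f h := L (c + h).
have hf : holo_disc f (5/2 - eta/4).
  by apply: holo_disc_shift => h hr; apply: hol; lra.
(* The radii decrease from [5/2 - eta/4] (no zeros) through [5/2 - 3 * eta/8] (logarithm) and
   [5/2 - eta/2] (coefficients) to [5/2 - eta] (the point), since each tool needs some room. *)
have [||g [a [M [pg a0 gE]]]] := @log_disc R f (5/2 - 3 * eta/8) (5/2 - eta/4) _ _ hf nz; try lra.
have c2 h : normc h <= 1 -> 2 <= complex.Re (c + h).
  by move=> h1; rewrite ReD /=; have := Re_le_nc h; rewrite ler_norml; lra.
have f0 : `|ln (normc (f 0))| <= 4 * d%:R.
  by apply: (ln_L_bound _).2; apply: c2; rewrite normc0.
pose M' := 2 * (G + 4 * d%:R).
have M'0 : 0 <= M' by rewrite /M' mulr_ge0// addr_ge0// mulr_ge0.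
have hb k : normc (a k) * r3 ^+ k <= M'.
  case: k => [|k]; first by rewrite a0 normc0 mul0r.
  have := @borel_caratheodory R g a (5/2 - 3 * eta/8) M (G + 4 * d%:R) r3 k.+1 r30.
  rewrite a0 subr0; apply => //; first by lra.
  move=> z zr; have := gE z zr; have := LG z; rewrite -/(f z).
  by move: f0; rewrite ler_norml => /andP[f0 _] /(_ ltac:(move: zr eta0; slim; lra)); move: f0; slim; lra.
have pa := psum_pser r30 hb.
have pg3 : pser g a r3 M by apply: (pser_shrink r30 _ pg); lra.
have gz0 : normc (g z0 - \sum_(m < N) a m * z0 ^+ m) <=
    M' * (expR (- (eta * N%:R / 5)) * (5 / eta)).
  rewrite (pser_uniq r30 pg3 pa z0r); apply: (le_trans (pa.2 _ z0r N)).
  by rewrite -mulrA ler_wpM2l.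
pose cc (j : 'I_X.+1 * 'I_X.+1) := lcoef al j.1 j.2.+1 * ps (ppow j) c.
pose p z := \sum_(j | @okj X j) cc j * ps (ppow j) z.
have pE z : PX al X (c + z) = p z.
  by rewrite /PX /p; apply: eq_bigr => j _; rewrite psD mulrA.
pose pc k := \sum_(j | @okj X j) cc j * e (ppow j) k.
have pp : pser p pc r3 (\sum_(j | @okj X j) normc (cc j) * expR (r3 * ln (ppow j)%:R)).
  by apply: pser_lin => // j /ppow_gt0/andP[j0 _]; exact: he.
have r31 : 1 <= r3 by lra.
have pq := pserB ltr01 (pser_shrink ltr01 r31 pg3) (pser_shrink ltr01 r31 pp).
have Lap h : normc h <= 1 -> `|ln (normc (f h)) - complex.Re (p h)| <= 4 * d%:R / X%:R.
  by move=> h1; rewrite -pE; exact: (L_approx al1 EP X0 (c2 h h1)).2.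
have p0 : p 0 = pc 0%N by exact: (pser0 r30 pp).
(* Borel-Caratheodory on the unit disc: the real part of [g - p] is [ln |f| - ln |f 0| - Re p], and
   [ln |f| - Re p] is at most [4 d / X] in absolute value, also at the centre. *)
have dif k : (0 < k)%N -> normc (a k - pc k) * (4/5) ^+ k <= 16 * d%:R / X%:R.
  move=> k0.
  have := @borel_caratheodory R _ _ 1 _ (4 * d%:R / X%:R - ln (normc (f 0))) (4/5) k _ _ pq _ k0.
  move=> H; apply: (le_trans (H _ _ _)); [slim; lra|slim; lra| |].
    move=> z z1; rewrite ReB; have := gE z; have := Lap z (ltW z1).
    rewrite ler_norml => /andP[_ h1] /(_ ltac:(move: z1 eta1; slim; lra)); move: h1; slim; lra.
  rewrite ReB a0 -p0 /=; have := Lap 0; rewrite normc0 => /(_ ler01).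
  rewrite ler_norml => /andP[h1 _].
  have -> : 16 * d%:R / X%:R = 4 * (4 * d%:R / X%:R) :> R by ring.
  by move: (4 * d%:R / X%:R) (ln _) (complex.Re _) h1 => u v w; slim; lra.
case: N N0 gz0 rb => // N _ gz0 _.
pose D := \sum_(j | @okj X j) lcoef al j.1 j.2.+1 * ps_rem e N.+1 z0 (ppow j) * ps (ppow j) c.
rewrite -/D.
have PE : p z0 = \sum_(m < N.+1) pc m * z0 ^+ m + D.
  rewrite /p /D /ps_rem.
  have -> : \sum_(m < N.+1) pc m * z0 ^+ m =
      \sum_(j | @okj X j) cc j * \sum_(m < N.+1) e (ppow j) m * z0 ^+ m.
    rewrite (eq_bigr (fun m : 'I_N.+1 => \sum_(j | @okj X j) cc j * (e (ppow j) m * z0 ^+ m))).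
      by rewrite exchange_big; apply: eq_bigr => j _; rewrite mulr_sumr.
    by move=> m _; rewrite mulr_suml; apply: eq_bigr => j _; rewrite mulrA.
  by rewrite -big_split; apply: eq_bigr => j _; rewrite /cc /=; ring.
pose S := \sum_(m < N) (a m.+1 - pc m.+1) * z0 ^+ m.+1.
have SE : \sum_(m < N.+1) a m * z0 ^+ m - \sum_(m < N.+1) pc m * z0 ^+ m = S - p 0.
  rewrite -sumrB big_ord_recl /= a0 p0 mul0r expr0 mulr1 add0r addrC; congr (_ - _).
  by apply: eq_bigr => m _; rewrite mulrBl.
have S1 : normc S <= N.+1%:R * (16 * d%:R / X%:R * 4 ^+ N.+1).
  apply: (le_trans (nc_sum _ _ _)); apply: (@le_trans _ _ (\sum_(m < N) 16 * d%:R / X%:R * 4 ^+ N.+1)).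
    apply: ler_sum => m _; rewrite normcM nc_X.
    have q0 : (0 : R) < (4/5) ^+ m.+1 by rewrite exprn_gt0//; lra.
    have h1 := dif m.+1 isT; rewrite -(ler_pdivlMr _ _ q0) in h1.
    apply: (@le_trans _ _ (16 * d%:R / X%:R / (4 / 5) ^+ m.+1 * (5/2) ^+ m.+1)).
      apply: ler_pM; rewrite ?nc_ge0 ?exprn_ge0 ?nc_ge0//.
      by rewrite lerXn2r ?nnegrE ?nc_ge0//; move: nz0 eta0; slim; lra.
    have dX : 0 <= 16 * d%:R / X%:R :> R by rewrite divr_ge0 ?mulr_ge0// ltW.
    rewrite -mulrA; apply: (ler_wpM2l dX).
    apply: (@le_trans _ _ (4 ^+ m.+1)); last first.
      by rewrite ler_weXn2l// ?ltnS ?(ltnW (ltn_ord m))//; slim; lra.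
    by rewrite -exprVn -exprMn lerXn2r ?nnegrE//; slim; lra.
  by rewrite sumr_const card_ord -[X in X <= _]mulr_natl ler_wpM2r ?ler_nat//.
have z0r' : normc z0 < 5/2 - 3 * eta/8 by move: nz0 eta0; slim; lra.
have := gE z0 z0r'; rewrite -/(f z0) pE PE => ->.
set U := g z0 - _ in gz0.
have -> : ln (normc (f 0)) + complex.Re (g z0) - complex.Re (\sum_(m < N.+1) pc m * z0 ^+ m + D) =
   (ln (normc (f 0)) - complex.Re (p 0)) + complex.Re S + complex.Re U - complex.Re D.
  have -> : g z0 = U + S - p 0 + \sum_(m < N.+1) pc m * z0 ^+ m.
    by rewrite -(addrA U) -SE /U; ring.
  by rewrite !ReD !ReN; ring.
have h1 := Lap 0; rewrite normc0 in h1; have {}h1 := h1 ler01.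
have h2 := le_trans (Re_le_nc S) S1.
have h3 := le_trans (Re_le_nc U) gz0.
have h4 := Re_le_nc D.
apply: (le_trans (ler_normB _ _)); apply: lerD => //.
apply: (le_trans (ler_normD _ _)); apply: lerD => //.
by apply: (le_trans (ler_normD _ _)); apply: lerD.
Qed.

Lemma ps_line n (x t : R) : ps n (x +i* t)%C =
  ((expR (- x * ln n%:R))%:C)%C * ei (t * (- ln n%:R)).
Proof.
rewrite -ce_real -ceD; congr ce; apply/eqP; rewrite eq_complex /=.
by apply/andP; split; apply/eqP; ring.
Qed.

(** For [n = ppow j] the Taylor remainder is at most [W * n^(5/2 - eta/2)], with [W] the factor from
    [ratio_bound], and [ps n] at [3 + i t] brings [n^(-3)]. The coefficients are thus at most
    [d * W * n^(-1/2)], and the diagonal is a harmonic sum. *)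
Lemma D_mean_square (e : nat -> nat -> C) (eta T : R) (X N : nat) :
  0 < eta <= 2^-1 -> (0 < X)%N -> 0 < T ->
  (forall n, (0 < n)%N -> pser (ps n) (e n) (5/2 - eta/2) (expR ((5/2 - eta/2) * ln n%:R))) ->
  \int[mu]_(t in `[T, (2 * T)]) (normc (\sum_(j | @okj X j) lcoef al j.1 j.2.+1 *
     ps_rem e N (((eta - 5/2)%:C)%C) (ppow j) * ps (ppow j) (3 +i* t)%C) ^+ 2) <=
  (d%:R * (expR (- (eta * N%:R / 5)) * (5 / eta))) ^+ 2 *
    (T * (1 + ln X%:R) + 2 * X%:R ^+ 3).
Proof.
move=> eta01 X0 T0 he; have /andP[eta0 eta1] := eta01.
have nz0 : normc (((eta - 5/2)%:C)%C : C) = 5/2 - eta.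
  by rewrite nc_real ler0_norm ?opprB//; lra.
have rb := ratio_bound N eta01.
move: (((eta - 5/2)%:C)%C : C) nz0 => z0 nz0.
have [W WE] : exists W, W = expR (- (eta * N%:R / 5)) * (5 / eta) by eexists.
rewrite -WE in rb *.
have W0 : 0 <= W by rewrite WE mulr_ge0 ?expR_ge0// divr_ge0// ltW.
pose b (j : 'I_X.+1 * 'I_X.+1) := lcoef al j.1 j.2.+1 * ps_rem e N z0 (ppow j) *
  ((expR (- 3 * ln (ppow j)%:R))%:C)%C.
have -> : (fun t => normc (\sum_(j | @okj X j) lcoef al j.1 j.2.+1 *
     ps_rem e N z0 (ppow j) * ps (ppow j) (3 +i* t)%C) ^+ 2) =
  (fun t => normc (\sum_(j | @okj X j) b j * ei (t * (- ln (ppow j)%:R))) ^+ 2).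
  apply/funext => t; congr (normc _ ^+ 2); apply: eq_bigr => j _.
  by rewrite ps_line /b !mulrA.
apply: (le_trans (mean_square b T0 (fun j => @ppow_gt0 X j) (@ppow_inj X))).
have bj j : okj j -> normc (b j) <= d%:R * W * expR (- (2^-1 * ln (ppow j)%:R)).
  move=> oj; have /andP[j0 jX] := ppow_gt0 oj.
  have ln0 : (0 : R) <= ln (ppow j)%:R by rewrite ln_ge0// ler1n.
  have /andP[pj _] := oj.
  have lc : normc (lcoef al j.1 j.2.+1) <= d%:R.
    by apply: (le_trans (nc_lcoef al1 pj (ltn0Sn j.2))); rewrite ler_pdivrMr// ler_peMr// ler1n.
  rewrite /b (normcM (lcoef al j.1 j.2.+1 * ps_rem e N z0 (ppow j))) (normcM (lcoef al j.1 j.2.+1)).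
  rewrite nc_real (ger0_norm (expR_ge0 _)) -!mulrA.
  apply: ler_pM => //; rewrite ?nc_ge0 ?mulr_ge0 ?nc_ge0 ?expR_ge0//.
  have z0r : normc z0 < 5/2 - eta/2 by lra.
  apply: (@le_trans _ _ (expR ((5 / 2 - eta / 2) * ln (ppow j)%:R) * W * expR (- 3 * ln (ppow j)%:R))).
    rewrite ler_wpM2r ?expR_ge0//; apply: (le_trans ((he _ j0).2 _ z0r N)).
    by rewrite -mulrA ler_wpM2l ?expR_ge0// nz0.
  rewrite mulrAC -expRD mulrC ler_wpM2l// ler_expR -mulrDl -[X in _ <= X]mulNr ler_wpM2r//; move: eta0 eta1; lra.
rewrite mulrDr; apply: lerD.
  rewrite (mulrCA _ T) ler_wpM2l ?(ltW T0)//.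
  apply: (@le_trans _ _ (\sum_(j | @okj X j) (d%:R * W) ^+ 2 * (ppow j)%:R^-1)).
    apply: ler_sum => j oj; have /andP[j0 jX] := ppow_gt0 oj.
    apply: (@le_trans _ _ ((d%:R * W * expR (- (2^-1 * ln (ppow j)%:R))) ^+ 2)).
      by rewrite lerXn2r ?nnegrE ?nc_ge0 ?mulr_ge0 ?expR_ge0// bj.
    rewrite exprMn ler_wpM2l ?exprn_ge0 ?mulr_ge0//.
    rewrite -expRM_natl -mulr_natl mulrN mulrA mulfV ?mul1r//.
    by rewrite expRN lnK// posrE ltr0n.
  rewrite -mulr_sumr ler_wpM2l ?exprn_ge0 ?mulr_ge0//.
  apply: (le_trans (@sum_ppow_le R X (fun n => n%:R^-1) _)).
    by move=> n; rewrite invr_ge0.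
  exact: harmonic_le.
have sb : \sum_(j | @okj X j) normc (b j) <= d%:R * W * X%:R.
  apply: (@le_trans _ _ (\sum_(j | @okj X j) d%:R * W * 1)).
    apply: ler_sum => j oj; apply: (le_trans (bj j oj)).
    rewrite ler_wpM2l ?mulr_ge0// expR_le1 oppr_le0 mulr_ge0 ?invr_ge0// ln_ge0// ler1n.
    by have /andP[] := ppow_gt0 oj.
  rewrite -mulr_sumr ler_wpM2l ?mulr_ge0//.
  apply: (le_trans (@sum_ppow_le R X (fun=> 1) _)) => //.
  by rewrite sumr_const_nat subn1.
apply: (@le_trans _ _ (2 * X%:R * (d%:R * W * X%:R) ^+ 2)).
  rewrite ler_wpM2l ?mulr_ge0// lerXn2r ?nnegrE ?mulr_ge0//.
  by apply: sumr_ge0 => j _; exact: nc_ge0.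
by rewrite le_eqVlt; apply/orP; left; apply/eqP; ring.
Qed.

End LogApprox.


(** * Moments and the random model *)

Section Moments.
Variable R : realType.
Local Notation C := (R[i]).

Lemma pow_expand (A : comPzRingType) (I : finType) (P : pred I) (F : I -> A) q :
  (\sum_(i | P i) F i) ^+ q = \sum_(s : {ffun 'I_q -> I} | s \in ffun_on P) \prod_k F (s k).
Proof. by rewrite -[q in LHS]card_ord -prodr_const bigA_distr_big. Qed.

Lemma rootu_sum K a (I : Type) (r : seq I) (P : pred I) (v : I -> int) :
  @rootu R K a (\sum_(i <- r | P i) v i) = \prod_(i <- r | P i) @rootu R K a (v i).
Proof.
elim/big_rec2: _ => [|i y1 y2 _ IH]; first exact: rootu0.
by rewrite rootuD IH.
Qed.

Lemma ln_natprod (I : Type) (r : seq I) (P : pred I) (n : I -> nat) :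
  (forall i, P i -> (0 < n i)%N) ->
  ln ((\prod_(i <- r | P i) n i)%:R : R) = \sum_(i <- r | P i) ln (n i)%:R.
Proof.
move=> n0; elim: r => [|i r IH]; first by rewrite !big_nil ln1.
rewrite !big_cons; case: ifP => // Pi.
by rewrite natrM lnM ?IH// posrE ltr0n ?n0// prodn_cond_gt0.
Qed.

Lemma logn_natprod p (I : Type) (r : seq I) (P : pred I) (n : I -> nat) :
  (forall i, P i -> (0 < n i)%N) ->
  logn p (\prod_(i <- r | P i) n i) = (\sum_(i <- r | P i) logn p (n i))%N.
Proof.
move=> n0; elim: r => [|i r IH]; first by rewrite !big_nil logn1.
rewrite !big_cons; case: ifP => // Pi.
by rewrite lognM ?IH ?n0// prodn_cond_gt0.
Qed.

Lemma Re_half (z : C) : ((complex.Re z)%:C)%C = z / 2 + (z^*)%C / 2.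
Proof.
have e2 : (2^-1 : C) = ((2^-1 : R)%:C)%C by rewrite -(rmorph_nat (real_complex R)) fmorphV.
case: z => a b; rewrite e2; apply/eqP; rewrite eq_complex /=.
by apply/andP; split; apply/eqP; field.
Qed.

Lemma sum_pair_bool (A : nmodType) (I : finType) (P : pred I) (F : I * bool -> A) :
  \sum_(i : I * bool | P i.1) F i = \sum_(j | P j) (F (j, true) + F (j, false)).
Proof.
rewrite (eq_bigl (fun i : I * bool => P i.1 && xpredT i.2)); last by move=> i; rewrite andbT.
rewrite (eq_bigr (fun i => F (i.1, i.2))); last by case.
by rewrite -(pair_big P xpredT (fun j b => F (j, b))); apply: eq_bigr => j _; rewrite big_bool.
Qed.

Variables (X K : nat) (w : 'I_X.+1 * 'I_X.+1 -> C).
Local Notation J := ('I_X.+1 * 'I_X.+1)%type.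
Local Notation Om := {ffun 'I_X.+1 -> 'I_K}.

(** Expectation for independent uniform [phi p] in ['I_K]; the root of unity indexed by [phi p] is
    the random counterpart of [p ^ (- i t)]. *)
Definition EE (F : Om -> C) : C := (K%:R ^+ X.+1)^-1 * \sum_phi F phi.

Definition xt (t : R) := complex.Re (\sum_(j | @okj X j) w j * ei (t * - ln (ppow j)%:R)).

Definition xm (phi : Om) :=
  complex.Re (\sum_(j | @okj X j) w j * @rootu R K (phi j.1) (j.2.+1)%:Z).

(** The boolean marks the conjugate in [Re z = z / 2 + z^* / 2]. Powers of a real part thus become
    sums of monomials with signed exponents, to which unique factorisation applies. *)
Definition fexp (i : J * bool) : int := if i.2 then - (i.1.2.+1)%:Z else (i.1.2.+1)%:Z.

Definition fcoef (i : J * bool) : C := (if i.2 then ((w i.1)^*)%C else w i.1) / 2.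

Lemma Re_expand (F : J -> C) :
  ((complex.Re (\sum_(j | @okj X j) w j * F j))%:C)%C =
  \sum_(i : J * bool | okj i.1) fcoef i * (if i.2 then ((F i.1)^*)%C else F i.1).
Proof.
rewrite (sum_pair_bool (@okj X)) Re_sum (rmorph_sum (real_complex R)); apply: eq_bigr => j _.
rewrite [LHS]/= Re_half addrC /fcoef /=.
have -> : ((w j * F j)^*)%C = ((w j)^*)%C * ((F j)^*)%C by exact: (rmorphM (@conjc R)).
by congr (_ + _); ring.
Qed.

Lemma xt_expand t : ((xt t)%:C)%C =
  \sum_(i : J * bool | okj i.1) fcoef i * ei (t * - ((fexp i)%:~R * ln (i.1.1 : nat)%:R)).
Proof.
rewrite /xt Re_expand; apply: eq_bigr => -[j b] /= /andP[pj _]; congr (_ * _).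
have e : ln (ppow j)%:R = (j.2.+1)%:R * ln (j.1 : nat)%:R :> R.
  by rewrite /ppow natrX lnXn ?ltr0n ?prime_gt0// mulr_natl.
rewrite /fexp e; case: b => //=.
by rewrite ei_conj; congr ei; rewrite mulrNz mulNr !mulrN.
Qed.

Lemma xm_expand phi : ((xm phi)%:C)%C =
  \sum_(i : J * bool | okj i.1) fcoef i * @rootu R K (phi i.1.1) (fexp i).
Proof.
rewrite /xm Re_expand; apply: eq_bigr => -[j b] /= _; congr (_ * _).
by rewrite /fexp; case: b => //=; rewrite rootuN.
Qed.

Lemma EE_prod (F : 'I_X.+1 -> 'I_K -> C) :
  EE (fun phi => \prod_p F p (phi p)) = \prod_p (K%:R^-1 * \sum_a F p a).
Proof. by rewrite /EE -bigA_distr_bigA big_split /= prodr_const card_ord exprVn. Qed.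

Section OneTerm.
Variables (q : nat) (s : {ffun 'I_q -> J * bool}).
Hypothesis sP : forall k, okj (s k).1.

Let V (p : 'I_X.+1) : int := \sum_(k | (s k).1.1 == p) fexp (s k).

Lemma prod_rootu_V (phi : Om) :
  \prod_k @rootu R K (phi (s k).1.1) (fexp (s k)) = \prod_p @rootu R K (phi p) (V p).
Proof.
rewrite (partition_big (fun k => (s k).1.1) xpredT)//=; apply: eq_bigr => p _.
by rewrite /V rootu_sum; apply: eq_bigr => k /eqP ->.
Qed.

Lemma V_small (p : 'I_X.+1) : (q * X.+1 < K)%N -> (`|V p| < K)%N.
Proof.
move=> qK; rewrite -ltz_nat abszE; apply: (@le_lt_trans _ _ ((q * X.+1)%N%:Z)); last by rewrite ltz_nat.
apply: (le_trans (ler_norm_sum _ _ _)).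
apply: (@le_trans _ _ (\sum_(k < q) (X.+1)%:Z)).
  rewrite big_mkcond; apply: ler_sum => k _; case: ifP => // _.
  by rewrite /fexp; case: ifP => _; rewrite ?normrN ger0_norm// lez_nat.
by rewrite sumr_const card_ord -mulr_natl natz -PoszM.
Qed.

(** Terms without and with conjugate collect into two integers [m1] and [m2] up to [X ^ q]. Equality
    would force equal [p]-adic valuations, that is [V p = 0]; so they differ and [ln_gap]
    applies. *)
Lemma freq_gap : (exists p, V p != 0) ->
  ((X ^ q)%:R)^-1 <= `|\sum_k (fexp (s k))%:~R * ln ((s k).1.1 : nat)%:R : R|.
Proof.
move=> [p Vp].
pose n k := ppow (s k).1.
have n0 k : (0 < n k)%N by have /andP[] := ppow_gt0 (sP k).
have nX k : (n k <= X)%N by have /andP[] := ppow_gt0 (sP k).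
pose m1 := (\prod_(k | ~~ (s k).2) n k)%N; pose m2 := (\prod_(k | (s k).2) n k)%N.
have bound (Q : pred 'I_q) : (0 < \prod_(k | Q k) n k <= X ^ q)%N.
  rewrite prodn_cond_gt0//= big_mkcond /=.
  have -> : (X ^ q = \prod_(k < q) X)%N by rewrite prod_nat_const card_ord.
  by apply: leq_prod => k _; case: ifP => // _; exact: leq_trans (n0 k) (nX k).
have -> : \sum_k (fexp (s k))%:~R * ln ((s k).1.1 : nat)%:R = ln m1%:R - ln m2%:R :> R.
  rewrite !ln_natprod// (bigID (fun k => (s k).2)) /= addrC -sumrN; congr (_ + _).
    apply: eq_bigr => k /negbTE b; have /andP[pj _] := sP k.
    by rewrite /fexp b /n /ppow natrX lnXn ?ltr0n ?prime_gt0// mulr_natl.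
  apply: eq_bigr => k b; have /andP[pj _] := sP k.
  by rewrite /fexp b /n /ppow natrX lnXn ?ltr0n ?prime_gt0// mulrNz mulNr mulr_natl.
apply: ln_gap; [exact: bound|exact: bound|].
apply: contra Vp => /eqP m12.
have [pp|np] := boolP (prime p); last first.
  rewrite /V big_pred0// => k; apply/negbTE; apply: contra np => /eqP <-.
  by have /andP[] := sP k.
have lg (Q : pred 'I_q) : logn p (\prod_(k | Q k) n k) =
    (\sum_(k | Q k && ((s k).1.1 == p)) ((s k).1.2).+1)%N.
  rewrite logn_natprod// big_mkcondr /=; apply: eq_bigr => k _.
  have /andP[pj _] := sP k.
  rewrite /n /ppow lognX logn_prime// -val_eqE /= [(p : nat) == _]eq_sym.
  by case: eqP => _; rewrite ?muln1 ?muln0.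
have := congr1 (logn p) m12; rewrite !lg => e.
rewrite /V (bigID (fun k => (s k).2)) /= addrC.
rewrite (eq_bigr (fun k => (((s k).1.2).+1)%:Z)); last by move=> k /andP[_ /negbTE b]; rewrite /fexp b.
rewrite [X in _ + X](eq_bigr (fun k => - (((s k).1.2).+1)%:Z)); last first.
  by move=> k /andP[_ b]; rewrite /fexp b.
rewrite sumrN subr_eq0; apply/eqP.
have PS (Q : pred 'I_q) : \sum_(k | Q k) (((s k).1.2).+1)%:Z = (\sum_(k | Q k) ((s k).1.2).+1)%N%:Z.
  by rewrite -natz natr_sum; apply: eq_bigr => k _; rewrite natz.
rewrite !PS; congr (_%:Z); move: e; under eq_bigl do rewrite andbC.
by move=> ->; apply: eq_bigl => k; rewrite andbC.
Qed.

(** If every total exponent [V p] is 0, the integral is [T] and the expectation 1. Otherwise the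
    expectation is 0, because [q * X.+1 < K] keeps [V p] from being a nonzero multiple of [K], and
    the integral is bounded through the frequency gap. *)
Lemma one_term (T : R) : 0 < T -> (0 < X)%N -> (q * X.+1 < K)%N ->
  normc (cint T (2 * T) (fun t => \prod_k ei (t * - ((fexp (s k))%:~R * ln ((s k).1.1 : nat)%:R))) -
    (T%:C)%C * EE (fun phi => \prod_k @rootu R K (phi (s k).1.1) (fexp (s k)))) <= 2 * X%:R ^+ q.
Proof.
move=> T0 X0 qK.
have K0 : (0 : R) < K%:R by rewrite ltr0n (leq_ltn_trans _ qK).
have K0' : (K%:R : C) != 0 by rewrite -nc_eq0 nc_nat gt_eqF.
pose La := \sum_k (fexp (s k))%:~R * ln ((s k).1.1 : nat)%:R : R.
rewrite (@eq_cint _ _ _ _ (fun t => ei (t * - La))); last first.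
  move=> t _; rewrite -ei_sum; congr ei; rewrite -mulr_sumr -sumrN; congr (_ * _).
have -> : EE (fun phi => \prod_k @rootu R K (phi (s k).1.1) (fexp (s k))) =
    \prod_p (if V p == 0 then 1 else 0).
  have -> : EE (fun phi => \prod_k @rootu R K (phi (s k).1.1) (fexp (s k))) =
      EE (fun phi => \prod_p @rootu R K (phi p) (V p)).
    by rewrite /EE; congr (_ * _); apply: eq_bigr => phi _; exact: prod_rootu_V.
  rewrite (EE_prod (fun p a => @rootu R K a (V p))); apply: eq_bigr => p _.
  by rewrite sum_rootu ?V_small//; case: ifP => _; rewrite ?mulr0 ?mulVf.
have XX : 0 <= 2 * X%:R ^+ q :> R by rewrite mulr_ge0// exprn_ge0.
have [allz|] := pselect (forall p, V p = 0).
  have -> : La = 0.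
    rewrite /La (partition_big (fun k => (s k).1.1) xpredT)//= big1// => p _.
    rewrite (eq_bigr (fun k => (fexp (s k))%:~R * ln (p : nat)%:R)); last by move=> k /eqP ->.
    by rewrite -mulr_suml -(rmorph_sum (intr : int -> R)) -/(V p) allz mul0r.
  rewrite big1 ?mulr1; last by move=> p _; rewrite allz eqxx.
  rewrite (@eq_cint _ _ _ _ (fun=> 1)); last by move=> t _; rewrite oppr0 mulr0 ei0.
  rewrite cint_cst ?mulr1; last by lra.
  have -> : 2 * T - T = T by ring.
  by rewrite subrr normc0.
move=> /existsNP[p /eqP Vp].
rewrite (bigD1 p)//= (negbTE Vp) mul0r mulr0 subr0.
have gap := freq_gap (ex_intro _ p Vp); rewrite -/La in gap.
have X0' : (0 : R) < (X ^ q)%:R by rewrite ltr0n expn_gt0 X0.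
have La0 : 0 < `|La| by apply: lt_le_trans gap; rewrite invr_gt0.
apply: (le_trans (cint_ei T0 _)); first by rewrite oppr_eq0 -normr_gt0.
rewrite normrN ler_pM2l// -natrX -[X in _ <= X]invrK lef_pV2 ?posrE ?invr_gt0//.
Qed.

End OneTerm.

Lemma sum_fcoef : \sum_(i : J * bool | okj i.1) normc (fcoef i) = \sum_(j | @okj X j) normc (w j).
Proof.
rewrite (sum_pair_bool (@okj X)); apply: eq_bigr => j _; rewrite /fcoef /= !normcM normcV nc_nat nc_conj.
by field.
Qed.

Lemma moments_close (T : R) q : 0 < T -> (0 < X)%N -> (q * X.+1 < K)%N ->
  normc (cint T (2 * T) (fun t => ((xt t)%:C)%C ^+ q) -
    (T%:C)%C * EE (fun phi => ((xm phi)%:C)%C ^+ q)) <=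
  2 * X%:R ^+ q * (\sum_(j | @okj X j) normc (w j)) ^+ q.
Proof.
move=> T0 X0 qK.
pose A (s : {ffun 'I_q -> J * bool}) t :=
  \prod_k ei (t * - ((fexp (s k))%:~R * ln ((s k).1.1 : nat)%:R)) : C.
pose B (s : {ffun 'I_q -> J * bool}) phi :=
  \prod_k @rootu R K ((phi : Om) (s k).1.1) (fexp (s k)).
pose Q := [pred i : J * bool | okj i.1].
have cA s : rcnt_on T (2 * T) (A s).
  move=> t _.
  apply: (@cnt_ext _ _ _ (fun t => ei (t * \sum_k - ((fexp (s k))%:~R * ln ((s k).1.1 : nat)%:R)))).
  - by exists 1 => // h _; rewrite mulr_sumr ei_sum.
  - by rewrite mulr_sumr ei_sum.
  - exact: rcnt_ei.
rewrite (@eq_cint _ _ _ _ (fun t => \sum_(s in ffun_on Q) \prod_k fcoef (s k) * A s t)); last first.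
  by move=> t _; rewrite xt_expand (pow_expand Q); apply: eq_bigr => s _; rewrite big_split.
rewrite cint_sum; last by move=> s _ t tT; apply: cntM; [exact: cnt_cst|exact: cA].
have -> : EE (fun phi => ((xm phi)%:C)%C ^+ q) =
    \sum_(s in ffun_on Q) \prod_k fcoef (s k) * EE (B s).
  rewrite /EE (eq_bigr (fun phi => \sum_(s in ffun_on Q) \prod_k fcoef (s k) * B s phi)).
    rewrite exchange_big mulr_sumr; apply: eq_bigr => s _.
    by rewrite -mulr_sumr mulrCA.
  by move=> phi _; rewrite xm_expand (pow_expand Q); apply: eq_bigr => s _; rewrite big_split.
rewrite mulr_sumr -sumrB; apply: (le_trans (nc_sum _ _ _)).
rewrite -sum_fcoef (pow_expand Q) mulr_sumr; apply: ler_sum => s sQ.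
rewrite cintZ; last exact: cA.
rewrite mulrCA -mulrBr normcM nc_prod mulrC ler_wpM2r//.
  by apply: prodr_ge0 => k _; exact: nc_ge0.
by apply: one_term => // k; move/ffun_onP: sQ; apply.
Qed.

End Moments.


(** * Taylor remainders of the exponential *)

Section Taylor.
Variable R : realType.
Local Notation C := (R[i]).
Local Notation mu := (@lebesgue_measure R).

Definition ce_rem n (z : C) : C := ce z - \sum_(k < n) z ^+ k / (k`!)%:R.

Lemma ce_rem_cder n z : cder (ce_rem n.+1) z (ce_rem n z).
Proof.
rewrite /ce_rem; apply: cderD; first exact: cder_ce.
apply: cderN.
have -> : \sum_(k < n) z ^+ k / (k`!)%:R =
    \sum_(k < n.+1) (k%:R * z ^+ k.-1 * (k`!)%:R^-1 + z ^+ k * 0).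
  rewrite [RHS]big_ord_recl /= !mul0r mulr0 addr0 add0r; apply: eq_bigr => k _.
  rewrite /= mulr0 addr0 factS natrM invfM.
  rewrite [_ * z ^+ k]mulrC -mulrA; congr (_ * _).
  by rewrite mulrA mulfV ?mul1r// -nc_eq0 nc_nat pnatr_eq0.
by apply: cder_sum => k _; apply: cderM; [exact: cder_X|exact: cder_cst].
Qed.

Lemma int_pow n (v : R) : 0 < v ->
  \int[mu]_(x in `[0, v]) (x ^+ n / (n`!)%:R) = v ^+ n.+1 / (n.+1`!)%:R.
Proof.
move=> v0.
pose Q m (z : C) : C := z ^+ m * (m`!)%:R^-1.
have dQ z : cder (Q n.+1) z (Q n z).
  have -> : Q n z = n.+1%:R * z ^+ n * (n.+1`!)%:R^-1 + z ^+ n.+1 * 0.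
    rewrite mulr0 addr0 /Q factS natrM invfM [_ * z ^+ n]mulrC -mulrA; congr (_ * _).
    by rewrite mulrA mulfV ?mul1r// -nc_eq0 nc_nat pnatr_eq0.
  by apply: cderM; [exact: cder_X|exact: cder_cst].
have QE m (x : R) : Q m (0 + (x%:C)%C * 1) = ((x ^+ m / (m`!)%:R)%:C)%C.
  by rewrite add0r mulr1 /Q rmorphM fmorphV rmorph_nat rmorphXn.
have dR (x : R) : is_derive x (1 : R) (fun y : R => y ^+ n.+1 / (n.+1`!)%:R) (x ^+ n / (n`!)%:R).
  have := @rder_Re R (fun y => Q n.+1 (0 + (y%:C)%C * 1)) x _
    (cder_rder (dQ _) (rder_affine 0 1 x)).
  rewrite mulr1 QE /=; congr (is_derive _ _ _ _).
  by apply/funext => y; rewrite QE.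
rewrite (@real_FTC R _ (fun y => y ^+ n.+1 / (n.+1`!)%:R))//.
  by rewrite expr0n /= mul0r subr0.
move=> x _; have : rcnt (fun y => ((y ^+ n / (n`!)%:R)%:C)%C) x.
  apply: (@cnt_ext _ _ _ (fun y => Q n (0 + (y%:C)%C * 1))).
  - by exists 1 => // h _; rewrite QE.
  - by rewrite QE.
  - apply: cnt_comp; first exact: rcnt_affine.
    apply: cntM; last exact: cnt_cst.
    by apply: cder_cnt; exact: cder_X.
by move=> /rcnt_Re.
Qed.

(** Each remainder is the integral of the previous one along the ray in direction [k]. On the
    imaginary axis [ce] has modulus 1, so the bound carries no exponential factor and high-order
    expansions of characteristic functions stay usable. *)
Lemma ce_rem_bound n (k : C) (v : R) : complex.Re k = 0 -> normc k = 1 -> 0 <= v ->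
  normc (ce_rem n (0 + (v%:C)%C * k)) <= v ^+ n / (n`!)%:R.
Proof.
move=> k0 k1; elim: n v => [|n IH] v v0.
  by rewrite /ce_rem big_ord0 subr0 nc_ce add0r ReZl k0 mulr0 expR0 expr0 fact0 divr1.
have z0 : ce_rem n.+1 (0 + (0%:C)%C * k) = 0.
  rewrite /ce_rem add0r mul0r ce0 big_ord_recl expr0 fact0 divr1 big1 ?addr0 ?subrr//.
  by move=> i _; rewrite exprS !mul0r.
move: v0; rewrite le_eqVlt => /orP[/eqP <-|v0]; first by rewrite z0 normc0 expr0n /= mul0r.
have rc x : rcnt (fun x => ce_rem n (0 + (x%:C)%C * k) * k) x.
  apply: cntM; last exact: cnt_cst.
  apply: cnt_comp; first exact: rcnt_affine.
  rewrite /ce_rem; apply: cntB; first by apply: cder_cnt; exact: cder_ce.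
  apply: cnt_sum => i _; apply: cntM; last exact: cnt_cst.
  by apply: cder_cnt; exact: cder_X.
have -> : ce_rem n.+1 (0 + (v%:C)%C * k) = cint 0 v (fun x => ce_rem n (0 + (x%:C)%C * k) * k).
  rewrite (@cint_FTC R _ (fun x => ce_rem n.+1 (0 + (x%:C)%C * k)))//; last first.
  - by move=> x _; apply: cder_rder; [exact: ce_rem_cder|exact: rder_affine].
  - exact: ltW.
  by rewrite z0 subr0.
rewrite -int_pow//; apply: nc_cint_le => //.
  apply: continuous_on_integrable => x _.
  have : rcnt (fun y => (((y ^+ n / (n`!)%:R) : R)%:C)%C) x.
    apply: (@cnt_ext _ _ _ (fun y => (0 + (y%:C)%C * 1) ^+ n * (n`!)%:R^-1)).
    - by exists 1 => // h _; rewrite add0r mulr1 rmorphM fmorphV rmorph_nat rmorphXn.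
    - by rewrite add0r mulr1 rmorphM fmorphV rmorph_nat rmorphXn.
    - apply: cntM; last exact: cnt_cst.
      apply: (@cnt_comp _ _ _ (fun y => 0 + (y%:C)%C * 1) _ (fun z => z ^+ n)).
        exact: rcnt_affine.
      by apply: cder_cnt; exact: cder_X.
  by move=> /rcnt_Re.
move=> x /andP[x0 _]; rewrite (normcM (ce_rem n _)) k1 mulr1; exact: IH.
Qed.

Lemma ei_taylor n (v : R) :
  normc (ei v - \sum_(k < n) (0 +i* v)%C ^+ k / (k`!)%:R) <= `|v| ^+ n / (n`!)%:R.
Proof.
pose k : C := if 0 <= v then 'i%C else - 'i%C.
have kE : (0 +i* v)%C = 0 + ((`|v|)%:C)%C * k.
  rewrite /k; case: ifPn => v0; apply/eqP; rewrite eq_complex /=.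
    by rewrite ger0_norm// mulr0 !mul0r mulr1 subr0 !addr0 add0r !eqxx.
  rewrite -ltNge in v0; rewrite ltr0_norm// oppr0 mulr0 !mul0r mulrN1 opprK subr0 !addr0 add0r.
  by rewrite !eqxx.
rewrite /ei kE; apply: ce_rem_bound => //; rewrite /k.
  by case: ifP => _; rewrite /= ?oppr0.
by case: ifP => _; rewrite ?normcN nc_i.
Qed.

Lemma expR_2nd (z : R) : expR z <= 1 + z + 2 * z ^+ 2 * expR `|z|.
Proof.
have [z0|z0] := leP 0 z.
  rewrite ger0_norm//; have h := expR_ge1Dx (- z).
  have : (1 - z) * expR z <= 1.
    apply: (@le_trans _ _ (expR (- z) * expR z)); first by rewrite ler_wpM2r ?expR_ge0.
    by rewrite -expRD addNr expR0.
  have : 0 <= expR z * z ^+ 2 by rewrite mulr_ge0 ?expR_ge0 ?sqr_ge0.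
  rewrite expr2; move: (expR z) => E; move: z0; clear; nra.
have z2 : z <= 2^-1 by apply: (le_trans (ltW z0)); rewrite invr_ge0.
have h := expR_quad z2; have h2 : 2 * z ^+ 2 <= 2 * z ^+ 2 * expR `|z|.
  rewrite ler_peMr//; first by rewrite mulr_ge0// sqr_ge0.
  by rewrite -expR0 ler_expR.
move: (expR z) (2 * z ^+ 2) (2 * z ^+ 2 * expR `|z|) h h2 => u v u' h h2; lra.
Qed.

End Taylor.

(** * The contribution of a single prime *)

Section OnePrime.
Variable R : realType.
Local Notation C := (R[i]).
Variables (K : nat) (x : 'I_K -> R) (B : R).
Hypothesis K0 : (0 < K)%N.

Definition avg (F : 'I_K -> R) : R := K%:R^-1 * \sum_a F a.

Lemma avg_cst c : avg (fun=> c) = c.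
Proof.
rewrite /avg sumr_const card_ord -[c *+ K]mulr_natl mulrA mulVf ?mul1r//.
by rewrite pnatr_eq0 -lt0n.
Qed.

Lemma avgD F G : avg (fun a => F a + G a) = avg F + avg G.
Proof. by rewrite /avg big_split mulrDr. Qed.

Lemma avgZ c F : avg (fun a => c * F a) = c * avg F.
Proof. by rewrite /avg -mulr_sumr mulrCA. Qed.

Lemma le_avg F G : (forall a, F a <= G a) -> avg F <= avg G.
Proof. by move=> FG; rewrite /avg ler_wpM2l ?invr_ge0// ler_sum. Qed.

Hypothesis x0 : avg x = 0.
Hypothesis xB : forall a, `|x a| <= B.

Lemma avg_exp (A y : R) : avg (fun a => x a ^+ 2) <= A ->
  avg (fun a => expR (y * x a)) <= expR (2 * y ^+ 2 * expR (`|y| * B) * A).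
Proof.
move=> xA.
apply: (@le_trans _ _ (avg (fun a => (1 + y * x a) + 2 * y ^+ 2 * expR (`|y| * B) * x a ^+ 2))).
  apply: le_avg => a; apply: (le_trans (expR_2nd _)); rewrite lerD2l.
  have -> : 2 * y ^+ 2 * expR (`|y| * B) * x a ^+ 2 = 2 * (y * x a) ^+ 2 * expR (`|y| * B) by ring.
  rewrite ler_wpM2l//; first by rewrite mulr_ge0// sqr_ge0.
  by rewrite ler_expR normrM ler_wpM2l.
rewrite !avgD !avgZ avg_cst x0 mulr0 addr0; apply: (le_trans (expR_ge1Dx _)).
rewrite ler_expR; apply: ler_wpM2l xA; apply: mulr_ge0 (expR_ge0 _); apply: mulr_ge0 => //.
exact: sqr_ge0.
Qed.

(** Taylor expansion with cubic remainder, [m] being the mean of [x a ^+ 2]: the linear term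
    averages to 0, the quadratic one gives [1 - th^2 m / 2], and the remainder is at most
    [th^2 m / 6] because [|th * x a| <= 1]. Together this is at most [1 - th^2 m / 3]. *)
Lemma avg_ei (A th : R) : `|th| * B <= 1 -> A <= avg (fun a => x a ^+ 2) ->
  normc (K%:R^-1 * \sum_a ei (th * x a)) <= expR (- (th ^+ 2 / 3 * A)).
Proof.
move=> tB xA; set m := avg _ in xA.
have B0 : 0 <= B by have := xB (Ordinal K0); apply: le_trans.
have m0 : 0 <= m by rewrite /m /avg mulr_ge0 ?invr_ge0// sumr_ge0// => a _; exact: sqr_ge0.
have KR : (K%:R : R) != 0 by rewrite pnatr_eq0 -lt0n.
have KC : (K%:R : C) != 0 by rewrite -nc_eq0 nc_nat.
have tx a : `|th * x a| <= 1 by rewrite normrM (le_trans _ tB)// ler_wpM2l.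
have thm : th ^+ 2 * m <= 1.
  rewrite -avgZ -(avg_cst 1); apply: le_avg => a.
  by rewrite -exprMn -(real_normK (num_real _)) expr_le1.
pose P a : C := \sum_(k < 3) (0 +i* (th * x a))%C ^+ k / (k`!)%:R.
have PE a : P a = ((1 - th ^+ 2 / 2 * x a ^+ 2)%:C)%C + (0 +i* (th * x a))%C.
  rewrite /P !big_ord_recl big_ord0 /= /bump /= expr0 expr1 !fact0 factS mul1n !divr1 addr0.
  have e2 : (2^-1 : C) = ((2^-1 : R)%:C)%C by rewrite -(rmorph_nat (real_complex R)) fmorphV.
  rewrite [((1 + 1) `!)%N]/= e2 expr2; apply/eqP; rewrite eq_complex /=.
  by apply/andP; split; apply/eqP; ring.
have PS : K%:R^-1 * \sum_a P a = ((1 - th ^+ 2 / 2 * m)%:C)%C.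
  rewrite (eq_bigr (fun a => ((1 - th ^+ 2 / 2 * x a ^+ 2)%:C)%C + (0 +i* (th * x a))%C)); last first.
    by move=> a _; exact: PE.
  rewrite big_split mulrDr /= -(rmorph_sum (real_complex R)).
  have -> : \sum_a (0 +i* (th * x a))%C = 0 :> C.
    apply/eqP; rewrite eq_complex Re_sum Im_sum /= big1 ?eqxx//= -mulr_sumr.
    have : \sum_a x a = 0.
      by move: x0; rewrite /avg => /eqP; rewrite mulf_eq0 invr_eq0 (negbTE KR) => /eqP.
    by move=> ->; rewrite mulr0.
  rewrite mulr0 addr0 -(rmorph_nat (real_complex R)) -fmorphV -(rmorphM (real_complex R)).
  congr (_%:C)%C; rewrite -/(avg (fun a => 1 - th ^+ 2 / 2 * x a ^+ 2)).
  rewrite (_ : avg _ = avg (fun a => 1 + (- (th ^+ 2 / 2)) * x a ^+ 2)).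
    by rewrite avgD avgZ avg_cst mulNr.
  by rewrite /avg; congr (_ * _); apply: eq_bigr => a _; rewrite mulNr.
have -> : K%:R^-1 * \sum_a ei (th * x a) =
    K%:R^-1 * \sum_a P a + K%:R^-1 * \sum_a (ei (th * x a) - P a).
  by rewrite -mulrDr -big_split /=; congr (_ * _); apply: eq_bigr => a _; rewrite addrC subrK.
apply: (le_trans (le_normcD _ _)); rewrite PS nc_real.
have h1 : normc (K%:R^-1 * \sum_a (ei (th * x a) - P a)) <= th ^+ 2 / 6 * m.
  rewrite normcM normcV nc_nat -avgZ /avg ler_wpM2l ?invr_ge0//.
  apply: (le_trans (nc_sum _ _ _)); apply: ler_sum => a _.
  apply: (le_trans (ei_taylor 3 _)).
  have -> : th ^+ 2 / 6 * x a ^+ 2 = `|th * x a| ^+ 2 / 6.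
    by rewrite real_normK ?num_real//; ring.
  rewrite [(3`!)%N]/= ler_pM2r ?invr_gt0// exprS ler_piMl ?exprn_ge0//.
apply: (le_trans (lerD (lexx _) h1)).
rewrite ger0_norm; last by move: thm; lra.
have -> : 1 - th ^+ 2 / 2 * m + th ^+ 2 / 6 * m = 1 + - (th ^+ 2 / 3 * m) by field.
apply: (le_trans (expR_ge1Dx _)); rewrite ler_expR lerN2 ler_wpM2l//.
by rewrite divr_ge0 ?sqr_ge0.
Qed.

Lemma avg_sq_bounds (u v : 'I_K -> R) (b : R) : (forall a, x a = u a + v a) ->
  (forall a, `|v a| <= b) ->
  avg (fun a => u a ^+ 2) / 2 - b ^+ 2 <= avg (fun a => x a ^+ 2) <=
  2 * avg (fun a => u a ^+ 2) + 2 * b ^+ 2.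
Proof.
move=> xE vb.
have v2 a : v a ^+ 2 <= b ^+ 2.
  by rewrite -(real_normK (num_real (v a))) lerXn2r ?nnegrE// (le_trans _ (vb a)).
apply/andP; split.
  rewrite -(avg_cst (- b ^+ 2)) mulrC -avgZ -avgD; apply: le_avg => a; rewrite xE.
  have := sqr_ge0 (u a + 2 * v a); have := v2 a; clear v2 xE vb; move: (u a) (v a) (b ^+ 2) => {}u {}v b2.
  rewrite !expr2; nra.
rewrite -(avg_cst (2 * b ^+ 2)) -avgZ -avgD; apply: le_avg => a; rewrite xE.
have := sqr_ge0 (u a - v a); have := v2 a; clear v2 xE vb; move: (u a) (v a) (b ^+ 2) => {}u {}v b2.
rewrite !expr2; nra.
Qed.

End OnePrime.


(** * The random model *)

Section Model.
Variable R : realType.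
Local Notation C := (R[i]).
Local Notation mu := (@lebesgue_measure R).
Variables (X K d : nat) (w : 'I_X.+1 * 'I_X.+1 -> C).
Local Notation Om := {ffun 'I_X.+1 -> 'I_K}.

(* [p ^ (-1/2)] *)
Definition qp (p : nat) : R := expR (- (2^-1 * ln p%:R)).

Lemma qp_sq p : (0 < p)%N -> qp p ^+ 2 = p%:R^-1.
Proof.
move=> p0; rewrite /qp -expRM_natl mulrN mulrA mulfV ?mul1r// expRN lnK//.
by rewrite posrE ltr0n.
Qed.

Lemma qp_ge0 p : 0 <= qp p.
Proof. exact: expR_ge0. Qed.

Lemma qp_le p : (1 < p)%N -> qp p <= 3/4.
Proof.
move=> p1; have q34 : (0 : R) <= 3/4 by lra.
rewrite -(ler_pXn2r (ltn0Sn 1)) ?nnegrE ?qp_ge0//.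
rewrite qp_sq ?(ltnW p1)//; apply: (@le_trans _ _ (2^-1)); last by rewrite expr2; lra.
by rewrite lef_pV2 ?posrE ?ltr0n ?(ltnW p1)// ler_nat.
Qed.

Lemma qp_sum p (P : pred 'I_X.+1) m : (1 < p)%N -> (forall k, P k -> (m <= k)%N) ->
  \sum_(k | P k) qp p ^+ k.+1 <= 4 * qp p ^+ m.+1.
Proof.
move=> p1 Pm; have q0 := qp_ge0 p; have q1 := qp_le p1.
apply: (@le_trans _ _ (\sum_(m <= k < X.+1) qp p ^+ k.+1)).
  rewrite big_geq_mkord /= big_mkcond [X in _ <= X]big_mkcond; apply: ler_sum => k _.
  case: ifP => [/Pm -> //|_]; case: ifP => // _; exact: exprn_ge0.
under eq_bigr do rewrite exprS.
rewrite -mulr_sumr exprS mulrCA ler_wpM2l//.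
have h : 0 <= qp p < 1 by lra.
apply: (le_trans (geo_sum_le _ _ h)); rewrite ler_pdivrMr; last by lra.
rewrite mulrC mulrA ler_peMl ?exprn_ge0//; lra.
Qed.

Definition zp (p : 'I_X.+1) (a : 'I_K) : C :=
  \sum_(k | okj (p, k)) w (p, k) * @rootu R K a (k.+1)%:Z.

Definition xp (p : 'I_X.+1) (a : 'I_K) : R := complex.Re (zp p a).

Lemma xm_sum (phi : Om) : xm w phi = \sum_p xp p (phi p).
Proof.
rewrite /xm /xp -Re_sum /zp; congr (complex.Re _).
rewrite (pair_big_dep xpredT (fun p k => okj (p, k))
  (fun p k => w (p, k) * @rootu R K (phi p) (k.+1)%:Z)) /=.
by rewrite (eq_bigl (fun j => okj (j.1, j.2))); [apply: eq_bigr|]; case.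
Qed.

Hypothesis K2 : (X.+2 < K)%N.
Hypothesis wd : forall p k, okj (p, k) -> normc (w (p, k)) <= d%:R * qp p ^+ k.+1.

Let K0 : (0 < K)%N. Proof. exact: leq_ltn_trans K2. Qed.

Lemma zp_nonprime (p : 'I_X.+1) a : ~~ prime p -> zp p a = 0.
Proof. by move=> np; rewrite /zp big_pred0// => k; rewrite /okj /= (negbTE np). Qed.

Lemma sum_Re_rootu (c : C) (v : int) : (0 < `|v| < K)%N ->
  \sum_(a < K) complex.Re (c * @rootu R K a v) = 0.
Proof.
move=> /andP[v0 vK]; rewrite -Re_sum -mulr_sumr sum_rootu//.
by rewrite -absz_eq0 eqn0Ngt v0 mulr0.
Qed.

Lemma avg_xp p : avg (xp p) = 0.
Proof.
rewrite /avg /xp; under eq_bigr do rewrite /zp Re_sum.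
rewrite exchange_big big1 ?mulr0// => k _; apply: sum_Re_rootu => /=.
by apply: leq_ltn_trans K2; rewrite ltnS ltnW.
Qed.

Lemma zp_bound (p : 'I_X.+1) (a : 'I_K) (P : pred 'I_X.+1) m : prime p -> (forall k, P k -> okj (p, k) && (m <= k)%N) ->
  normc (\sum_(k | P k) w (p, k) * @rootu R K a (k.+1)%:Z) <= 4 * d%:R * qp p ^+ m.+1.
Proof.
move=> pp Pm; apply: (le_trans (nc_sum _ _ _)).
apply: (@le_trans _ _ (\sum_(k | P k) d%:R * qp p ^+ k.+1)).
  by apply: ler_sum => k /Pm/andP[ok _]; rewrite normcM nc_rootu mulr1 wd.
rewrite -mulr_sumr -mulrA mulrCA ler_wpM2l//; apply: qp_sum; first exact: prime_gt1.
by move=> k /Pm/andP[].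
Qed.

Lemma xp_bound (p : 'I_X.+1) a : prime p -> `|xp p a| <= 4 * d%:R * qp p.
Proof.
move=> pp; apply: (le_trans (Re_le_nc _)).
by have := @zp_bound p a (fun k => okj (p, k)) 0 pp; rewrite expr1; apply => k ->.
Qed.

Lemma Re_sq (z : C) : complex.Re z ^+ 2 = 2^-1 * (normc z ^+ 2 + complex.Re (z * z)).
Proof. by rewrite nc_sqr cReM; field. Qed.

(** The first power of [p] has mean square [|w|^2 / 2] by orthogonality, and the higher powers
    together are at most [4 d / p]. The constant factors lost here are harmless, since only the
    order of growth of the sum over [p] is used. *)
Lemma xp_sq (p : 'I_X.+1) : prime p ->
  normc (w (p, ord0)) ^+ 2 / 4 - 16 * d%:R ^+ 2 / p%:R ^+ 2 <= avg (fun a => xp p a ^+ 2) <=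
  normc (w (p, ord0)) ^+ 2 + 32 * d%:R ^+ 2 / p%:R ^+ 2.
Proof.
move=> pp; have p0 := prime_gt0 pp.
have ok0 : okj (p, ord0 : 'I_X.+1).
  by rewrite /okj /= pp /= expn1 -ltnS ltn_ord.
pose u (a : 'I_K) := complex.Re (w (p, ord0) * @rootu R K a 1).
pose v (a : 'I_K) := complex.Re (\sum_(k | okj (p, k) && (k != ord0)) w (p, k) * @rootu R K a (k.+1)%:Z).
have xE a : xp p a = u a + v a by rewrite /xp /zp (bigD1 (ord0 : 'I_X.+1) ok0) /= ReD.
have vb a : `|v a| <= 4 * d%:R * qp p ^+ 2.
  apply: (le_trans (Re_le_nc _)); apply: zp_bound => // k /andP[-> k0] /=.
  by rewrite lt0n.
have au : avg (fun a => u a ^+ 2) = normc (w (p, ord0)) ^+ 2 / 2.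
  have uE a : u a ^+ 2 = 2^-1 * normc (w (p, ord0)) ^+ 2 +
      2^-1 * complex.Re (w (p, ord0) ^+ 2 * @rootu R K a 2).
    rewrite /u Re_sq -mulrDr normcM nc_rootu mulr1; congr (_ * (_ + complex.Re _)).
    by rewrite mulrACA -rootuD.
  rewrite /avg (eq_bigr _ (fun a _ => uE a)) big_split mulrDr /=.
  rewrite -[X in X + _]/(avg (fun=> _)) avg_cst// -mulr_sumr sum_Re_rootu ?mulr0 ?addr0 1?mulrC//.
  by apply: leq_ltn_trans K2.
have bE : (4 * d%:R * qp p ^+ 2) ^+ 2 = 16 * d%:R ^+ 2 / p%:R ^+ 2 :> R.
  rewrite qp_sq//; move: (p%:R : R) => P; rewrite !exprMn exprVn; congr (_ * _ * _); by ring.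
have /andP[h1 h2] := avg_sq_bounds K0 xE vb.
rewrite au bE in h1 h2; apply/andP; split.
  by move: h1; move: (avg _) (16 * _ / _) => A b; lra.
move: h2; have -> : 32 * d%:R ^+ 2 / p%:R ^+ 2 = 2 * (16 * d%:R ^+ 2 / p%:R ^+ 2) :> R by ring.
by move: (avg _) (16 * _ / _) => A b; lra.
Qed.

Definition ER (F : Om -> R) : R := (K%:R ^+ X.+1)^-1 * \sum_phi F phi.

Lemma ER_prod (F : 'I_X.+1 -> 'I_K -> R) :
  ER (fun phi => \prod_p F p (phi p)) = \prod_p avg (F p).
Proof. by rewrite /ER -bigA_distr_bigA big_split /= prodr_const card_ord exprVn. Qed.

Lemma le_ER F G : (forall phi, F phi <= G phi) -> ER F <= ER G.
Proof. by move=> FG; rewrite /ER ler_wpM2l ?invr_ge0 ?exprn_ge0// ler_sum. Qed.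

Lemma ER_EE F : ((ER F)%:C)%C = EE (fun phi => ((F phi)%:C)%C).
Proof.
rewrite /ER /EE rmorphM fmorphV rmorphXn rmorph_nat; congr (_ * _).
exact: (rmorph_sum (real_complex R)).
Qed.

Lemma nc_EE F G : (forall phi, normc (F phi) <= G phi) -> normc (EE F) <= ER G.
Proof.
move=> FG; rewrite /EE /ER normcM normcV nc_X nc_nat ler_wpM2l ?invr_ge0 ?exprn_ge0//.
by apply: (le_trans (nc_sum _ _ _)); exact: ler_sum.
Qed.

Lemma model_exp (y : R) : ER (fun phi => expR (y * xm w phi)) <=
  expR (\sum_(p < X.+1 | prime p) 2 * y ^+ 2 * expR (`|y| * (4 * d%:R)) *
    (normc (w (p, ord0)) ^+ 2 + 32 * d%:R ^+ 2 / p%:R ^+ 2)).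
Proof.
have -> : ER (fun phi => expR (y * xm w phi)) = ER (fun phi => \prod_p expR (y * xp p (phi p))).
  by rewrite /ER; congr (_ * _); apply: eq_bigr => phi _; rewrite xm_sum mulr_sumr expR_sum.
rewrite (ER_prod (fun p a => expR (y * xp p a))) expR_sum [X in _ <= X]big_mkcond; apply: ler_prod => p _.
apply/andP; split.
  by rewrite /avg mulr_ge0 ?invr_ge0// sumr_ge0// => a _; exact: expR_ge0.
have [pp|np] := boolP (prime p).
  apply: avg_exp => //; first exact: avg_xp.
    move=> a; apply: (le_trans (xp_bound _ pp)); rewrite ler_piMr ?mulr_ge0//.
    by have := qp_le (prime_gt1 pp); lra.
  by have /andP[] := xp_sq pp.
rewrite -[X in _ <= X](avg_cst K0 1); apply: le_avg => a.
by rewrite /xp zp_nonprime// mulr0 expR0.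
Qed.

(** Independence factors the characteristic function over the primes. Those below [P0], where
    [th * xp] may be too large for [avg_ei], are estimated by 1. *)
Lemma model_char (th : R) (P0 : nat) :
  (forall p, prime p -> (P0 <= p)%N -> `|th| * (4 * d%:R * qp p) <= 1) ->
  normc (EE (fun phi : Om => ei (th * xm w phi))) <=
  expR (- \sum_(p < X.+1 | prime p && (P0 <= p)%N)
    th ^+ 2 / 3 * (normc (w (p, ord0)) ^+ 2 / 4 - 16 * d%:R ^+ 2 / p%:R ^+ 2)).
Proof.
move=> thP.
have -> : EE (fun phi : Om => ei (th * xm w phi)) = EE (fun phi => \prod_p ei (th * xp p (phi p))).
  by rewrite /EE; congr (_ * _); apply: eq_bigr => phi _; rewrite xm_sum mulr_sumr ei_sum.
rewrite (EE_prod (fun p a => ei (th * xp p a))) nc_prod -sumrN expR_sum.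
rewrite [X in _ <= X]big_mkcond; apply: ler_prod => p _; rewrite nc_ge0 /=.
case: ifPn => [/andP[pp Pp]|_].
  apply: (@avg_ei _ _ _ (4 * d%:R * qp p)) => //.
  - exact: avg_xp.
  - by move=> a; exact: xp_bound.
  - exact: thP.
  - by have /andP[] := xp_sq pp.
rewrite normcM normcV nc_nat; apply: (@le_trans _ _ (avg (fun a : 'I_K => 1))); last by rewrite avg_cst.
rewrite /avg ler_wpM2l ?invr_ge0//; apply: (le_trans (nc_sum _ _ _)).
by apply: ler_sum => a _; rewrite nc_ei.
Qed.

Lemma rcnt_xt t : rcnt (fun t => ((xt w t)%:C)%C) t.
Proof.
apply: (@cnt_ext _ _ _ (fun t => \sum_(i : _ * bool | okj i.1)
   fcoef w i * ei (t * - ((fexp i)%:~R * ln (i.1.1 : nat)%:R)))).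
- by exists 1 => // h _; rewrite xt_expand.
- by rewrite xt_expand.
- by apply: cnt_sum => i _; apply: cntM; [exact: cnt_cst|exact: rcnt_ei].
Qed.

Lemma rcnt_ei_xt th t : rcnt (fun t => ei (th * xt w t)) t.
Proof.
have e s : (0 +i* (th * xt w s))%C = (0 +i* th)%C * ((xt w s)%:C)%C.
  by apply/eqP; rewrite eq_complex /= !mul0r mulr0 subr0 add0r !eqxx.
apply: (@cnt_ext _ _ _ (fun t => ce ((0 +i* th)%C * ((xt w t)%:C)%C))).
- by exists 1 => // h _; rewrite -e.
- by rewrite -e.
- apply: (@cnt_comp _ _ _ (fun t => (0 +i* th)%C * ((xt w t)%:C)%C) _ (@ce R)).
    by apply: cntM; [exact: cnt_cst|exact: rcnt_xt].
  by apply: cder_cnt; exact: cder_ce.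
Qed.

(** Both characteristic functions are replaced by Taylor polynomials with remainder of order
    [2 * N]. That order is even, so the remainder is bounded by a moment without absolute values,
    and the moment over [t] is itself transferred to the model. In all [2 * N + 1] moments are
    compared, whence the factor of the last term. *)
Lemma charfun_bound (T th S : R) (N : nat) : 0 < T -> (0 < X)%N -> 1 <= S ->
  \sum_(j | @okj X j) normc (w j) <= S -> ((2 * N) * X.+1 < K)%N ->
  normc (cint T (2 * T) (fun t => ei (th * xt w t))) <=
  T * normc (EE (fun phi : Om => ei (th * xm w phi))) +
  2 * T * (`|th| ^+ (2 * N) / ((2 * N)`!)%:R * ER (fun phi => xm w phi ^+ (2 * N))) +
  ((2 * N).+1)%:R * (2 * ((1 + `|th|) * X%:R * S) ^+ (2 * N)).
Proof.
move=> T0 X0 S1 wS NK; have K0' := K0; move: (2 * N)%N (oddM 2 N) NK => M evM NK.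
have {}evM : ~~ odd M by rewrite evM.
have evpos (x : R) : `|x| ^+ M = x ^+ M.
  by rewrite -normrX ger0_norm// exprn_even_ge0.
have X1 : (1 : R) <= X%:R by rewrite ler1n.
have XS : 1 <= X%:R * S by rewrite mulr_ege1.
have [EX EXE] : exists EX, ER (fun phi => xm w phi ^+ M) = EX by eexists.
pose c k : C := (0 +i* th)%C ^+ k / (k`!)%:R.
have nck k : normc (c k) = `|th| ^+ k / (k`!)%:R.
  rewrite /c normcM normcV nc_X nc_nat; congr (_ ^+ _ / _).
  by rewrite /= expr0n add0r sqrtr_sqr.
have cE (x : R) k : (0 +i* (th * x))%C ^+ k / (k`!)%:R = c k * ((x%:C)%C ^+ k) :> C.
  have -> : (0 +i* (th * x))%C = (0 +i* th)%C * (x%:C)%C :> C.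
    by apply/eqP; rewrite eq_complex /= !mul0r mulr0 subr0 add0r !eqxx.
  by rewrite exprMn /c mulrAC.
have tay (x : R) : normc (ei (th * x) - \sum_(k < M) c k * ((x%:C)%C ^+ k)) <= `|th| ^+ M / (M`!)%:R * x ^+ M.
  have := ei_taylor M (th * x); rewrite normrM exprMn (evpos x) mulrAC.
  by rewrite (eq_bigr (fun k : 'I_M => c k * ((x%:C)%C ^+ k)))// => k _; exact: cE.
have rcP k t : rcnt (fun t => ((xt w t)%:C)%C ^+ k) t.
  apply: (@cnt_comp _ _ _ (fun t => ((xt w t)%:C)%C) _ (fun z => z ^+ k)); first exact: rcnt_xt.
  by apply: cder_cnt; exact: cder_X.
have rcS t : rcnt (fun t => \sum_(k < M) c k * ((xt w t)%:C)%C ^+ k) t.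
  by apply: cnt_sum => k _; apply: cntM; [exact: cnt_cst|exact: rcP].
pose eps k := cint T (2 * T) (fun t => ((xt w t)%:C)%C ^+ k) -
    (T%:C)%C * EE (fun phi : Om => ((xm w phi)%:C)%C ^+ k).
have epsb k : (k <= M)%N -> normc (eps k) <= 2 * (X%:R * S) ^+ M.
  move=> kM; apply: (le_trans (moments_close w T0 X0 _)).
    by apply: leq_ltn_trans NK; rewrite leq_mul2r kM orbT.
  rewrite -mulrA ler_pM2l// -exprMn; apply: (@le_trans _ _ ((X%:R * S) ^+ k)).
    rewrite lerXn2r ?nnegrE ?mulr_ge0 ?sumr_ge0//; [|by apply: le_trans S1|by rewrite ler_wpM2l].
    by move=> j _; exact: nc_ge0.
  by rewrite ler_weXn2l.
have xEC : (fun phi : Om => ((xm w phi)%:C)%C ^+ M) = (fun phi => ((xm w phi ^+ M)%:C)%C).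
  by apply/funext => phi; rewrite rmorphXn.
have intM : \int[mu]_(t in `[T, (2 * T)]) (`|th| ^+ M / (M`!)%:R * xt w t ^+ M) <=
    `|th| ^+ M / (M`!)%:R * (T * EX + 2 * (X%:R * S) ^+ M).
  have -> : \int[mu]_(t in `[T, (2 * T)]) (`|th| ^+ M / (M`!)%:R * xt w t ^+ M) =
      complex.Re (cint T (2 * T) (fun t => ((`|th| ^+ M / (M`!)%:R)%:C)%C * ((xt w t)%:C)%C ^+ M)).
    rewrite /cint /=; congr (Rintegral _ _ _); apply/funext => t.
    by rewrite -(rmorphXn (real_complex R)) -(rmorphM (real_complex R)).
  rewrite cintZ; last by move=> t _; exact: rcP.
  rewrite ReZl ler_wpM2l ?divr_ge0 ?exprn_ge0//.
  have -> : cint T (2 * T) (fun t => ((xt w t)%:C)%C ^+ M) = eps M + ((T * EX)%:C)%C.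
    by rewrite /eps xEC -ER_EE EXE -(rmorphM (real_complex R)) subrK.
  rewrite ReD /= addrC lerD2l; apply: (le_trans (ler_norm _)).
  by apply: (le_trans (Re_le_nc _)); exact: epsb.
have h1 : normc (cint T (2 * T) (fun t => ei (th * xt w t) - \sum_(k < M) c k * ((xt w t)%:C)%C ^+ k)) <=
    `|th| ^+ M / (M`!)%:R * (T * EX + 2 * (X%:R * S) ^+ M).
  apply: le_trans intM; apply: nc_cint_le.
  - by move=> t _; apply: cntB; [exact: rcnt_ei_xt|exact: rcS].
  - apply: continuous_on_integrable => t _.
    have : rcnt (fun t => ((`|th| ^+ M / (M`!)%:R * xt w t ^+ M)%:C)%C) t.
      apply: (@cnt_ext _ _ _ (fun t => ((`|th| ^+ M / (M`!)%:R)%:C)%C * ((xt w t)%:C)%C ^+ M)).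
      - by exists 1 => // h _; rewrite -(rmorphXn (real_complex R)) -(rmorphM (real_complex R)).
      - by rewrite -(rmorphXn (real_complex R)) -(rmorphM (real_complex R)).
      - by apply: cntM; [exact: cnt_cst|exact: rcP].
    by move=> /rcnt_Re.
  - by move=> t _; exact: tay.
have h2 : cint T (2 * T) (fun t => \sum_(k < M) c k * ((xt w t)%:C)%C ^+ k) =
    (T%:C)%C * EE (fun phi : Om => \sum_(k < M) c k * ((xm w phi)%:C)%C ^+ k) +
    \sum_(k < M) c k * eps k.
  rewrite cint_sum; last by move=> k _ t _; apply: cntM; [exact: cnt_cst|exact: rcP].
  have -> : EE (fun phi : Om => \sum_(k < M) c k * ((xm w phi)%:C)%C ^+ k) =
      \sum_(k < M) c k * EE (fun phi : Om => ((xm w phi)%:C)%C ^+ k).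
    rewrite /EE exchange_big mulr_sumr; apply: eq_bigr => k _.
    by rewrite -mulr_sumr mulrCA.
  rewrite mulr_sumr -big_split; apply: eq_bigr => k _.
  rewrite cintZ; last by move=> t _; exact: rcP.
  by rewrite /eps /=; ring.
have h3 : normc (EE (fun phi : Om => \sum_(k < M) c k * ((xm w phi)%:C)%C ^+ k)) <=
    normc (EE (fun phi : Om => ei (th * xm w phi))) + `|th| ^+ M / (M`!)%:R * EX.
  have -> : EE (fun phi : Om => \sum_(k < M) c k * ((xm w phi)%:C)%C ^+ k) =
     EE (fun phi : Om => ei (th * xm w phi)) -
     EE (fun phi : Om => ei (th * xm w phi) - \sum_(k < M) c k * ((xm w phi)%:C)%C ^+ k).
    by rewrite /EE -mulrBr sumrB; congr (_ * _); ring.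
  apply: (le_trans (ncB _ _)); rewrite lerD2l -EXE.
  have -> : `|th| ^+ M / (M`!)%:R * ER (fun phi => xm w phi ^+ M) =
      ER (fun phi => `|th| ^+ M / (M`!)%:R * xm w phi ^+ M).
    by rewrite /ER -mulr_sumr mulrCA.
  by apply: nc_EE => phi; exact: tay.
have th1 : 1 <= 1 + `|th| by rewrite lerDl.
have ck k : (k <= M)%N -> `|th| ^+ k / (k`!)%:R <= (1 + `|th|) ^+ M.
  move=> kM; apply: (@le_trans _ _ (`|th| ^+ k)).
    by rewrite ler_pdivrMr ?ltr0n ?fact_gt0// ler_peMr ?exprn_ge0// ler1n fact_gt0.
  apply: (@le_trans _ _ ((1 + `|th|) ^+ k)); last by rewrite ler_weXn2l.
  by rewrite lerXn2r ?nnegrE// ?lerDr//; apply: le_trans th1.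
have XM0 : 0 <= 2 * (X%:R * S) ^+ M by rewrite mulr_ge0// exprn_ge0//; apply: le_trans XS.
have h4 : normc (\sum_(k < M) c k * eps k) <= M%:R * ((1 + `|th|) ^+ M * (2 * (X%:R * S) ^+ M)).
  apply: (le_trans (nc_sum _ _ _)).
  have -> : M%:R * ((1 + `|th|) ^+ M * (2 * (X%:R * S) ^+ M)) =
     \sum_(k < M) (1 + `|th|) ^+ M * (2 * (X%:R * S) ^+ M).
    by rewrite sumr_const card_ord mulr_natl.
  apply: ler_sum => k _; rewrite normcM nck; have kM := ltnW (ltn_ord k).
  by apply: ler_pM; rewrite ?nc_ge0 ?divr_ge0 ?exprn_ge0 ?ck ?epsb.
have -> : cint T (2 * T) (fun t => ei (th * xt w t)) =
   cint T (2 * T) (fun t => ei (th * xt w t) - \sum_(k < M) c k * ((xt w t)%:C)%C ^+ k) +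
   cint T (2 * T) (fun t => \sum_(k < M) c k * ((xt w t)%:C)%C ^+ k).
  rewrite cintB; [by rewrite subrK|by move=> t _; exact: rcnt_ei_xt|by move=> t _; exact: rcS].
apply: (le_trans (le_normcD _ _)); rewrite h2.
apply: (le_trans (lerD h1 (le_normcD _ _))).
rewrite (normcM (T%:C)%C) nc_real (gtr0_norm T0).
have h5 := ler_wpM2l (ltW T0) h3.
apply: (le_trans (lerD (lexx _) (lerD h5 h4))).
have h6 : `|th| ^+ M / (M`!)%:R * (2 * (X%:R * S) ^+ M) <= (1 + `|th|) ^+ M * (2 * (X%:R * S) ^+ M).
  by rewrite ler_wpM2r// ck.
have -> : 2 * ((1 + `|th|) * X%:R * S) ^+ M = (1 + `|th|) ^+ M * (2 * (X%:R * S) ^+ M).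
  by rewrite -mulrA exprMn mulrCA.
have -> : (M.+1%:R : R) = M%:R + 1 by rewrite natr1.
rewrite EXE.
have fin (A D F G H E U : R) : A * F <= D ->
    A * (U * E + F) + (U * (G + A * E) + H * D) <= U * G + 2 * U * (A * E) + (H + 1) * D.
  by move=> h; have := h; move: h; clear; lra.
exact: fin.
Qed.

(** A single term of the exponential series: [v^(2 N) / (2 N)!] is at most [expR |v|], hence at most
    [expR v + expR (- v)]. Taking [y] larger than the frequency of the characteristic function turns
    a bound on the Laplace transform into a geometric gain in [N]. *)
Lemma moment_exp (y : R) (N : nat) : 0 < y -> (0 < N)%N ->
  y ^+ (2 * N) / ((2 * N)`!)%:R * ER (fun phi => xm w phi ^+ (2 * N)) <=
  ER (fun phi => expR (y * xm w phi)) + ER (fun phi => expR (- y * xm w phi)).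
Proof.
move=> y0 N0.
have -> : ER (fun phi => expR (y * xm w phi)) + ER (fun phi => expR (- y * xm w phi)) =
   ER (fun phi => expR (y * xm w phi) + expR (- y * xm w phi)).
  by rewrite /ER big_split mulrDr.
have -> : y ^+ (2 * N) / ((2 * N)`!)%:R * ER (fun phi => xm w phi ^+ (2 * N)) =
   ER (fun phi => y ^+ (2 * N) / ((2 * N)`!)%:R * xm w phi ^+ (2 * N)).
  by rewrite /ER -mulr_sumr mulrCA.
apply: le_ER => phi; rewrite mulrAC -exprMn mulNr; move: (y * _) => v.
have M0 : (0 < 2 * N)%N by rewrite muln_gt0.
have -> : v ^+ (2 * N) = `|v| ^+ (2 * N) by rewrite !exprM real_normK ?num_real.
apply: (@le_trans _ _ (expR `|v|)).
  move: M0; case: (2 * N)%N => // M _.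
  by apply: le_trans (expR_ge1Dxn M (normr_ge0 v)); rewrite lerDr.
have [v0|v0] := leP 0 v; first by rewrite ger0_norm// lerDl expR_ge0.
by rewrite ltr0_norm// lerDr expR_ge0.
Qed.

End Model.


(** * Dirichlet coefficients at primes *)

Section Coefficients.
Variable R : realType.
Local Notation C := (R[i]).

(* [n ^ (- s)] for real [s]. *)
Definition rs (n : nat) (s : R) : R := expR (- (s * ln n%:R)).

Lemma ps_rs n (s : R) : ps n (s%:C)%C = ((rs n s)%:C)%C.
Proof. by rewrite -ce_real /ps; congr ce; apply/eqP; rewrite eq_complex /=; apply/andP; split; apply/eqP; ring. Qed.

Lemma rs_ge0 n s : 0 <= rs n s.
Proof. exact: expR_ge0. Qed.

Lemma rs_gt0 n s : 0 < rs n s.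
Proof. exact: expR_gt0. Qed.

Lemma rsD n s s' : rs n (s + s') = rs n s * rs n s'.
Proof. by rewrite /rs -expRD; congr expR; ring. Qed.

Lemma rs2 n : (0 < n)%N -> rs n 2 = (n%:R ^+ 2)^-1.
Proof. by move=> n0; rewrite /rs expRN mulr_natl -lnXn ?ltr0n// lnK// posrE exprn_gt0// ltr0n. Qed.

Lemma rs_le m n s : 0 <= s -> (0 < m <= n)%N -> rs n s <= rs m s.
Proof.
move=> s0 /andP[m0 mn]; rewrite /rs ler_expR lerN2 ler_wpM2l//.
by rewrite ler_ln ?posrE ?ltr0n ?(leq_trans m0)// ler_nat.
Qed.

Lemma rs_le1 n s : 0 <= s -> (0 < n)%N -> rs n s <= 1.
Proof. by move=> s0 n0; rewrite /rs expR_le1 oppr_le0 mulr_ge0// ln_ge0// ler1n. Qed.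

Lemma rsM m n s : (0 < m)%N -> (0 < n)%N -> rs (m * n) s = rs m s * rs n s.
Proof.
by move=> m0 n0; rewrite /rs natrM lnM ?posrE ?ltr0n// -expRD; congr expR; ring.
Qed.

(* [F] agrees with the Dirichlet polynomial with coefficients [b] up to [O((p+1)^-s)]. *)
Definition dap (p : nat) (F : R -> C) (b : nat -> C) := exists K : R, forall s : R, 4 <= s ->
  normc (F s - \sum_(1 <= n < p.+1) b n * ((rs n s)%:C)%C) <= K * rs p.+1 s.

(** As the real [s] grows, the first nonzero term [c n * n^(-s)] would dominate everything from
    [n + 1] on by the factor [(1 + 1 / n)^s]. *)
Lemma dap_zero p (c : nat -> C) (K : R) :
  (forall s : R, 4 <= s -> normc (\sum_(1 <= n < p.+1) c n * ((rs n s)%:C)%C) <= K * rs p.+1 s) ->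
  forall n, (0 < n <= p)%N -> c n = 0.
Proof.
move=> H n; elim/ltn_ind: n => n IH /andP[n0 np].
pose K' := `|K| + \sum_(1 <= m < p.+1) normc (c m).
have K'0 : 0 <= K' by rewrite addr_ge0// sumr_ge0// => m _; exact: nc_ge0.
pose D : R := ln (n.+1%:R / n%:R).
have D0 : 0 < D.
  have /andP[h _] := @ln_succ R n n0; apply: lt_le_trans h.
  by rewrite invr_gt0.
have key (s : R) : 4 <= s -> normc (c n) <= K' * expR (- (s * D)).
  move=> s4; have s0 : 0 <= s by lra.
  have rn : rs n.+1 s = rs n s * expR (- (s * D)).
    by rewrite /rs -expRD /D ln_div ?posrE ?ltr0n//; congr expR; ring.
  rewrite -(ler_pM2l (rs_gt0 n s)) mulrCA -rn.
  have h := H s s4.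
  rewrite (@big_cat_nat _ _ _ n) ?(leq_trans np)//= in h.
  rewrite big_nat_cond big1 in h; last first.
    by move=> m /andP[/andP[m1 mn] _]; rewrite IH ?mul0r// m1 ltnW// (leq_trans mn).
  rewrite add0r big_ltn ?ltnS// in h.
  set S := \sum_(_ <= _ < _) _ in h.
  have Sb : normc S <= (\sum_(1 <= m < p.+1) normc (c m)) * rs n.+1 s.
    apply: (le_trans (nc_sum _ _ _)); rewrite mulr_suml.
    rewrite [X in _ <= X](@big_cat_nat _ _ _ n.+1)//= ?ltnS// ?(ltnW (leqW np)) 1?ltnW//.
    apply: (@le_trans _ _ (\sum_(n.+1 <= m < p.+1) normc (c m) * rs n.+1 s)).
      rewrite big_nat_cond [X in _ <= X]big_nat_cond; apply: ler_sum => m /andP[/andP[nm _] _].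
      by rewrite normcM nc_real ger0_norm ?rs_ge0// ler_wpM2l ?nc_ge0// rs_le.
    by rewrite lerDr sumr_ge0// => m _; rewrite mulr_ge0 ?nc_ge0 ?rs_ge0.
  have Kb : K * rs p.+1 s <= `|K| * rs n.+1 s.
    apply: (@le_trans _ _ (`|K| * rs p.+1 s)); first by rewrite ler_wpM2r ?rs_ge0// ler_norm.
    by rewrite ler_wpM2l// rs_le.
  have := nc_ler_add (c n * ((rs n s)%:C)%C) S; have e : normc (c n * ((rs n s)%:C)%C) = rs n s * normc (c n).
    by rewrite normcM nc_real ger0_norm ?rs_ge0// mulrC.
  rewrite e /K' mulrDl => h2; move: (rs n s * normc (c n)) (normc S) Sb Kb h h2.
  by move=> u v; move: (normc _) (K * _) (`|K| * _) ((\sum_(_ <= _ < _) _) * _) => *; lra.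
apply/eqP; rewrite -nc_eq0 eq_le nc_ge0 andbT; apply: le_eps => e e0; rewrite add0r.
pose s := Num.max 4 (K' / (D * e)).
have s4 : 4 <= s by rewrite le_max lexx.
apply: (le_trans (key s s4)); rewrite expRN ler_pdivrMr ?expR_gt0//.
have h : K' <= s * D * e.
  by rewrite -mulrA -ler_pdivrMr ?mulr_gt0// le_max lexx orbT.
apply: (le_trans h); rewrite mulrC ler_wpM2l ?(ltW e0)//.
by apply: le_trans (expR_ge1Dx _); rewrite lerDr.
Qed.

Lemma dap_uniq p F b b' : dap p F b -> dap p F b' -> forall n, (0 < n <= p)%N -> b n = b' n.
Proof.
move=> [K H] [K' H'] n np; apply/eqP; rewrite -subr_eq0; apply/eqP.
apply: (@dap_zero p (fun n => b n - b' n) (K' + K)) np => s s4.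
have -> : \sum_(1 <= n < p.+1) (b n - b' n) * ((rs n s)%:C)%C =
   (F s - \sum_(1 <= n < p.+1) b' n * ((rs n s)%:C)%C) - (F s - \sum_(1 <= n < p.+1) b n * ((rs n s)%:C)%C).
  under eq_bigr do rewrite mulrBl.
  by rewrite sumrB; ring.
by apply: (le_trans (ncB _ _)); rewrite mulrDl lerD ?H ?H'.
Qed.

Lemma multiples_sum (V : zmodType) p q (G : nat -> V) : (0 < q)%N ->
  \sum_(1 <= m < p.+1 | (q %| m)%N) G m = \sum_(1 <= n < p.+1 | (q * n <= p)%N) G (q * n)%N.
Proof.
move=> q0.
transitivity (\sum_(1 <= m < p.+1) \sum_(1 <= n < p.+1 | m == (q * n)%N) G m).
  rewrite big_mkcond /= big_nat_cond [RHS]big_nat_cond; apply: eq_bigr => m /andP[/andP[m1 mp] _].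
  case: ifP => [/dvdnP[k mk]|qm]; last first.
    by rewrite big1// => n /eqP e; move: qm; rewrite e dvdn_mulr.
  rewrite (eq_bigl (fun n => n == k)).
    rewrite big_nat1_eq; case: ifP => // /negbT; rewrite negb_and -leqNgt -ltnNge => /orP[|].
      by rewrite leqn0 => /eqP k0; move: m1; rewrite mk k0.
    by rewrite ltnS => /(leq_trans (_ : m < p.+1)%N); rewrite mk; nia.
  by move=> n; rewrite mk mulnC eqn_pmul2l// eq_sym.
rewrite (exchange_big_dep_nat xpredT)//= big_mkcond [RHS]big_mkcond /=.
rewrite big_nat_cond [RHS]big_nat_cond; apply: eq_bigr => n /andP[/andP[n1 np] _].
rewrite big_nat1_eq; congr (if _ then _ else _).
by rewrite ltnS muln_gt0 q0 n1.
Qed.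

(** Multiplication by an Euler factor moves coefficients from [n] to [q * n]; those pushed beyond
    [p] join the error. *)
Lemma dap_factor p F b q (al : C) : normc al <= 1 -> (1 < q)%N -> dap p F b ->
  dap p (fun s => (1 - al * ((rs q s)%:C)%C) * F s)
    (fun n => b n - (if (q %| n)%N then al * b (n %/ q)%N else 0)).
Proof.
move=> al1 q1 [K H]; have q0 : (0 < q)%N by exact: ltnW.
pose B := \sum_(1 <= n < p.+1) normc (b n).
exists (2 * `|K| + B) => s s4; have s0 : 0 <= s by lra.
set S := \sum_(1 <= n < p.+1) b n * ((rs n s)%:C)%C.
have rq : rs q s <= 1 by exact: rs_le1.
have -> : (1 - al * ((rs q s)%:C)%C) * F s -
    \sum_(1 <= n < p.+1) (b n - (if (q %| n)%N then al * b (n %/ q)%N else 0)) * ((rs n s)%:C)%C =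
  (1 - al * ((rs q s)%:C)%C) * (F s - S) -
    al * \sum_(1 <= n < p.+1 | (p < q * n)%N) b n * ((rs (q * n) s)%:C)%C.
  have -> : \sum_(1 <= n < p.+1) (b n - (if (q %| n)%N then al * b (n %/ q)%N else 0)) * ((rs n s)%:C)%C =
      S - al * \sum_(1 <= n < p.+1 | (q * n <= p)%N) b n * ((rs (q * n) s)%:C)%C.
    under eq_bigr do rewrite mulrBl.
    rewrite sumrB; congr (_ - _); rewrite mulr_sumr.
    have -> : \sum_(1 <= n < p.+1 | (q * n <= p)%N) al * (b n * ((rs (q * n) s)%:C)%C) =
        \sum_(1 <= n < p.+1 | (q * n <= p)%N) al * (b ((q * n) %/ q)%N * ((rs (q * n) s)%:C)%C).
      by apply: eq_bigr => n _; rewrite mulKn.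
    rewrite -(@multiples_sum _ p q (fun m => al * (b (m %/ q)%N * ((rs m s)%:C)%C)) q0).
    rewrite [RHS]big_mkcond; apply: eq_bigr => m _.
    by case: ifP => _; rewrite ?mul0r// mulrA.
  have : S * ((rs q s)%:C)%C = \sum_(1 <= n < p.+1 | (q * n <= p)%N) b n * ((rs (q * n) s)%:C)%C +
      \sum_(1 <= n < p.+1 | (p < q * n)%N) b n * ((rs (q * n) s)%:C)%C.
    rewrite /S mulr_suml (bigID (fun n => (q * n <= p)%N)) /=.
    congr (_ + _); last under eq_bigl do rewrite -ltnNge;
      rewrite big_nat_cond [RHS]big_nat_cond; apply: eq_bigr => n /andP[/andP[n1 _] _];
      by rewrite -mulrA -(rmorphM (real_complex R)) rsM// [rs n s * _]mulrC.
  move: (\sum_(1 <= n < p.+1 | (q * n <= p)%N) _) (\sum_(1 <= n < p.+1 | (p < q * n)%N) _).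
  move=> u v e; have -> : al * v = al * (S * ((rs q s)%:C)%C) - al * u by rewrite e; ring.
  by ring.
apply: (le_trans (ncB _ _)); rewrite (mulrDl (2 * `|K|)); apply: lerD.
  rewrite normcM -(mulrA 2); apply: ler_pM; rewrite ?nc_ge0//.
    apply: (le_trans (ncB _ _)); rewrite normc1 normcM nc_real ger0_norm ?rs_ge0//.
    have : normc al * rs q s <= 1 by rewrite mulr_ile1 ?nc_ge0 ?rs_ge0.
    by lra.
  by apply: (le_trans (H s s4)); rewrite ler_wpM2r ?rs_ge0// ler_norm.
rewrite normcM; apply: (@le_trans _ _ (1 * (B * rs p.+1 s))); last by rewrite mul1r.
apply: ler_pM; rewrite ?nc_ge0//; apply: (le_trans (nc_sum _ _ _)).
rewrite /B mulr_suml big_mkcond; apply: ler_sum => n _; case: ifP => [pqn|_].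
  by rewrite normcM nc_real ger0_norm ?rs_ge0// ler_wpM2l ?nc_ge0// rs_le.
by rewrite mulr_ge0 ?nc_ge0 ?rs_ge0.
Qed.

Lemma dap_prod p F b (I : Type) (r : seq I) (P : pred I) (q : I -> nat) (al : I -> C) :
  prime p -> (forall i, P i -> normc (al i) <= 1) -> (forall i, P i -> (1 < q i)%N) -> dap p F b ->
  exists b', [/\ dap p (fun s => (\prod_(i <- r | P i) (1 - al i * ((rs (q i) s)%:C)%C)) * F s) b',
    b' 1%N = b 1%N & b' p = b p - (\sum_(i <- r | P i && (q i == p)) al i) * b 1%N].
Proof.
move=> pp al1 q1 dF; elim: r => [|i r [b' [db b1 bp]]].
  exists b; split => //; last by rewrite big_nil mul0r subr0.
  by have [K H] := dF; exists K => s s4; rewrite big_nil mul1r; exact: H.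
case Pi : (P i); last first.
  exists b'; split => //; last by rewrite big_cons Pi.
  by have [K H] := db; exists K => s s4; rewrite big_cons Pi; exact: H.
have [K H] := dap_factor (al1 i Pi) (q1 i Pi) db.
eexists; split.
- by exists K => s s4; rewrite big_cons Pi -mulrA; exact: H.
- by rewrite /= b1; case: ifP => [|_]; rewrite ?subr0// dvdn1 => /eqP e; have := q1 i Pi; rewrite e.
- rewrite /= big_cons Pi /= bp.
  have -> : (q i %| p)%N = (q i == p).
    apply/idP/eqP => [|->]; last exact: dvdnn.
    by move=> /(prime_nt_dvdP pp) H'; apply: H'; have := q1 i Pi; case: (q i) => [|[|]].
  case: eqP => [->|_]; last by rewrite subr0.
  by rewrite divnn prime_gt0//= b1; ring.
Qed.

Lemma nc_prod_sub1 (I : Type) (r : seq I) (P : pred I) (A : I -> C) (b : I -> R) :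
  (forall i, P i -> normc (A i - 1) <= expR (b i) - 1) ->
  normc (\prod_(i <- r | P i) A i - 1) <= expR (\sum_(i <- r | P i) b i) - 1.
Proof.
move=> Ab; elim: r => [|i r IH]; first by rewrite !big_nil expR0 !subrr normc0.
rewrite !big_cons; case: ifP => // Pi; rewrite expRD.
move: IH; set A' := \prod_(_ <- _ | _) _; set S := \sum_(_ <- _ | _) _ => IH.
have -> : A i * A' - 1 = A i * (A' - 1) + (A i - 1) by ring.
apply: (le_trans (le_normcD _ _)); rewrite normcM.
have h1 : normc (A i) <= expR (b i).
  rewrite -[A i](subrK 1); apply: (le_trans (le_normcD _ _)); rewrite normc1.
  by have := Ab i Pi; lra.
have h2 := ler_pM (nc_ge0 _) (nc_ge0 _) h1 IH; have h3 := Ab i Pi.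
by move: h2 h3; move: (normc _ * normc _) (expR (b i)) (expR S) (normc (A i - 1)) => *; lra.
Qed.

Variables (a : nat -> C) (d : nat) (al : 'I_d -> nat -> C) (L : C -> C).
Hypothesis al1 : forall j p, prime p -> normc (al j p) <= 1.
Hypothesis EP : euler_product al (L : R[i]^o -> R[i]^o).
Hypothesis DS : dirichlet_series a (L : R[i]^o -> R[i]^o).

Lemma dap_L p : (0 < p)%N -> dap p (fun s => L (s%:C)%C) a.
Proof.
move=> p0.
have cp n (s : R) : (cpow n%:R (- (s%:C)%C) : C) = ((rs n s)%:C)%C.
  by rewrite -ps_rs /ps ce_cexp.
have DSs (s : R) : 1 < s -> forall e : R, 0 < e -> exists N, forall n, (N <= n)%N ->
    normc (\sum_(1 <= k < n) a k * ((rs k s)%:C)%C - L (s%:C)%C) <= e.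
  move=> s1; have /cvgC H := DS (s1 : 1 < complex.Re (s%:C)%C).
  move=> e /H[N HN]; exists N => n /HN.
  by under eq_bigr do rewrite cp.
(* Convergence at 2 bounds the terms [a n * n^(-2)]. In [s >= 4], two powers of [n] pay for this
   bound and two for the convergence of the tail. *)
have [M [M0 aM]] : exists M : R, 0 <= M /\ forall n, (0 < n)%N -> normc (a n) * rs n 2 <= M.
  have [N HN] := DSs 2 (ltr1n _ 2) 1 ltr01.
  pose S := \sum_(n < N) normc (a n) * rs n 2.
  have S0 : 0 <= S by apply: sumr_ge0 => n _; rewrite mulr_ge0 ?nc_ge0 ?rs_ge0.
  exists (2 + S); split => [|n n0]; first by lra.
  have [nN|Nn] := ltnP n N.
    rewrite /S (bigD1 (Ordinal nN))//= addrCA lerDl addr_ge0// sumr_ge0// => m _.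
    by rewrite mulr_ge0 ?nc_ge0 ?rs_ge0.
  have h1 := HN n Nn; have h2 := HN n.+1 (leqW Nn).
  have -> : normc (a n) * rs n 2 = normc ((\sum_(1 <= k < n.+1) a k * ((rs k 2)%:C)%C - L (2%:C)%C) -
      (\sum_(1 <= k < n) a k * ((rs k 2)%:C)%C - L (2%:C)%C)).
    rewrite big_nat_recr//=.
    have -> : \sum_(1 <= k < n) a k * ((rs k 2)%:C)%C + a n * ((rs n 2)%:C)%C - L (2%:C)%C -
       (\sum_(1 <= k < n) a k * ((rs k 2)%:C)%C - L (2%:C)%C) = a n * ((rs n 2)%:C)%C by ring.
    by rewrite normcM nc_real ger0_norm ?rs_ge0.
  by apply: (le_trans (ncB _ _)); lra.
exists (M * rs p.+1 (- 4)) => s s4.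
have s1 : 1 < s by lra.
have {}DSs := DSs s s1.
apply: (@nc_lim _ (fun n => \sum_(1 <= k < n) a k * ((rs k s)%:C)%C - \sum_(1 <= k < p.+1) a k * ((rs k s)%:C)%C) _ _ p.+1).
  move=> e /DSs[N HN]; exists N => n /HN.
  by congr (normc _ <= e); ring.
move=> n pn; rewrite (@big_cat_nat _ _ _ p.+1)//=.
rewrite [X in normc X](_ : _ = \sum_(p.+1 <= k < n) a k * ((rs k s)%:C)%C); last by ring.
apply: (le_trans (nc_sum _ _ _)); rewrite -mulrA -rsD.
apply: (@le_trans _ _ (\sum_(p.+1 <= k < n) M * rs p.+1 (-4 + s) * (k%:R ^+ 2)^-1)).
  rewrite big_nat_cond [X in _ <= X]big_nat_cond; apply: ler_sum => k /andP[/andP[pk _] _].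
  have k0 : (0 < k)%N by exact: leq_ltn_trans pk.
  rewrite normcM nc_real ger0_norm ?rs_ge0// -rs2//.
  have -> : rs k s = rs k 2 * (rs k (-4 + s) * rs k 2) by rewrite -!rsD; congr rs; ring.
  rewrite (mulrA (normc (a k))) -(mulrA M); apply: ler_pM; rewrite ?aM ?mulr_ge0 ?nc_ge0 ?rs_ge0//.
  by rewrite ler_wpM2r ?rs_ge0// rs_le//; lra.
rewrite -mulr_sumr ler_piMr ?mulr_ge0 ?rs_ge0//.
move: pn; rewrite leq_eqVlt => /orP[/eqP <-|pn]; first by rewrite big_geq.
apply: (le_trans (tail_sq_sum _ p0 (ltnW pn))).
by rewrite invf_le1 ?ltr0n// ler1n.
Qed.

(** The finite product cancels all Euler factors with primes up to [p]. Those left are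
    [1 + O(q^(-s))] with [q > p], so only the constant term survives among the indices up to [p]. *)
Lemma dap_tail p : (0 < p)%N ->
  dap p (fun s => (\prod_(i : 'I_p.+1 * 'I_d | prime i.1) (1 - al i.2 i.1 * ((rs i.1 s)%:C)%C)) *
     L (s%:C)%C) (fun n => (n == 1%N)%:R).
Proof.
move=> p0; pose E := expR (2 * d%:R) : R.
exists (2 * d%:R * rs p.+1 (-2) * E) => s s4.
have s1 : 1 < s by lra.
have cp n : (cpow n%:R (- (s%:C)%C) : C) = ((rs n s)%:C)%C by rewrite -ps_rs /ps ce_cexp.
have -> : \sum_(1 <= n < p.+1) (n == 1%N)%:R * ((rs n s)%:C)%C = 1 :> C.
  rewrite big_ltn ?ltnS// eqxx mul1r big_nat_cond big1 ?addr0.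
    by rewrite /rs ln1 mulr0 oppr0 expR0.
  by move=> n /andP[/andP[n1 _] _]; rewrite gtn_eqF ?mul0r.
pose fac q j : C := 1 - al j q * ((rs q s)%:C)%C.
have small q j : prime q -> normc (al j q * ((rs q s)%:C)%C) <= rs q s.
  by move=> pq; rewrite normcM nc_real ger0_norm ?rs_ge0// ler_piMl ?rs_ge0 ?al1.
have half q : prime q -> rs q s <= 2^-1.
  move=> pq; have q0 := prime_gt0 pq.
  have -> : rs q s = rs q 2 * rs q (s - 2) by rewrite -rsD; congr rs; ring.
  apply: (@le_trans _ _ (rs q 2)); first by rewrite ler_piMr ?rs_ge0// rs_le1//; lra.
  rewrite rs2// lef_pV2 ?posrE ?exprn_gt0 ?ltr0n// -natrX ler_nat.
  by apply: (leq_trans (prime_gt1 pq)); rewrite expnS expn1 leq_pmulr.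
have fac0 q j : prime q -> fac q j != 0.
  move=> pq; rewrite -nc_gt0; have := nc_ler_sub 1 (al j q * ((rs q s)%:C)%C); rewrite normc1.
  by have := small q j pq; have := half q pq; rewrite /fac; lra.
pose PP := \prod_(i : 'I_p.+1 * 'I_d | prime i.1) fac i.1 i.2.
have PPE : PP = \prod_(1 <= q < p.+1 | prime q) \prod_(j < d) fac q j.
  rewrite /PP (eq_bigl (fun i : 'I_p.+1 * 'I_d => prime i.1 && xpredT i.2)); last by move=> i; rewrite andbT.
  rewrite -(pair_big (fun q : 'I_p.+1 => prime q) xpredT (fun (q : 'I_p.+1) j => fac q j)) /=.
  rewrite -(big_mkord (fun q => prime q) (fun q => \prod_(j < d) fac q j)).
  by rewrite (big_ltn_cond (ltn0Sn p)).
rewrite -/PP.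
have /cvgC EPs := EP (s1 : 1 < complex.Re (s%:C)%C).
pose A n : C := \prod_(1 <= q < n | prime q) \prod_(j < d) (fac q j)^-1.
have AE n : \prod_(1 <= q < n | prime q) \prod_(j < d) (1 - al j q * cpow q%:R (- (s%:C)%C))^-1 = A n.
  by apply: eq_bigr => q _; apply: eq_bigr => j _; rewrite cp.
apply: (@nc_lim _ (fun n => PP * A n - 1) _ _ p.+1).
  move=> e e0; have P1 : 0 < normc PP + 1 by rewrite ltr_wpDl ?nc_ge0.
  have [N HN] := EPs _ (divr_gt0 e0 P1); exists N => n /HN; rewrite AE => h.
  have -> : PP * A n - 1 - (PP * L (s%:C)%C - 1) = PP * (A n - L (s%:C)%C) by ring.
  rewrite normcM; apply: (@le_trans _ _ ((normc PP + 1) * (e / (normc PP + 1)))).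
    by apply: ler_pM; rewrite ?nc_ge0// lerDl.
  by rewrite mulrCA mulfV ?mulr1// gt_eqF.
move=> n pn.
have -> : PP * A n = \prod_(p.+1 <= q < n | prime q) \prod_(j < d) (fac q j)^-1.
  rewrite /A (@big_cat_nat _ _ _ p.+1)//= mulrA PPE -big_split /= big1 ?mul1r// => q pq.
  by rewrite -big_split /= big1// => j _; rewrite mulfV ?fac0.
pose z q j : C := al j q * ((rs q s)%:C)%C / fac q j.
have zE q j : prime q -> (fac q j)^-1 = 1 + z q j.
  move=> pq; have := fac0 q j pq; rewrite /z /fac; move: (al j q * _) => x x0.
  by field; exact: x0.
have zb q j : prime q -> normc (z q j) <= 2 * rs q s.
  move=> pq; rewrite normcM normcV ler_pdivrMr ?nc_gt0 ?fac0//.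
  have h1 : 2^-1 <= normc (fac q j).
    have := nc_ler_sub 1 (al j q * ((rs q s)%:C)%C); rewrite normc1.
    by have := small q j pq; have := half q pq; rewrite /fac; lra.
  apply: (le_trans (small q j pq)).
  have h2 := ler_wpM2l (rs_ge0 q s) h1.
  by rewrite -mulrA; move: (rs q s * normc _) h2 => u h2; lra.
have inner q : prime q -> normc (\prod_(j < d) (fac q j)^-1 - 1) <= expR (2 * d%:R * rs q s) - 1.
  move=> pq.
  have -> : 2 * d%:R * rs q s = \sum_(j < d) 2 * rs q s.
    by rewrite sumr_const card_ord -[X in _ = X]mulr_natl; ring.
  apply: nc_prod_sub1 => j _; rewrite zE// addrAC subrr add0r.
  by apply: (le_trans (zb q j pq)); have := expR_ge1Dx (2 * rs q s); lra.
apply: (le_trans (nc_prod_sub1 _ inner)).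
pose S0 := 2 * d%:R * rs p.+1 (-2 + s).
have S00 : 0 <= S0 by rewrite !mulr_ge0 ?rs_ge0.
have Sb : \sum_(p.+1 <= q < n | prime q) 2 * d%:R * rs q s <= S0.
  apply: (@le_trans _ _ (\sum_(p.+1 <= q < n) S0 * (q%:R ^+ 2)^-1)).
    rewrite big_mkcond big_nat_cond [X in _ <= X]big_nat_cond; apply: ler_sum => q /andP[/andP[pq _] _].
    have q0 : (0 < q)%N by exact: leq_ltn_trans pq.
    case: ifP => _; last by rewrite mulr_ge0// invr_ge0 exprn_ge0.
    have -> : rs q s = rs q (-2 + s) * rs q 2 by rewrite -rsD; congr rs; ring.
    rewrite -rs2// /S0 -!mulrA !ler_wpM2l// ler_wpM2r ?rs_ge0// rs_le//; lra.
  rewrite -mulr_sumr ler_piMr//.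
  move: pn; rewrite leq_eqVlt => /orP[/eqP <-|pn]; first by rewrite big_geq.
  apply: (le_trans (tail_sq_sum _ p0 (ltnW pn))).
  by rewrite invf_le1 ?ltr0n// ler1n.
apply: (@le_trans _ _ (expR S0 - 1)); first by rewrite lerD2r ler_expR.
have -> : 2 * d%:R * rs p.+1 (-2) * E * rs p.+1 s = S0 * E.
  by rewrite /S0 rsD; ring.
have S0d : expR S0 <= E.
  by rewrite /E ler_expR /S0 ler_piMr ?mulr_ge0// rs_le1//; lra.
have h : (1 - S0) * expR S0 <= 1.
  apply: (@le_trans _ _ (expR (- S0) * expR S0)); first by rewrite ler_wpM2r ?expR_ge0// expR_ge1Dx.
  by rewrite -expRD addNr expR0.
have h2 := ler_wpM2l S00 S0d.
by move: h; rewrite mulrBl mul1r; lra.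
Qed.

(** Connects the two descriptions of [L]: the second moment is assumed for [a p], while the
    Dirichlet polynomial is built from [al]. Multiplying by all Euler factors up to [p] leaves the
    constant 1, and the coefficient at [p] then says [a p - \sum_j al j p = 0]. *)
Lemma coef_prime p : prime p -> a p = \sum_(j < d) al j p.
Proof.
move=> pp; have p0 := prime_gt0 pp.
have [b' [db b1 bp]] := @dap_prod p (fun s => L (s%:C)%C) a _
  (index_enum ('I_p.+1 * 'I_d)%type) (fun i => prime i.1) (fun i => i.1) (fun i => al i.2 i.1) pp
  (fun i pi => al1 i.2 pi) (fun i pi => prime_gt1 pi) (dap_L p0).
have u := dap_uniq db (dap_tail p0).
have a1 : a 1%N = 1 by rewrite -b1 u.
have : b' p = 0 by rewrite u ?p0 ?leqnn// gtn_eqF ?prime_gt1.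
rewrite bp a1 mulr1 => /eqP; rewrite subr_eq0 => /eqP ->.
rewrite (eq_bigl (fun i : 'I_p.+1 * 'I_d => (i.1 == ord_max) && xpredT i.2)); last first.
  by move=> [i j] /=; rewrite andbT -val_eqE /=; case: eqP => [->|_]; rewrite ?pp ?andbF.
by rewrite -(pair_big (fun i => i == ord_max) xpredT (fun (i : 'I_p.+1) j => al j i)) big_pred1_eq.
Qed.

End Coefficients.


(** * Equidistribution modulo 1 *)

Section Fejer.
Variable R : realType.
Local Notation C := (R[i]).
Local Notation mu := (@lebesgue_measure R).

Definition dk N (z : R) : C := \sum_(a < N) ei (a%:R * z).

Lemma ei_nat (n : nat) z : ei (n%:R * z) = ei z ^+ n :> C.
Proof.
elim: n => [|n IH]; first by rewrite mul0r ei0 expr0.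
by rewrite exprS -IH -eiD; congr ei; rewrite -natr1; ring.
Qed.

Lemma dk_telescope N z : (ei z - 1) * dk N z = ei (N%:R * z) - 1.
Proof.
rewrite /dk; under eq_bigr do rewrite ei_nat.
by rewrite -subrX1 ei_nat.
Qed.

Lemma dk_bound N z (c : R) : 0 < c -> c <= normc (ei z - 1) ^+ 2 ->
  normc (dk N z) ^+ 2 <= 4 / c.
Proof.
move=> c0 cz; rewrite ler_pdivlMr//.
have h : normc (ei z - 1) * normc (dk N z) <= 2.
  rewrite -normcM dk_telescope; apply: (le_trans (ncB _ _)).
  by rewrite nc_ei normc1.
have h2 : (normc (ei z - 1) * normc (dk N z)) ^+ 2 <= 2 ^+ 2.
  by rewrite lerXn2r ?nnegrE ?mulr_ge0 ?nc_ge0.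
rewrite exprMn in h2; have -> : 4 = 2 ^+ 2 :> R by rewrite expr2; ring.
by apply: le_trans h2; rewrite mulrC ler_wpM2r ?exprn_ge0 ?nc_ge0.
Qed.

Lemma ei_sub1 (z : R) : normc (ei z - 1) ^+ 2 = 2 - 2 * cos z.
Proof.
rewrite /ei ce_im nc_sqr /= subr0.
have := cos2Dsin2 z; rewrite sqrrB1; move: (cos z) (sin z) => a b; lra.
Qed.

Lemma ei_2pi (k : int) : ei (2 * pi * k%:~R) = 1 :> C.
Proof.
have e1 : ei (2 * pi) = 1 :> C by rewrite /ei ce_im mulr_natl cos2pi sin2pi.
case: k => n; first by rewrite mulrC -[n%:~R]/(n%:R) ei_nat e1 expr1n.
have : ((ei (2 * pi * (n.+1)%:R))^*)%C = 1 :> C by rewrite mulrC ei_nat e1 expr1n rmorph1.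
by rewrite ei_conj NegzE mulrNz mulrN.
Qed.

Lemma ei_far (y kap : R) : 0 < kap <= 2^-1 -> (forall k : int, kap <= `|y - k%:~R|) ->
  2 - 2 * cos (2 * pi * kap) <= normc (ei (2 * pi * y) - 1) ^+ 2.
Proof.
move=> /andP[k0 k1] far.
have pi0 := pi_gt0 R.
pose y0 := y - (Num.floor y)%:~R.
have /andP[f1 f2] := floor_itv y.
have y00 : 0 <= y0 by rewrite subr_ge0.
have y01 : y0 < 1 by move: f2; rewrite intrD /y0; lra.
have h1 : kap <= y0 by have := far (Num.floor y); rewrite ger0_norm.
have h2 : kap <= 1 - y0.
  have := far (Num.floor y + 1); rewrite intrD ler0_norm; first by rewrite /y0; lra.
  by move: y01; rewrite /y0; lra.
have -> : ei (2 * pi * y) = ei (2 * pi * y0).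
  have -> : 2 * pi * y = 2 * pi * y0 + 2 * pi * (Num.floor y)%:~R by rewrite /y0; ring.
  by rewrite eiD ei_2pi mulr1.
rewrite ei_sub1 lerD2l lerN2 ler_pM2l//.
have bd (b : R) : 0 <= b -> b <= 2^-1 -> 0 <= 2 * pi * b <= pi.
  move=> b0 b1; rewrite !mulr_ge0 ?(ltW pi0)//=.
  have -> : 2 * pi * b = pi * (2 * b) by ring.
  by rewrite ler_piMr ?(ltW pi0)//; lra.
have mono (a b : R) : 0 <= a -> a <= b -> b <= 2^-1 -> cos (2 * pi * b) <= cos (2 * pi * a).
  move=> a0 ab b1; rewrite leNgt ltr_cos ?in_itv /=; first by rewrite -leNgt ler_pM2l ?mulr_gt0.
    by apply: bd => //; exact: le_trans ab.
  by apply: bd => //; exact: le_trans ab _.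
have [yh|yh] := leP y0 2^-1; first by apply: mono => //; exact: ltW.
have -> : cos (2 * pi * y0) = cos (2 * pi * (1 - y0)).
  rewrite -(cosN (2 * pi * y0)) -(cosD2pi (- (2 * pi * y0))); congr cos.
  by rewrite -mulr_natl; ring.
apply: mono; [exact: ltW|exact: h2|].
by move: (y0) yh => x yh; lra.
Qed.

Lemma cos_kap (kap : R) : 0 < kap <= 2^-1 -> 0 < 2 - 2 * cos (2 * pi * kap).
Proof.
move=> /andP[k0 k1]; have pi0 := pi_gt0 R.
have : cos (2 * pi * kap) < cos 0.
  rewrite ltr_cos ?in_itv /= ?lexx ?(ltW pi0)//; first by rewrite !mulr_gt0.
  by apply/andP; split; [rewrite !mulr_ge0// ltW|move: (pi : R) pi0 => P P0; nra].
by rewrite cos0; lra.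
Qed.

(** Normalised squares of Dirichlet kernels centred at the grid points [j / N] in [S]. Over the
    whole grid they sum to the constant 1 ([fejer_total]), so over the points near an arc they form
    a trigonometric polynomial that imitates its indicator. *)
Definition fejer N (S : pred 'I_N) (y : R) : R :=
  (N%:R ^+ 2)^-1 * \sum_(j < N | S j) normc (dk N (2 * pi * (y - j%:R / N%:R))) ^+ 2.

Lemma dk_expand N (j : 'I_N) y :
  ((normc (dk N (2 * pi * (y - j%:R / N%:R))) ^+ 2)%:C)%C =
  \sum_(a < N) \sum_(b < N) @rootu R N j (b%:Z - a%:Z) * ei (2 * pi * (a%:Z - b%:Z)%:~R * y).
Proof.
rewrite -Re_conjM /dk mulr_suml; apply: eq_bigr => a _.
rewrite [X in _ * X = _](_ : _ = \sum_(b < N) ei (- (b%:R * (2 * pi * (y - j%:R / N%:R))))); last first.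
  rewrite (rmorph_sum (@conjc R)); apply: eq_bigr => b _; exact: ei_conj.
rewrite mulr_sumr; apply: eq_bigr => b _.
by rewrite -eiD /rootu -/(ei _) -eiD; congr ei; rewrite !intrD !mulrNz -!pmulrn; ring.
Qed.

Lemma fejer_total N y : (0 < N)%N -> fejer (N := N) xpredT y = 1.
Proof.
move=> N0; have NR : (N%:R : R) != 0 by rewrite pnatr_eq0 -lt0n.
rewrite /fejer.
suff -> : \sum_(j < N) normc (dk N (2 * pi * (y - j%:R / N%:R))) ^+ 2 = N%:R ^+ 2.
  by rewrite mulVf// expf_eq0.
apply: (@complexI R); rewrite (rmorph_sum (real_complex R)).
rewrite (eq_bigr _ (fun j _ => dk_expand j y)) exchange_big /=.
rewrite (eq_bigr (fun=> N%:R)); last first.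
  move=> a _; rewrite exchange_big (bigD1 a)//= [X in _ + X]big1 ?addr0.
    under eq_bigr do rewrite subrr rootu0 mulr0z mulr0 mul0r ei0 mul1r.
    by rewrite sumr_const card_ord.
  move=> b ba; rewrite -mulr_suml sum_rootu.
    by rewrite subr_eq0 eqz_nat val_eqE (negbTE ba) mul0r.
  have := ltn_ord a; have := ltn_ord b; clear; lia.
by rewrite sumr_const card_ord rmorphXn rmorph_nat -[X in X = _]mulr_natl expr2.
Qed.

Lemma fejer_ge0 N (S : pred 'I_N) y : 0 <= fejer S y.
Proof.
rewrite /fejer mulr_ge0 ?invr_ge0 ?exprn_ge0// sumr_ge0// => j _.
by rewrite exprn_ge0 ?nc_ge0.
Qed.

(* Points of the grid [j / N] within [2 kap] of the arc [[a1, a2]] modulo 1. *)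
Definition near_arc (a1 a2 kap : R) N (j : 'I_N) : bool :=
  [|| (N%:R * (a1 - 2 * kap) <= j%:R) && (j%:R <= N%:R * (a2 + 2 * kap)),
      j%:R <= N%:R * (a2 + 2 * kap - 1) | N%:R * (a1 - 2 * kap + 1) <= j%:R].

Lemma arc_far (a1 a2 kap q z : R) (n : int) : 0 <= kap -> a1 <= z -> z <= a2 ->
  (q < a1 - 2 * kap) || (a2 + 2 * kap < q) -> a2 + 2 * kap - 1 < q -> q < a1 - 2 * kap + 1 ->
  2 * kap <= `|z - (q + n%:~R)|.
Proof.
move=> k0 za1 za2 n1 n2 n3; have [n0|n0|n0] := ltgtP n 0.
- have : n%:~R <= -1 :> R by rewrite -[-1]/((-1)%:~R) ler_int; lia.
  by move=> h; rewrite ger0_norm; lra.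
- have : 1 <= n%:~R :> R by rewrite -[1]/(1%:~R) ler_int; lia.
  by move=> h; rewrite ler0_norm; lra.
- by rewrite n0 addr0; case/orP: n1 => h; [rewrite ger0_norm; lra|rewrite ler0_norm; lra].
Qed.

(** Grid points outside [near_arc] are at least [2 * kap] from [y], hence [kap] from [y'], modulo 1.
    With [c = 2 - 2 * cos (2 * pi * kap)] each of their squared kernels is at most [4 / c], and
    there are at most [N] of them against the weight [1 / N^2]. *)
Lemma fejer_near (a1 a2 kap y y' : R) N (k : int) : (0 < N)%N -> 0 < kap <= 2^-1 ->
  a1 <= y - k%:~R <= a2 -> `|y' - y| <= kap ->
  1 - 4 / (2 - 2 * cos (2 * pi * kap)) / N%:R <= fejer (near_arc a1 a2 kap (N := N)) y'.
Proof.
move=> N0 kk /andP[ya1 ya2] yy; have c0 := cos_kap kk.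
have NR : (0 : R) < N%:R by rewrite ltr0n.
have kap0 : 0 < kap by case/andP: kk.
set c := 2 - _ in c0 *; rewrite lerBlDr -[X in X <= _](fejer_total y' N0).
rewrite /fejer (bigID (near_arc a1 a2 kap (N := N)) xpredT) /= mulrDr lerD2l.
apply: (@le_trans _ _ ((N%:R ^+ 2)^-1 * \sum_(j < N) 4 / c)).
  rewrite ler_wpM2l ?invr_ge0 ?exprn_ge0// big_mkcond; apply: ler_sum => j _.
  case: ifPn => [nj|_]; last by rewrite divr_ge0// ltW.
  apply: dk_bound => //; apply: ei_far => // m.
  move: nj; rewrite /near_arc !negb_or negb_and -!ltNge => /and3P[n1 n2 n3].
  pose q : R := j%:R / N%:R.
  have jE : j%:R = N%:R * q by rewrite /q mulrCA mulfV ?mulr1// gt_eqF.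
  rewrite jE !ltr_pM2l// in n1 n2 n3; rewrite -/q.
  have far : 2 * kap <= `|y - q - m%:~R|.
    have -> : y - q - m%:~R = (y - k%:~R) - (q + (m - k)%:~R) by rewrite intrB; ring.
    exact: arc_far (ltW kap0) ya1 ya2 n1 n2 n3.
  have := ler_normB (y' - q - m%:~R) (y' - y).
  have -> : y' - q - m%:~R - (y' - y) = y - q - m%:~R by ring.
  move: far yy; move: (`|y - q - m%:~R|) (`|y' - q - m%:~R|) (`|y' - y|) => A1 A2 A3 far yy h.
  by move: far yy h; lra.
rewrite sumr_const card_ord -[X in _ * X]mulr_natl le_eqVlt; apply/orP; left; apply/eqP.
by field; rewrite !gt_eqF.
Qed.

Lemma count_interval (lo hi : R) n : lo <= hi + 1 ->
  \sum_(j < n) ((lo <= j%:R) && (j%:R <= hi))%:R <= hi - lo + 1 :> R.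
Proof.
elim: n hi => [|n IH] hi lh; first by rewrite big_ord0; lra.
rewrite big_ord_recr /=; have [/andP[ln nh]|_] := boolP ((lo <= n%:R) && (n%:R <= hi)); last first.
  by rewrite addr0; exact: IH.
have -> : \sum_(j < n) ((lo <= j%:R) && (j%:R <= hi))%:R =
    \sum_(j < n) ((lo <= j%:R) && (j%:R <= (n%:R - 1 : R)))%:R :> R.
  apply: eq_bigr => j _; congr (nat_of_bool (_ && _))%:R.
  have jn : j%:R + 1 <= n%:R :> R by rewrite natr1 ler_nat ltn_ord.
  by rewrite lerBrDr jn; apply/idP; lra.
have h := IH (n%:R - 1); rewrite subrK in h; have {}h := h ln.
rewrite (_ : (true%:R : R) = 1)//; move: h nh; lra.
Qed.

Lemma near_arc_count (a1 a2 kap : R) N : 0 < kap -> 0 <= a1 -> a1 <= a2 -> a2 <= 1 ->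
  \sum_(j < N | near_arc a1 a2 kap j) 1 <= N%:R * (a2 - a1 + 8 * kap) + 3 :> R.
Proof.
move=> k0 a10 a12 a21; have N0 : (0 : R) <= N%:R by [].
(* The three alternatives of [near_arc], the last two widened by means of [a2 <= 1] and [0 <= a1].
   Their lengths add up to [a2 - a1 + 8 * kap], and each may hold one point more than its scaled
   length. *)
pose f1 (j : 'I_N) := (N%:R * (a1 - 2 * kap) <= j%:R) && (j%:R <= N%:R * (a2 + 2 * kap)).
pose f2 (j : 'I_N) := ((0 : R) <= j%:R) && (j%:R <= N%:R * (2 * kap)).
pose f3 (j : 'I_N) := (N%:R * (1 - 2 * kap) <= j%:R) && (j%:R <= (N%:R : R)).
apply: (@le_trans _ _ (\sum_(j < N) ((f1 j)%:R + (f2 j)%:R + (f3 j)%:R))).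
  rewrite big_mkcond; apply: ler_sum => j _; case: ifP => [/or3P[h|h|h]|_].
  - by rewrite /f1 h -addrA lerDl addr_ge0.
  - have -> : f2 j.
      rewrite /f2 ler0n /=; apply: (le_trans h); rewrite ler_wpM2l//; lra.
    by rewrite -addrA addrCA lerDl addr_ge0.
  - have -> : f3 j.
      rewrite /f3 ler_nat (ltnW (ltn_ord j)) andbT; apply: le_trans h; rewrite ler_wpM2l//; lra.
    by rewrite lerDr addr_ge0.
  - by rewrite !addr_ge0.
have k0' := mulr_ge0 N0 (ltW k0); have Na := mulr_ge0 N0 (ltW k0).
have Na12 : N%:R * a1 <= N%:R * a2 by rewrite ler_wpM2l.
have Na1 : 0 <= N%:R * a1 by rewrite mulr_ge0.
rewrite !big_split /=.
have c1 := @count_interval (N%:R * (a1 - 2 * kap)) (N%:R * (a2 + 2 * kap)) N ltac:(lra).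
have c2 := @count_interval 0 (N%:R * (2 * kap)) N ltac:(lra).
have c3 := @count_interval (N%:R * (1 - 2 * kap)) N%:R N ltac:(lra).
by move: c1 c2 c3; rewrite /f1 /f2 /f3; lra.
Qed.

(** For each grid point the [N] constant terms of the expanded kernel give [N * T], and the other
    pairs at most [e1 * T] each. After division by [N^2] the mean is at most [1 / N + e1]. *)
Lemma fejer_mean (T b e1 : R) (u : R -> R) N (S : pred 'I_N) : 0 < T -> 0 < b -> (0 < N)%N ->
  0 <= e1 ->
  (forall th t, rcnt (fun t => ei (th * u t)) t) ->
  (forall m : int, (`|m| < N)%N -> m != 0 ->
    normc (cint T (2 * T) (fun t => ei (2 * pi * m%:~R / b * u t))) <= e1 * T) ->
  (forall t, {for t, continuous (fun t => fejer S (u t / b))}) /\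
  \int[mu]_(t in `[T, (2 * T)]) fejer S (u t / b) <=
    T * ((\sum_(j < N | S j) 1) * (N%:R^-1 + e1)).
Proof.
move=> T0 b0 N0 e10 cu mean.
have NR : (0 : R) < N%:R by rewrite ltr0n.
pose g (j a c : 'I_N) : C := @rootu R N j (c%:Z - a%:Z).
pose th (a c : 'I_N) : R := 2 * pi * (a%:Z - c%:Z)%:~R / b.
pose Hc t : C := (((N%:R ^+ 2)^-1)%:C)%C *
  \sum_(j < N | S j) \sum_(a < N) \sum_(c < N) g j a c * ei (th a c * u t).
have HE t : ((fejer S (u t / b))%:C)%C = Hc t.
  rewrite /fejer /Hc (rmorphM (real_complex R)); congr (_ * _).
  rewrite (rmorph_sum (real_complex R)); apply: eq_bigr => j _.
  rewrite [LHS]dk_expand; apply: eq_bigr => a _; apply: eq_bigr => c _.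
  by rewrite /g /th; congr (_ * ei _); ring.
have cj j a c t : rcnt (fun t => g j a c * ei (th a c * u t)) t.
  by apply: cntM; [exact: cnt_cst|exact: cu].
have cH t : rcnt Hc t.
  apply: cntM; first exact: cnt_cst.
  by apply: cnt_sum => j _; apply: cnt_sum => a _; apply: cnt_sum => c _; exact: cj.
split.
  move=> t; have : rcnt (fun t => ((fejer S (u t / b))%:C)%C) t.
    apply: (@cnt_ext _ _ _ Hc) => //; first by exists 1 => // h _; rewrite HE.
    exact: cH.
  by move=> /rcnt_Re.
have -> : \int[mu]_(t in `[T, (2 * T)]) fejer S (u t / b) = complex.Re (cint T (2 * T) Hc).
  by rewrite -(@eq_cint _ _ _ (fun t => ((fejer S (u t / b))%:C)%C)).
rewrite /Hc cintZ; last first.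
  by move=> t _; apply: cnt_sum => j _; apply: cnt_sum => a _; apply: cnt_sum => c _; exact: cj.
rewrite ReZl cint_sum; last first.
  by move=> j _ t _; apply: cnt_sum => a _; apply: cnt_sum => c _; exact: cj.
have [I IE] : exists I : 'I_N -> C, forall j, cint T (2 * T)
    (fun t => \sum_(a < N) \sum_(c < N) g j a c * ei (th a c * u t)) = I j.
  by exists (fun j => cint T (2 * T) (fun t => \sum_(a < N) \sum_(c < N) g j a c * ei (th a c * u t))).
rewrite (eq_bigr _ (fun j _ => IE j)) Re_sum.
have Ib j : complex.Re (I j) <= N%:R * T + N%:R ^+ 2 * (e1 * T).
  rewrite -IE cint_sum; last by move=> a _ t _; apply: cnt_sum => c _; exact: cj.
  have -> : N%:R * T + N%:R ^+ 2 * (e1 * T) = \sum_(a < N) (T + N%:R * (e1 * T)).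
    by rewrite sumr_const card_ord -[X in _ = X]mulr_natl; ring.
  have [I2 I2E] : exists I2 : 'I_N -> 'I_N -> C, forall a c,
      cint T (2 * T) (fun t => g j a c * ei (th a c * u t)) = I2 a c.
    by exists (fun a c => cint T (2 * T) (fun t => g j a c * ei (th a c * u t))).
  have -> : \sum_(a < N) cint T (2 * T) (fun t => \sum_(c < N) g j a c * ei (th a c * u t)) =
      \sum_(a < N) \sum_(c < N) I2 a c.
    apply: eq_bigr => a _; rewrite cint_sum; last by move=> c _ t _; exact: cj.
    by apply: eq_bigr => c _; exact: I2E.
  rewrite Re_sum; apply: ler_sum => a _.
  rewrite Re_sum (bigD1 a)//=; apply: lerD.
    rewrite -I2E (@eq_cint _ _ _ _ (fun=> 1)); last first.
      by move=> t _; rewrite /g /th !subrr rootu0 mulr0z mulr0 !mul0r ei0 mulr1.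
    rewrite cint_cst; last by lra.
    by rewrite ReZl /=; lra.
  apply: (@le_trans _ _ (\sum_(c < N) e1 * T)); last by rewrite sumr_const card_ord mulr_natl.
  rewrite [X in X <= _]big_mkcond; apply: ler_sum => c _; case: ifP => [ca|_]; last first.
    by rewrite mulr_ge0// ltW.
  apply: (le_trans (ler_norm _)); apply: (le_trans (Re_le_nc _)).
  rewrite -I2E cintZ; last by move=> t _; exact: cu.
  rewrite normcM nc_rootu mul1r; apply: mean; first by have := ltn_ord a; have := ltn_ord c; lia.
  by rewrite subr_eq0 eqz_nat val_eqE eq_sym ca.
apply: (@le_trans _ _ ((N%:R ^+ 2)^-1 * \sum_(j < N | S j) (N%:R * T + N%:R ^+ 2 * (e1 * T)))).
  by rewrite ler_wpM2l ?invr_ge0 ?exprn_ge0// ler_sum.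
have -> : \sum_(j < N | S j) (N%:R * T + N%:R ^+ 2 * (e1 * T)) =
    (\sum_(j < N | S j) 1) * (N%:R * T + N%:R ^+ 2 * (e1 * T)).
  by rewrite mulr_suml; apply: eq_bigr => j _; rewrite mul1r.
rewrite le_eqVlt; apply/orP; left; apply/eqP; move: (\sum_(j < N | S j) 1) => s.
by field; rewrite gt_eqF.
Qed.

Lemma bad_intervals (zs : seq R) : exists B : set R, [/\ measurable B,
  (mu B <= (5 * (size zs)%:R)%:E)%E & forall t z, z \in zs -> `|t - z| <= 5/2 -> B t].
Proof.
elim: zs => [|z zs [B [mB muB Bt]]].
  by exists set0; split => //; rewrite measure0 mulr0.
exists (`[z - 5/2, z + 5/2] `|` B); split.
- exact: measurableU.
- apply: (@le_trans _ _ (mu `[(z - 5/2)%R, (z + 5/2)%R]%classic + mu B)%E); first exact: measureU2.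
  rewrite lebesgue_measure_itv /= lte_fin ifT; last by lra.
  rewrite -EFinB; have -> : 5 * (size (z :: zs))%:R = 5 + 5 * (size zs)%:R :> R.
    by rewrite /= -natr1; ring.
  rewrite [X in (_ <= X)%E]EFinD; apply: leeD => //; rewrite lee_fin; lra.
- move=> t z'; rewrite inE => /orP[/eqP ->|z'zs] h; last by right; exact: Bt h.
  by left; rewrite /= in_itv /=; move: h; rewrite ler_norml; lra.
Qed.

(** Off the bad intervals, of length 5 each, the indicator of [E] is at most [H]. *)
Lemma measure_bound (E : set R) (H : R -> R) (zs : seq R) (T : R) :
  measurable E -> E `<=` `[T, (2 * T)] ->
  (forall t, T <= t <= 2 * T -> {for t, continuous H}) -> (forall t, 0 <= H t) ->
  (forall t, E t -> 1 <= H t \/ exists2 z, z \in zs & `|t - z| <= 5/2) ->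
  (mu E <= (\int[mu]_(t in `[T, (2 * T)]) H t + 5 * (size zs)%:R)%:E)%E.
Proof.
move=> mE ED cH H0 EH.
have [B [mB muB Bt]] := bad_intervals zs.
have iH := continuous_on_integrable cH.
apply: (@le_trans _ _ (mu ((E `\` B) `|` B))).
  apply: le_measure; rewrite ?inE//; first by apply: measurableU => //; exact: measurableD.
  by move=> t Et; have [Bt'|nBt] := pselect (B t); [right|left].
apply: (@le_trans _ _ (mu (E `\` B) + mu B)%E).
  by apply: measureU2 => //; exact: measurableD.
rewrite EFinD; apply: leeD => //.
rewrite /Rintegral fineK; last exact: integrable_fin_num.
have -> : mu (E `\` B) = (\int[mu]_(x in `[T, (2 * T)%R]%classic) (\1_(E `\` B) x)%:E)%E.
  rewrite integral_indic//; last exact: measurableD.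
  congr (mu _); apply/seteqP; split => [t [Et nB]|t [[Et nB] _]]; split => //; exact: ED.
apply: ge0_le_integral => //.
- by apply/measurable_realfun.measurable_EFinP; apply: measurable_realfun.measurable_indic; exact: measurableD.
- exact: (measurable_int mu).
- move=> t _ /=; rewrite lee_fin indicE; case: (boolP (t \in E `\` B)) => //=.
  rewrite inE => -[Et nB]; have [//|[z zzs tz]] := EH t Et.
  by exfalso; apply: nB; exact: Bt tz.
Qed.

End Fejer.


(** * Upper bounds for arcs *)

Section Equidistribution.
Variable R : realType.
Local Notation C := (R[i]).
Local Notation mu := (@lebesgue_measure R).

Lemma rcnt_nc2 (D : R -> C) t : rcnt D t -> {for t, continuous (fun t => normc (D t) ^+ 2)}.
Proof.
move=> cD; have cN : {for t, continuous (fun t => normc (D t))} by exact: rcnt_nc.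
have -> : (fun t => normc (D t) ^+ 2) = (fun t => normc (D t) * normc (D t)).
  by apply/funext => s; rewrite expr2.
exact: cvgM.
Qed.

Lemma shift_int (m : int) (N : nat) : (`|m| < N)%N -> exists2 k : nat, (k < 2 * N)%N & k%:Z - N%:Z = m.
Proof. by move=> mN; exists `|(m + N%:Z)%R|%N; lia. Qed.

(** Here [u] has a decaying characteristic function, and [v] is close to it outside few intervals,
    up to a [D] small in mean square. In the majorant [H] of the proof, the kernel part reaches 1
    when [u] is near the arc, and the part with [D] does so when [D] is too large to conclude
    (Chebyshev). *)
Lemma arc_upper (u v : R -> R -> R) (b a1 a2 e : R) :
  0 < b -> 0 <= a1 -> a1 <= a2 -> a2 <= 1 -> 0 < e ->
  (forall T th t, rcnt (fun t => ei (th * u T t)) t) ->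
  (forall th e, th != 0 -> 0 < e ->
    \forall T \near +oo, normc (cint T (2 * T) (fun t => ei (th * u T t))) <= e * T) ->
  (forall e, 0 < e -> \forall T \near +oo, exists (D : R -> C) (zs : seq R),
    [/\ forall t, rcnt D t,
        \int[mu]_(t in `[T, (2 * T)]) (normc (D t) ^+ 2) <= e * T,
        (size zs)%:R <= e * T
      & forall t, T <= t <= 2 * T ->
         (exists2 z, z \in zs & `|t - z| <= 5/2) \/ `|v T t - u T t| <= e + normc (D t)]) ->
  \forall T \near +oo, forall E : set R, measurable E -> E `<=` `[T, (2 * T)] ->
    (forall t, E t -> exists k : int, a1 <= v T t / b - k%:~R <= a2) ->
    (mu E <= ((a2 - a1 + e) * T)%:E)%E.
Proof.
move=> b0 a10 a12 a21 e0 cu mean app.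
have [ee [ee0 ee1 eee]] : exists ee : R, [/\ 0 < ee, ee <= 1 & ee <= e].
  by exists (Num.min e 1); rewrite lt_min e0 ltr01 !ge_min !lexx orbT.
(* The parameters are fixed one after the other: [kap] by the allowed loss, the grid size [N] by
   [kap], the frequency bound [e1] by the number of grid points used, and [e2], the quality of the
   approximation, by [kap]. Only then does [T] grow. *)
have [kap [kap0 kapE]] : exists kap : R, 0 < kap /\ 64 * kap = ee.
  by exists (ee / 64); split; [rewrite divr_gt0|field].
have kk : 0 < kap <= 2^-1 by rewrite kap0 /=; lra.
have c0 := cos_kap kk.
have [c cE] : exists c : R, c = 2 - 2 * cos (2 * pi * kap) by eexists.
rewrite -cE in c0.
have [N [N0 N1 N2]] : exists N : nat, [/\ (0 < N)%N, 4 / c / N%:R <= ee / 16 & 3 / N%:R <= ee / 16].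
  have q0 : 0 <= 16 * (4 / c + 3) / ee by rewrite divr_ge0 ?mulr_ge0 ?addr_ge0 ?divr_ge0// ltW.
  have := truncnS_gt (16 * (4 / c + 3) / ee); move: (Num.truncn _) => n h.
  rewrite ltr_pdivrMr// in h.
  exists n.+1; have n0 : (0 : R) < n.+1%:R by rewrite ltr0n.
  have c4 : 0 <= 4 / c by rewrite divr_ge0// ltW.
  by split => //; rewrite ler_pdivrMr//; move: (n.+1%:R : R) (4 / c) h c4 => m q h c4; move: h c4; clear; lra.
have NR : (0 : R) < N%:R by rewrite ltr0n.
pose S := near_arc a1 a2 kap (N := N).
have [Sc ScE] : exists Sc : R, Sc = \sum_(j < N | S j) 1 by eexists.
have Sc0 : 0 <= Sc by rewrite ScE sumr_ge0.
have Scb : Sc <= N%:R * (a2 - a1 + 8 * kap) + 3.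
  by rewrite ScE; exact: near_arc_count.
have ScN : Sc / N%:R <= a2 - a1 + ee / 8 + ee / 16.
  apply: (@le_trans _ _ (a2 - a1 + 8 * kap + 3 / N%:R)); last by move: N2 kapE; lra.
  rewrite ler_pdivrMr// mulrDl divfK ?gt_eqF//; move: Scb; clear; lra.
have [e1 [e10 e1E]] : exists e1 : R, 0 < e1 /\ Sc * e1 <= ee / 16.
  exists (ee / (16 * (Sc + 1))); have s1 : 0 < Sc + 1 by move: Sc0; clear; lra.
  split; first by rewrite divr_gt0// mulr_gt0.
  rewrite mulrA ler_pdivrMr ?mulr_gt0//.
  have -> : ee / 16 * (16 * (Sc + 1)) = ee * Sc + ee by field.
  by rewrite mulrC lerDl ltW.
have [kp [kp0 kpE]] : exists kp : R, 0 < kp /\ 2 * kp = b * kap.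
  by exists (b * kap / 2); split; [rewrite divr_gt0 ?mulr_gt0|field].
have kp2 : 0 < kp ^+ 2 by rewrite exprn_gt0.
have [e2 [e20 e2a e2b e2c]] : exists e2 : R, [/\ 0 < e2, e2 <= kp, e2 / kp ^+ 2 <= ee / 8 & 5 * e2 <= ee / 8].
  exists (Num.min kp (Num.min (ee / 8 * kp ^+ 2) (ee / 40))); split.
  - by rewrite !lt_min kp0 mulr_gt0 ?divr_gt0.
  - by rewrite ge_min lexx.
  - by rewrite ler_pdivrMr// !ge_min lexx orbT.
  - have -> : ee / 8 = 5 * (ee / 40) by field.
    by rewrite ler_pM2l// !ge_min lexx !orbT.
(* Only finitely many frequencies matter; indexing them by an ordinal shifted by [N] lets all bounds
   hold for the same large [T]. *)
have means : \forall T \near +oo, forall a : 'I_(2 * N),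
    (a : nat)%:Z - N%:Z != 0 ->
    normc (cint T (2 * T) (fun t => ei (2 * pi * ((a : nat)%:Z - N%:Z)%:~R / b * u T t))) <= e1 * T.
  apply: filter_forall => a; have [->|an] := eqVneq ((a : nat)%:Z - N%:Z) 0; first by near=> T.
  have th0 : 2 * pi * ((a : nat)%:Z - N%:Z)%:~R / b != 0 :> R.
    by rewrite !mulf_neq0 ?invr_eq0 ?intr_eq0// ?gt_eqF// pi_gt0.
  by have := mean _ e1 th0 e10; apply: filterS => T h _.
near=> T => E mE ED Earc.
have T0 : 0 < T by near: T; exact: pinf_gt.
have [D [zs [cD intD szs good]]] : exists (D : R -> C) (zs : seq R),
    [/\ forall t, rcnt D t,
        \int[mu]_(t in `[T, (2 * T)]) (normc (D t) ^+ 2) <= e2 * T,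
        (size zs)%:R <= e2 * T
      & forall t, T <= t <= 2 * T ->
         (exists2 z, z \in zs & `|t - z| <= 5/2) \/ `|v T t - u T t| <= e2 + normc (D t)].
  by near: T; exact: app.
have meanT (m : int) : (`|m| < N)%N -> m != 0 ->
    normc (cint T (2 * T) (fun t => ei (2 * pi * m%:~R / b * u T t))) <= e1 * T.
  move=> mN m0.
  have [k aN am] := shift_int mN.
  have : forall a : 'I_(2 * N),
    (a : nat)%:Z - N%:Z != 0 ->
    normc (cint T (2 * T) (fun t => ei (2 * pi * ((a : nat)%:Z - N%:Z)%:~R / b * u T t))) <= e1 * T.
    by near: T; exact: means.
  by move=> /(_ (Ordinal aN)) /=; rewrite am; apply.
have [cF intF] := fejer_mean S T0 b0 N0 (ltW e10) (cu T) meanT.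
have [s sE] : exists s : R, s = 1 - 4 / c / N%:R by eexists.
have s1 : 1 - ee / 16 <= s by rewrite sE; move: (4 / c / _) N1 => q; clear; lra.
have s0 : 0 < s by move: s1 ee1; clear; lra.
pose H t := s^-1 * fejer S (u T t / b) + (kp ^+ 2)^-1 * normc (D t) ^+ 2.
have cH t : {for t, continuous H}.
  apply: cvgD; apply: cvgM; [exact: cvg_cst|exact: cF|exact: cvg_cst|exact: rcnt_nc2].
have H0 t : 0 <= H t.
  by rewrite addr_ge0// mulr_ge0 ?invr_ge0 ?exprn_ge0 ?nc_ge0 ?fejer_ge0 ?ltW.
have := @measure_bound R E H zs T mE ED (fun t _ => cH t) H0.
have EH t : E t -> 1 <= H t \/ exists2 z, z \in zs & `|t - z| <= 5/2.
  move=> Et; have tT : T <= t <= 2 * T by have := ED t Et; rewrite /= in_itv.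
  have [bad|close] := good t tT; [by right|left].
  have [Dk|Dk] := leP kp (normc (D t)).
    rewrite -[X in X <= _]add0r; apply: lerD.
      by rewrite mulr_ge0 ?fejer_ge0 ?invr_ge0 ?ltW.
    by rewrite mulrC (ler_pdivlMr _ _ kp2) mul1r lerXn2r ?nnegrE ?(ltW kp0) ?nc_ge0.
  have [k hk] := Earc t Et.
  have yy : `|u T t / b - v T t / b| <= kap.
    rewrite -mulrBl normrM normfV (gtr0_norm b0) ler_pdivrMr// distrC (mulrC kap) -kpE.
    by apply: (le_trans close); move: e2a Dk; clear; lra.
  have := fejer_near N0 kk hk yy; rewrite -cE -sE -/S => fs.
  rewrite -[X in X <= _]addr0; apply: lerD.
    by rewrite mulrC ler_pdivlMr// mul1r.
  by rewrite mulr_ge0 ?invr_ge0 ?exprn_ge0 ?nc_ge0// ltW.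
move=> /(_ EH) /le_trans; apply; rewrite lee_fin.
have iF : mu.-integrable `[T, (2 * T)] (EFin \o (fun t => fejer S (u T t / b))).
  by apply: continuous_on_integrable => t _; exact: cF.
have iD : mu.-integrable `[T, (2 * T)] (EFin \o (fun t => normc (D t) ^+ 2)).
  by apply: continuous_on_integrable => t _; exact: rcnt_nc2.
have iF' : mu.-integrable `[T, (2 * T)] (EFin \o (fun t => s^-1 * fejer S (u T t / b))).
  by apply: continuous_on_integrable => t _; apply: cvgM; [exact: cvg_cst|exact: cF].
have iD' : mu.-integrable `[T, (2 * T)] (EFin \o (fun t => (kp ^+ 2)^-1 * normc (D t) ^+ 2)).
  by apply: continuous_on_integrable => t _; apply: cvgM; [exact: cvg_cst|exact: rcnt_nc2].
rewrite /H RintegralD//.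
have -> : \int[mu]_(t in `[T, (2 * T)]) (s^-1 * fejer S (u T t / b)) =
    s^-1 * \int[mu]_(t in `[T, (2 * T)]) fejer S (u T t / b) by rewrite RintegralZl.
have -> : \int[mu]_(t in `[T, (2 * T)]) ((kp ^+ 2)^-1 * normc (D t) ^+ 2) =
    (kp ^+ 2)^-1 * \int[mu]_(t in `[T, (2 * T)]) (normc (D t) ^+ 2) by rewrite RintegralZl.
have h1 : s^-1 * \int[mu]_(t in `[T, (2 * T)]) fejer S (u T t / b) <= T * (a2 - a1 + ee / 2).
  rewrite mulrC ler_pdivrMr//; apply: (le_trans intF); rewrite -ScE -mulrA ler_wpM2l ?(ltW T0)//.
  rewrite mulrDr; apply: (@le_trans _ _ (a2 - a1 + ee / 4)); first by move: ScN e1E; clear; lra.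
  have a0 : 0 <= a2 - a1 + ee / 2 by move: a12 ee0; clear; lra.
  apply: (@le_trans _ _ ((a2 - a1 + ee / 2) * (1 - ee / 16))); last by rewrite ler_wpM2l.
  have a3 : a2 - a1 <= 1 by move: a10 a21; clear; lra.
  by move: (a2 - a1) a3 a0 ee0 ee1 => x; clear; nra.
have h2 : (kp ^+ 2)^-1 * \int[mu]_(t in `[T, (2 * T)]) (normc (D t) ^+ 2) <= ee / 8 * T.
  rewrite mulrC ler_pdivrMr//; apply: (le_trans intD).
  rewrite mulrAC ler_wpM2r ?(ltW T0)// -ler_pdivrMr//.
have h3 : 5 * (size zs)%:R <= ee / 8 * T.
  by apply: (@le_trans _ _ (5 * (e2 * T))); [rewrite ler_pM2l|rewrite mulrA ler_wpM2r ?(ltW T0)].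
have h4 : ee * T <= e * T by rewrite ler_wpM2r// ltW.
apply: (le_trans (lerD (lerD h1 h2) h3)).
have e3 : 0 < ee * T by rewrite mulr_gt0.
by move: e3 h4; clear; lra.
Unshelve. all: by end_near. Qed.

End Equidistribution.


(** * The scale log log T *)

Section Scales.
Variable R : realType.

(** With [T = expR (expR x)], the variable [x] is [log log T], and the estimates compare powers of
    [x] with exponentials of multiples of [x]. *)
Lemma near_expR2 (P : set R) : (\forall x \near +oo, P (expR (expR x))) -> \forall T \near +oo, P T.
Proof.
move=> /near_ln/near_ln[M [Mr H]]; exists (Num.max M 1); split; first exact: num_real.
move=> T; rewrite gt_max => /andP[MT T1]; have := H T MT.
have T0 : 0 < T by exact: lt_trans T1.
by rewrite lnK ?posrE ?ln_gt0// lnK ?posrE.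
Qed.

Lemma near_cube (k c : R) : 0 < k -> \forall x \near +oo, c * x ^+ 3 <= expR (k * x).
Proof.
move=> k0; near=> x.
have x0 : 0 < x by near: x; exact: pinf_gt.
have xc : 24 * c / k ^+ 4 <= x by near: x; exact: pinf_ge.
have kx : 0 <= k * x by rewrite mulr_ge0// ltW.
have := expR_ge1Dxn 3 kx; rewrite [(4`!)%N]/= => h.
apply: (@le_trans _ _ ((k * x) ^+ 4 / 24)); last first.
  by apply: le_trans h; rewrite lerDr.
rewrite ler_pdivrMr ?exprn_gt0// in xc.
have -> : (k * x) ^+ 4 / 24 = x * k ^+ 4 / 24 * x ^+ 3 by ring.
rewrite ler_wpM2r ?exprn_ge0 ?(ltW x0)//.
by move: (x * _) xc => q; lra.
Unshelve. all: by end_near. Qed.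

(* The length of the Dirichlet polynomials, [exp (log T / (log log T)^2)]. *)
Definition XT (T : R) : nat := Num.truncn (expR (ln T / (ln (ln T)) ^+ 2)).

Lemma XT_bounds (x : R) : 1 <= x -> 4 * x ^+ 2 <= expR x ->
  let X := XT (expR (expR x)) in
  [/\ (0 < X)%N, ln (X%:R) <= expR x / x ^+ 2 & expR x / x ^+ 2 <= 2 * ln (X%:R)].
Proof.
move=> x1 xx X; have x0 : 0 < x by lra.
have x2 : 0 < x ^+ 2 by rewrite exprn_gt0.
have [Y YE] : exists Y, Y = expR x / x ^+ 2 by eexists.
have XE : X = Num.truncn (expR Y) by rewrite /X /XT !expRK YE.
rewrite -YE XE; have Y4 : 4 <= Y by rewrite YE ler_pdivlMr.
have E0 := expR_ge0 Y; have E1 := expR_ge1Dx Y.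
have h1 : (Num.truncn (expR Y))%:R <= expR Y by rewrite truncn_le.
have h2 := truncnS_gt (expR Y).
move: (Num.truncn (expR Y)) h1 h2 => n h1 h2; rewrite -natr1 in h2.
have n0 : (0 : R) < n%:R by lra.
split; first by rewrite -(ltr0n R).
  by rewrite -[X in _ <= X]expRK ler_ln ?posrE// ?expR_gt0.
have : expR (Y / 2) <= n%:R.
  have := expR_ge1Dx (Y / 2); have e : expR Y = expR (Y / 2) * expR (Y / 2).
    by rewrite -expRD; congr expR; field.
  rewrite e in h2; move: (expR (Y / 2)) h2 => q h2 h3; nra.
rewrite -[X in _ <= X -> _](lnK (_ : n%:R \in Num.pos)) ?posrE// ler_expR.
by move: (ln n%:R) => q; lra.
Qed.

End Scales.

(** * Decay of the characteristic function *)

Section CharacteristicFunction.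
Variable R : realType.
Local Notation C := (R[i]).
Variables (a : nat -> C) (d : nat) (al : 'I_d -> nat -> C) (L : C -> C) (delta : R).
Hypothesis al1 : forall j p, prime p -> normc (al j p) <= 1.
Hypothesis EP : euler_product al (L : R[i]^o -> R[i]^o).
Hypothesis DS : dirichlet_series a (L : R[i]^o -> R[i]^o).
Hypothesis delta01 : 0 < delta < 1.

Definition sT (T : R) : R := 2^-1 + 1 / (ln T) `^ delta.

Lemma sT_exp (x : R) : sT (expR (expR x)) = 2^-1 + expR (- (delta * x)).
Proof.
by rewrite /sT expRK /powR gt_eqF ?expR_gt0// expRK div1r -expRN.
Qed.

Definition uT (T t : R) : R := complex.Re (PX al (XT T) (sT T +i* t)%C).

Definition wc (X : nat) (s : R) (j : 'I_X.+1 * 'I_X.+1) : C :=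
  lcoef al j.1 j.2.+1 * ((expR (- s * ln (ppow j)%:R))%:C)%C.

Lemma uT_xt T t : uT T t = xt (wc (X := XT T) (sT T)) t.
Proof.
rewrite /uT /xt /PX; congr (complex.Re _); apply: eq_bigr => j _.
by rewrite ps_line mulrA.
Qed.

Lemma rcnt_uT T th t : rcnt (fun t => ei (th * uT T t)) t.
Proof.
have -> : (fun t => ei (th * uT T t)) = (fun t => ei (th * xt (wc (X := XT T) (sT T)) t)) :> (R -> C).
  by apply/funext => s; rewrite uT_xt.
exact: rcnt_ei_xt.
Qed.

Lemma ln_ppow X (j : 'I_X.+1 * 'I_X.+1) : okj j -> ln (ppow j)%:R = j.2.+1%:R * ln (j.1 : nat)%:R :> R.
Proof. by move=> /andP[pj _]; rewrite /ppow natrX lnXn ?ltr0n ?prime_gt0// mulr_natl. Qed.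

Lemma wc_bound X (s : R) p k : 2^-1 <= s -> @okj X (p, k) -> normc (wc s (p, k)) <= d%:R * qp R p ^+ k.+1.
Proof.
move=> s1 ok; have /andP[/= pp _] := ok.
rewrite /wc (normcM (lcoef _ _ _)) nc_real (ger0_norm (expR_ge0 _)); apply: ler_pM; rewrite ?nc_ge0 ?expR_ge0//.
  apply: (le_trans (nc_lcoef al1 pp (ltn0Sn k))).
  by rewrite ler_pdivrMr// ler_peMr// ler1n.
rewrite ln_ppow//= /qp -expRM_natl ler_expR.
have q0 : (0 : R) <= ln (p : nat)%:R by rewrite ln_ge0// ler1n prime_gt0.
have m0 : (0 : R) <= k.+1%:R by [].
move: (ln _) (k.+1%:R : R) q0 m0 => q m q0 m0.
have s2 : 0 <= s - 2^-1 by rewrite subr_ge0.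
by have := mulr_ge0 s2 (mulr_ge0 m0 q0); lra.
Qed.

Lemma lcoef1 p : prime p -> lcoef al p 1 = a p.
Proof.
move=> pp; rewrite /lcoef divr1 (coef_prime al1 EP DS pp).
by apply: eq_bigr => j _; rewrite expr1.
Qed.

Lemma wc0 X (s : R) (p : 'I_X.+1) : prime p ->
  normc (wc s (p, ord0 : 'I_X.+1)) ^+ 2 = normc (a p) ^+ 2 * expR (- (2 * s * ln (p : nat)%:R)).
Proof.
move=> pp; rewrite /wc (normcM (lcoef _ _ _)) nc_real (ger0_norm (expR_ge0 _)) exprMn /= lcoef1//.
by congr (_ * _); rewrite -expRM_natl /ppow /= expn1; congr expR; ring.
Qed.

Lemma nc_a p : prime p -> normc (a p) <= d%:R.
Proof.
move=> pp; rewrite -lcoef1//; apply: (le_trans (nc_lcoef al1 pp (ltn0Sn 0))).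
by rewrite divr1.
Qed.

Definition SA (n : nat) : R := \sum_(1 <= p < n.+1 | prime p) normc (a p) ^+ 2 / p%:R.

Lemma second_moment (aleph : R) (c : R[i]^o) : prime_second_moment a aleph c ->
  exists C0 : R, forall x : R, expR 1 <= x ->
    `|SA (Num.truncn x) - aleph * ln (ln x)| <= C0.
Proof.
move=> [K H]; exists (`|K| + `|complex.Re c|) => x xe.
have x2 : 2 <= x by have := expR_ge1Dx (1 : R); lra.
have l1 : 1 <= ln x by rewrite -ler_expR lnK// posrE; lra.
have := H x x2; rewrite -/(SA (Num.truncn x)) => h.
have h1 : normc ((SA (Num.truncn x))%:C%C - ((aleph * ln (ln x))%:C%C + c)) <= `|K|.
  apply: (le_trans h); apply: (@le_trans _ _ (`|K| / ln x)).
    by rewrite ler_wpM2r ?ler_norm// invr_ge0; lra.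
  by rewrite ler_pdivrMr ?ler_peMr//; lra.
have := le_trans (Re_le_nc _) h1; rewrite ReB ReD /= => h2.
have -> : SA (Num.truncn x) - aleph * ln (ln x) =
  (SA (Num.truncn x) - (aleph * ln (ln x) + complex.Re c)) + complex.Re c by ring.
by apply: (le_trans (ler_normD _ _)); rewrite lerD2r.
Qed.

Lemma V_upper X (s : R) : 2^-1 <= s ->
  \sum_(p < X.+1 | prime p) normc (wc s (p, ord0 : 'I_X.+1)) ^+ 2 <= SA X.
Proof.
move=> s1.
have -> : SA X = \sum_(p < X.+1 | prime p) normc (a p) ^+ 2 / p%:R.
  by rewrite /SA -(big_mkord (fun p => prime p) (fun p => normc (a p) ^+ 2 / p%:R)) [RHS](big_ltn_cond (ltn0Sn X)).
apply: ler_sum => p pp; rewrite wc0// ler_wpM2l ?exprn_ge0 ?nc_ge0//.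
have p0 := prime_gt0 pp.
rewrite -[X in _ <= X^-1]lnK ?posrE ?ltr0n// -expRN ler_expR lerN2 ler_peMl ?ln_ge0 ?ler1n//; lra.
Qed.

(** For [p <= Y] the condition [eta * ln Y <= 1] gives [p^(-2 eta) >= expR (-2)], so the weighted
    sum keeps a fixed share of [SA Y]. The primes below [P0] are removed at a cost of at most [d^2]
    each. *)
Lemma V_lower X Y P0 (s eta : R) : s = 2^-1 + eta -> 0 < eta -> (Y <= X)%N ->
  eta * ln Y%:R <= 1 ->
  expR (-2) * SA Y - d%:R ^+ 2 * P0%:R <=
  \sum_(p < X.+1 | prime p && (P0 <= p)%N) normc (wc s (p, ord0 : 'I_X.+1)) ^+ 2.
Proof.
move=> sE eta0 YX etaY.
pose f p := if (p <= Y)%N then expR (-2) * (normc (a p) ^+ 2 / p%:R) else 0.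
have f0 p : 0 <= f p.
  by rewrite /f; case: ifP => // _; rewrite mulr_ge0 ?expR_ge0// divr_ge0 ?exprn_ge0 ?nc_ge0.
apply: (@le_trans _ _ (\sum_(p < X.+1 | prime p && (P0 <= p)%N) f p)); last first.
  apply: ler_sum => p /andP[pp _]; rewrite /f wc0//; case: ifP => [pY|_]; last first.
    by rewrite mulr_ge0 ?expR_ge0// exprn_ge0 ?nc_ge0.
  have p0 := prime_gt0 pp.
  rewrite mulrCA ler_wpM2l ?exprn_ge0 ?nc_ge0//.
  rewrite -[X in _ * X^-1 <= _]lnK ?posrE ?ltr0n// -expRN -expRD ler_expR sE.
  have h : eta * ln (p : nat)%:R <= 1.
    apply: le_trans etaY; rewrite ler_wpM2l ?(ltW eta0)// ler_ln ?posrE ?ltr0n ?(leq_trans p0)//.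
    by rewrite ler_nat.
  by move: (ln _) h => q h; rewrite mulrDr mulrDl; move: h; rewrite mulfV// mul1r; lra.
have all : \sum_(p < X.+1 | prime p) f p = expR (-2) * SA Y.
  rewrite -(big_mkord (fun p => prime p) f) (big_ltn_cond (ltn0Sn X)) /=.
  rewrite (@big_cat_nat _ _ _ Y.+1)//= [X in _ + X]big_nat_cond [X in _ + X]big1 ?addr0; last first.
    by move=> p /andP[/andP[Yp _] _]; rewrite /f leqNgt Yp.
  rewrite /SA mulr_sumr big_nat_cond [RHS]big_nat_cond; apply: eq_bigr => p /andP[/andP[_ pY] _].
  by rewrite /f -ltnS pY.
have := all; rewrite (bigID (fun p : 'I_X.+1 => (P0 <= p)%N)) /= => <-.
rewrite lerBlDr lerD2l.
apply: (@le_trans _ _ (\sum_(p < X.+1) ((0 <= (p%:R : R)) && (p%:R <= (P0%:R - 1 : R)))%:R * d%:R ^+ 2)).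
  rewrite big_mkcond; apply: ler_sum => p _; case: ifP => [/andP[pp]|_]; last first.
    by rewrite mulr_ge0 ?exprn_ge0.
  rewrite -ltnNge => pP; have -> : (p%:R <= (P0%:R - 1 : R)).
    by rewrite lerBrDr natr1 ler_nat.
  rewrite ler0n /= mul1r /f; case: ifP => _; last by rewrite exprn_ge0.
  apply: (@le_trans _ _ (1 * normc (a p) ^+ 2)).
    have e1 : expR (-2) <= 1 :> R by rewrite expR_le1; lra.
    apply: (ler_pM _ _ e1); rewrite ?expR_ge0 ?divr_ge0 ?exprn_ge0 ?nc_ge0//.
    by rewrite ler_pdivrMr ?ltr0n ?prime_gt0// ler_peMr ?exprn_ge0 ?nc_ge0// ler1n prime_gt0.
  by rewrite mul1r lerXn2r ?nnegrE ?nc_ge0// nc_a.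
rewrite -mulr_suml mulrC ler_wpM2l ?exprn_ge0//.
have := @count_interval R 0 (P0%:R - 1) X.+1; rewrite subrK subr0 subrK; apply.
exact: ler0n.
Qed.

Hypothesis psm : exists (aleph : R) (c : R[i]^o), 0 < aleph /\ prime_second_moment a aleph c.
Local Ltac slim := clear -al1 EP DS delta01 psm.

Lemma sum_inv_sq X (P : pred 'I_X.+1) : (forall p, P p -> (0 < p)%N) ->
  \sum_(p < X.+1 | P p) ((p : nat)%:R ^+ 2)^-1 <= 2 :> R.
Proof.
move=> P0; apply: le_trans (inv_sq_sum R X).
have n0 : P ord0 = false by apply/negP => /P0.
rewrite big_mkcond big_ord_recl n0 /= add0r; apply: ler_sum => p _.
by case: ifP => _; rewrite ?invr_ge0 ?exprn_ge0// /bump leq0n add1n.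
Qed.

Lemma wc_sum X (s : R) : 2^-1 <= s -> \sum_(j | @okj X j) normc (wc s j) <= 1 + d%:R * X%:R.
Proof.
move=> s1; apply: (@le_trans _ _ (\sum_(j | @okj X j) d%:R * 1)).
  apply: ler_sum => -[p k] ok; apply: (le_trans (wc_bound s1 ok)); rewrite ler_wpM2l//.
  by rewrite exprn_ile1 ?qp_ge0//; have /andP[/= pp _] := ok; have := qp_le R (prime_gt1 pp); lra.
rewrite -mulr_sumr; apply: (@le_trans _ _ (d%:R * X%:R)); last by rewrite lerDr.
rewrite ler_wpM2l//; apply: (le_trans (@sum_ppow_le R X (fun=> 1) _)) => //.
by rewrite sumr_const_nat subn1.
Qed.

Lemma main_term (th : R) : th != 0 -> exists c1 c2 : R, 0 < c1 /\
  forall (X Y K : nat) (s eta : R), s = 2^-1 + eta -> 0 < eta -> (Y <= X)%N ->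
    eta * ln Y%:R <= 1 -> (X.+2 < K)%N ->
    normc (EE (fun phi : {ffun 'I_X.+1 -> 'I_K} => ei (th * xm (wc s) phi))) <=
    expR (- (c1 * SA Y - c2)).
Proof.
(* From [P0] on, [4 d |th| p^(-1/2) <= 1], the range in which [model_char] uses the one-prime
   estimate. *)
move=> th0; pose P0 := (Num.truncn (16 * d%:R ^+ 2 * th ^+ 2)).+1.
have th2 : 0 < th ^+ 2 by rewrite exprn_even_gt0.
exists (th ^+ 2 / 12 * expR (-2)), (th ^+ 2 / 12 * (d%:R ^+ 2 * P0%:R) + th ^+ 2 / 3 * (16 * d%:R ^+ 2 * 2)).
split; first by rewrite mulr_gt0 ?expR_gt0 ?divr_gt0.
move=> X Y K s eta sE eta0 YX etaY XK; have s1 : 2^-1 <= s by rewrite sE lerDl ltW.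
have thP p : prime p -> (P0 <= p)%N -> `|th| * (4 * d%:R * qp R p) <= 1.
  move=> pp P0p; have p0 : (0 : R) < p%:R by rewrite ltr0n prime_gt0.
  have q0 := qp_ge0 R p.
  rewrite -(ler_pXn2r (ltn0Sn 1)) ?nnegrE ?mulr_ge0// !exprMn qp_sq ?prime_gt0// real_normK ?num_real//.
  rewrite expr1n mulrA ler_pdivrMr// mul1r.
  apply: (@le_trans _ _ (P0%:R)); last by rewrite ler_nat.
  apply/ltW; apply: le_lt_trans (truncnS_gt _).
  by rewrite le_eqVlt; apply/orP; left; apply/eqP; ring.
apply: (le_trans (model_char XK (fun p k ok => wc_bound s1 ok) thP)); rewrite ler_expR lerN2.
have Vl := @V_lower X Y P0 s eta sE eta0 YX etaY.
set V := \sum_(p < X.+1 | _) _ in Vl.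
have iv : \sum_(p < X.+1 | prime p && (P0 <= p)%N) ((p : nat)%:R ^+ 2)^-1 <= 2 :> R.
  by apply: sum_inv_sq => p /andP[/prime_gt0].
have -> : \sum_(p < X.+1 | prime p && (P0 <= p)%N) th ^+ 2 / 3 *
     (normc (wc s (p, ord0)) ^+ 2 / 4 - 16 * d%:R ^+ 2 / p%:R ^+ 2) =
   th ^+ 2 / 12 * V - th ^+ 2 / 3 * (16 * d%:R ^+ 2 *
     \sum_(p < X.+1 | prime p && (P0 <= p)%N) ((p : nat)%:R ^+ 2)^-1).
  rewrite /V !mulr_sumr -sumrB; apply: eq_bigr => p _.
  by move: (normc _ ^+ 2) ((p%:R ^+ 2)^-1) => A B; field.
have h1 := ler_wpM2l (ltW (divr_gt0 th2 (ltr0n R 12))) Vl.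
have h2 : th ^+ 2 / 3 * (16 * d%:R ^+ 2 *
     \sum_(p < X.+1 | prime p && (P0 <= p)%N) ((p : nat)%:R ^+ 2)^-1) <= th ^+ 2 / 3 * (16 * d%:R ^+ 2 * 2).
  by rewrite ler_wpM2l ?divr_ge0 ?(ltW th2)// ler_wpM2l// mulr_ge0// exprn_ge0.
move: h1 h2; move: (th ^+ 2 / 3 * (16 * d%:R ^+ 2 * \sum_(_ < _ | _) _)) => B.
by rewrite mulrBr mulrA; lra.
Qed.

Lemma tail_term (y : R) : exists c3 c4 : R, 0 <= c3 /\
  forall (X K : nat) (s : R), 2^-1 <= s -> (X.+2 < K)%N ->
    ER (fun phi : {ffun 'I_X.+1 -> 'I_K} => expR (y * xm (wc s) phi)) <= expR (c3 * SA X + c4).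
Proof.
pose c3 := 2 * y ^+ 2 * expR (`|y| * (4 * d%:R)).
have c30 : 0 <= c3 by apply: mulr_ge0 (expR_ge0 _); apply: mulr_ge0 => //; exact: sqr_ge0.
exists c3, (c3 * (32 * d%:R ^+ 2 * 2)); split => // X K s s1 XK.
apply: (le_trans (model_exp XK (fun p k ok => wc_bound s1 ok) y)); rewrite ler_expR -/c3 -mulr_sumr -mulrDr.
rewrite ler_wpM2l// big_split /=; apply: lerD; first exact: V_upper.
rewrite -mulr_sumr ler_wpM2l ?mulr_ge0 ?exprn_ge0//.
by apply: sum_inv_sq => p /prime_gt0.
Qed.

Lemma quarter_exp N : (4 ^+ N)^-1 <= expR (- N%:R) :> R.
Proof.
have h : 2^-1 <= expR (- 2^-1) :> R by apply: le_trans (expR_ge1Dx _); lra.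
have -> : - N%:R = N%:R * (- 2^-1 + - 2^-1) :> R by field.
rewrite expRM_natl expRD -exprVn lerXn2r ?nnegrE ?invr_ge0 ?mulr_ge0 ?expR_ge0//.
have -> : 4^-1 = 2^-1 * 2^-1 :> R by field.
by apply: ler_pM; rewrite ?invr_ge0.
Qed.

(** The base is at most a constant times [X^2], so the logarithm of the power is about
    [4 * N * ln X <= 8 * M * expR x / x]. One factor [x] of the [x ^+ 2] in [XT] pays for [N], the
    other makes this [o(ln T)]. *)
Lemma error_term (th e M : R) : 0 < e -> 1 <= M -> \forall x \near +oo, forall (X N : nat),
  (0 < X)%N -> ln X%:R <= expR x / x ^+ 2 -> N%:R <= M * x + 1 ->
  ((2 * N).+1)%:R * (2 * ((1 + `|th|) * X%:R * (1 + d%:R * X%:R)) ^+ (2 * N)) <=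
  e * expR (expR x).
Proof.
move=> e0 M1.
have base0 : 0 < (1 + `|th|) * (1 + d%:R) by rewrite mulr_gt0 ?ltr_wpDr.
pose b1 := ln ((1 + `|th|) * (1 + d%:R)).
have b10 : 0 <= b1 by rewrite ln_ge0// mulr_ege1// lerDl.
near=> x => X N X0 Xu Nx.
have x1 : 1 <= x by near: x; exact: pinf_ge.
have xM : 32 * M <= x by near: x; exact: pinf_ge.
have xc : 8 * M * (5 + 2 * b1) * x ^+ 3 <= expR (1 * x) by near: x; exact: near_cube.
have xe : 2 / e <= x by near: x; exact: pinf_ge.
rewrite mul1r in xc.
have XR : (0 : R) < X%:R by rewrite ltr0n.
have X1 : (1 : R) <= X%:R by rewrite ler1n.
have x0 : 0 < x by lra.
have [l lE] : exists l, l = expR x by eexists.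
rewrite -lE in xc Xu *.
have lx : x <= l by rewrite lE; apply: le_trans (expR_ge1Dx x); rewrite lerDr.
have l0 : 0 < l by exact: lt_le_trans lx.
have N0 : (0 : R) <= N%:R by [].
have Nx2 : N%:R <= 2 * M * x.
  by apply: (le_trans Nx); have := mulr_ege1 M1 x1; lra.
have bb : (1 + `|th|) * X%:R * (1 + d%:R * X%:R) <= expR (b1 + 2 * ln X%:R).
  rewrite expRD lnK ?posrE// -[2 * ln X%:R]/(2%:R * ln X%:R) expRM_natl lnK ?posrE//.
  have h : 1 + d%:R * X%:R <= (1 + d%:R) * X%:R :> R by rewrite (mulrDl 1) mul1r lerD2r.
  have h0 : 0 <= (1 + `|th|) * X%:R by rewrite mulr_ge0// addr_ge0.
  apply: (le_trans (ler_wpM2l h0 h)).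
  by rewrite le_eqVlt; apply/orP; left; apply/eqP; ring.
have b0 : 0 <= (1 + `|th|) * X%:R * (1 + d%:R * X%:R) by rewrite !mulr_ge0// ?addr_ge0 ?mulr_ge0.
apply: (@le_trans _ _ (expR (4 * N%:R + 1 + 2 * N%:R * (b1 + 2 * ln X%:R)))).
  have -> : 2 * N%:R * (b1 + 2 * ln X%:R) = (2 * N)%:R * (b1 + 2 * ln X%:R) by rewrite natrM.
  rewrite expRD expRM_natl mulrA; apply: ler_pM; rewrite ?mulr_ge0 ?exprn_ge0//.
    apply: (le_trans _ (expR_ge1Dx _)); rewrite -natr1 natrM; lra.
  by rewrite lerXn2r ?nnegrE ?expR_ge0.
have h1 : 4 * N%:R + 1 + 2 * N%:R * (b1 + 2 * ln X%:R) <= l / 2.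
  have g1 : 4 * (N%:R * ln X%:R) <= l / 4.
    apply: (@le_trans _ _ (4 * (2 * M * x * (l / x ^+ 2)))).
      by rewrite ler_pM2l// ler_pM ?ln_ge0.
    have -> : 4 * (2 * M * x * (l / x ^+ 2)) = 8 * M * l / x by field; rewrite gt_eqF.
    rewrite ler_pdivrMr//; have := ler_wpM2r (ltW l0) xM; lra.
  have g2 : N%:R * (4 + 2 * b1) + 1 <= l / 4.
    have s1 : N%:R * (4 + 2 * b1) <= 2 * M * x * (4 + 2 * b1) by rewrite ler_wpM2r//; lra.
    have s2 : 2 * M * x * (5 + 2 * b1) <= l / 4.
      have x3 : x <= x ^+ 3 by rewrite exprS ler_peMr ?exprn_ege1 ?ltW.
      have k0 : 0 <= 8 * M * (5 + 2 * b1) by rewrite !mulr_ge0//; move: M1 b10; slim; lra.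
      by have := ler_wpM2l k0 x3; move: xc; slim; lra.
    have s3 : 1 <= M * x by exact: mulr_ege1.
    by move: s1 s2 s3; slim; lra.
  by move: g1 g2; slim; lra.
apply: (@le_trans _ _ (expR (l / 2))); first by rewrite ler_expR.
have -> : expR l = expR (l / 2) * expR (l / 2) by rewrite -expRD; congr expR; field.
rewrite mulrA ler_peMl ?expR_ge0//.
apply: (@le_trans _ _ (e * (l / 2))).
  rewrite mulrA ler_pdivlMr// mul1r mulrC -ler_pdivrMr//; exact: le_trans lx.
by rewrite ler_wpM2l ?(ltW e0)//; apply: le_trans (expR_ge1Dx _); rewrite lerDr.
Unshelve. all: by end_near. Qed.

Lemma charlim th e : th != 0 -> 0 < e ->
  \forall T \near +oo, normc (cint T (2 * T) (fun t => ei (th * uT T t))) <= e * T.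
Proof.
move=> th0 e0; apply: near_expR2.
have [aleph [c [al0 /second_moment[C0 HC]]]] := psm.
have [c1 [c2 [c10 main]]] := main_term th0.
have th0' : 0 < `|th| by rewrite normr_gt0.
(* Twice the frequency, so that [|th| ^+ (2 * N)] is [y ^+ (2 * N) / 4 ^+ N] and [moment_exp] yields
   a gain of [4 ^+ N]. *)
have [y [y0 yE]] : exists y : R, 0 < y /\ y = 2 * `|th| by exists (2 * `|th|); rewrite mulr_gt0.
have [c3 [c4 [c30 tl]]] := tail_term y.
have [c5 [c6 [c50 tl']]] := tail_term (- y).
(* The Laplace transforms grow at most like [expR (c3 * aleph * x)] and [expR (c5 * aleph * x)];
   with [N >= M * x] the gain [expR (- N)] beats them by a further factor [expR x]. *)
have [M [M1 M3 M5]] : exists M : R, [/\ 1 <= M, c3 * aleph + 1 <= M & c5 * aleph + 1 <= M].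
  have u3 := mulr_ge0 c30 (ltW al0); have u5 := mulr_ge0 c50 (ltW al0).
  by exists (c3 * aleph + c5 * aleph + 1); split; lra.
have /andP[de0 de1] := delta01.
near=> x.
have x1 : 1 <= x by near: x; exact: pinf_ge.
have x0 : 0 < x by lra.
have xx4 : 4 * x ^+ 3 <= expR (1 * x) by near: x; exact: near_cube.
have xx1 : 1 * x ^+ 3 <= expR ((1 - delta) * x) by near: x; apply: near_cube; rewrite subr_gt0.
have x23 : x ^+ 2 <= x ^+ 3 by rewrite ler_weXn2l.
rewrite mul1r in xx1; rewrite mul1r in xx4.
have xx : 4 * x ^+ 2 <= expR x by apply: le_trans xx4; rewrite ler_pM2l.
have [X0 Xu Xl] := XT_bounds x1 xx.
have sE := sT_exp x.
have eta0 : 0 < expR (- (delta * x)) by exact: expR_gt0.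
have s1 : 2^-1 <= sT (expR (expR x)) by rewrite sE lerDl ltW.
have HX := HC (expR (expR x / x ^+ 2)).
have XE : XT (expR (expR x)) = Num.truncn (expR (expR x / x ^+ 2)) by rewrite /XT !expRK.
rewrite -XE in HX.
have cb (K : nat) S N (K2 : ((XT (expR (expR x))).+2 < K)%N) :=
  @charfun_bound R (XT (expR (expR x))) K (wc (sT (expR (expR x)))) K2 (expR (expR x)) th S N.
have -> : (fun t => ei (th * uT (expR (expR x)) t)) =
    (fun t => ei (th * xt (wc (X := XT (expR (expR x))) (sT (expR (expR x)))) t)) :> (R -> C).
  by apply/funext => t; rewrite uT_xt.
(* [Y] is cut where [eta * ln Y] reaches 1, that is at [ln Y = (ln T) ^ delta], and [SA Y] still
   grows like [aleph * delta * x]. The inequality [Y <= X] rests on [delta < 1]. *)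
have YX : (Num.truncn (expR (expR (delta * x))) <= XT (expR (expR x)))%N.
  rewrite XE; apply: le_truncn; rewrite ler_expR ler_pdivlMr ?exprn_gt0//.
  have -> : expR x = expR (delta * x) * expR ((1 - delta) * x) by rewrite -expRD; congr expR; ring.
  by rewrite ler_wpM2l ?expR_ge0//; exact: le_trans xx1.
have HY := HC (expR (expR (delta * x))).
have dx0 : 0 <= delta * x by rewrite mulr_ge0// ltW.
have e1 : 1 <= expR (delta * x) by rewrite -expR0 ler_expR.
have Y0 : (0 < Num.truncn (expR (expR (delta * x))))%N.
  by rewrite truncn_gt0 -expR0 ler_expR expR_ge0.
have etaY : expR (- (delta * x)) * ln (Num.truncn (expR (expR (delta * x))))%:R <= 1.
  rewrite expRN mulrC ler_pdivrMr ?expR_gt0// mul1r -[X in _ <= X]expRK.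
  by rewrite ler_ln ?posrE ?ltr0n ?expR_gt0// truncn_le expR_ge0.
have {}main K := main (XT (expR (expR x))) _ K (sT (expR (expR x))) _ sE eta0 YX etaY.
have {}HY : aleph * (delta * x) - C0 <= SA (Num.truncn (expR (expR (delta * x)))).
  by have := HY _; rewrite !expRK ler_expR => /(_ e1); rewrite ler_norml => /andP[h _]; move: h; slim; lra.
have {}HX : SA (XT (expR (expR x))) <= aleph * x + C0.
  have x20 : 0 < x ^+ 2 by rewrite exprn_gt0.
  have := HX _; rewrite ler_expR !expRK ler_pdivlMr// mul1r => h.
  have {}h := h (le_trans (_ : x ^+ 2 <= 4 * x ^+ 2) xx); have := h _.
  move=> /(_ ltac:(by rewrite ler_peMl// ?exprn_ge0 ?ltW//; slim; lra)); rewrite ler_norml => /andP[_ h2].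
  have lnx : ln (expR x / x ^+ 2) <= x.
    rewrite -[X in _ <= X]expRK ler_ln ?posrE ?expR_gt0 ?divr_gt0 ?expR_gt0//.
    by rewrite ler_pdivrMr// ler_peMr ?expR_ge0// exprn_ege1.
  by have := ler_wpM2l (ltW al0) lnx; move: h2; slim; lra.
have tlX K := tl (XT (expR (expR x))) K (sT (expR (expR x))) s1.
have tlX' K := tl' (XT (expR (expR x))) K (sT (expR (expR x))) s1.
have wS := wc_sum (XT (expR (expR x))) s1.
have err : forall (X N : nat),
  (0 < X)%N -> ln X%:R <= expR x / x ^+ 2 -> N%:R <= M * x + 1 ->
  ((2 * N).+1)%:R * (2 * ((1 + `|th|) * X%:R * (1 + d%:R * X%:R)) ^+ (2 * N)) <=
  e / 3 * expR (expR x).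
  by near: x; apply: error_term => //; rewrite divr_gt0.
have xa : (c1 * C0 + c2 - ln (e / 3)) / (c1 * aleph * delta) <= x by near: x; exact: pinf_ge.
have xb : c3 * C0 + c4 - ln (e / 12) <= x by near: x; exact: pinf_ge.
have xd : c5 * C0 + c6 - ln (e / 12) <= x by near: x; exact: pinf_ge.
have {}err := err _ _ X0 Xu.
move: (XT (expR (expR x))) (sT (expR (expR x))) (Num.truncn (expR (expR (delta * x))))
  X0 Xu Xl sE s1 XE cb YX Y0 etaY main HY HX tlX tlX' wS err => X s Y X0 Xu Xl sE s1 XE cb YX Y0 etaY main HY HX tlX tlX' wS err.
have T0 : 0 < expR (expR x) := expR_gt0 _.
move: (expR (expR x)) T0 cb err => T T0 cb err.
have Mx0 : 0 <= M * x := mulr_ge0 (le_trans ler01 M1) (ltW x0).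
have [N [N0 N1 N2]] : exists N : nat, [/\ (0 < N)%N, M * x <= N%:R & N%:R <= M * x + 1].
  exists (Num.truncn (M * x)).+1; split => //; first exact/ltW/truncnS_gt.
  by rewrite -natr1 lerD2r truncn_le.
have [K [K2 NK]] : exists K : nat, (X.+2 < K)%N /\ ((2 * N) * X.+1 < K)%N.
  by exists ((2 * N) * X.+1 + X.+2).+1; rewrite !ltnS leq_addl leq_addr.
have S1 : 1 <= 1 + d%:R * X%:R :> R by rewrite lerDl mulr_ge0.
apply: (le_trans (cb K _ N K2 T0 X0 S1 wS NK)).
have t1 : T * normc (EE (fun phi : {ffun 'I_X.+1 -> 'I_K} => ei (th * xm (wc s) phi))) <= e / 3 * T.
  rewrite mulrC ler_wpM2r ?(ltW T0)//; apply: (le_trans (main K K2)).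
  rewrite -[X in _ <= X]lnK ?posrE ?divr_gt0// ler_expR.
  have ca : 0 < c1 * aleph * delta by rewrite !mulr_gt0.
  rewrite ler_pdivrMr// in xa; have := ler_wpM2l (ltW c10) HY.
  by move: (ln _) xa => q; slim; lra.
have bnd (c7 c8 : R) : 0 <= c7 -> c7 * aleph + 1 <= M -> c7 * C0 + c8 - ln (e / 12) <= x ->
    (4 ^+ N)^-1 * expR (c7 * SA X + c8) <= e / 12.
  move=> c70 cM cx; apply: (@le_trans _ _ (expR (- N%:R) * expR (c7 * SA X + c8))).
    by rewrite ler_wpM2r ?expR_ge0 ?quarter_exp.
  rewrite -expRD -[X in _ <= X]lnK ?posrE ?divr_gt0// ler_expR.
  have g1 := ler_wpM2l c70 HX; have g2 := ler_wpM2r (ltW x0) cM.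
  by move: g1 g2 N1 cx; move: (ln _) (SA X) (N%:R : R) => q q1 q2; slim; lra.
have t2 : 2 * T * (`|th| ^+ (2 * N) / ((2 * N)`!)%:R *
    ER (fun phi : {ffun 'I_X.+1 -> 'I_K} => xm (wc s) phi ^+ (2 * N))) <= e / 3 * T.
  have me := @moment_exp R X K (wc s) y N y0 N0.
  have -> : `|th| ^+ (2 * N) = (4 ^+ N)^-1 * y ^+ (2 * N).
    rewrite yE exprMn mulrA [X in _ = _ * X * _]exprM.
    have -> : 2 ^+ 2 = 4 :> R by rewrite expr2; ring.
    by rewrite mulVf ?mul1r// expf_neq0.
  rewrite -!mulrA (mulrA (y ^+ _)).
  have q0 : 0 <= (4 ^+ N)^-1 :> R by rewrite invr_ge0 exprn_ge0.
  have g1 := bnd _ _ c30 M3 xb; have g2 := bnd _ _ c50 M5 xd.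
  have g3 := ler_wpM2l q0 (le_trans me (lerD (tlX K K2) (tlX' K K2))).
  rewrite mulrDr in g3.
  have g4 := le_trans g3 (lerD g1 g2).
  have -> : e * (3^-1 * T) = 2 * (T * (e / 12 + e / 12)) by field.
  by rewrite ler_pM2l// ler_wpM2l ?(ltW T0).
have t3 := err N N2.
apply: (le_trans (lerD (lerD t1 t2) t3)).
by rewrite -!mulrDl le_eqVlt; apply/orP; left; apply/eqP; field.
Unshelve. all: by end_near. Qed.

End CharacteristicFunction.


Lemma expN_le (R : realType) (x : R) : 0 < x -> expR (- x) <= x^-1.
Proof.
move=> x0; rewrite expRN lef_pV2 ?posrE ?expR_gt0//.
by apply: le_trans (expR_ge1Dx x); rewrite lerDr.
Qed.

Lemma small_exp (R : realType) (c e : R) : 0 <= c -> 0 < e ->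
  \forall x \near +oo, c * expR (- x) <= e.
Proof.
move=> c0 e0; near=> x; have x0 : 0 < x by near: x; exact: pinf_gt.
have xc : c / e <= x by near: x; exact: pinf_ge.
apply: (le_trans (ler_wpM2l c0 (expN_le x0))).
by rewrite ler_pdivrMr// mulrC -ler_pdivrMr.
Unshelve. all: by end_near. Qed.

Lemma ln3T (R : realType) (x : R) : 0 <= x ->
  expR x <= ln (3 * expR (expR x)) <= 3 * expR x.
Proof.
move=> x0; rewrite lnM ?posrE ?expR_gt0// expRK.
have h1 : 0 <= ln (3 : R) by rewrite ln_ge0//; lra.
have h2 : ln (3 : R) <= 2 by apply: (le_trans (ln_le_sub1 _)); lra.
have := expR_ge1Dx x; move: (ln 3) (expR x) h1 h2 => p q h1 h2 h3.
by apply/andP; split; lra.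
Qed.

Lemma small_polynomial (R : realType) (g D : R) (N X : nat) : 0 < g -> 0 <= D -> X%:R = expR g ->
  N%:R <= g / 4 -> N%:R * (16 * D / X%:R * 4 ^+ N) <= 64 * D / g.
Proof.
move=> g0 D0 Xg Nu.
have XR : (0 : R) < X%:R by rewrite Xg expR_gt0.
apply: (@le_trans _ _ (16 * D * expR (- (g / 4)))).
  have -> : N%:R * (16 * D / X%:R * 4 ^+ N) = 16 * D * (N%:R * 4 ^+ N / X%:R) by ring.
  rewrite ler_wpM2l ?mulr_ge0//.
  apply: (@le_trans _ _ (expR (3 * N%:R) / X%:R)).
    rewrite ler_wpM2r ?invr_ge0 ?(ltW XR)//.
    apply: (@le_trans _ _ (2 ^+ N * 4 ^+ N)).
      by rewrite ler_wpM2r ?exprn_ge0// -natrX ler_nat ltnW// ltn_expl.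
    have two : 2 <= expR 1 :> R by have := expR_ge1Dx (1 : R); lra.
    rewrite -exprMn (mulrC 3) expRM_natl lerXn2r ?nnegrE ?expR_ge0 ?mulr_ge0//.
    have -> : expR 3 = expR 1 ^+ 3 :> R by rewrite -expRM_natl mulr1.
    have -> : 2 * 4 = 2 ^+ 3 :> R by rewrite !exprS expr0; ring.
    by rewrite lerXn2r ?nnegrE ?expR_ge0.
  rewrite Xg -expRN -expRD ler_expR; move: (N%:R : R) Nu => n Nu; lra.
have g4 : 0 < g / 4 by rewrite divr_gt0.
apply: (le_trans (ler_wpM2l (mulr_ge0 (ler0n R 16) D0) (expN_le g4))).
by rewrite le_eqVlt; apply/orP; left; apply/eqP; field; rewrite gt_eqF.
Qed.

(** Here [x = ln l], [l = ln T], [i = 1 / l], [g = ln X], [q = ln (3 T)], and [W] is the Taylor tail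
    factor. The cube in [W <= 5 * i ^+ 3] absorbs the factor [q] from the size of [ln |L|] and the
    factor [1 + g] from the mean square, and still leaves a power of [i]. *)
Lemma numeric_core (R : realType) (eta x l i g q A D e T W : R) (N X : nat) :
  0 < e -> 0 <= A -> 0 <= D -> 0 < T -> 2 <= x -> 1 <= l -> 0 < i -> i <= 1 -> l * i = 1 ->
  0 <= q -> q <= 3 * l -> 8 * x <= g -> g <= l / x ^+ 2 -> X%:R = expR g -> T = expR l ->
  N%:R <= g / 4 -> 0 <= W -> W <= 5 * i ^+ 3 ->
  (30 * A + 40 * D) * i <= e / 3 -> 100 * D ^+ 2 * i <= e -> 64 * D / (e / 3) <= x ->
  4 * D / X%:R + N%:R * (16 * D / X%:R * 4 ^+ N) + 2 * (A * q + 4 * D) * W <= e /\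
  (D * W) ^+ 2 * (T * (1 + g) + 2 * X%:R ^+ 3) <= e * T.
Proof.
move=> e0 A0 D0 T0 x2 l1 i0 i1 li q0 q2 gx Xu Xg TE Nu W0 W1 sm1 sm2 sm3.
have e3 : 0 < e / 3 by rewrite divr_gt0.
have x0 : 0 < x by exact: lt_le_trans x2.
have g0 : 0 < g by apply: lt_le_trans gx; rewrite mulr_gt0.
have x20 : 0 < x ^+ 2 by rewrite exprn_gt0.
have XR : (0 : R) < X%:R by rewrite Xg expR_gt0.
have i2 : i ^+ 2 <= i by rewrite expr2 ler_piMl ?(ltW i0).
have i3 : i ^+ 3 <= i by apply: le_trans i2; rewrite exprS ler_piMl ?exprn_ge0 ?(ltW i0).
have xg : x <= g by apply: le_trans gx; rewrite ler_peMl ?(ltW x0)//; clear; lra.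
have Dx : 64 * D <= e / 3 * x by move: sm3; rewrite ler_pdivrMr// (mulrC x).
have Dg : 64 * D <= e / 3 * g by apply: (le_trans Dx); rewrite ler_pM2l.
split.
  have t1 : 4 * D / X%:R <= e / 3.
    have gX : g <= X%:R by rewrite Xg; apply: le_trans (expR_ge1Dx g); rewrite lerDr.
    rewrite ler_pdivrMr//; apply: (@le_trans _ _ (e / 3 * g)); last by rewrite ler_pM2l.
    by apply: le_trans Dg; rewrite ler_wpM2r//; clear; lra.
  have t2 : N%:R * (16 * D / X%:R * 4 ^+ N) <= e / 3.
    apply: (le_trans (small_polynomial g0 D0 Xg Nu)); rewrite ler_pdivrMr//.
  have t3 : 2 * (A * q + 4 * D) * W <= e / 3.
    apply: le_trans sm1.
    apply: (@le_trans _ _ (2 * (A * (3 * l) + 4 * D) * (5 * i ^+ 3))).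
      apply: ler_pM => //; first by rewrite mulr_ge0// addr_ge0 ?mulr_ge0.
      by rewrite ler_pM2l// lerD2r ler_wpM2l.
    have -> : 2 * (A * (3 * l) + 4 * D) * (5 * i ^+ 3) =
      30 * A * ((l * i) * i ^+ 2) + 40 * D * i ^+ 3 by ring.
    by rewrite li mul1r (mulrDl (30 * A)); apply: lerD; rewrite ler_wpM2l// mulr_ge0.
  by move: t1 t2 t3; clear => t1 t2 t3; lra.
have lx : l / x ^+ 2 <= l / 3.
  rewrite ler_wpM2l ?lef_pV2 ?posrE//; first exact: le_trans l1.
  apply: (@le_trans _ _ (2 ^+ 2)); first by clear; rewrite expr2; lra.
  by rewrite lerXn2r ?nnegrE ?(ltW x0).
have X3 : X%:R ^+ 3 <= T.
  rewrite Xg TE -expRM_natl ler_expR.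
  by move: Xu lx; clear => Xu lx; lra.
have gl : g <= l by move: Xu lx l1; clear => Xu lx l1; lra.
apply: (@le_trans _ _ ((D * (5 * i ^+ 3)) ^+ 2 * (4 * l * T))).
  apply: ler_pM.
  - by rewrite exprn_ge0// mulr_ge0.
  - by rewrite addr_ge0 ?mulr_ge0 ?exprn_ge0 ?addr_ge0 ?(ltW T0) ?(ltW g0).
  - by rewrite lerXn2r ?nnegrE ?mulr_ge0 ?exprn_ge0 ?(ltW i0)// ler_wpM2l.
  - have h1 : T * (1 + g) <= T * (1 + l) by rewrite ler_pM2l// lerD2l.
    have h2 : T * 3 <= T * (3 * l) by rewrite ler_pM2l// ler_peMr.
    by move: h1 h2 X3; move: (X%:R ^+ 3) => Y; clear => h1 h2 X3; lra.
have -> : (D * (5 * i ^+ 3)) ^+ 2 * (4 * l * T) =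
   100 * D ^+ 2 * ((l * i) * (i ^+ 3 * i ^+ 2)) * T by ring.
rewrite li mul1r ler_wpM2r ?(ltW T0)//; apply: le_trans sm2.
rewrite ler_wpM2l ?mulr_ge0 ?exprn_ge0// (le_trans _ i3)// ler_piMr ?exprn_ge0 ?(ltW i0)//.
exact: le_trans i1.
Qed.

Lemma numeric_choice (R : realType) (delta A e : R) (d : nat) : 0 < delta < 1 -> 0 <= A -> 0 < e ->
  \forall x \near +oo, forall X : nat,
  (0 < X)%N -> ln X%:R <= expR x / x ^+ 2 -> expR x / x ^+ 2 <= 2 * ln X%:R ->
  exists2 N : nat, (0 < N)%N &
  let eta := expR (- (delta * x)) in let T := expR (expR x) in
  let W := expR (- (eta * N%:R / 5)) * (5 / eta) in
  4 * d%:R / X%:R + N%:R * (16 * d%:R / X%:R * 4 ^+ N) +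
    2 * (A * ln (3 * T) + 4 * d%:R) * W <= e /\
  (d%:R * W) ^+ 2 * (T * (1 + ln X%:R) + 2 * X%:R ^+ 3) <= e * T.
Proof.
move=> /andP[de0 de1] A0 e0.
near=> x => X X0 Xu Xl.
have x2 : 2 <= x by near: x; exact: pinf_ge.
have x0 : 0 < x by exact: lt_le_trans x2.
have x20 : 0 < x ^+ 2 by rewrite exprn_gt0.
have xc1 : 16 * x ^+ 3 <= expR (1 * x) by near: x; exact: near_cube.
have xc2 : 320 * x ^+ 3 <= expR ((1 - delta) * x).
  by near: x; apply: near_cube; rewrite subr_gt0.
have sm1 : (30 * A + 40 * d%:R) * expR (- x) <= e / 3.
  by near: x; apply: small_exp; [rewrite addr_ge0// mulr_ge0|rewrite divr_gt0].
have sm2 : 100 * d%:R ^+ 2 * expR (- x) <= e.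
  by near: x; apply: small_exp => //; rewrite mulr_ge0// exprn_ge0.
have sm3 : 64 * d%:R / (e / 3) <= x by near: x; exact: pinf_ge.
rewrite mul1r in xc1.
have gx : 8 * x <= ln X%:R.
  have : 16 * x <= expR x / x ^+ 2 by rewrite ler_pdivlMr// -mulrA -exprS.
  by move: Xl; move: (ln X%:R) (expR x / _) => u v; clear => h1 h2; lra.
(* [N <= ln X / 4] lets [1 / X] beat [N * 4 ^ N <= 8 ^ N <= expR (3 * N)]; [N >= ln X / 8] makes
   [eta * N / 5 >= 4 * x], hence [W <= 5 * expR (- 3 * x)]. *)
have [N [N0 Nu Nl]] : exists N : nat, [/\ (0 < N)%N, N%:R <= (ln X%:R / 4 : R) & (ln X%:R / 8 : R) <= N%:R].
  move: (ln X%:R) gx => g gx.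
  have g16 : 16 <= g by apply: le_trans gx; move: x2; clear => x2; lra.
  have g4 : 0 <= g / 4 by move: g16; clear => h; lra.
  exists (Num.truncn (g / 4)); have h2 := truncnS_gt (g / 4).
  have h1 : (Num.truncn (g / 4))%:R <= g / 4 by rewrite truncn_le.
  move: (Num.truncn _) h1 h2 => n h1 h2.
  have {}h2 : g / 4 < n%:R + 1 by rewrite natr1.
  by split => //; [rewrite -(ltr0n R)|]; move: h1 h2 g16; move: (n%:R : R); clear => m *; lra.
exists N => //=.
have NN : 4 * x <= expR (- (delta * x)) * N%:R / 5.
  have e1 := expR_gt0 (- (delta * x)).
  have h1 : expR (- (delta * x)) * (ln X%:R / 8) <= expR (- (delta * x)) * N%:R by rewrite ler_pM2l.
  have h2 : expR (- (delta * x)) * (expR x / x ^+ 2) <= expR (- (delta * x)) * (2 * ln X%:R) by rewrite ler_pM2l.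
  have h3 : 320 * x <= expR (- (delta * x)) * (expR x / x ^+ 2).
    rewrite mulrA ler_pdivlMr// -mulrA -exprS.
    by apply: (le_trans xc2); rewrite -expRD le_eqVlt; apply/orP; left; apply/eqP; congr expR; ring.
  move: (expR (- (delta * x))) (ln X%:R) (N%:R : R) (expR x / x ^+ 2) h1 h2 h3; clear => u v w y *; lra.
have iE : expR (- x) * expR x = 1 by rewrite -expRD addNr expR0.
have /andP[q1 q2] := ln3T (ltW x0).
apply: (@numeric_core R (expR (- (delta * x))) x (expR x) (expR (- x))) => //.
- by rewrite -expR0 ler_expR ltW.
- exact: expR_gt0.
- by rewrite expR_le1 oppr_le0 ltW.
- by rewrite mulrC.
- by apply: le_trans q1; exact: expR_ge0.
- by rewrite lnK// posrE ltr0n.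
- apply: (@le_trans _ _ (expR (- (4 * x)) * (5 * expR (delta * x)))).
    apply: ler_pM; rewrite ?expR_ge0 ?divr_ge0 ?expR_ge0//; first by rewrite ler_expR lerN2.
    by rewrite expRN invrK.
  rewrite mulrCA ler_pM2l// -expRD -expRM_natl ler_expR.
  have : delta * x <= 1 * x by rewrite ler_wpM2r ?(ltW x0) ?(ltW de1).
  by move: (delta * x); clear => u h; lra.
Unshelve. all: by end_near. Qed.

(** * Approximation of ln |L| outside few heights *)

Section Approximation.
Variable R : realType.
Local Notation C := (R[i]).
Local Notation mu := (@lebesgue_measure R).
Variables (d : nat) (al : 'I_d -> nat -> C) (L : C -> C) (delta T0 A beta : R).
Hypothesis al1 : forall j p, prime p -> normc (al j p) <= 1.
Hypothesis EP : euler_product al (L : R[i]^o -> R[i]^o).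
Hypothesis delta01 : 0 < delta < 1.
Hypothesis hol : forall z : C, T0 < complex.Im z -> exists l, cder L z l.
Hypothesis A0 : 0 <= A.
Hypothesis growth : \forall t \near +oo, forall x, -1 <= x ->
  normc (L (x +i* t)%C) <= expR (A * ln t).
Hypothesis beta0 : 0 < beta.
Hypothesis ZD : zero_density (L : R[i]^o -> R[i]^o) beta.
Local Ltac slim := clear -al1 EP delta01 hol A0 growth beta0 ZD.

Definition vT (T t : R) : R := ln (normc (L (sT delta T +i* t)%C)).

Lemma zeros_near e : 0 < e -> \forall x \near +oo, exists zs : seq C,
  (size zs)%:R <= e * expR (expR x) /\
  forall z, L z = 0 -> 2^-1 + expR (- (delta * x)) / 4 <= complex.Re z ->
    expR (expR x) / 2 <= complex.Im z <= 3 * expR (expR x) -> z \in zs.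
Proof.
move=> e0; have [K /near_ex1[M HM]] := ZD; have /andP[de0 de1] := delta01.
near=> x.
have x1 : 1 <= x by near: x; exact: pinf_ge.
have xM : M <= x by near: x; exact: pinf_ge.
have xT : 2 * (T0 + 11) <= x by near: x; exact: pinf_ge.
have xc : 8 / beta * x ^+ 3 <= expR ((1 - delta) * x).
  by near: x; apply: near_cube; rewrite subr_gt0.
have sm : 9 * `|K| * expR (- x) <= e by near: x; apply: small_exp.
have x0 : 0 < x by lra.
have /andP[q1 q2] := ln3T (ltW x0).
have lx : x <= expR x by apply: le_trans (expR_ge1Dx x); rewrite lerDr.
have Tx : x <= expR (expR x).
  by apply: (le_trans lx); apply: le_trans (expR_ge1Dx _); rewrite lerDr.
have [T TE] : exists T, T = expR (expR x) by eexists.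
rewrite -TE in q1 q2 Tx *; have TP : 0 < T by move: Tx x0; slim; lra.
apply: (@zero_list R L _ (3 * T) (T / 2)); [by move: TP; slim; lra|by rewrite mulr_ge0 ?ltW| |].
  apply: (le_trans (HM (3 * T) _ _ _)); [by move: TP Tx xM; slim; lra|by rewrite lerDl divr_ge0 ?expR_ge0|].
  rewrite lee_fin.
  have -> : 1 - beta * (2^-1 + expR (- (delta * x)) / 4 - 2^-1) =
      1 - beta / 4 * expR (- (delta * x)) by field.
  rewrite /powR gt_eqF; last by move: TP; slim; lra.
  have qE : expR (ln (3 * T)) = 3 * T by rewrite lnK// posrE mulr_gt0.
  move: (ln (3 * T)) qE q1 q2 => q qE q1 q2.
  have -> : expR ((1 - beta / 4 * expR (- (delta * x))) * q) =
      3 * T * expR (- (beta / 4 * (expR (- (delta * x)) * q))).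
    by rewrite -qE -expRD; congr expR; ring.
  have h1 : 2 * x <= beta / 4 * (expR (- (delta * x)) * q).
    apply: (@le_trans _ _ (beta / 4 * (8 / beta * x ^+ 3))).
      have -> : beta / 4 * (8 / beta * x ^+ 3) = 2 * x ^+ 3 by field; rewrite gt_eqF.
      by rewrite ler_pM2l// exprS ler_peMr ?exprn_ege1// ltW.
    rewrite ler_pM2l ?divr_gt0//; apply: (le_trans xc).
    apply: (@le_trans _ _ (expR (- (delta * x)) * expR x)); last by rewrite ler_pM2l ?expR_gt0.
    by rewrite -expRD le_eqVlt; apply/orP; left; apply/eqP; congr expR; ring.
  have h2 : expR (- (beta / 4 * (expR (- (delta * x)) * q))) <= expR (- x) * expR (- x).
    by rewrite -expRD ler_expR; move: h1; slim; lra.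
  have q0 : 0 <= q by apply: le_trans q1; exact: expR_ge0.
  have E0 := expR_ge0 (- (beta / 4 * (expR (- (delta * x)) * q))).
  move: (expR (- (beta / 4 * (expR (- (delta * x)) * q)))) h2 E0 => E h2 E0.
  apply: (@le_trans _ _ (`|K| * (3 * T * E) * q)).
    by rewrite ler_wpM2r// ler_wpM2r ?ler_norm// !mulr_ge0// ltW.
  apply: (@le_trans _ _ (`|K| * (3 * T * (expR (- x) * expR (- x))) * (3 * expR x))).
    apply: ler_pM => //; first by rewrite !mulr_ge0// ltW.
    by rewrite ler_wpM2l// ler_wpM2l// mulr_ge0// ltW.
  have xi : expR x * expR (- x) = 1 by rewrite -expRD subrr expR0.
  have -> : `|K| * (3 * T * (expR (- x) * expR (- x))) * (3 * expR x) =
      9 * `|K| * expR (- x) * (expR x * expR (- x)) * T by ring.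
  by rewrite xi mulr1 ler_wpM2r// ltW.
move=> z fz sz /andP[z1 z2].
have eta0 : 0 < expR (- (delta * x)) by exact: expR_gt0.
have zre : complex.Re z < 2.
  rewrite ltNge; apply/negP => h2; have [nz _] := ln_L_bound al1 EP h2.
  by rewrite fz eqxx in nz.
have zI : T0 + 11 <= complex.Im z by move: z1 xT Tx; slim; lra.
have zR : 2^-1 <= complex.Re z by move: sz eta0; slim; lra.
(* The witness that [L] is not identically 0 near [z] is the point [3 + i Im z], in the half-plane
   [Re s >= 2]; the radius 10 reaches it and stays above [T0]. *)
apply: (@zero_mult_gt0 R L 10 z (((3 - complex.Re z)%:C)%C)) => //.
- by move=> h h10; apply: hol; rewrite ImD; have := Im_le_nc h; rewrite ler_norml => /andP[h1 _]; move: h1 h10 zI; slim; lra.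
- by rewrite nc_real ltr_norml; apply/andP; split; move: zre zR; slim; lra.
- have [//|] := @ln_L_bound R d al L al1 EP (z + ((3 - complex.Re z)%:C)%C).
  by rewrite ReD /=; slim; lra.
Unshelve. all: by end_near. Qed.

(** [D] is the Taylor tail of [P_X], and [zs] lists the heights of zeros. Points of the disc of
    radius [5/2 - eta/4] about [3 + i t] have real part above [1/2 + eta/4], so a zero there would
    be listed and its height would be within [5/2] of [t]. *)
Lemma log_L_near_PX e : 0 < e -> \forall T \near +oo, exists (D : R -> C) (zs : seq R),
    [/\ forall t, rcnt D t,
        \int[mu]_(t in `[T, (2 * T)]) (normc (D t) ^+ 2) <= e * T,
        (size zs)%:R <= e * T
      & forall t, T <= t <= 2 * T ->
         (exists2 z, z \in zs & `|t - z| <= 5/2) \/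
         `|vT T t - uT al delta T t| <= e + normc (D t)].
Proof.
move=> e0; apply: near_expR2; have /andP[de0 de1] := delta01.
have [M0 HM] := near_ex1 growth.
near=> x.
have x1 : 1 <= x by near: x; exact: pinf_ge.
have x0 : 0 < x by lra.
have xx4 : 4 * x ^+ 3 <= expR (1 * x) by near: x; exact: near_cube.
rewrite mul1r in xx4.
have xx : 4 * x ^+ 2 <= expR x by apply: le_trans xx4; rewrite ler_pM2l// ler_weXn2l.
have [X0 Xu Xl] := XT_bounds x1 xx.
have xde : 2 / delta <= x by near: x; exact: pinf_ge.
have xM : M0 + 5 <= x by near: x; exact: pinf_ge.
have xT : T0 + 5 <= x by near: x; exact: pinf_ge.
have num : forall X : nat,
  (0 < X)%N -> ln X%:R <= expR x / x ^+ 2 -> expR x / x ^+ 2 <= 2 * ln X%:R ->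
  exists2 N : nat, (0 < N)%N &
  let eta := expR (- (delta * x)) in let T := expR (expR x) in
  let W := expR (- (eta * N%:R / 5)) * (5 / eta) in
  4 * d%:R / X%:R + N%:R * (16 * d%:R / X%:R * 4 ^+ N) +
    2 * (A * ln (3 * T) + 4 * d%:R) * W <= e /\
  (d%:R * W) ^+ 2 * (T * (1 + ln X%:R) + 2 * X%:R ^+ 3) <= e * T.
  by near: x; exact: numeric_choice.
have [zs [szs hz]] : exists zs : seq C,
  (size zs)%:R <= e * expR (expR x) /\
  forall z, L z = 0 -> 2^-1 + expR (- (delta * x)) / 4 <= complex.Re z ->
    expR (expR x) / 2 <= complex.Im z <= 3 * expR (expR x) -> z \in zs.
  by near: x; exact: zeros_near.
have [N N0 [n1 n2]] := num _ X0 Xu Xl.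
have sE := sT_exp delta x.
have dx : 2 <= delta * x by rewrite mulrC -ler_pdivrMr.
have eta01 : 0 < expR (- (delta * x)) <= 2^-1.
  rewrite expR_gt0 /=; apply: (le_trans (expN_le _)); first by move: dx; slim; lra.
  by rewrite lef_pV2 ?posrE//; move: dx; slim; lra.
have lx : x <= expR x by apply: le_trans (expR_ge1Dx x); rewrite lerDr.
have Tx : x <= expR (expR x).
  by apply: (le_trans lx); apply: le_trans (expR_ge1Dx _); rewrite lerDr.
have T3 : 0 <= ln (3 * expR (expR x)).
  by have /andP[h _] := ln3T (ltW x0); apply: le_trans h; exact: expR_ge0.
have T10 : 5 <= expR (expR x).
  have := expR_ge1Dx (expR x); have : 4 <= expR x; last by slim; lra.
  by apply: le_trans xx; rewrite ler_peMr// exprn_ege1.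
rewrite /vT /uT sE.
move: (expR (- (delta * x))) eta01 n1 n2 hz {sE} => eta eta01 n1 n2 hz.
move: (expR (expR x)) (XT _) X0 n1 n2 hz szs Tx T3 T10 {num Xu Xl} => T X X0 n1 n2 hz szs Tx T3 T10.
have /andP[eta0 eta1] := eta01.
have TP : 0 < T by move: T10; slim; lra.
(* One family of Taylor coefficients for all [n], since the pointwise and the mean-square estimates
   must speak of the same [D]. *)
have [c hc] : exists c : nat -> nat -> C, forall n, (0 < n)%N ->
    pser (ps n) (c n) (5/2 - eta/2) (expR ((5/2 - eta/2) * ln n%:R)).
  have H n : exists c : nat -> C, (0 < n)%N ->
      pser (ps n) c (5/2 - eta/2) (expR ((5/2 - eta/2) * ln n%:R)).
    case: n => [|n]; first by exists (fun=> 0).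
    have r0 : 0 < 5/2 - eta/2 by move: eta1; slim; lra.
    by have [c hc] := @ps_pser R _ n.+1 r0 isT; exists c.
  by have [c hc] := choice H; exists c.
exists (fun t => \sum_(j | @okj X j) lcoef al j.1 j.2.+1 *
     ps_rem c N (((eta - 5/2)%:C)%C) (ppow j) * ps (ppow j) (3 +i* t)%C), (map (@complex.Im R) zs).
split.
- move=> t; apply: cnt_sum => j _; apply: cntM; first exact: cnt_cst.
  apply: (@cnt_ext _ _ _ (fun t => ((expR (- 3 * ln (ppow j)%:R))%:C)%C * ei (t * (- ln (ppow j)%:R)))).
  + by exists 1 => // h _; rewrite -ps_line.
  + by rewrite -ps_line.
  + by apply: cntM; [exact: cnt_cst|exact: rcnt_ei].
- by apply: le_trans n2; exact: D_mean_square.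
- by rewrite size_map.
move=> t /andP[t1 t2].
have [bad|nb] := pselect (exists2 z, z \in map (@complex.Im R) zs & `|t - z| <= 5/2); [by left|right].
have G0 : 0 <= A * ln (3 * T) by rewrite mulr_ge0.
have nz h : normc h < 5/2 - eta/4 -> L ((3 +i* t)%C + h) != 0.
  move=> hr; apply/eqP => Lz; apply: nb.
  have hR := Re_le_nc h; have hI := Im_le_nc h; rewrite !ler_norml in hR hI.
  move: hR hI => /andP[hR1 hR2] /andP[hI1 hI2].
  exists (complex.Im ((3 +i* t)%C + h)).
    by apply: map_f; apply: hz => //; rewrite ?ReD ?ImD /=; [|apply/andP; split]; move: hr hR1 hI1 hI2 t1 t2 T10 eta0; slim; lra.
  by rewrite ImD /= ler_norml; apply/andP; split; move: hI1 hI2 hr eta0; slim; lra.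
apply: (le_trans (log_approx al1 EP eta01 X0 N0 G0 hc _ nz _)).
- move=> h hr; apply: hol; rewrite ImD /=.
  by have := Im_le_nc h; rewrite ler_norml => /andP[hI _]; move: hI hr t1 Tx xT; slim; lra.
- move=> h hr; have nzh := nz h hr; move: nzh.
  have hR := Re_le_nc h; have hI := Im_le_nc h; rewrite !ler_norml in hR hI.
  move: hR hI => /andP[hR1 hR2] /andP[hI1 hI2].
  have -> : (3 +i* t)%C + h = ((3 + complex.Re h) +i* (t + complex.Im h))%C by case: (h).
  move=> nzh.
  have I1 : M0 <= t + complex.Im h by move: t1 hI1 hr xM Tx eta0; slim; lra.
  have R1 : -1 <= 3 + complex.Re h by move: hR1 hr eta0; slim; lra.
  have I0 : 0 < t + complex.Im h by move: t1 hI1 hr T10 eta0; slim; lra.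
  have I3 : t + complex.Im h <= 3 * T by move: t2 hI2 hr eta0 T10; slim; lra.
  rewrite -[X in _ <= X]expRK ler_ln ?posrE ?expR_gt0 ?nc_gt0//.
  apply: (le_trans (HM _ I1 _ R1)); rewrite ler_expR ler_wpM2l// ler_ln ?posrE//.
  by move: I3 TP I0; slim; lra.
- by rewrite lerD2r.
Unshelve. all: by end_near. Qed.

End Approximation.


(** * Mantissas as positions modulo 1, and the conclusion *)

Section MantissaSet.
Variable R : realType.
Local Notation C := (R[i]).
Implicit Types (B x tau : R).

Lemma ln_expz B (k : int) : 0 < B -> ln (B ^ k) = k%:~R * ln B.
Proof.
move=> B0; have -> : B ^ k = expR (k%:~R * ln B).
  by rewrite -powR_intmul ?ltW// /powR gt_eqF.
by rewrite expRK.
Qed.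

Lemma ln_mantissa B x : 1 < B -> 0 < x ->
  1 <= mantissa B x < B /\
  exists k : int, ln x / ln B - k%:~R = ln (mantissa B x) / ln B.
Proof.
move=> B1 x0; have B0 : 0 < B := lt_trans ltr01 B1.
have [mm [k xk]] := mantissaP B1 x0; split=> //; exists k.
have m0 : 0 < mantissa B x by case/andP: mm => h _; exact: lt_le_trans h.
rewrite {1}xk lnM ?posrE ?exprz_gt0// ln_expz// mulrDl mulfK ?addrK//.
by rewrite gt_eqF// ln_gt0.
Qed.

(** A countable union of intervals, whence measurability. The condition [tau < B] keeps [x / B ^ k]
    below [B] on the interval from [B ^ k] to [tau * B ^ k], so that it is the mantissa there. *)
Lemma mantissa_set B tau : 1 < B -> tau < B ->
  [set x | 1 <= mantissa B x <= tau] = \bigcup_(k : int) `[B ^ k, tau * B ^ k]%classic.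
Proof.
move=> B1 tB; have B0 : 0 < B := lt_trans ltr01 B1.
apply/seteqP; split => x /=.
  move=> /andP[m1 mt]; have [x0|x0|x0] := ltgtP x 0.
  (* A negative number satisfies no [mantissa_spec], and the default value 0 of [mantissa] is below
     1. *)
  - move: m1 mt; rewrite /mantissa lt_eqF// => m1 mt.
    have [[m mE]|nm] := pselect (exists m, mantissa_spec B x m); last first.
      by move: m1; rewrite xgetPN ?ler10// => m hm; apply: nm; exists m.
    have := xgetPex 0 (ex_intro _ m mE); rewrite /= => -[/andP[g1 _] [k xk]].
    have : 0 <= x by rewrite xk mulr_ge0 ?exprz_ge0 ?ltW// (lt_le_trans ltr01).
    by rewrite leNgt x0.
  - have [_ [k xk]] := mantissaP B1 x0; exists k => //=.
    rewrite in_itv /= {1 2}xk ler_pMl ?exprz_gt0// m1 /=.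
    by rewrite ler_pM2r ?exprz_gt0.
  - by move: m1; rewrite /mantissa x0 eqxx ler10.
move=> [k _] /=; rewrite in_itv /= => /andP[xk1 xk2].
have Bk : 0 < B ^ k by rewrite exprz_gt0.
have x0 : 0 < x by exact: lt_le_trans xk1.
have -> : mantissa B x = x / B ^ k.
  apply: (mantissa_spec_uniq B1 (mantissaP B1 x0)); split; last first.
    by exists k; rewrite divfK// gt_eqF.
  by rewrite ler_pdivlMr// mul1r xk1 /= (le_lt_trans _ tB)// ler_pdivrMr.
by rewrite ler_pdivlMr// mul1r xk1 /= ler_pdivrMr.
Qed.

Lemma measurable_mantissa_set B tau : 1 < B -> tau < B ->
  measurable [set x | 1 <= mantissa B x <= tau].
Proof.
by move=> B1 tB; rewrite mantissa_set//; apply: countable_bigcupT_measurable.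
Qed.

Lemma rcnt_vertical (L : C -> C) (s t : R) : (exists l, cder L (s +i* t)%C l) ->
  rcnt (fun t => L (s +i* t)%C) t.
Proof.
move=> [l dl].
have e (y : R) : (s +i* y)%C = (s%:C)%C + (y%:C)%C * 'i%C.
  by apply/eqP; rewrite eq_complex /= !mul0r !mulr0 !mulr1 subr0 !addr0 add0r !eqxx.
apply: (@cnt_ext _ _ _ (fun y => L ((s%:C)%C + (y%:C)%C * 'i%C))).
- by exists 1 => // h _; rewrite -e.
- by rewrite -e.
- apply: cnt_comp; first exact: rcnt_affine.
  by rewrite -e; exact: cder_cnt dl.
Qed.

End MantissaSet.

Theorem theorem4p4 (R : realType) (a : nat -> R[i]^o) (L : R[i]^o -> R[i]^o)
    (delta B tau : R) :
  good_Lfunction a L -> 0 < delta < 1 -> 1 < B -> 1 <= tau < B ->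
  let sigma (T : R) := 2^-1 + 1 / (ln T) `^ delta in
  let E (T : R) := [set t : R | T <= t <= 2 * T /\
    1 <= mantissa B (normc (L (sigma T +i* t)%C)) <= tau] in
  (lebesgue_measure (E T) * (T^-1)%:E)%E @[T --> +oo] --> (ln tau / ln B)%:E.
Proof.
move=> good d01 B1 /andP[t1 tB] sigma E.
case: good => DS [[d [al [EP al1]]] [[mero fo fin_ _]
  [[omega [Q [h [lam [mu_ [Q0 lam0 _ FE]]]]]] [psm [beta [beta0 ZD]]]]]].
have [T0 HT0] := L_holo mero fin_.
have LB (x t : R) : 2 <= x -> normc (L (x +i* t)%C : R[i]) <= expR (4 * d%:R).
  move=> x2; have [nz hb] := @ln_L_bound R d al L al1 EP (x +i* t)%C x2.
  rewrite -[X in X <= _]lnK ?posrE ?nc_gt0// ler_expR.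
  exact: le_trans (ler_norm _) hb.
have [A1 [A10 left_]] := L_left Q0 lam0 FE (fun z hz => (HT0 z hz).1) (fun t => LB 2 t (lexx _)).
have [A [A0 gr]] := phragmen_lindelof A10 fo (fun z hz => (HT0 z hz).2) LB left_.
have chl := charlim al1 EP DS d01 psm.
have app := log_L_near_PX al1 EP d01 (fun z hz => (HT0 z hz).2) A0 gr beta0 ZD.
have b0 : 0 < ln B by rewrite ln_gt0.
have tau0 : 0 < tau by exact: lt_le_trans t1.
have a0 : 0 <= ln tau / ln B by apply: divr_ge0; [exact: ln_ge0|exact: ltW].
have a1 : ln tau / ln B <= 1.
  by rewrite ler_pdivrMr// mul1r ler_ln ?posrE ?(ltW tB)// (lt_trans tau0).
(* The arc from 0 to [log_B tau] and the one from [log_B tau] to 1 both get upper bounds. As the two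
   sets of [t] fill an interval of length [T], the second bound is a lower bound for the first
   set. *)
have up1 e e0 := @arc_upper R (uT al delta) (vT L delta) (ln B) 0 (ln tau / ln B) e
  b0 (lexx 0) a0 a1 e0 (rcnt_uT al delta) chl app.
have up2 e e0 := @arc_upper R (uT al delta) (vT L delta) (ln B) (ln tau / ln B) 1 e
  b0 a0 a1 (lexx 1) e0 (rcnt_uT al delta) chl app.
pose mu := @lebesgue_measure R.
have mE T : T0 < T -> measurable (E T).
  move=> TT.
  have -> : E T = `[T, (2 * T)]%classic `&`
      (fun t => normc (L (sigma T +i* t)%C : R[i])) @^-1` [set x | 1 <= mantissa B x <= tau].
    by apply/seteqP; split => t /=; rewrite in_itv.
  apply: measurable_realfun.subspace_continuous_measurable_fun => //; last exact: measurable_mantissa_set.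
  apply: continuous_in_subspaceT => t; rewrite inE /= in_itv /= => /andP[Tt _].
  by apply: rcnt_nc; apply: rcnt_vertical; apply: (HT0 _ _).2; exact: lt_le_trans Tt.
have key e : 0 < e -> \forall T \near +oo, mu (E T) \is a fin_num /\
    `|fine (mu (E T)) - (ln tau / ln B) * T| <= e * T /\ 0 < T.
  move=> e0; near=> T.
  have T1 : T0 < T by near: T; exact: pinf_gt.
  have TP : 0 < T by near: T; exact: pinf_gt.
  have mET := mE T T1.
  have ED : E T `<=` `[T, (2 * T)] by move=> t [tT _] /=; rewrite in_itv.
  pose F := `[T, (2 * T)]%classic `\` E T.
  have mF : measurable F by exact: measurableD.
  have h1 : (mu (E T) <= ((ln tau / ln B - 0 + e) * T)%:E)%E.
    have H : forall E : set R, measurable E -> E `<=` `[T, (2 * T)] ->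
      (forall t, E t -> exists k : int, 0 <= vT L delta T t / ln B - k%:~R <= ln tau / ln B) ->
      (mu E <= ((ln tau / ln B - 0 + e) * T)%:E)%E by near: T; exact: up1.
    apply: H => // t [_ /andP[m1 mt]].
    have x0 : 0 < normc (L (sigma T +i* t)%C : R[i]).
      rewrite lt_neqAle nc_ge0 andbT; apply/eqP => x0.
      by move: m1; rewrite -x0 /mantissa eqxx ler10.
    have [_ [k kE]] := ln_mantissa B1 x0; exists k; rewrite kE.
    have m0 := lt_le_trans ltr01 m1.
    apply/andP; split; first by apply: divr_ge0; [exact: ln_ge0|exact: ltW].
    by rewrite ler_pM2r ?invr_gt0// ler_ln ?posrE.
  have h2 : (mu F <= ((1 - ln tau / ln B + e) * T)%:E)%E.
    have H : forall E : set R, measurable E -> E `<=` `[T, (2 * T)] ->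
      (forall t, E t -> exists k : int, ln tau / ln B <= vT L delta T t / ln B - k%:~R <= 1) ->
      (mu E <= ((1 - ln tau / ln B + e) * T)%:E)%E by near: T; exact: up2.
    apply: H => //; first by move=> t [].
    move=> t [tT nE].
    have [x0|x0] := eqVneq (normc (L (sigma T +i* t)%C : R[i])) 0.
      (* At a zero of [L] the convention [ln 0 = 0] gives [vT = 0]; the integer [k = -1] moves this
         to position 1, so that zeros, whose mantissa is 0, are counted in the second arc. *)
      have v0 : vT L delta T t = 0 by rewrite /vT -/(sigma T) x0 ln0.
      by exists (-1); rewrite v0 mul0r sub0r mulrN1z opprK a1 lexx.
    have {}x0 : 0 < normc (L (sigma T +i* t)%C : R[i]) by rewrite lt_neqAle eq_sym x0 nc_ge0.
    have [/andP[m1 mB] [k kE]] := ln_mantissa B1 x0; exists k; rewrite kE.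
    have mt : tau < mantissa B (normc (L (sigma T +i* t)%C : R[i])).
      rewrite ltNge; apply/negP => mt; apply: nE; split; last by rewrite m1.
      by move: tT; rewrite /= in_itv.
    have m0 := lt_le_trans ltr01 m1; have B0 := lt_trans ltr01 B1.
    apply/andP; split; first by rewrite ler_pM2r ?invr_gt0// ler_ln ?posrE// ltW.
    by rewrite ler_pdivrMr// mul1r ler_ln ?posrE// ltW.
  have h3 : (mu (E T) + mu F = T%:E)%E.
    have -> : T%:E = mu `[T, (2 * T)]%classic.
      rewrite /mu lebesgue_measure_itv /= lte_fin ifT; last by move: TP; clear; lra.
      by rewrite -EFinB; congr EFin; ring.
    rewrite -measureU//; last exact: setDIK.
    by congr (mu _); rewrite /F setDUK.
  have f1 : mu (E T) \is a fin_num.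
    by rewrite ge0_fin_numE ?measure_ge0//; apply: le_lt_trans h1 _; exact: ltry.
  have f2 : mu F \is a fin_num.
    by rewrite ge0_fin_numE ?measure_ge0//; apply: le_lt_trans h2 _; exact: ltry.
  split => //; split => //.
  move: h1 h2 h3; rewrite -(fineK f1) -(fineK f2) !lee_fin -EFinD => h1 h2 [h3].
  rewrite fineK// ler_norml; move: h1 h2 h3; move: (fine (mu (E T))) (fine (mu F)) (ln tau / ln B).
  by move=> u v w h1 h2 h3; apply/andP; split; move: h1 h2 h3; clear; lra.
apply/fine_cvgP; split.
  by have := key 1 ltr01; apply: filterS => T [f _]; rewrite fin_numM.
apply/cvgrPdist_le => e e0; have := key e e0; apply: filterS => T [f [h1 TP]] /=.
rewrite fineM//= distrC.
have -> : fine (lebesgue_measure (E T)) / T - ln tau / ln B =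
    (fine (mu (E T)) - ln tau / ln B * T) / T.
  by rewrite mulrBl mulfK ?gt_eqF.
by rewrite normrM normfV (gtr0_norm TP) ler_pdivrMr.
Unshelve. all: by end_near. Qed.
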